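(* Let $M=(M_k)$ be a weight sequence that is log-convex and has moderate growth, and let $C^{[M]}$ denote either $C^{(M)}$ or $C^{\{M\}}$. Let $E,F,G,E_1,F_1$ and $E_i,F_i$ ($i$ in an index set $I$) be convenient vector spaces and let $U$ and $V$ be $c^\infty$-open subsets of convenient vector spaces (in (6), (2): $U$ is a $c^\infty$-open subset of some convenient vector space). Then: (1) The exponential law holds: $C^{[M]}(U,C^{[M]}(V,G))\cong C^{[M]}(U\times V,G)$ is a linear $C^{[M]}$-diffeomorphism of convenient vector spaces. Moreover the following canonical mappings are $C^{[M]}$: (2) $\operatorname{ev}:C^{[M]}(U,F)\times U\to F$, $\operatorname{ev}(f,x)=f(x)$; (3) $\operatorname{ins}:E\to C^{[M]}(F,E\times F)$, $\operatorname{ins}(x)(y)=(x,y)$; (4) $(\ )^\wedge:C^{[M]}(U,C^{[M]}(V,G))\to C^{[M]}(U\times V,G)$, $g^\wedge(x,y)=g(x)(y)$; (5) $(\ )^\vee:C^{[M]}(U\times V,G)\to C^{[M]}(U,C^{[M]}(V,G))$, $f^\vee(x)(y)=f(x,y)$; (6) $\operatorname{comp}:C^{[M]}(F,G)\times C^{[M]}(U,F)\to C^{[M]}(U,G)$, $(f,g)\mapsto f\circ g$; (7) $C^{[M]}(\cdot,\cdot):C^{[M]}(F,F_1)\times C^{[M]}(E_1,E)\to C^{[M]}\big(C^{[M]}(E,F),C^{[M]}(E_1,F_1)\big)$, $(f,g)\mapsto(h\mapsto f\circ h\circ g)$; (8) $\prod:\prod_iC^{[M]}(E_i,F_i)\to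 C^{[M]}\big(\prod_iE_i,\prod_iF_i\big)$, $(f_i)_i\mapsto\big((x_i)_i\mapsto(f_i(x_i))_i\big)$.
   Context: $\mathbb N=\{0,1,2,\dots\}$. A weight sequence $M=(M_k)_{k\in\mathbb N}$ is a sequence of positive reals with $M_0=1\le M_1$. It is log-convex if $k\mapsto\log M_k$ is convex; it has moderate growth if $\sup_{j,k\ge1}\big(M_{j+k}/(M_jM_k)\big)^{1/(j+k)}<\infty$. $C^{[M]}$ stands, within one statement, either everywhere for $C^{(M)}$ or everywhere for $C^{\{M\}}$. Jets on Banach spaces. For Banach spaces $E,F$ let $L^k_{\rm sym}(E,F)$ be the Banach space of bounded symmetric $k$-linear maps $E^k\to F$ with the operator norm. For compact $K\subseteq E$ and $f=(f^k)_k\in\prod_k C(K,L^k_{\rm sym}(E,F))$ put $\|f\|_k=\sup_{x\in K}\|f^k(x)\|$, $(R^n_yf)^k(x)=f^k(x)-\sum_{j=0}^n\frac1{j!}f^{j+k}(y)(x-y,\dots,x-y,\cdot)$, $|||f|||_{n,k}=\sup\{(n+1)!\,\|(R^n_yf)^k(x)\|/\|x-y\|^{n+1}:x\ne y\in K\}$, and $$\|f\|_\rho=\max\Big\{\sup_m\frac{\|f\|_m}{m!\rho^mM_m},\ \sup_{n,k}\frac{|||f|||_{n,k}}{(n+k+1)!\rho^{n+k+1}M_{n+k+1}}\Big\}.$$ $C^M_\rho(E\supseteq K,F)$ is the space of those $f$ with $\|f\|_\rho<\infty$, normed by $\|\cdot\|_\rho$. For compact convex $K$ put $C^{(M)}(E\supseteq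 K,F)=\varprojlim_{\rho>0}C^M_\rho(E\supseteq K,F)$ and $C^{\{M\}}(E\supseteq K,F)=\varinjlim_{\rho>0}C^M_\rho(E\supseteq K,F)$ (locally convex limits). For open $U\subseteq E$, $C^{[M]}(U,F)$ is the space of all $C^\infty$ (Fréchet) maps $f:U\to F$ with $j^\infty f|_K=(f^{(k)}|_K)_k\in C^{[M]}(E\supseteq K,F)$ for all compact convex $K\subseteq U$, with the initial locally convex topology induced by the maps $f\mapsto j^\infty f|_K$. Convenient vector spaces. A convenient vector space is a real Hausdorff locally convex space that is Mackey complete. Its $c^\infty$-topology is the final topology with respect to all $C^\infty$-curves $\mathbb R\to E$. A mapping on a $c^\infty$-open set is $C^\infty$ if it maps $C^\infty$-curves to $C^\infty$-curves. $F^*$ is the space of continuous linear functionals. For closed absolutely convex bounded $B\subseteq E$, $E_B$ is the span of $B$ with the Minkowski functional of $B$ as norm (a Banach space), $i_B:E_B\to E$ the inclusion, $U_B=U\cap E_B$. For $c^\infty$-open $U\subseteq E$, $$C^{[M]}(U,F)=\{f\in C^\infty(U,F):\ell\circ f\circ i_B\in C^{[M]}(U_B,\mathbb R)\ \forall\ell\in F^*,\forall B\},$$ with the initial locally convex structure induced by all maps $f\mapsto\ell\circ f\circ i_B\in C^{[M]}(U_B,\mathbb R)$; this is a convenient vector space. A mapping is called $C^{[M]}$ if it lies in $C^{[M]}(U,F)$. A $C^{[M]}$-diffeomorphism is a bijective $C^{[M]}$-mapping with $C^{[M]}$ inverse. *)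

(* Defs.v *)
From HB Require Import structures.
From mathcomp Require Import all_boot all_order all_algebra all_fingroup.
From mathcomp Require Import all_classical all_reals all_analysis.
From mathcomp Require Import ring lra.

Set Implicit Arguments.
Unset Strict Implicit.
Unset Printing Implicit Defensive.

Import Order.TTheory GRing.Theory Num.Theory.
Import numFieldNormedType.Exports.

Local Open Scope classical_set_scope.
Local Open Scope ring_scope.

Record seminorm (R : realType) (V : lmodType R) := Seminorm {
  seminorm_fun :> V -> R ;
  seminormD : forall x y, seminorm_fun (x + y) <= seminorm_fun x + seminorm_fun y ;
  seminormZ : forall a x, seminorm_fun (a *: x) = `|a| * seminorm_fun x }.

Section SeminormTheory.
Context (R : realType) (V : lmodType R) (p : seminorm V).

Lemma seminorm0 : p 0 = 0.
Proof. by have := seminormZ p 0 0; rewrite scale0r normr0 mul0r. Qed.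

Lemma seminormN x : p (- x) = p x.
Proof. by rewrite -scaleN1r seminormZ normrN1 mul1r. Qed.

Lemma seminorm_ge0 x : 0 <= p x.
Proof. by have := seminormD p x (- x); rewrite subrr seminorm0 seminormN; lra. Qed.

End SeminormTheory.

(* V with the locally convex topology generated by the seminorms in P *)
Definition seminormed (R : realType) (V : lmodType R) (P : set (seminorm V)) :
  Type := V.

Section SeminormTopology.
Context (R : realType) (V : lmodType R) (P : set (seminorm V)).
Local Notation W := (seminormed P).

HB.instance Definition _ := GRing.Lmodule.on W.

Definition seminorm_ball n (p : 'I_n -> seminorm V) (x : V) (e : R) : set V :=
  [set y | forall i, p i (y - x) < e].

Definition seminorm_nbhs (x : W) : set_system W :=
  [set A | exists n (p : 'I_n -> seminorm V) (e : R),
     [/\ forall i, P (p i), 0 < e & seminorm_ball p x e `<=` A]].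

HB.instance Definition _ := hasNbhs.Build W seminorm_nbhs.

Lemma seminorm_nbhs_filter (x : W) : ProperFilter (nbhs x).
Proof.
split.
  move=> -[n [p [e [_ e0 /(_ x)]]]]; apply => i.
  by rewrite subrr seminorm0.
split.
- by exists 0%N, (fun i : 'I_0 => match notF (ltn_ord i) with end), 1; split => // -[].
- move=> A B [n [p [e [Pp e0 pA]]]] [m [q [d [Pq d0 qB]]]].
  exists (n + m)%N, (fun i => match fintype.split i with inl j => p j | inr j => q j end),
    (Num.min e d); split.
  + by move=> i; case: fintype.split.
  + by rewrite lt_min e0.
  + move=> y Hy; split; [apply: pA|apply: qB] => i.
      have := Hy (lshift m i).
      by rewrite (unsplitK (inl i)) lt_min => /andP[].
    have := Hy (rshift n i).
    by rewrite (unsplitK (inr i)) lt_min => /andP[].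
- move=> A B AB [n [p [e [Pp e0 pA]]]]; exists n, p, e; split => //.
  exact: subset_trans AB.
Qed.

Lemma seminorm_nbhs_singleton (x : W) (A : set W) : nbhs x A -> A x.
Proof.
move=> [n [p [e [_ e0]]]]; apply => i.
by rewrite subrr seminorm0.
Qed.

Lemma seminorm_ball_nbhs n (p : 'I_n -> seminorm V) (x : V) (e : R) :
  (forall i, P (p i)) -> forall y : V, seminorm_ball p x e y ->
  nbhs (y : W) (seminorm_ball p x e).
Proof.
move=> Pp y xy.
pose d := \big[Num.min/1]_(i < n) (e - p i (y - x)).
have d0 : 0 < d.
  rewrite /d; elim/big_ind: _ => // [a b a0 b0|i _].
    by rewrite lt_min a0.
  by rewrite subr_gt0.
exists n, p, d; split => // z zd i.
have zi : p i (z - y) < e - p i (y - x).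
  apply: lt_le_trans (zd i) _; rewrite /d; exact: bigmin_le_cond.
have := seminormD (p i) (z - y) (y - x); rewrite addrA subrK; lra.
Qed.

Lemma seminorm_nbhs_nbhs (x : W) (A : set W) : nbhs x A -> nbhs x (nbhs^~ A).
Proof.
move=> [n [p [e [Pp e0 pA]]]]; exists n, p, e; split => // y xy.
apply: filterS pA _; first exact: (seminorm_nbhs_filter y).
exact: seminorm_ball_nbhs.
Qed.

HB.instance Definition _ := Nbhs_isNbhsTopological.Build W
  seminorm_nbhs_filter seminorm_nbhs_singleton seminorm_nbhs_nbhs.

Lemma seminorm_add_continuous : continuous (fun x : W * W => x.1 + x.2).
Proof.
move=> [x y] A [n [p [e [Pp e0 pA]]]].
have e20 : 0 < e / 2 by rewrite divr_gt0.
exists (seminorm_ball p x (e / 2), seminorm_ball p y (e / 2)) => /=.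
  by split; exists n, p, (e / 2); split.
move=> [x' y'] /= [xx yy]; apply: pA => i /=.
have := seminormD (p i) (x' - x) (y' - y); rewrite addrACA -opprD.
have := xx i; have := yy i; lra.
Qed.

Lemma seminorm_scale_continuous : continuous (fun z : R^o * W => z.1 *: z.2).
Proof.
move=> [a x] A [n [p [e [Pp e0 pA]]]].
pose m := `|a| + 1 + \sum_(i < n) p i x.
have pm i : `|a| + 1 + p i x <= m.
  rewrite lerD2l (bigD1 i)//= lerDl; apply: sumr_ge0 => j _; exact: seminorm_ge0.
have m0 : 0 < m.
  have : 0 <= \sum_(i < n) p i x by apply: sumr_ge0 => j _; exact: seminorm_ge0.
  by have := normr_ge0 a; rewrite /m; lra.
pose d := Num.min 1 (e / m).
have d0 : 0 < d by rewrite lt_min ltr01 divr_gt0.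
exists (ball a d, seminorm_ball p x d) => /=.
  by split; [exact: nbhsx_ballx|exists n, p, d; split].
move=> [b y] /= [ab xy]; apply: pA => i /=.
have -> : b *: y - a *: x = b *: (y - x) + (b - a) *: x.
  by rewrite scalerBr scalerBl addrA subrK.
apply: le_lt_trans (seminormD _ _ _) _; rewrite !seminormZ.
move: ab; rewrite -ball_normE /= distrC => ab.
have b1 : `|b| <= `|a| + 1.
  have := ler_normD (b - a) a; rewrite subrK.
  have : d <= 1 by rewrite ge_min lexx.
  lra.
have dm : d * m <= e by rewrite -ler_pdivlMr// ge_min lexx orbT.
have h1 : `|b| * p i (y - x) <= (`|a| + 1) * p i (y - x).
  by apply: ler_wpM2r => //; exact: seminorm_ge0.
have h2 : (`|a| + 1) * p i (y - x) < (`|a| + 1) * d.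
  by rewrite ltr_pM2l ?ltr_wpDl//; exact: xy.
have h3 : `|b - a| * p i x <= d * p i x.
  by apply: ler_wpM2r; [exact: seminorm_ge0|exact: ltW].
have h4 : d * (`|a| + 1 + p i x) <= d * m by rewrite ler_pM2l.
move: h4; rewrite mulrDr; lra.
Qed.

Lemma seminorm_ball_convex n (p : 'I_n -> seminorm V) (x : V) (e : R) :
  convex_set (seminorm_ball p x e : set (convex_lmodType V)).
Proof.
apply/convex_setW => y z; rewrite !inE => xy xz l l0 l1; rewrite inE => i.
have -> : conv l y z - x = l%:num *: (y - x) + (1 - l%:num) *: (z - x) :> V.
  rewrite !scalerBr addrACA -opprD -scalerDl.
  by rewrite [l%:num + _]addrC subrK scale1r.
apply: le_lt_trans (seminormD _ _ _) _; rewrite !seminormZ.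
have -> : `|l%:num| = l%:num :> R by rewrite ger0_norm.
rewrite [`|1 - _|]ger0_norm; last by rewrite subr_ge0 ltW.
have {}xy := xy i; have {}xz := xz i.
have h1 : l%:num * p i (y - x) < l%:num * e by rewrite ltr_pM2l.
have h2 : (1 - l%:num) * p i (z - x) < (1 - l%:num) * e.
  by rewrite ltr_pM2l// subr_gt0.
lra.
Qed.

Lemma seminorm_locally_convex : exists2 B : set_system W,
  (forall b, b \in B -> convex_set b) & basis B.
Proof.
exists [set b | exists n (p : 'I_n -> seminorm V) x e,
          (forall i, P (p i)) /\ b = seminorm_ball p x e].
  by move=> b; rewrite inE => -[n [p [x [e [_ ->]]]]]; exact: seminorm_ball_convex.
split.
  move=> b [n [p [x [e [Pp ->]]]]]; rewrite openE => y xy.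
  exact: seminorm_ball_nbhs.
move=> x A [n [p [e [Pp e0 pA]]]]; exists (seminorm_ball p x e) => //.
split; first by exists n, p, x, e.
by move=> i; rewrite subrr seminorm0.
Qed.

HB.instance Definition _ := PreTopologicalLmod_isTvs.Build R W
  seminorm_add_continuous seminorm_scale_continuous seminorm_locally_convex.
HB.instance Definition _ := PreTopologicalNmodule_isTopologicalNmodule.Build
  W seminorm_add_continuous.
HB.instance Definition _ := TopologicalNmodule_isTopologicalLmodule.Build
  R W seminorm_scale_continuous.
HB.instance Definition _ := Uniform_isTvs.Build R W seminorm_locally_convex.

End SeminormTopology.


Section ProductTvs.
Context (R : realType) (I : Type) (E : I -> tvsType R).
Local Notation P := (prod_topology E).

Definition prodfun_add (f g : P) : P := fun i => f i + g i.
Definition prodfun_opp (f : P) : P := fun i => - f i.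
Definition prodfun_zero : P := fun i => 0.
Definition prodfun_scale (a : R) (f : P) : P := fun i => a *: f i.

Lemma prodfun_addA : associative prodfun_add.
Proof. by move=> f g h; apply: functional_extensionality_dep => i; rewrite /prodfun_add addrA. Qed.

Lemma prodfun_addC : commutative prodfun_add.
Proof. by move=> f g; apply: functional_extensionality_dep => i; rewrite /prodfun_add addrC. Qed.

Lemma prodfun_add0 : left_id prodfun_zero prodfun_add.
Proof. by move=> f; apply: functional_extensionality_dep => i; rewrite /prodfun_add add0r. Qed.

Lemma prodfun_addN : left_inverse prodfun_zero prodfun_opp prodfun_add.
Proof. by move=> f; apply: functional_extensionality_dep => i; rewrite /prodfun_add addNr. Qed.

HB.instance Definition _ := GRing.isZmodule.Build P
  prodfun_addA prodfun_addC prodfun_add0 prodfun_addN.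

Lemma prodfun_scaleA a b (f : P) :
  prodfun_scale a (prodfun_scale b f) = prodfun_scale (a * b) f.
Proof. by apply: functional_extensionality_dep => i; rewrite /prodfun_scale scalerA. Qed.

Lemma prodfun_scale1 : left_id 1 prodfun_scale.
Proof. by move=> f; apply: functional_extensionality_dep => i; rewrite /prodfun_scale scale1r. Qed.

Lemma prodfun_scaleDr : right_distributive prodfun_scale +%R.
Proof. by move=> a f g; apply: functional_extensionality_dep => i; exact: scalerDr. Qed.

Lemma prodfun_scaleDl (f : P) : {morph prodfun_scale^~ f : a b / a + b}.
Proof. by move=> a b; apply: functional_extensionality_dep => i; exact: scalerDl. Qed.

HB.instance Definition _ := GRing.Zmodule_isLmodule.Build R P
  prodfun_scaleA prodfun_scale1 prodfun_scaleDr prodfun_scaleDl.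

Lemma prodfun_cvg (F : set_system P) (f : P) : Filter F ->
  F --> f <-> forall i (A : set (E i)), nbhs (f i) A -> F [set g : P | A (g i)].
Proof.
move=> FF; split=> [/cvg_sup Ff i A fA|Ff].
  apply: (Ff i).
  exact: (@initial_continuous _ _ (fun g : P => g i) f A fA).
apply/cvg_sup => i A [_ [[B oB <-] fB] BA].
apply: filterS BA _; apply: Ff; exact: open_nbhs_nbhs.
Qed.

Lemma prodfun_proj_nbhs (f : P) i (A : set (E i)) :
  nbhs (f i) A -> nbhs f [set g : P | A (g i)].
Proof. by move=> fA; apply: (prodfun_cvg f _).1. Qed.

Lemma prodfun_add_continuous : continuous (fun x : P * P => x.1 + x.2).
Proof.
move=> [f g]; apply/prodfun_cvg => i A fgA.
have [[B C] /= [fB gC] BCA] := @add_continuous (E i) (f i, g i) A fgA.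
exists ([set h : P | B (h i)], [set h : P | C (h i)]).
  by split; exact: prodfun_proj_nbhs.
by move=> [f' g'] [/= ? ?]; exact: (BCA (f' i, g' i)).
Qed.

Lemma prodfun_scale_continuous : continuous (fun z : R^o * P => z.1 *: z.2).
Proof.
move=> [a f]; apply/prodfun_cvg => i A afA.
have [[B C] /= [aB fC] BCA] := @scale_continuous R (E i) (a, f i) A afA.
exists (B, [set h : P | C (h i)]); first by split => //; exact: prodfun_proj_nbhs.
by move=> [b g] [/= ? ?]; exact: (BCA (b, g i)).
Qed.

Lemma prodfun_locally_convex : exists2 B : set_system P,
  (forall b, b \in B -> convex_set b) & basis B.
Proof.
pose B : set_system P := [set b | open b /\ convex_set (b : set (convex_lmodType P))].
exists B => [b|]; first by rewrite inE => -[].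
split; first by move=> b [].
move=> f; pose F : set_system P := filter_from (fun b => B b /\ b f) id.
have FF : Filter F.
  apply: filter_from_filter; first exists setT.
    by split => //; split; [exact: openT|move=> x y l _ _; rewrite inE].
  move=> b c [[ob cb] fb] [[oc cc] fc]; exists (b `&` c) => //; split=> //.
  split; first exact: openI.
  move=> x y l /[!inE] -[bx cx] [by_ cy].
  by split; apply/set_mem; [apply: cb|apply: cc]; rewrite inE.
change (F --> f).
apply/prodfun_cvg => i A.
have [C Ccvx [Co CB]] := @locally_convex R (E i).
move=> /CB[c [Cc fc] cA]; exists [set g : P | c (g i)] => [|g /= /cA//].
split=> //; split.
  rewrite openE => g /= cg; apply: prodfun_proj_nbhs.
  by apply: open_nbhs_nbhs; split => //; exact: Co.
move=> x y l /[!inE] /= cx cy.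
by apply/set_mem; apply: (Ccvx c) => //; rewrite inE.
Qed.

HB.instance Definition _ := PreTopologicalNmodule_isTopologicalNmodule.Build
  P prodfun_add_continuous.
HB.instance Definition _ := TopologicalNmodule_isTopologicalLmodule.Build
  R P prodfun_scale_continuous.
HB.instance Definition _ := Uniform_isTvs.Build R P prodfun_locally_convex.

End ProductTvs.

(* Suprema are taken in [0, +oo], so that the supremum of the empty set is 0. *)
Definition nnsup (R : realType) (A : set (\bar R)) : \bar R :=
  ereal_sup (0%E |` A).

Section ExtendedSeminorms.
Context (R : realType).
Local Open Scope ereal_scope.

Lemma nnsup_ge0 (A : set (\bar R)) : 0 <= nnsup A.
Proof. by apply: ereal_sup_ubound; left. Qed.

Lemma nnsup_ubound (A : set (\bar R)) a : A a -> a <= nnsup A.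
Proof. by move=> Aa; apply: ereal_sup_ubound; right. Qed.

Lemma nnsup_le (A : set (\bar R)) b :
  0 <= b -> (forall a, A a -> a <= b) -> nnsup A <= b.
Proof. by move=> b0 Ab; apply: ge_ereal_sup => x [->//|/Ab]. Qed.

Variable V : lmodType R.

(* N is an extended seminorm; finite bounds make sums and products meaningful *)
Definition eseminorm (N : V -> \bar R) :=
  [/\ N 0%R = 0, forall x, 0 <= N x,
      forall x y (a b : R), N x <= a%:E -> N y <= b%:E -> N (x + y)%R <= (a + b)%:E &
      forall c x (a : R), N x <= a%:E -> N (c *: x)%R <= (`|c| * a)%:E].

Lemma eseminorm_norm (F : normedModType R) (L : V -> F) :
  (forall c x y, L (c *: x + y) = c *: L x + L y)%R ->
  eseminorm (fun x => `|L x|%:E).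
Proof.
move=> LL.
have L0 : L 0%R = 0%R.
  by have := LL (-1)%R 0%R 0%R; rewrite scaler0 addr0 scaleN1r addNr.
have LD x y : L (x + y)%R = (L x + L y)%R by have := LL 1%R x y; rewrite !scale1r.
have LZ c x : L (c *: x)%R = (c *: L x)%R by have := LL c x 0%R; rewrite L0 !addr0.
split=> [|x|x y a b|c x a]; rewrite ?L0 ?normr0 ?lee_fin//.
  by move=> xa yb; rewrite LD (le_trans (ler_normD _ _))// lerD.
by move=> xa; rewrite LZ normrZ ler_wpM2l.
Qed.

Lemma eseminorm_sup I (D : set I) (N : I -> V -> \bar R) :
  (forall i, D i -> eseminorm (N i)) ->
  eseminorm (fun x => nnsup [set N i x | i in D]).
Proof.
have ub i x (a : \bar R) : D i -> nnsup [set N i x | i in D] <= a -> N i x <= a.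
  by move=> Di xa; apply: le_trans xa; apply: nnsup_ubound; exists i.
have pos x (a : R) : nnsup [set N i x | i in D] <= a%:E -> (0 <= a)%R.
  by move=> xa; rewrite -lee_fin; apply: le_trans xa; exact: nnsup_ge0.
move=> HN; split=> [|x|x y a b xa yb|c x a xa]; last 3 first.
- exact: nnsup_ge0.
- apply: nnsup_le; first by rewrite lee_fin addr_ge0// ?(pos _ _ xa) ?(pos _ _ yb).
  by move=> _ [i Di <-]; have [_ _ + _] := HN _ Di; apply; exact: ub.
- apply: nnsup_le; first by rewrite lee_fin mulr_ge0// (pos _ _ xa).
  by move=> _ [i Di <-]; have [_ _ _] := HN _ Di; apply; exact: ub.
apply/eqP; rewrite eq_le nnsup_ge0 andbT; apply: nnsup_le => // _ [i Di <-].
by have [-> _ _ _] := HN _ Di.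
Qed.

Lemma eseminorm_scale (c : R) (N : V -> \bar R) : (0 < c)%R ->
  eseminorm N -> eseminorm (fun x => c%:E * N x).
Proof.
move=> c0 [N00 N0 ND NZ].
have Nle x (a : R) : (c%:E * N x <= a%:E) = (N x <= (c^-1 * a)%:E).
  by rewrite EFinM lee_pdivlMl.
split=> [|x|x y a b|d x a]; rewrite ?Nle.
- by rewrite N00 mule0.
- by rewrite mule_ge0// lee_fin ltW.
- by rewrite mulrDr; exact: ND.
- by rewrite mulrCA; exact: NZ.
Qed.

Lemma eseminorm_max (N N' : V -> \bar R) :
  eseminorm N -> eseminorm N' -> eseminorm (fun x => maxe (N x) (N' x)).
Proof.
move=> [N00 N0 ND NZ] [N00' N0' ND' NZ']; split=> [|x|x y a b|c x a].
- by rewrite N00 N00' maxxx.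
- by rewrite le_max N0.
- by rewrite !ge_max => /andP[? ?] /andP[? ?]; rewrite ND ?ND'.
- by rewrite !ge_max => /andP[? ?]; rewrite NZ ?NZ'.
Qed.

Lemma eseminorm_lty (N : V -> \bar R) c x y : eseminorm N ->
  N x < +oo -> N y < +oo -> N (c *: x + y)%R < +oo.
Proof.
move=> [_ N0 ND NZ] Nx Ny.
have fx : N x <= (fine (N x))%:E by rewrite fineK// ge0_fin_numE.
have fy : N y <= (fine (N y))%:E by rewrite fineK// ge0_fin_numE.
exact: le_lt_trans (ND _ _ _ _ (NZ c _ _ fx) fy) (ltry _).
Qed.

End ExtendedSeminorms.

Section Multilinear.
Context (R : realType) (E F : normedModType R).

Definition opnorm k (T : ('I_k -> E) -> F) : \bar R :=
  nnsup [set (`|T v|)%:E | v in [set v | forall i, `|v i| <= 1]].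

Definition set_coord k (v : 'I_k -> E) (i : 'I_k) (x : E) : 'I_k -> E :=
  fun j => if j == i then x else v j.

(* elements of L^k_sym(E, F) *)
Definition bounded_sym_multilinear k (T : ('I_k -> E) -> F) :=
  [/\ forall v i a x y,
        T (set_coord v i (a *: x + y)) = a *: T (set_coord v i x) + T (set_coord v i y),
      forall v (s : 'S_k), T (v \o s) = T v
    & (opnorm T < +oo)%E].

End Multilinear.


Lemma eseminorm_opnorm (R : realType) (V : lmodType R) (E F : normedModType R) k
    (L : V -> ('I_k -> E) -> F) :
  (forall c x y v, L (c *: x + y) v = c *: L x v + L y v) ->
  eseminorm (fun x => opnorm (L x)).
Proof.
move=> LL; apply: eseminorm_sup => v _.
by apply: eseminorm_norm => c x y; exact: LL.
Qed.

(* A jet J on A assigns to (k, (x, v)), with x \in A and v : E^k, the value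
   J^k(x)(v). *)
Definition jets (R : realType) (E : normedModType R) (A : set E)
    (F : normedModType R) : Type :=
  {k : nat & (A * ('I_k -> E))%type} -> F.

HB.instance Definition _ (R : realType) (E : normedModType R) (A : set E)
    (F : normedModType R) :=
  GRing.Lmodule.on (jets A F).

Definition jet_coef (R : realType) (E F : normedModType R) (A : set E)
    (J : jets A F) k (x : A) (v : 'I_k -> E) : F :=
  J (existT _ k (x, v)).

Record weight_sequence (R : realType) := WeightSequence {
  weight :> nat -> R ;
  weight_gt0 : forall k, 0 < weight k ;
  weight0 : weight 0%N = 1 ;
  weight1 : 1 <= weight 1%N }.

Definition log_convex (R : realType) (M : weight_sequence R) :=
  forall k, 2 * ln (M k.+1) <= ln (M k) + ln (M k.+2).

Definition moderate_growth (R : realType) (M : weight_sequence R) :=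
  (ereal_sup [set ((M (j + k)%N / (M j * M k)) `^ ((j + k)%:R^-1))%:E
               | j in [set j | (0 < j)%N] & k in [set k | (0 < k)%N]] < +oo)%E.

Section JetNorm.
Context (R : realType) (M : weight_sequence R).
Context (E : normedModType R) (K : set E) (F : normedModType R).
Implicit Type J : jets K F.

Definition taylor_remainder J n (y : K) k (x : K) : ('I_k -> E) -> F := fun v =>
  jet_coef J x v - \sum_(j < n.+1) (j`!%:R)^-1 *:
    jet_coef J y (fun i : 'I_(j + k) =>
      match fintype.split i with inl _ => val x - val y | inr l => v l end).

Definition jet_norm k J : \bar R := nnsup [set opnorm (@jet_coef _ _ _ _ J k x) | x in [set: K]].

Definition jet_rnorm n k J : \bar R :=
  nnsup [set (((n.+1)`!%:R / `|val xy.1 - val xy.2| ^+ n.+1)%:E *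
              opnorm (taylor_remainder J n xy.2 (k := k) xy.1))%E
        | xy in [set xy : K * K | xy.1 != xy.2]].

Definition jet_weight (rho : R) m : R := m`!%:R * rho ^+ m * M m.

Definition jet_rho_norm (rho : R) J : \bar R :=
  maxe (nnsup [set ((jet_weight rho m)^-1%:E * jet_norm m J)%E | m in [set: nat]])
       (nnsup [set ((jet_weight rho (nk.1 + nk.2 + 1))^-1%:E * jet_rnorm nk.1 nk.2 J)%E
              | nk in [set: nat * nat]]).

Lemma jet_weight_gt0 rho m : 0 < rho -> 0 < jet_weight rho m.
Proof. by move=> r0; rewrite !mulr_gt0 ?exprn_gt0 ?weight_gt0// ltr0n fact_gt0. Qed.

Lemma eseminorm_rho rho : 0 < rho -> eseminorm (jet_rho_norm rho).
Proof.
move=> r0; apply: eseminorm_max.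
  apply: eseminorm_sup => m _.
  apply: eseminorm_scale; first by rewrite invr_gt0 jet_weight_gt0.
  by apply: eseminorm_sup => x _; exact: eseminorm_opnorm.
apply: eseminorm_sup => -[n k] _.
apply: eseminorm_scale; first by rewrite invr_gt0 jet_weight_gt0.
apply: eseminorm_sup => -[x y] /= /eqP xy.
apply: eseminorm_scale.
  rewrite divr_gt0 ?ltr0n ?fact_gt0// exprn_gt0// normr_gt0 subr_eq0.
  by apply/eqP => /val_inj.
apply: eseminorm_opnorm => c J J' v; rewrite /taylor_remainder /jet_coef.
rewrite scalerBr addrACA -opprD scaler_sumr -big_split/=.
by congr (_ - _); apply: eq_bigr => j _; rewrite scalerDr !scalerA mulrC.
Qed.

Lemma jet_rho_norm_le rho rho' J : 0 < rho -> rho <= rho' ->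
  (jet_rho_norm rho' J <= jet_rho_norm rho J)%E.
Proof.
move=> r0 rr'.
have w m : (jet_weight rho' m)^-1 <= (jet_weight rho m)^-1.
  rewrite lef_pV2 ?posrE ?jet_weight_gt0 ?(lt_le_trans r0)//.
  rewrite ler_wpM2r ?(ltW (weight_gt0 _ _))// ler_wpM2l//.
  by rewrite lerXn2r ?nnegrE ?(ltW r0)// (le_trans (ltW r0)).
rewrite ge_max; apply/andP; split; apply: nnsup_le.
- by rewrite le_max nnsup_ge0.
- move=> _ [m _ <-]; rewrite le_max; apply/orP; left.
  apply: le_trans (nnsup_ubound _); last by exists m.
  by rewrite lee_wpmul2r// ?lee_fin// nnsup_ge0.
- by rewrite le_max nnsup_ge0.
- move=> _ [nk _ <-]; rewrite le_max; apply/orP; right.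
  apply: le_trans (nnsup_ubound _); last by exists nk.
  by rewrite lee_wpmul2r// ?lee_fin// nnsup_ge0.
Qed.

End JetNorm.

Inductive umode := Beurling | Roumieu.

Section JetSpace.
Context (R : realType) (md : umode) (M : weight_sequence R).
Context (E : normedModType R) (K : set E) (F : normedModType R).

(* J lies in \prod_k C(K, L^k_sym(E, F)) *)
Definition continuous_jet (J : jets K F) := forall k,
  (forall x, bounded_sym_multilinear (@jet_coef _ _ _ _ J k x)) /\
  forall (x : K) (e : R), 0 < e -> exists2 d : R, 0 < d & forall y : K,
    `|val y - val x| < d ->
    (opnorm (fun v : 'I_k -> E => jet_coef J y v - jet_coef J x v)%R <= e%:E)%E.

Definition is_ujet (J : jets K F) := continuous_jet J /\
  match md with
  | Beurling => forall rho, 0 < rho -> (jet_rho_norm M rho J < +oo)%E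
  | Roumieu => exists2 rho, 0 < rho & (jet_rho_norm M rho J < +oo)%E
  end.

Definition ujet_pred : {pred jets K F} := mem [set J | is_ujet J].

Lemma bounded_sym_multilinear_lc k c (T S : ('I_k -> E) -> F) :
  bounded_sym_multilinear T -> bounded_sym_multilinear S ->
  bounded_sym_multilinear (fun v => c *: T v + S v).
Proof.
move=> [Tl Ts Tb] [Sl Ss Sb]; split.
- move=> v i a x y; rewrite Tl Sl !scalerDr !scalerA (mulrC c) addrACA.
  by [].
- by move=> v s; rewrite Ts Ss.
- exact: (@eseminorm_lty _ _ _ c T S (@eseminorm_opnorm R (('I_k -> E) -> F) E F k id _)).
Qed.

Lemma continuous_jet0 : continuous_jet 0.
Proof.
have op0 k : opnorm (fun _ : 'I_k -> E => 0 : F) = 0%E.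
  by have [] := @eseminorm_opnorm R (('I_k -> E) -> F) E F k id (fun _ _ _ _ => erefl).
move=> k; split=> [x|x e e0].
  split=> [v i a y z|v s|]; rewrite /jet_coef ?scaler0 ?addr0//.
  by rewrite op0.
exists 1 => // y _; rewrite /jet_coef.
by under [X in opnorm X]eq_fun do rewrite subr0; rewrite op0 lee_fin ltW.
Qed.

Lemma continuous_jet_lc c J J' :
  continuous_jet J -> continuous_jet J' -> continuous_jet (c *: J + J').
Proof.
move=> HJ HJ' k; have [Jm Jc] := HJ k; have [Jm' Jc'] := HJ' k; split.
  by move=> x; exact: (bounded_sym_multilinear_lc c (Jm x) (Jm' x)).
move=> x e e0.
have c0 : 0 < 2 * (`|c| + 1) by have := normr_ge0 c; lra.
have [d d0 dJ] := Jc x (e / (2 * (`|c| + 1))) (divr_gt0 e0 c0).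
have e20 : 0 < e / 2 by rewrite divr_gt0.
have [d' d0' dJ'] := Jc' x (e / 2) e20.
exists (Num.min d d'); first by rewrite lt_min d0.
move=> y; rewrite lt_min => /andP[/dJ h /dJ' h'].
have [_ _ ND NZ] := @eseminorm_opnorm R (('I_k -> E) -> F) E F k id (fun _ _ _ _ => erefl).
have := ND _ _ _ _ (NZ c _ _ h) h'.
have -> : (c *: (fun v => jet_coef J y v - jet_coef J x v) +
    (fun v => jet_coef J' y v - jet_coef J' x v)) =
  (fun v : 'I_k -> E => jet_coef (c *: J + J') y v - jet_coef (c *: J + J') x v).
  apply/funext => v.
  transitivity (c *: (jet_coef J y v - jet_coef J x v) +
                (jet_coef J' y v - jet_coef J' x v)); first by [].
  by rewrite scalerBr addrACA -opprD.
move/le_trans; apply; rewrite lee_fin.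
have : `|c| * (e / (2 * (`|c| + 1))) <= e / 2.
  rewrite mulrA ler_pdivrMr// mulrA divfK// mulrC ler_pM2l//; lra.
lra.
Qed.

Lemma ujet_submod_closed : GRing.submod_closed ujet_pred.
Proof.
split=> [|c J J']; rewrite !inE => //=.
  split; first exact: continuous_jet0.
  have H rho : 0 < rho -> (jet_rho_norm M rho (0%R : jets K F) < +oo)%E.
    by move=> /(eseminorm_rho M K F)[-> _ _ _]; exact: ltry.
  by case: md => //; exists 1; [|exact: H].
move=> [Jc JM] [Jc' JM']; split; first exact: continuous_jet_lc.
move: JM JM'; case: md.
  by move=> JM JM' rho r0; apply: eseminorm_lty; [exact: eseminorm_rho|exact: JM|exact: JM'].
move=> [r r0 Jr] [s s0 Js]; exists (Num.max r s); first by rewrite lt_max r0.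
have rs0 : 0 < Num.max r s by rewrite lt_max r0.
apply: eseminorm_lty; first exact: eseminorm_rho.
  by apply: le_lt_trans Jr; apply: jet_rho_norm_le => //; rewrite le_max lexx.
by apply: le_lt_trans Js; apply: jet_rho_norm_le => //; rewrite le_max lexx orbT.
Qed.

HB.instance Definition _ := GRing.isSubmodClosed.Build R (jets K F) ujet_pred
  ujet_submod_closed.

(* C^[M](E \supseteq K, F) *)
Record ujet := Ujet { ujet_val :> jets K F ; _ : ujet_val \in ujet_pred }.

HB.instance Definition _ := [isSub for ujet_val].
HB.instance Definition _ := [Choice of ujet by <:].
HB.instance Definition _ := [SubChoice_isSubLmodule of ujet by <:].

(* Projective limit: the topology is generated by the norms of the steps.
   Inductive limit: it is generated by all the seminorms whose restrictions to
   all the steps are continuous. *)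
Definition ujet_seminorms : set (seminorm ujet) :=
  match md with
  | Beurling => [set p | exists2 rho : R, 0 < rho &
                  forall J : ujet, (p J)%:E = jet_rho_norm M rho J]
  | Roumieu => [set p | forall rho : R, 0 < rho -> exists C : R,
                  forall J : ujet, (jet_rho_norm M rho J < +oo)%E ->
                    ((p J)%:E <= C%:E * jet_rho_norm M rho J)%E]
  end.

HB.instance Definition _ := Tvs.copy ujet (seminormed ujet_seminorms).

End JetSpace.

Definition initial_seminorms (R : realType) (V : lmodType R) (I : Type)
    (T : I -> tvsType R) (phi : forall i, V -> T i) : set (seminorm V) :=
  [set p | exists i, exists2 q : seminorm (T i),
     continuous (q : T i -> R^o) & forall v, p v = q (phi i v)].

Section BanachSpaces.
Context (R : realType) (md : umode) (M : weight_sequence R).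
Context (E : normedModType R) (U : set E) (F : normedModType R).

Definition cons_vec k (h : E) (v : 'I_k -> E) : 'I_k.+1 -> E :=
  fun i => if unlift ord0 i is Some j then v j else h.

(* J is the jet (f^(k))_k of Frechet derivatives of f, where
   f^(k+1)(x)(h, v_1, .., v_k) = D(f^(k))(x)(h)(v_1, .., v_k) *)
Definition frechet_jet (f : U -> F) (J : jets U F) :=
  [/\ forall x v, jet_coef J (k := 0) x v = f x,
      forall k x, bounded_sym_multilinear (@jet_coef _ _ _ _ J k x)
    & forall k (x : U) (e : R), 0 < e -> exists2 d : R, 0 < d & forall y : U,
        `|val y - val x| < d ->
        (opnorm (fun v : 'I_k -> E => jet_coef J y v - jet_coef J x v -
                   jet_coef J x (cons_vec (val y - val x) v))%R
         <= (e * `|val y - val x|)%:E)%E].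

Definition subset_incl (T : Type) (A B : set T) (AB : A `<=` B) (x : A) : B :=
  SigSub (mem_set (AB _ (set_valP x))).

Definition jet_restrict (K : set E) (KU : K `<=` U) (J : jets U F) : jets K F :=
  fun s => jet_coef J (subset_incl KU (projT2 s).1) (projT2 s).2.

Record compact_convex_subset := CompactConvexSubset {
  ccset :> set E ;
  ccset_sub : ccset `<=` U ;
  ccset_compact : compact ccset ;
  ccset_convex : convex_set (ccset : set (convex_lmodType E)) }.

Definition is_ubanach_jet (f : U -> F) (J : jets U F) :=
  frechet_jet f J /\ forall K : compact_convex_subset,
    is_ujet md M (jet_restrict (@ccset_sub K) J).

Definition is_ubanach (f : U -> F) := exists J, is_ubanach_jet f J.

Definition ubanach_pred : {pred U -> F} := mem [set f | is_ubanach f].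

Lemma frechet_jet_lc c f g J L :
  frechet_jet f J -> frechet_jet g L -> frechet_jet (c *: f + g) (c *: J + L).
Proof.
move=> [J0 Jm Jd] [L0 Lm Ld]; split.
- by move=> x v; rewrite [LHS]/(c *: jet_coef J x v + jet_coef L x v) J0 L0.
- by move=> k x; exact: (bounded_sym_multilinear_lc c (Jm k x) (Lm k x)).
move=> k x e e0.
have c0 : 0 < 2 * (`|c| + 1) by have := normr_ge0 c; lra.
have e20 : 0 < e / 2 by rewrite divr_gt0.
have [d d0 dJ] := Jd k x (e / (2 * (`|c| + 1))) (divr_gt0 e0 c0).
have [d' d0' dL] := Ld k x (e / 2) e20.
exists (Num.min d d'); first by rewrite lt_min d0.
move=> y; rewrite lt_min => /andP[/dJ h /dL h'].
have [_ _ ND NZ] := @eseminorm_opnorm R (('I_k -> E) -> F) E F k id (fun _ _ _ _ => erefl).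
have := ND _ _ _ _ (NZ c _ _ h) h'.
set lhs := opnorm _ => H.
rewrite (_ : opnorm _ = lhs).
  apply: le_trans H _; rewrite lee_fin mulrA -mulrDl ler_wpM2r//.
  have : `|c| * (e / (2 * (`|c| + 1))) <= e / 2.
    rewrite mulrA ler_pdivrMr// mulrA divfK// mulrC ler_pM2l//; lra.
  lra.
congr opnorm; apply/funext => v.
set w := cons_vec _ _.
transitivity (c *: (jet_coef J y v - jet_coef J x v - jet_coef J x w) +
  (jet_coef L y v - jet_coef L x v - jet_coef L x w)); last by [].
by rewrite !scalerBr addrACA -opprD addrACA -opprD.
Qed.

Lemma frechet_jet0 : frechet_jet 0 0.
Proof.
have op0 k : opnorm (fun _ : 'I_k -> E => 0 : F) = 0%E.
  by have [] := @eseminorm_opnorm R (('I_k -> E) -> F) E F k id (fun _ _ _ _ => erefl).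
split.
- by [].
- by move=> k x; have [Jm _] := @continuous_jet0 R E U F k; exact: Jm.
move=> k x e e0; exists 1 => // y _.
rewrite (_ : opnorm _ = 0%E); last first.
  by rewrite -(op0 k); congr opnorm; apply/funext => v; rewrite /jet_coef !subr0.
by rewrite lee_fin mulr_ge0// ltW.
Qed.

Lemma ubanach_submod_closed : GRing.submod_closed ubanach_pred.
Proof.
split=> [|c f g]; rewrite !inE /=.
  exists 0; split; first exact: frechet_jet0.
  move=> K; have [+ _] := ujet_submod_closed md M K F.
  by rewrite inE.
move=> [J [Jf JK]] [L [Lg LK]]; exists (c *: J + L); split.
  exact: frechet_jet_lc.
move=> K; have [_ +] := ujet_submod_closed md M K F.
move=> /(_ c (jet_restrict (@ccset_sub K) J) (jet_restrict (@ccset_sub K) L)).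
by rewrite !inE; apply; [exact: JK|exact: LK].
Qed.

HB.instance Definition _ := GRing.isSubmodClosed.Build R (U -> F) ubanach_pred
  ubanach_submod_closed.

(* C^[M](U, F) for U open in E *)
Record ubanach := Ubanach { ubanach_val :> U -> F ; _ : ubanach_val \in ubanach_pred }.

HB.instance Definition _ := [isSub for ubanach_val].
HB.instance Definition _ := [Choice of ubanach by <:].
HB.instance Definition _ := [SubChoice_isSubLmodule of ubanach by <:].

(* j^\infty f; it is unique when U is open *)
Definition jet (f : ubanach) : jets U F := projT1 (cid (set_mem (valP f))).

Lemma jetP (f : ubanach) : is_ubanach_jet f (jet f).
Proof. exact: projT2 (cid (set_mem (valP f))). Qed.

Definition jet_on (K : compact_convex_subset) (f : ubanach) : ujet md M K F :=
  Ujet (mem_set ((jetP f).2 K)).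

HB.instance Definition _ := Tvs.copy ubanach (seminormed (initial_seminorms jet_on)).

End BanachSpaces.

Section Disks.
Context (R : realType) (E : tvsType R).

Definition tvs_bounded (B : set E) :=
  forall W : set E, nbhs 0 W -> exists2 r : R, 0 < r & B `<=` [set r *: w | w in W].

Definition absolutely_convex (B : set E) :=
  forall x y (a b : R), B x -> B y -> `|a| + `|b| <= 1 -> B (a *: x + b *: y).

Definition mackey_cauchy (u : nat -> E) :=
  exists B : set E, exists mu : nat -> nat -> R,
  [/\ tvs_bounded B, absolutely_convex B,
      forall e : R, 0 < e -> exists N, forall m n, (N <= m)%N -> (N <= n)%N -> `|mu m n| <= e
    & forall m n, exists2 b, B b & u m - u n = mu m n *: b].

Definition mackey_complete :=
  forall u : nat -> E, mackey_cauchy u -> exists l : E, u @ \oo --> l.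

Definition convenient := hausdorff_space E /\ mackey_complete.

(* The sets B for which E_B is considered. That E is Hausdorff makes the
   Minkowski functional of B a norm; it is recorded here, rather than proved
   for every E in use, so that E_B is defined for all tvsTypes. *)
Record disk := Disk {
  disk_set :> set E ;
  disk_closed : closed disk_set ;
  disk_absconvex : absolutely_convex disk_set ;
  disk_bounded : tvs_bounded disk_set ;
  disk_hausdorff : hausdorff_space E }.

Definition linear_span (B : set E) : set E :=
  [set x | forall S : set E, S 0 -> (forall (a : R) y z, S y -> S z -> S (a *: y + z)) ->
     B `<=` S -> S x].

End Disks.

Section DiskSpace.
Context (R : realType) (E : tvsType R) (B : disk E).

Definition disk_span : {pred E} := mem (linear_span B).

Lemma disk_span_submod_closed : GRing.submod_closed disk_span.
Proof.
split=> [|a x y]; rewrite !inE /=; first by move=> S S0 _ _; exact: S0.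
by move=> Sx Sy S S0 SL BS; apply: (SL); [exact: Sx|exact: Sy].
Qed.

HB.instance Definition _ := GRing.isSubmodClosed.Build R E disk_span
  disk_span_submod_closed.

(* E_B *)
Record disk_space := DiskSpace { disk_incl :> E ; _ : disk_incl \in disk_span }.

HB.instance Definition _ := [isSub for disk_incl].
HB.instance Definition _ := [Choice of disk_space by <:].
HB.instance Definition _ := [SubChoice_isSubLmodule of disk_space by <:].

Definition minkowski_set (x : E) : set R :=
  [set r | 0 < r /\ exists2 b, disk_set B b & x = r *: b].

Definition minkowski (x : disk_space) : R := inf (minkowski_set (disk_incl x)).

Lemma minkowski_lb x : lbound (minkowski_set x) 0.
Proof. by move=> r [/ltW]. Qed.

Lemma disk_spanE (x : E) : linear_span B x -> x = 0 \/ minkowski_set x !=set0.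
Proof.
move=> /(_ [set x | x = 0 \/ minkowski_set x !=set0]); apply; first by left.
  have B0 b : disk_set B b -> disk_set B 0.
    move=> Bb; have := @disk_absconvex _ _ B b b 0 0 Bb Bb.
    by rewrite !scale0r addr0 normr0 addr0; apply.
  move=> a y z Hy [->|[s [s0 [c Bc ->]]]].
    case: Hy => [->|[r [r0 [b Bb ->]]]]; first by left; rewrite scaler0 addr0.
    right; exists ((`|a| + 1) * r); split; first by rewrite mulr_gt0// ltr_wpDl.
    have a1 : `|a| + 1 != 0 by rewrite gt_eqF// ltr_wpDl.
    exists ((a / (`|a| + 1)) *: b + 0 *: b).
      apply: disk_absconvex => //; rewrite normr0 addr0 normrM normfV.
      rewrite [`|_ + 1|]ger0_norm ?addr_ge0//.
      by rewrite ler_pdivrMr ?ltr_wpDl// mul1r lerDl.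
    rewrite scale0r !addr0 !scalerA; congr (_ *: _).
    by field.
  right; case: Hy => [->|[r [r0 [b Bb ->]]]].
    by exists s; split => //; exists c => //; rewrite scaler0 add0r.
  have t0 : 0 < `|a| * r + s by rewrite ltr_wpDl// mulr_ge0// ltW.
  exists (`|a| * r + s); split => //.
  exists ((a * r / (`|a| * r + s)) *: b + (s / (`|a| * r + s)) *: c).
    apply: disk_absconvex => //.
    rewrite !normrM !normfV (gtr0_norm r0) (gtr0_norm s0) (gtr0_norm t0).
    by rewrite -mulrDl divff// gt_eqF.
  rewrite scalerDr !scalerA.
  by congr (_ *: _ + _ *: _); field; rewrite gt_eqF.
move=> b Bb; right; exists 1; split => //; exists b => //.
by rewrite scale1r.
Qed.

Lemma minkowski0 : minkowski 0 = 0.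
Proof.
have [[r0 Hr0]|/nonemptyPn E0] := pselect (minkowski_set 0 !=set0); last first.
  by rewrite /minkowski [X in inf X]E0 inf0.
have [r00 [b Bb e]] := Hr0.
have b0 : b = 0 by move/esym/eqP: e; rewrite scaler_eq0 gt_eqF//= => /eqP.
apply/eqP; rewrite eq_le; apply/andP; split; last first.
  by apply: lb_le_inf; [exists r0|exact: minkowski_lb].
apply/ler_addgt0Pr => e' e0; rewrite add0r.
apply: ge_inf; first by exists 0; exact: minkowski_lb.
by split => //; exists 0; rewrite ?scaler0// -b0.
Qed.

Lemma minkowski_lt (x : disk_space) e : minkowski x < e ->
  x = 0 \/ exists2 r, minkowski_set (disk_incl x) r & r < e.
Proof.
case: (disk_spanE (set_mem (valP x))) => [x0 _|ne].
  by left; apply: val_inj.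
move=> xe; right.
have hi : has_inf (minkowski_set x) by split => //; exists 0; exact: minkowski_lb.
have e0 : 0 < e - minkowski x by rewrite subr_gt0.
have [r Hr] := inf_adherent e0 hi.
by rewrite addrC subrK => re; exists r.
Qed.

Lemma minkowski_ge0 x : 0 <= minkowski x.
Proof.
case: (disk_spanE (set_mem (valP x))) => [x0|ne].
  by rewrite (_ : x = 0) ?minkowski0//; exact: val_inj.
exact: lb_le_inf ne (@minkowski_lb _).
Qed.

Lemma minkowski_le (x : disk_space) r : minkowski_set (disk_incl x) r -> minkowski x <= r.
Proof. by move=> xr; apply: ge_inf => //; exists 0; exact: minkowski_lb. Qed.

Lemma minkowskiD x y : minkowski (x + y) <= minkowski x + minkowski y.
Proof.
apply/ler_addgt0Pr => e e0.
have e20 : 0 < e / 2 by rewrite divr_gt0.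
have xe : minkowski x < minkowski x + e / 2 by rewrite ltrDl.
have ye : minkowski y < minkowski y + e / 2 by rewrite ltrDl.
have [->|[r [r0 [b Bb xb]] re]] := minkowski_lt xe.
  by rewrite add0r minkowski0 add0r lerDl ltW.
have [->|[s [s0 [c Bc yc]] se]] := minkowski_lt ye.
  by rewrite addr0 minkowski0 addr0 lerDl ltW.
have rs0 : 0 < r + s by rewrite addr_gt0.
suff : minkowski (x + y) <= r + s by lra.
apply: minkowski_le; split => //.
exists ((r / (r + s)) *: b + (s / (r + s)) *: c).
  apply: disk_absconvex => //.
  rewrite !normrM !normfV (gtr0_norm r0) (gtr0_norm s0) (gtr0_norm rs0).
  by rewrite -mulrDl divff// gt_eqF.
rewrite [LHS]/(disk_incl x + disk_incl y) xb yc scalerDr !scalerA.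
by congr (_ *: _ + _ *: _); field; rewrite gt_eqF.
Qed.

Lemma minkowskiZ_le a x : minkowski (a *: x) <= `|a| * minkowski x.
Proof.
have [->|a0] := eqVneq a 0; first by rewrite scale0r minkowski0 normr0 mul0r.
have na0 : 0 < `|a| by rewrite normr_gt0.
apply/ler_addgt0Pr => e e0.
have xe : minkowski x < minkowski x + e / `|a| by rewrite ltrDl divr_gt0.
have [->|[r [r0 [b Bb xb]] re]] := minkowski_lt xe.
  by rewrite scaler0 minkowski0 mulr0 add0r ltW.
apply: (@le_trans _ _ (`|a| * r)); last first.
  have -> : `|a| * minkowski x + e = `|a| * (minkowski x + e / `|a|).
    by rewrite mulrDr [_ * (e / _)]mulrC divfK// gt_eqF.
  by rewrite ler_wpM2l// ltW.
apply: minkowski_le; split; first by rewrite mulr_gt0.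
exists ((a / `|a|) *: b + 0 *: b).
  apply: disk_absconvex => //.
  by rewrite normr0 addr0 normrM normfV normr_id divff// gt_eqF.
transitivity (a *: (r *: b)); first by rewrite -xb.
rewrite scale0r addr0 !scalerA; congr (_ *: _).
by rewrite mulrAC [X in _ = X * _]mulrCA divff ?mulr1 ?gt_eqF.
Qed.

Lemma minkowskiZ a x : minkowski (a *: x) = `|a| * minkowski x.
Proof.
apply/eqP; rewrite eq_le minkowskiZ_le/=.
have [->|a0] := eqVneq a 0; first by rewrite normr0 mul0r minkowski_ge0.
rewrite -ler_pdivlMl ?normr_gt0// -normfV.
by rewrite -{1}[x](scalerK a0) minkowskiZ_le.
Qed.

Lemma minkowski_eq0 x : minkowski x = 0 -> x = 0.
Proof.
move=> x0; apply: val_inj => /=; apply/esym.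
apply: (disk_hausdorff B) => W1 W2 W10 W2x.
suff : W1 (disk_incl x) by move=> W1x; exists (disk_incl x); split => //; exact: nbhs_singleton.
have W10' : nbhs ((0 : R^o) *: (0 : E)) W1 by rewrite scale0r.
have [[D V] /= [D0 V0] DVW] := @scale_continuous R E (0, 0) W1 W10'.
have [r r0 BV] := @disk_bounded _ _ B V V0.
have /nbhs_ballP[d d0 dD] := D0.
have dr0 : 0 < d / r by rewrite divr_gt0.
have [->|[s [s0 [b Bb ->]] sdr]] := @minkowski_lt x (d / r) ltac:(by rewrite x0).
  exact: nbhs_singleton.
have [v Vv <-] := BV b Bb; rewrite scalerA.
apply: (DVW (s * r, v)); split => //=; apply: dD.
rewrite -ball_normE /= sub0r normrN gtr0_norm ?mulr_gt0//.
by rewrite -ltr_pdivlMr.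
Qed.

HB.instance Definition _ := Lmodule_isNormed.Build R disk_space
  minkowskiD minkowskiZ minkowski_eq0.

End DiskSpace.

Section SmoothMaps.
Context (R : realType).

(* d n is the n-th derivative of c *)
Definition smooth_curve (E : tvsType R) (c : R -> E) :=
  exists d : nat -> R -> E, d 0%N = c /\
    forall n t, (h^-1 *: (d n (t + h) - d n t)) @[h --> (0 : R)^'] --> d n.+1 t.

Definition cinf_open (E : tvsType R) (U : set E) :=
  forall c : R -> E, smooth_curve c -> open (c @^-1` U).

Definition smooth_map (E F : tvsType R) (U : set E) (f : U -> F) :=
  forall c : R -> U, smooth_curve (fun t => val (c t)) -> smooth_curve (f \o c).

Lemma smooth_curve_lc (E : tvsType R) (a : R) (c d : R -> E) :
  smooth_curve c -> smooth_curve d -> smooth_curve (fun t => a *: c t + d t).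
Proof.
move=> [c' [c'0 Hc]] [d' [d'0 Hd]].
exists (fun n t => a *: c' n t + d' n t); rewrite c'0 d'0; split => // n t.
have := Hd n t; have := Hc n t.
set u := fun h => _; set v := fun h => _ => uc vd.
rewrite (_ : (fun h => _) = (fun h => a *: u h + v h)); last first.
  apply/funext => h; rewrite /u /v opprD addrACA -scalerBr scalerDr.
  by rewrite !scalerA mulrC.
have au : (a *: u h) @[h --> (0 : R)^'] --> a *: c' n.+1 t.
  apply: (@continuous2_cvg R R^o E E _ _ (cst a) u (fun x y => x *: y)) => //.
    exact: (@scale_continuous R E (a, _)).
  exact: cvg_cst.
apply: (@continuous2_cvg R E E E _ _ (fun h => a *: u h) v (fun x y => x + y)) => //.
exact: (@add_continuous E (_, _)).
Qed.

Lemma smooth_map_lc (E F : tvsType R) (U : set E) (a : R) (f g : U -> F) :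
  smooth_map f -> smooth_map g -> smooth_map (a *: f + g).
Proof. by move=> fs gs c cs; exact: smooth_curve_lc (fs c cs) (gs c cs). Qed.

Lemma smooth_map0 (E F : tvsType R) (U : set E) : smooth_map (0 : U -> F).
Proof.
move=> c _; exists (fun _ _ => 0); split => // n t.
by under eq_fun do rewrite subrr scaler0; exact: cvg_cst.
Qed.

End SmoothMaps.

Section UltraSpaces.
Context (R : realType) (md : umode) (M : weight_sequence R).
Context (E : tvsType R) (U : set E) (F : tvsType R).

(* U_B = U \cap E_B *)
Definition disk_slice (B : disk E) : set (disk_space B) := [set x | U (disk_incl x)].
Arguments disk_slice : clear implicits.

Definition slice_incl (B : disk E) (x : disk_slice B) : U :=
  SigSub (mem_set (set_valP x : U (disk_incl (val x)))).

(* l is an element of F^* *)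
Definition is_ultra (f : U -> F) := smooth_map f /\
  forall (l : {linear F -> R^o}) (B : disk E), continuous l ->
    is_ubanach md M (l \o f \o @slice_incl B : disk_slice B -> R^o).

Definition ultra_pred : {pred U -> F} := mem [set f | is_ultra f].

Lemma ultra_submod_closed : GRing.submod_closed ultra_pred.
Proof.
split=> [|c f g]; rewrite !inE /=.
  split=> [|l B cl]; first exact: smooth_map0.
  rewrite (_ : _ \o _ \o _ = 0).
    have [+ _] := ubanach_submod_closed md M (disk_slice B) R^o.
    by rewrite inE.
  by apply/funext => x; rewrite /= linear0.
move=> [fs fM] [gs gM]; split=> [|l B cl]; first exact: smooth_map_lc.
rewrite (_ : _ \o _ \o _ = c *: (l \o f \o @slice_incl B : _ -> R^o) +
  (l \o g \o @slice_incl B)).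
  have [_ +] := ubanach_submod_closed md M (disk_slice B) R^o.
  move=> /(_ c (l \o f \o @slice_incl B) (l \o g \o @slice_incl B)).
  by rewrite !inE; apply; [exact: fM|exact: gM].
by apply/funext => x; rewrite /= linearP.
Qed.

HB.instance Definition _ := GRing.isSubmodClosed.Build R (U -> F) ultra_pred
  ultra_submod_closed.

(* C^[M](U, F) for U c^oo-open in E *)
Record ultra := Ultra { ultra_val :> U -> F ; _ : ultra_val \in ultra_pred }.

HB.instance Definition _ := [isSub for ultra_val].
HB.instance Definition _ := [Choice of ultra by <:].
HB.instance Definition _ := [SubChoice_isSubLmodule of ultra by <:].

Record ultra_index := UltraIndex {
  ui_functional : {linear F -> R^o} ;
  ui_continuous : continuous ui_functional ;
  ui_disk : disk E }.

Definition ultra_pullback (i : ultra_index) (f : ultra) :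
    ubanach md M (disk_slice (ui_disk i)) R^o :=
  Ubanach (mem_set ((set_mem (valP f)).2 (ui_functional i) (ui_disk i) (@ui_continuous i))).

HB.instance Definition _ :=
  Tvs.copy ultra (seminormed (initial_seminorms ultra_pullback)).

End UltraSpaces.

(* A map defined on all of E is a map on the c^oo-open subset setT. *)
Definition inT (E : Type) (x : E) : [set: E] := SigSub (in_setT x).

Definition ultra_map (R : realType) (md : umode) (M : weight_sequence R)
    (E F : tvsType R) (f : E -> F) : Prop :=
  is_ultra md M (fun x : [set: E] => f (val x)).

Definition pair_in (E F : Type) (U : set E) (V : set F) (x : U) (y : V) : U `*` V :=
  SigSub (mem_set (conj (set_valP x) (set_valP y) : (U `*` V) (val x, val y))).

Definition fst_in (E F : Type) (U : set E) (V : set F) (z : U `*` V) : U :=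
  SigSub (mem_set (set_valP z).1).

Definition snd_in (E F : Type) (U : set E) (V : set F) (z : U `*` V) : V :=
  SigSub (mem_set (set_valP z).2).

(* Main.v *)
(* A map f is C^[M] exactly when it has iterated directional derivatives
   D s x (s a list of directions), tested weakly by continuous functionals,
   such that for every weight r of the class dual to [M] and all disks B and
   compact convex K in U_B, the vectors r_k / (k! M_k) D s x, with x in K and
   s in B^k, form a weakly bounded set. Testing against weights treats the
   Beurling and the Roumieu case alike, and weakly bounded sets are bounded. The
   same weights describe the bounded subsets of C^[M](U, F); hence this space is
   Mackey complete, and a map g into C^[M](V, G) is C^[M] as soon as its
   difference quotients, taken in V and in the parameter together, are bounded.
   This gives the exponential law by M_(j+k) <= C^(j+k) M_j M_k. Stability under
   composition is Faa di Bruno's formula and log-convexity, and evaluation is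
   C^[M] because it is linear in its first argument: each of its derivatives
   involves at most one direction of that argument. All other canonical maps are
   obtained from composition, evaluation and currying. *)

Require Import Defs.
From HB Require Import structures.
From mathcomp Require Import all_boot all_order all_algebra all_fingroup.
From mathcomp Require Import all_classical all_reals all_analysis.
From mathcomp Require Import ring lra zify.

Set Implicit Arguments.
Unset Strict Implicit.
Unset Printing Implicit Defensive.

Import Order.TTheory GRing.Theory Num.Theory.
Import numFieldNormedType.Exports.

Local Open Scope classical_set_scope.
Local Open Scope ring_scope.

(** * Functionals and bounded sets *)

(** The definition of C^[M] only speaks of scalar functions on the Banach spaces E_B, with one jet
    for each functional and each disk, whereas composition and currying need vector-valued
    derivatives that do not depend on the disk. Lists of directions provide them: linearity in each
    direction and symmetry are not imposed, but follow from local bounds and the uniqueness of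
    derivatives. Bounds are imposed on compact convex sets only, although the image of such a set
    under a C^[M] map is compact without being convex; hence bounds are extended to neighbourhoods,
    by means of fast converging sequences of counterexamples. Second order remainders carry the
    calculus: that they are weakly bounded, hence contained in a disk, says more than weak
    differentiability, survives substitution and limits, and can be tested without knowing the
    functionals of a function space or of an infinite product. In the Roumieu case the rate rho of
    the outer map depends on a disk that is itself built from the inner map; weights postpone the
    choice of rho until all disks are fixed. *)

Lemma linear_of (R : realType) (V W : lmodType R) (f : V -> W) :
  (forall a x y, f (a *: x + y) = a *: f x + f y) ->
  exists l : {linear V -> W}, forall x, l x = f x.
Proof.
move=> H; pose m := GRing.isLinear.Build R V W _ f H.
by exists (HB.pack f m : {linear V -> W}).
Qed.

Section HahnBanach.
Context (R : realType) (V : lmodType R).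

(* Maximal linear graphs dominated by p, empty or through (v, p v). *)
Let dominated_graph (p : seminorm V) (v : V) (G : set (V * R)) :=
  [/\ forall a x y, G x -> G y -> G (a *: x.1 + y.1, a * x.2 + y.2),
      forall x, G x -> x.2 <= p x.1 & G !=set0 -> G (v, p v)].

Let graph_line (p : seminorm V) v : dominated_graph p v
  [set x | exists a, x = (a *: v, a * p v)].
Proof.
split=> [a x y [b ->] [c ->]|x [a ->]/=|_]; last by exists 1; rewrite scale1r mul1r.
  by exists (a * b + c); rewrite /= scalerA -scalerDl mulrA -mulrDl.
by rewrite seminormZ ler_wpM2r ?seminorm_ge0// ler_norm.
Qed.

Let graph_extend (p : seminorm V) v G z : dominated_graph p v G ->
  G (v, p v) -> exists2 G', dominated_graph p v G' & G `<=` G' /\ exists s, G' (z, s).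
Proof.
move=> [Glin Gp _] Gv.
have G0 : G (0, 0).
  have := Glin (-1) _ _ Gv Gv; rewrite /= scaleN1r mulN1r !addNr; exact.
have GZ a x : G x -> G (a *: x.1, a * x.2).
  by move=> Gx; have := Glin a _ _ Gx G0; rewrite /= !addr0.
(* A value s at z keeps the extension below p when it separates these lower bounds from the upper
   bounds p (y.1 + z) - y.2 of [AB]; the supremum of [A] does. *)
pose A := [set x.2 - p (x.1 - z) | x in G].
have AB x y : G x -> G y -> x.2 - p (x.1 - z) <= p (y.1 + z) - y.2.
  move=> Gx Gy; have /= := Gp _ (Glin 1 _ _ Gx Gy); rewrite scale1r mul1r.
  have := seminormD p (x.1 - z) (y.1 + z); rewrite addrACA addNr addr0; lra.
have hA : has_sup A.
  split; first by exists (0 - p (0 - z)), (0, 0).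
  by exists (p (0 + z) - 0) => _ [x Gx <-]; exact: (AB _ (0, 0)).
pose s := sup A.
have As x : G x -> x.2 - p (x.1 - z) <= s.
  by move=> Gx; apply: sup_upper_bound => //; exists x.
have sB y : G y -> s <= p (y.1 + z) - y.2.
  by move=> Gy; apply: ge_sup; [case: hA|move=> _ [x Gx <-]; exact: AB].
exists [set x | exists2 y, G y & exists b, x = (y.1 + b *: z, y.2 + b * s)].
  split=> [a _ _ [x Gx [b ->]] [y Gy [c ->]]|_ [y Gy [b ->]]/=|_].
  - exists (a *: x.1 + y.1, a * x.2 + y.2); first exact: Glin.
    exists (a * b + c); congr pair => /=.
      by rewrite scalerDr scalerA addrACA -scalerDl.
    by rewrite mulrDr mulrA addrACA -mulrDl.
  - have [b0|b0|->] := ltgtP b 0; last by rewrite scale0r mul0r !addr0; exact: Gp.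
      have := As _ (GZ (- b)^-1 _ Gy); rewrite /=.
      have -> : y.1 + b *: z = - b *: ((- b)^-1 *: y.1 - z).
        by rewrite scalerBr scalerA mulfV ?oppr_eq0 ?lt_eqF// scale1r scaleNr opprK.
      rewrite seminormZ gtr0_norm ?oppr_gt0// -(ler_pM2l (_ : 0 < - b)) ?oppr_gt0//.
      rewrite mulrBr mulrA mulfV ?oppr_eq0 ?lt_eqF// mul1r; lra.
    have := sB _ (GZ b^-1 _ Gy); rewrite /=.
    have -> : y.1 + b *: z = b *: (b^-1 *: y.1 + z).
      by rewrite scalerDr scalerA mulfV ?gt_eqF// scale1r.
    rewrite seminormZ gtr0_norm// -(ler_pM2l b0) mulrBr mulrA mulfV ?gt_eqF//.
    rewrite mul1r; lra.
  - by exists (v, p v) => //; exists 0; rewrite scale0r mul0r !addr0.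
split=> [x Gx|]; first by exists x => //; exists 0; rewrite scale0r mul0r !addr0; case: x Gx.
by exists s, (0, 0) => //; exists 1; rewrite scale1r mul1r !add0r.
Qed.

(** Zorn's lemma on linear graphs below p. Attaining p at the prescribed v makes functionals
    separate points, and lets the gliding hump below choose at each vector a functional that is as
    large as p there. *)
Theorem Hahn_Banach (p : seminorm V) (v : V) :
  exists l : {linear V -> R^o}, (forall x, `|l x| <= p x) /\ l v = p v.
Proof.
have [G [PG Gmax]] : exists A, dominated_graph p v A /\
    forall B, A `<` B -> ~ dominated_graph p v B.
  apply: Zorn_bigcup => FF FP Ftot; split.
  - move=> a x y [A FA Ax] [B FB By].
    have [AB|BA] := Ftot _ _ FA FB.
      by exists B => //; have [+ _ _] := FP _ FB; apply => //; exact: AB.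
    by exists A => //; have [+ _ _] := FP _ FA; apply => //; exact: BA.
  - by move=> x [A FA Ax]; have [_ + _] := FP _ FA; exact.
  - by move=> [x [A FA Ax]]; exists A => //; have [_ _] := FP _ FA; apply; exists x.
have [Glin Gp Gne] := PG.
have Gv : G (v, p v).
  apply: contrapT => nGv.
  have G0 x : ~ G x by move=> Gx; apply: nGv; apply: Gne; exists x.
  apply: (Gmax _ _ (graph_line p v)); split; first by move=> x /G0.
  by move=> /(_ (0 *: v, 0 * p v)) H; apply/(G0 (0 *: v, 0 * p v))/H; exists 0.
have Gtot z : exists s, G (z, s).
  have [G' PG' [GG' [s G's]]] := graph_extend z PG Gv.
  exists s; apply: contrapT => nGs; apply: (Gmax _ _ PG'); split => //.
  by move=> /(_ _ G's).
have Guniq z s t : G (z, s) -> G (z, t) -> s = t.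
  move=> Gs Gt; have := Gp _ (Glin (-1) _ _ Gs Gt); have := Gp _ (Glin (-1) _ _ Gt Gs).
  rewrite /= !scaleN1r !addNr seminorm0 !mulN1r => h1 h2.
  by apply/eqP; rewrite eq_le; apply/andP; split; lra.
pose f z : R^o := projT1 (cid (Gtot z)).
have Gf z : G (z, f z) by exact: projT2 (cid (Gtot z)).
have [l lf] : exists l : {linear V -> R^o}, forall x, l x = f x.
  apply: linear_of => a x y; apply: (Guniq (a *: x + y)) => //.
  exact: (Glin a _ _ (Gf x) (Gf y)).
exists l; split=> [x|]; last by rewrite lf; exact: Guniq (Gf v) Gv.
rewrite ler_norml; apply/andP; split; last by rewrite lf; exact: Gp (Gf x).
by rewrite lerNl -linearN lf -(seminormN p); exact: Gp (Gf _).
Qed.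

End HahnBanach.

Section ContinuousDual.
Context (R : realType).
Implicit Type E : tvsType R.

Record cdual E := Cdual {
  cdual_fun :> {linear E -> R^o} ;
  cdual_continuous : continuous cdual_fun }.

Definition wbounded E (S : set E) :=
  forall l : cdual E, exists C : R, forall x, S x -> `|l x| <= C.

Lemma cdualZ E (l : cdual E) a x : l (a *: x) = a * l x.
Proof. exact: linearZ. Qed.

Lemma cdualD E (l : cdual E) x y : l (x + y) = l x + l y.
Proof. exact: linearD. Qed.

Lemma cdualB E (l : cdual E) x y : l (x - y) = l x - l y.
Proof. exact: linearB. Qed.

Lemma nbhs0_smallZ E (W : set E) (x : E) : nbhs 0 W ->
  exists2 d : R, 0 < d & forall t, `|t| < d -> W (t *: x).
Proof.
move=> W0; have W0' : nbhs ((0 : R^o) *: x) W by rewrite scale0r.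
have [[A B] /= [/nbhs_ballP[d d0 dA] Bx] ABW] := @scale_continuous R E (0, x) W W0'.
exists d => // t td; apply: (ABW (t, x)); split; last exact: nbhs_singleton.
by apply: dA; rewrite -ball_normE /= sub0r normrN.
Qed.

(** The Minkowski functional of a convex neighbourhood of 0, made symmetric by intersecting it with
    its negative. Local convexity is given by a base of convex sets, and this is how seminorms are
    recovered from it. Below, continuity of a seminorm is stated as its open unit ball being a
    neighbourhood of 0. *)
Lemma nbhs0_seminorm E (W : set E) : nbhs 0 W ->
  exists2 p : seminorm E, nbhs 0 [set x | p x < 1] & forall x, p x < 1 -> W x.
Proof.
move=> W0; have [Bs Bcvx [Bo Bb]] := @locally_convex R E.
have [C [BC C0] CW] := Bb 0 W W0.
have nC : nbhs 0 C by apply: open_nbhs_nbhs; split => //; exact: Bo.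
pose D := C `&` -%R @` C.
have nD : nbhs 0 D by apply: filterI => //; exact: nbhs0N.
have CC x y t : C x -> C y -> 0 <= t -> t <= 1 -> C (t *: x + (1 - t) *: y).
  move=> Cx Cy t0 t1; have t01 : 0 <= t <= 1 by rewrite t0.
  have := Bcvx C (mem_set BC) x y (Itv01 t0 t1) (mem_set Cx) (mem_set Cy).
  by rewrite inE.
have DC x y t : D x -> D y -> 0 <= t -> t <= 1 -> D (t *: x + (1 - t) *: y).
  move=> [Cx [x' Cx' xE]] [Cy [y' Cy' yE]] t0 t1; split; first exact: CC.
  by exists (t *: x' + (1 - t) *: y'); [exact: CC|rewrite -xE -yE !scalerN -opprD].
have DN x : D x -> D (- x).
  by move=> [Cx [x' Cx' xE]]; split; [rewrite -xE opprK|exists x].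
have D0 : D 0 by exact: nbhs_singleton.
have DZ x t : D x -> `|t| <= 1 -> D (t *: x).
  wlog t0 : x t / 0 <= t.
    move=> H Dx t1; have [|/ltW t0] := leP 0 t; first by move=> t0; exact: H.
    rewrite -[t]opprK scaleNr -scalerN; apply: H; rewrite ?oppr_ge0 ?normrN//.
    exact: DN.
  move=> Dx; rewrite ger0_norm// => t1.
  by have := DC x 0 t Dx D0 t0 t1; rewrite scaler0 addr0.
pose P x := [set r : R | 0 < r /\ D (r^-1 *: x)].
have Pne x : P x !=set0.
  have [d d0 dD] := nbhs0_smallZ x nD.
  exists (2 / d); split; first by rewrite divr_gt0.
  by apply: dD; rewrite invfM invrK gtr0_norm ?mulr_gt0 ?invr_gt0//; nra.
have P0 x : lbound (P x) 0 by move=> r [/ltW].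
have Pinf x : has_inf (P x) by split => //; exists 0.
pose p x : R := inf (P x).
have p0 x : 0 <= p x by exact: lb_le_inf.
have ple x r : 0 < r -> D (r^-1 *: x) -> p x <= r.
  by move=> r0 Dr; apply: ge_inf; [exists 0|split].
have pap x e : 0 < e -> exists2 r, P x r & r < p x + e.
  by move=> e0; exact: inf_adherent.
have pD x y : p (x + y) <= p x + p y.
  apply/ler_addgt0Pr => e e0; have e20 : 0 < e / 2 by rewrite divr_gt0.
  have [r [r0 Dr] re] := pap x _ e20; have [s [s0 Ds] se] := pap y _ e20.
  have rs0 : 0 < r + s by rewrite addr_gt0.
  suff : p (x + y) <= r + s by lra.
  apply: ple => //.
  have -> : (r + s)^-1 *: (x + y) =
      (r / (r + s)) *: (r^-1 *: x) + (1 - r / (r + s)) *: (s^-1 *: y).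
    rewrite !scalerA scalerDr; congr (_ *: _ + _ *: _); field;
      by rewrite ?gt_eqF.
  apply: DC => //; first by rewrite divr_ge0 ?ltW.
  by rewrite ler_pdivrMr// mul1r lerDl ltW.
have pZle a x : p (a *: x) <= `|a| * p x.
  have [->|a0] := eqVneq a 0.
    rewrite scale0r normr0 mul0r; apply/ler_addgt0Pr => e e0.
    by rewrite add0r; apply: ple => //; rewrite scaler0.
  have na0 : 0 < `|a| by rewrite normr_gt0.
  apply/ler_addgt0Pr => e e0.
  have [r [r0 Dr] re] := pap x _ (divr_gt0 e0 na0).
  apply: (@le_trans _ _ (`|a| * r)); last first.
    have -> : `|a| * p x + e = `|a| * (p x + e / `|a|) by field; rewrite normr_eq0.
    by rewrite ler_wpM2l// ltW.
  apply: ple; first by rewrite mulr_gt0.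
  rewrite scalerA invfM.
  have -> : `|a|^-1 / r * a = (`|a|^-1 * a) * r^-1 by ring.
  rewrite -scalerA; apply: DZ => //.
  by rewrite normrM normfV normr_id mulVf// gt_eqF.
have pZ a x : p (a *: x) = `|a| * p x.
  apply/eqP; rewrite eq_le pZle/=.
  have [->|a0] := eqVneq a 0; first by rewrite normr0 mul0r p0.
  rewrite -ler_pdivlMl ?normr_gt0// -normfV.
  by rewrite -{1}[x](scalerK a0) pZle.
exists (Seminorm pD pZ) => /= [|x p1].
  have := nbhs0Z (_ : (2^-1 : R) != 0) nD.
  move=> /(_ ltac:(by rewrite invr_eq0)) h; near=> x => /=.
  have [y Dy <-] : [set 2^-1 *: y | y in D] x by near: x.
  apply: (@le_lt_trans _ _ 2^-1); last lra.
  by apply: ple => //; rewrite invrK scalerA mulfV// scale1r.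
have [r [r0 Dr] r1] : exists2 r, P x r & r < p x + (1 - p x).
  by apply: pap; rewrite subr_gt0.
apply: CW; suff : D x by case.
rewrite -[x](scalerK (invr_neq0 (lt0r_neq0 r0))) invrK; apply: DZ => //.
by rewrite gtr0_norm//; lra.
Unshelve. all: by end_near. Qed.

Lemma nbhs0_seminorm_lt E (p : seminorm E) e : 0 < e ->
  nbhs 0 [set x | p x < 1] -> nbhs 0 [set x | p x < e].
Proof.
move=> e0 p1; have := nbhs0Z (lt0r_neq0 e0) p1; apply: filterS => _ [x /= px <-].
by rewrite seminormZ gtr0_norm// -[ltRHS]mulr1 ltr_pM2l.
Qed.

Lemma nbhs_sub0 E (x : E) (A : set E) : nbhs 0 A -> nbhs x [set y | A (y - x)].
Proof.
by move=> /(nbhsT x); apply: filterS => _ [y Ay <-] /=; rewrite addrAC subrr add0r.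
Qed.

Lemma seminorm_continuous E (p : seminorm E) :
  nbhs 0 [set x | p x < 1] -> continuous (p : E -> R^o).
Proof.
move=> p1 x; apply/cvgrPdist_lt => e e0; have := nbhs_sub0 x (nbhs0_seminorm_lt e0 p1).
apply: filterS => y /= yx; apply: le_lt_trans yx.
have := seminormD p x (y - x); have := seminormD p (y - x) (x - y).
have := seminormD p y (x - y); rewrite -(opprB y x) seminormN.
rewrite subrr opprB subrKC subrKC => h1 h2 h3.
by rewrite ler_norml; apply/andP; split; lra.
Qed.

Lemma continuous_seminorm_nbhs E (p : seminorm E) :
  continuous (p : E -> R^o) -> nbhs 0 [set x | p x < 1].
Proof.
move=> /(_ 0)/cvgrPdist_lt/(_ 1 ltr01); apply: filterS => x.
by rewrite seminorm0 sub0r normrN ger0_norm ?seminorm_ge0.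
Qed.

Lemma linear_continuous_seminorm E (p : seminorm E) (l : {linear E -> R^o}) C :
  nbhs 0 [set x | p x < 1] -> (forall x, `|l x| <= C * p x) -> continuous l.
Proof.
move=> p1 lp x; apply/cvgrPdist_lt => e e0.
have C1 : 0 < `|C| + 1 by rewrite ltr_wpDl.
have := nbhs_sub0 x (nbhs0_seminorm_lt (divr_gt0 e0 C1) p1).
apply: filterS => y /= yx; rewrite distrC -linearB.
apply: le_lt_trans (lp _) _; move: yx; rewrite ltr_pdivlMr// => yx.
apply: le_lt_trans yx; rewrite mulrC ler_wpM2l ?seminorm_ge0//.
by have := ler_norm C; lra.
Qed.

Lemma cdual_sep E (x : E) : hausdorff_space E -> (forall l : cdual E, l x = 0) -> x = 0.
Proof.
move=> hE lx; apply/esym/hE => A B A0 Bx.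
have [A' A'0 /= A'A] : exists2 p : seminorm E, nbhs 0 [set x | p x < 1] & forall x, p x < 1 -> A x.
  exact: nbhs0_seminorm.
have [l [lp lpx]] := Hahn_Banach A' x.
have lc : continuous l.
  by apply: (@linear_continuous_seminorm _ A' _ 1) => // y; rewrite mul1r.
exists x; split; last exact: nbhs_singleton.
by apply: A'A; rewrite -lpx (lx (Cdual lc)).
Qed.

Lemma cdual_ext E (x y : E) : hausdorff_space E ->
  (forall l : cdual E, l x = l y) -> x = y.
Proof.
move=> hE lxy; apply/eqP; rewrite -subr_eq0; apply/eqP/cdual_sep => // l.
by rewrite linearB lxy subrr.
Qed.

Lemma tvs_bounded_seminorm E (S : set E) :
  (forall p : seminorm E, nbhs 0 [set x | p x < 1] ->
    exists C : R, forall x, S x -> p x <= C) -> tvs_bounded S.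
Proof.
move=> HS W /nbhs0_seminorm[p p1 pW]; have [C SC] := HS p p1.
have C0 : 0 < `|C| + 1 by rewrite ltr_wpDl.
exists (`|C| + 1) => // x Sx; exists ((`|C| + 1)^-1 *: x); last first.
  by rewrite scalerA mulfV ?scale1r// gt_eqF.
apply: pW; rewrite seminormZ normfV (gtr0_norm C0) ltr_pdivrMl// mulr1.
by apply: le_lt_trans (SC _ Sx) _; have := ler_norm C; lra.
Qed.

Lemma bounded_seminorm E (S : set E) (p : seminorm E) : tvs_bounded S ->
  nbhs 0 [set x | p x < 1] -> exists C : R, forall x, S x -> p x <= C.
Proof.
move=> HS p1; have [r r0 Sr] := HS _ p1; exists r => x /Sr[y /= py <-].
by rewrite seminormZ gtr0_norm// -[leRHS]mulr1 ler_wpM2l// ltW.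
Qed.

Lemma cdual_seminorm E (l : cdual E) : exists2 p : seminorm E,
  nbhs 0 [set x | p x < 1] & forall x, p x = `|l x|.
Proof.
have pD x y : `|l (x + y)| <= `|l x| + `|l y| by rewrite linearD ler_normD.
have pZ a x : `|l (a *: x)| = `|a| * `|l x| by rewrite linearZ normrM.
exists (Seminorm pD pZ) => //=.
have := @cdual_continuous _ l 0; move=> /cvgrPdist_lt/(_ 1 ltr01).
by apply: filterS => x; rewrite linear0 sub0r normrN.
Qed.

Lemma bounded_wbounded E (S : set E) : tvs_bounded S -> wbounded S.
Proof.
move=> HS l; have [p p1 pl] := cdual_seminorm l.
by have [C SC] := bounded_seminorm HS p1; exists C => x /SC; rewrite pl.
Qed.

End ContinuousDual.

(** * Mackey's theorem: weakly bounded sets are bounded *)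

Section Mackey.
Context (R : realType) (E : tvsType R).

Let series_cvg4 (u : nat -> R) C : (forall n, `|u n| <= C * 4^-1 ^+ n) -> cvgn (series u).
Proof.
move=> uC; apply: normed_cvg; apply: (@series_le_cvg _ _ (geometric C 4^-1)) => //.
- by move=> n; exact: normr_ge0.
- by move=> n; exact: le_trans (normr_ge0 _) (uC n).
- by apply: is_cvg_geometric_series; rewrite ger0_norm; lra.
Qed.

(* Gliding hump: the sum of the functionals 4^-j l_j is unbounded on S. *)
Theorem wbounded_bounded (S : set E) : wbounded S -> tvs_bounded S.
Proof.
move=> wS; apply: tvs_bounded_seminorm => p p1; apply: contrapT => /forallNP Sp.
have pos4 n : 0 < (4^-1 : R) ^+ n by rewrite exprn_gt0.
have big C : exists x, S x /\ C <= p x.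
  have /existsNP[x /not_implyP[Sx /negP]] := Sp C.
  by rewrite -ltNge => /ltW ?; exists x.
pose pick C := projT1 (cid (big C)).
have pickS C : S (pick C) by have [] := projT2 (cid (big C)).
have pickp C : C <= p (pick C) by have [] := projT2 (cid (big C)).
have HB x : exists l : cdual E, (forall y, `|l y| <= p y) /\ l x = p x.
  have [l [lp lx]] := Hahn_Banach p x.
  have lc : continuous l.
    by apply: (@linear_continuous_seminorm _ _ p _ 1) => // y; rewrite mul1r.
  by exists (Cdual lc).
pose lam x : cdual E := projT1 (cid (HB x)).
have lamp x y : `|lam x y| <= p y by have [] := projT2 (cid (HB x)).
have lamx x : lam x x = p x by have [] := projT2 (cid (HB x)).
pose c x := projT1 (cid (wS (lam x))).
have cP x y : S y -> `|lam x y| <= c x by exact: (projT2 (cid (wS (lam x)))).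
(* [H n] bounds on all of S the sum of the terms before n. At [s n] the n-th term T = 4^-n p (s n)
   is at least 3/2 (n + H n), and the later terms add up to at most T / 3, since |l_j| <= p. So |L
   (s n)| >= 2/3 T - H n >= n. *)
pose nxt n H := pick (4 ^+ n * (3 / 2) * (n%:R + H)).
pose H := fix H n := if n is m.+1 then H m + 4^-1 ^+ m * c (nxt m (H m)) else 0.
pose s n := nxt n (H n).
have Ss n : S (s n) by exact: pickS.
pose u x n : R := 4^-1 ^+ n * lam (s n) x.
have uC x n : `|u x n| <= p x * 4^-1 ^+ n.
  by rewrite normrM (gtr0_norm (pos4 n)) mulrC ler_wpM2r// ltW.
have ucvg x : cvgn (series (u x)) by exact: series_cvg4 (uC x).
have [L LE] : exists L : {linear E -> R^o}, forall x, L x = limn (series (u x)).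
  apply: linear_of => a x y.
  transitivity (a * limn (series (u x)) + limn (series (u y))); last by [].
  apply/cvg_lim => //; rewrite (_ : series _ = (fun n => a * series (u x) n + series (u y) n)).
    by apply: cvgD => //; apply: cvgM => //; exact: cvg_cst.
  apply/funext => n; rewrite /series /= mulr_sumr -big_split/=; apply: eq_bigr => i _.
  rewrite /u (_ : lam _ _ = a * lam (s i) x + lam (s i) y :> R); first by ring.
  exact: linearP.
have Lub x C k : (forall n, (k <= n)%N -> `|series (u x) n| <= C) -> `|L x| <= C.
  move=> h; have /cvg_norm cv := ucvg x.
  rewrite LE -(cvg_lim _ cv)//; apply: limr_le; first by apply/cvg_ex; eexists; exact: cv.
  by exists k => // n /= kn; exact: h.
have Llb x C k : (forall n, (k <= n)%N -> C <= `|series (u x) n|) -> C <= `|L x|.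
  move=> h; have /cvg_norm cv := ucvg x.
  rewrite LE -(cvg_lim _ cv)//; apply: limr_ge; first by apply/cvg_ex; eexists; exact: cv.
  by exists k => // n /= kn; exact: h.
have serS x n : series (u x) n.+1 = series (u x) n + u x n.
  by rewrite /series /= big_nat_recr.
have Lc : continuous L.
  apply: (@linear_continuous_seminorm _ _ p _ (4 / 3)) => // x.
  apply: (Lub x _ 0%N) => n _.
  apply: (@le_trans _ _ (4 / 3 * p x * (1 - 4^-1 ^+ n))); last first.
    by have := pos4 n; have := seminorm_ge0 p x; nra.
  elim: n => [|n IH]; first by rewrite /series /= big_geq// normr0 expr0 subrr mulr0.
  rewrite serS; apply: le_trans (ler_normD _ _) _.
  have := uC x n; rewrite exprS; move: IH; set a := `|_|; set b := `|_|; lra.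
have [C LC] := wS (Cdual Lc).
have Lk k : k%:R <= `|L (s k)|.
  apply: (Llb _ _ k.+1) => n kn.
  have -> : n = (k.+1 + (n - k.+1))%N by rewrite subnKC.
  have hd m x : S x -> `|series (u x) m| <= H m.
    move=> Sx; elim: m => [|m IH]; first by rewrite /series /= big_geq// normr0.
    rewrite serS; apply: le_trans (ler_normD _ _) _; apply: lerD => //.
    by rewrite normrM (gtr0_norm (pos4 m)) ler_wpM2l ?(ltW (pos4 m))//; exact: cP.
  set P := p (s k).
  have P0 : 0 <= P by exact: seminorm_ge0.
  have uk : u (s k) k = 4^-1 ^+ k * P by rewrite /u lamx.
  have big_s : k%:R + H k <= 2 / 3 * (4^-1 ^+ k * P).
    have : 4 ^+ k * (3 / 2) * (k%:R + H k) <= P by exact: pickp.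
    rewrite -(ler_pM2l (pos4 k)) !mulrA exprVn mulVf ?expf_neq0// mul1r; lra.
  apply: (@le_trans _ _ (4^-1 ^+ k * P - H k - P * (4^-1 ^+ k - 4^-1 ^+ (k + (n - k.+1))) / 3)).
    have : 0 <= P * 4^-1 ^+ (k + (n - k.+1)) by rewrite mulr_ge0// ltW.
    lra.
  elim: (n - k.+1)%N => [|m IH].
    rewrite !addn0 subrr mulr0 mul0r subr0 serS uk.
    have := hd k _ (Ss k); have := ler_normB (series (u (s k)) k + 4^-1 ^+ k * P) (series (u (s k)) k).
    rewrite addrAC subrr add0r (ger0_norm (_ : 0 <= 4^-1 ^+ k * P)) ?mulr_ge0 ?(ltW (pos4 k))//.
    by lra.
  rewrite !addnS serS.
  have := uC (s k) (k.+1 + m)%N; rewrite -/P.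
  have := ler_normB (series (u (s k)) (k.+1 + m)%N + u (s k) (k.+1 + m)%N) (u (s k) (k.+1 + m)%N).
  rewrite addrK; move: IH; rewrite !addSn !exprS; lra.
have := Lk (Num.truncn C).+1; have := LC _ (Ss (Num.truncn C).+1).
rewrite /= => h1 h2.
have := truncnS_gt C; lra.
Qed.

End Mackey.

Section WeaklyBounded.
Context (R : realType).
Implicit Type E : tvsType R.

Lemma wboundedS E (S T : set E) : S `<=` T -> wbounded T -> wbounded S.
Proof. by move=> ST wT l; have [C TC] := wT l; exists C => x /ST/TC. Qed.

Lemma wboundedU E (S T : set E) : wbounded S -> wbounded T -> wbounded (S `|` T).
Proof.
move=> wS wT l; have [C SC] := wS l; have [D TD] := wT l.
exists (Num.max C D) => x [/SC h|/TD h]; rewrite le_max ?h// orbT//.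
Qed.

Lemma wbounded1 E (x : E) : wbounded [set x].
Proof. by move=> l; exists `|l x| => _ ->. Qed.

Lemma wbounded_seq E (s : seq E) : wbounded [set x | x \in s].
Proof.
elim: s => [|x s IH]; first by move=> l; exists 0.
apply: wboundedS (wboundedU (wbounded1 x) IH) => y /=.
by rewrite inE => /predU1P[->|?]; [left|right].
Qed.

End WeaklyBounded.

Section WeakDisks.
Context (R : realType).
Implicit Type E : tvsType R.

Lemma disk_normE E (B : disk E) (x : disk_space B) : `|x| = Defs.minkowski x.
Proof. by []. Qed.

Lemma disk_lift E (B : disk E) t (x : E) : 0 < t -> disk_set B (t^-1 *: x) ->
  exists2 y : disk_space B, disk_incl y = x & `|y| <= t.
Proof.
move=> t0 Bx; have sx : linear_span B x.
  move=> S S0 SL BS; rewrite -[x](scalerK (invr_neq0 (lt0r_neq0 t0))) invrK -[X in S X]addr0.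
  by apply: SL => //; exact: BS.
exists (DiskSpace (mem_set sx)) => //.
rewrite disk_normE; apply: minkowski_le; split => //; exists (t^-1 *: x) => //=.
by rewrite scalerA mulfV ?scale1r// gt_eqF.
Qed.

Lemma disk_lift1 E (B : disk E) (x : E) : disk_set B x ->
  exists2 y : disk_space B, disk_incl y = x & `|y| <= 1.
Proof. by move=> Bx; apply: disk_lift => //; rewrite invr1 scale1r. Qed.

Lemma diskZ E (B : disk E) a x : disk_set B x -> `|a| <= 1 -> disk_set B (a *: x).
Proof.
by move=> Bx a1; have := @disk_absconvex _ _ B x x a 0 Bx Bx;
  rewrite normr0 addr0 scale0r addr0; exact.
Qed.

(** The first alternative is there for the empty disk, whose span is the zero space; any other disk
    contains 0. *)
Lemma disk_norm_lt E (B : disk E) (y : disk_space B) r : `|y| < r ->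
  disk_incl y = 0 \/ disk_set B (r^-1 *: disk_incl y).
Proof.
rewrite disk_normE => yr; have r0 : 0 < r by exact: le_lt_trans (minkowski_ge0 _) yr.
have [->|[s [s0 [b Bb ->]] sr]] := minkowski_lt yr; [by left|right].
by rewrite scalerA; apply: diskZ => //; rewrite gtr0_norm ?mulr_gt0 ?invr_gt0// mulrC ler_pdivrMr// mul1r ltW.
Qed.

Lemma disk_inclD E (B : disk E) (x y : disk_space B) :
  disk_incl (x + y) = disk_incl x + disk_incl y.
Proof. by []. Qed.

Lemma disk_inclB E (B : disk E) (x y : disk_space B) :
  disk_incl (x - y) = disk_incl x - disk_incl y.
Proof. by []. Qed.

Lemma disk_inclZ E (B : disk E) a (x : disk_space B) :
  disk_incl (a *: x) = a *: disk_incl x.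
Proof. by []. Qed.

Lemma disk_incl_inj E (B : disk E) : injective (@disk_incl R E B).
Proof. by move=> x y xy; exact: val_inj. Qed.

Lemma disk_cdual E (B : disk E) (l : cdual E) :
  exists2 C, 0 <= C & forall y : disk_space B, `|l (disk_incl y)| <= C * `|y|.
Proof.
have [C BC] := bounded_wbounded (@disk_bounded _ _ B) l.
exists `|C| => // y; apply/ler_addgt0Pr => e e0.
have C1 : 0 < `|C| + 1 by rewrite ltr_wpDl.
have : `|y| < `|y| + e / (`|C| + 1) by rewrite ltrDl divr_gt0.
set r := _ + _ => yr; have r0 : 0 < r by exact: le_lt_trans yr.
have rC : `|C| * r <= `|C| * `|y| + e.
  rewrite mulrDr lerD2l mulrCA -[leRHS]mulr1 ler_pM2l// ler_pdivrMr// mul1r lerDl//.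
have [->|/BC] := disk_norm_lt yr; first by rewrite linear0 normr0 addr_ge0 ?mulr_ge0// ltW.
rewrite linearZ normrM normfV (gtr0_norm r0) ler_pdivrMl// => h.
apply: le_trans h _; rewrite mulrC; apply: le_trans rC.
by rewrite ler_wpM2r ?(ltW r0)// ler_norm.
Qed.

Lemma disk_wbounded E (B : disk E) : wbounded B.
Proof. exact/bounded_wbounded/disk_bounded. Qed.

(** A bound c l for each functional l cuts out a weakly closed, hence closed set; that it is bounded
    is Mackey's theorem. Every disk below arises in this way from weak bounds, through
    [wbounded_disk]. *)
Lemma wdisk_subproof E (c : cdual E -> R) (B := [set x : E | forall l : cdual E, `|l x| <= c l]) :
  [/\ closed B, absolutely_convex B & tvs_bounded B].
Proof.
split.
- rewrite (_ : B = \bigcap_(l in [set: cdual E]) ((l : E -> R^o) @^-1` [set t | `|t| <= c l])).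
    apply: closed_bigI => l _.
    apply: closed_comp => [x _|]; first exact: (@cdual_continuous _ _ l x).
    rewrite (_ : mkset _ = (Num.norm : R^o -> R) @^-1` [set t : R | t <= c l])//.
    apply: closed_comp => [t _|]; last exact: closed_le.
    exact: (@norm_continuous R R^o).
  by apply/seteqP; split=> [x Bx l _|x Bx l]; [exact: Bx|exact: Bx].
- move=> x y a b Bx By ab l; rewrite linearD !linearZ.
  have c0 : 0 <= c l by exact: le_trans (Bx l).
  apply: le_trans (ler_normD _ _) _; rewrite !normrM.
  have := ler_wpM2l (normr_ge0 a) (Bx l); have := ler_wpM2l (normr_ge0 b) (By l).
  have := ler_wpM2r c0 ab; lra.
- by apply: wbounded_bounded => l; exists (c l) => x; exact.
Qed.

Definition wdisk E (hE : hausdorff_space E) (c : cdual E -> R) : disk E :=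
  let: And3 cl ac bd := wdisk_subproof c in Disk cl ac bd hE.

Lemma wdiskE E (hE : hausdorff_space E) c :
  wdisk hE c = [set x | forall l : cdual E, `|l x| <= c l] :> set E.
Proof. by rewrite /wdisk; case: wdisk_subproof. Qed.

Lemma wbounded_disk E (S : set E) : hausdorff_space E -> wbounded S ->
  exists B : disk E, S `<=` B.
Proof.
move=> hE wS; exists (wdisk hE (fun l => projT1 (cid (wS l)))); rewrite wdiskE.
by move=> x Sx l; exact: (projT2 (cid (wS l))).
Qed.

End WeakDisks.
(** * Curves *)

Section RealDerivatives.
Context (R : realType).
Implicit Types (f g : R -> R) (t d h e : R).

(** Differentiability as a remainder estimate without division. A remainder of second order yields
    it directly, see [hasd_quad], and this is how most derivatives below are obtained. *)
Definition hasd f t d := forall e, 0 < e -> exists2 r, 0 < r &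
  forall h, `|h| < r -> `|f (t + h) - f t - h * d| <= e * `|h|.

Lemma hasdP f t d : hasd f t d <-> is_derive t 1 f d.
Proof.
have key : (h^-1 *: (f (h *: 1 + t) - f t) @[h --> (0:R)^'] --> d) <-> hasd f t d.
  split=> [/cvgrPdist_le H e e0|H].
    have /= := H e e0 => /nbhs_ballP[r r0 /= rH].
    exists r => // h hr; have [->|h0] := eqVneq h 0.
      by rewrite addr0 mul0r !subrr normr0 mulr0.
    have := rH h; rewrite /= /ball /= sub0r normrN => /(_ hr h0).
    rewrite -(ler_pM2r (_ : 0 < `|h|)) ?normr_gt0//; apply: le_trans.
    rewrite -normrM mulrBl /GRing.scale /= mulr1 [h + t]addrC mulrAC mulVf// mul1r.
    by rewrite [leRHS]distrC [d * h]mulrC.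
  apply/cvgrPdist_le => e e0; have [r r0 rH] := H e e0; near=> h.
  have h0 : h != 0 by near: h; exact: nbhs_dnbhs_neq.
  rewrite -(ler_pM2r (_ : 0 < `|h|)) ?normr_gt0//.
  apply: le_trans (rH h _); last first.
    by near: h; apply: dnbhs0_lt.
  rewrite -normrM mulrBl /GRing.scale /= mulr1 [h + t]addrC mulrAC mulVf// mul1r.
  by rewrite distrC [d * h]mulrC.
split=> [/key H|[df dE]]; last by apply/key; rewrite -dE; exact: df.
have cv : derivable f t 1 by apply/cvg_ex; exists d.
by apply: DeriveDef => //; exact: cvg_lim.
Unshelve. all: by end_near. Qed.

Lemma hasd_ext f g t d : (exists2 r, 0 < r & forall h, `|h| < r -> f (t + h) = g (t + h)) ->
  hasd f t d -> hasd g t d.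
Proof.
move=> [r r0 fg] H e e0; have [s s0 sH] := H e e0; exists (Num.min r s).
  by rewrite lt_min r0.
move=> h; rewrite lt_min => /andP[hr hs]; rewrite -fg//.
by have := fg 0; rewrite normr0 addr0 => <-//; exact: sH.
Qed.

Lemma hasd_uniq f t d d' : hasd f t d -> hasd f t d' -> d = d'.
Proof.
by move=> /hasdP H /hasdP H'; rewrite -(derive_val (is_derive := H)) -(derive_val (is_derive := H')).
Qed.

Lemma hasd_quad f t d r C : 0 < r ->
  (forall h, `|h| <= r -> `|f (t + h) - f t - h * d| <= C * h ^+ 2) -> hasd f t d.
Proof.
move=> r0 H e e0; have C1 : 0 < `|C| + 1 by rewrite ltr_wpDl.
exists (Num.min r (e / (`|C| + 1))); first by rewrite lt_min r0 divr_gt0.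
move=> h; rewrite lt_min => /andP[hr he]; apply: le_trans (H h (ltW hr)) _.
rewrite -normr_id -real_normK ?num_real// normr_id expr2 mulrA.
apply: ler_wpM2r => //; move: he; rewrite ltr_pdivlMr// => he.
have := ler_wpM2r (normr_ge0 h) (ler_norm C); have := normr_ge0 h; lra.
Qed.

Lemma hasd_cst c t : hasd (fun=> c) t 0.
Proof. by move=> e e0; exists 1 => // h _; rewrite mulr0 subrr subr0 normr0 mulr_ge0// ltW. Qed.

Lemma hasd_id t : hasd id t 1.
Proof. by move=> e e0; exists 1 => // h _; rewrite mulr1 [t + h]addrC addrK subrr normr0 mulr_ge0// ltW. Qed.

Lemma hasdD f g t d d' : hasd f t d -> hasd g t d' -> hasd (fun x => f x + g x) t (d + d').
Proof. by move=> /hasdP ? /hasdP ?; apply/hasdP; exact: is_deriveD. Qed.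

Lemma hasdM f g t d d' : hasd f t d -> hasd g t d' ->
  hasd (fun x => f x * g x) t (d * g t + f t * d').
Proof.
move=> /hasdP Hf /hasdP Hg; apply/hasdP.
rewrite (_ : _ + _ = f t *: d' + g t *: d); first exact: is_deriveM.
by rewrite /GRing.scale /= addrC [g t * d]mulrC.
Qed.

Lemma hasdZ f t d a : hasd f t d -> hasd (fun x => a * f x) t (a * d).
Proof. by move=> H; have := hasdM (hasd_cst a t) H; rewrite mul0r add0r. Qed.

Lemma hasd_sum (I : Type) (r : seq I) (P : pred I) (F : I -> R -> R) (G : I -> R) t :
  (forall i, P i -> hasd (F i) t (G i)) ->
  hasd (fun x => \sum_(i <- r | P i) F i x) t (\sum_(i <- r | P i) G i).
Proof.
move=> H; elim: r => [|i r IH].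
  by rewrite big_nil (_ : (fun _ => _) = fun=> 0)//; [exact: hasd_cst|apply/funext => x; rewrite big_nil].
rewrite (_ : (fun _ => _) = fun x => if P i then F i x + \sum_(i <- r | P i) F i x else \sum_(i <- r | P i) F i x).
  by rewrite big_cons; case: ifPn => // Pi; exact: hasdD (H _ Pi) IH.
by apply/funext => x; rewrite big_cons.
Qed.

Lemma hasd_affine f t d a b : hasd f (a + t * b) d -> hasd (fun x => f (a + x * b)) t (b * d).
Proof.
move=> H e e0; have b1 : 0 < `|b| + 1 by rewrite ltr_wpDl.
have [r r0 rH] := H (e / (`|b| + 1)) (divr_gt0 e0 b1).
exists (r / (`|b| + 1)); first exact: divr_gt0.
move=> h; rewrite ltr_pdivlMr// => hr.
have hb : `|h * b| < r.
  by rewrite normrM; apply: le_lt_trans hr; rewrite ler_wpM2l// lerDl.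
have := rH _ hb; rewrite mulrDl addrA -mulrA => /le_trans; apply.
have bb : `|b| / (`|b| + 1) <= 1 by rewrite ler_pdivrMr// mul1r lerDl.
have -> : e / (`|b| + 1) * `|h * b| = e * `|h| * (`|b| / (`|b| + 1)) by rewrite normrM; ring.
by rewrite ler_piMr// mulr_ge0// ltW.
Qed.

Lemma hasd_cont f t d : hasd f t d -> {for t, continuous f}.
Proof. by move=> /hasdP H; exact/differentiable_continuous/derivable1_diffP/ex_derive. Qed.

Lemma hasd_within f (d : R -> R) a b : (forall t, a <= t <= b -> hasd f t (d t)) ->
  {within `[a, b], continuous f}.
Proof.
move=> H; apply: continuous_in_subspaceT => t /set_mem /=.
by rewrite in_itv /= => tab; exact: hasd_cont (H t tab).
Qed.

Lemma hasd_MVT f (d : R -> R) a b : a <= b -> (forall t, a <= t <= b -> hasd f t (d t)) ->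
  exists2 c, a <= c <= b & f b - f a = d c * (b - a).
Proof.
move=> ab H; have [|c + ->] := @MVT_segment _ f d a b ab _ (hasd_within H).
  by move=> t; rewrite in_itv /= => /andP[at_ tb]; apply/hasdP/H; rewrite !ltW.
by rewrite in_itv /=; exists c.
Qed.

Lemma hasd_bounded f (d : R -> R) a b : (forall t, a <= t <= b -> hasd f t (d t)) ->
  exists C : R, forall t, a <= t <= b -> `|f t| <= C.
Proof.
move=> H; have [ab|ba] := leP a b; last first.
  by exists 0 => t /andP[at_ tb]; move: (le_lt_trans (le_trans at_ tb) ba); rewrite ltxx.
have [c1 _ h1] := EVT_max ab (hasd_within H).
have [c2 _ h2] := EVT_min ab (hasd_within H).
exists (Num.max (f c1) (- f c2)) => t tab; rewrite ler_norml lerNl !le_max.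
by rewrite lerN2 h1 ?h2 ?orbT// in_itv.
Qed.

(** Induction through the derivative: the remainder of order n for g' bounds the derivative of the
    remainder r of g. By the mean value theorem, the differences of A t^(n+2) / (n+2)! with r and
    with -r are then nonnegative. *)
Lemma taylor_bound n (g : nat -> R -> R) (A : R) :
  (forall k t, (k <= n)%N -> 0 <= t <= 1 -> hasd (g k) t (g k.+1 t)) ->
  (forall t, 0 <= t <= 1 -> `|g n.+1 t| <= A) ->
  forall t, 0 <= t <= 1 ->
  `|g 0%N t - \sum_(k < n.+1) k`!%:R^-1 * g k 0 * t ^+ k| <= A * (t ^+ n.+1 / n.+1`!%:R).
Proof.
elim: n g => [|n IH] g Hg gA t /andP[t0 t1].
  rewrite big_ord_recr big_ord0 /= expr0 !fact0 invr1 add0r mulr1 mul1r expr1 mulr1.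
  have [c /andP[c0 ct] ->] := hasd_MVT t0 (fun s st => Hg 0%N s (leqnn _)
    (let: conj a b := andP st in introT andP (conj a (le_trans b t1)))).
  rewrite subr0 normrM (ger0_norm t0) ler_wpM2r// gA// c0; exact: le_trans ct t1.
pose r s := g 0%N s - \sum_(k < n.+2) k`!%:R^-1 * g k 0 * s ^+ k.
pose r' s := g 1%N s - \sum_(k < n.+1) k`!%:R^-1 * g k.+1 0 * s ^+ k.
have pw k s : hasd (fun s => s ^+ k.+1) s (k.+1%:R * s ^+ k).
  elim: k => [|k IHk]; first by rewrite expr0 mulr1; exact: hasd_id.
  have := hasdM (hasd_id s) IHk; congr hasd; rewrite [k.+2%:R]mulrSr exprS; ring.
have rr' s : 0 <= s <= 1 -> hasd r s (r' s).
  move=> s01; rewrite /r /r'; apply: hasdD; first exact: Hg.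
  rewrite -[X in hasd _ _ X]mulN1r.
  rewrite (_ : (fun x => _) = (fun x => -1 * \sum_(k < n.+2) k`!%:R^-1 * g k 0 * x ^+ k)); last first.
    by apply/funext => x; rewrite mulN1r.
  apply: hasdZ; rewrite (_ : (fun x => _) = (fun x => g 0%N 0 + \sum_(k < n.+1)
      k.+1`!%:R^-1 * g k.+1 0 * x ^+ k.+1)); last first.
    by apply/funext => x; rewrite big_ord_recl /= fact0 invr1 mul1r expr0 mulr1.
  rewrite -[X in hasd _ _ X]add0r; apply: hasdD; first exact: hasd_cst.
  apply: hasd_sum => k _; have := hasdZ ((k.+1)`!%:R^-1 * g k.+1 0) (pw k s).
  congr hasd; rewrite factS natrM; field.
  by rewrite addrC natr1 !pnatr_eq0 -!lt0n fact_gt0.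
have r'A s : 0 <= s <= 1 -> `|r' s| <= A * (s ^+ n.+1 / n.+1`!%:R).
  move=> s01; apply: (IH (fun k => g k.+1)) => // k u kn; exact: Hg.
have q s : hasd (fun s => A * (s ^+ n.+2 / n.+2`!%:R)) s (A * (s ^+ n.+1 / n.+1`!%:R)).
  apply: hasdZ; have := hasdM (pw n.+1 s) (hasd_cst (n.+2`!%:R)^-1 s).
  rewrite mulr0 addr0; set a := _ / _; set b := _ / _; suff -> : a = b by [].
  by rewrite /a /b [(n.+2)`!]factS natrM invfM mulrACA mulfV ?mul1r// pnatr_eq0.
have r0 : r 0 = 0.
  rewrite /r big_ord_recl /= fact0 invr1 expr0 mul1r mulr1 big1 ?addr0 ?subrr// => i _.
  by rewrite expr0n mulr0.
have sgn (u : R) : `|u| <= 1 -> u * r t <= A * (t ^+ n.+2 / n.+2`!%:R).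
  move=> u1; have H s : 0 <= s <= t ->
      hasd (fun s => A * (s ^+ n.+2 / n.+2`!%:R) + (- u) * r s) s
        (A * (s ^+ n.+1 / n.+1`!%:R) + (- u) * r' s).
    move=> /andP[s0 st]; apply: hasdD => //; apply: hasdZ; apply: rr'.
    by rewrite s0 (le_trans st).
  have [c /andP[c0 ct]] := hasd_MVT t0 H.
  rewrite r0 mulr0 expr0n /= mul0r mulr0 addr0 !subr0 => e.
  rewrite -subr_ge0 -mulNr e mulr_ge0// -[X in X + _]opprK addrC subr_ge0 lerNl.
  have := r'A c; rewrite c0 (le_trans ct t1) => /(_ isT).
  rewrite mulNr; apply: le_trans; rewrite opprK; apply: le_trans (ler_norm _) _.
  by rewrite normrM ler_piMl.
rewrite -/(r t) ler_norml lerNl -mulN1r !sgn ?normrN1//=.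
by have := sgn 1; rewrite normr1 mul1r; apply.
Qed.

Lemma taylor1_bound (g g1 : R -> R) t h (A : R) :
  (forall s : R, 0 <= s <= 1 -> hasd g (t + s * h) (g1 (t + s * h))) ->
  (forall s : R, 0 <= s <= 1 -> `|g1 (t + s * h)| <= A) ->
  `|g (t + h) - g t| <= A * `|h|.
Proof.
move=> H0 H1.
have [c c01] := hasd_MVT ler01 (fun s s01 => hasd_affine (H0 s s01)).
rewrite mul1r mul0r addr0 subr0 mulr1 => ->.
by rewrite normrM mulrC ler_wpM2r// H1.
Qed.

Lemma taylor2_bound (g g1 g2 : R -> R) t h (A : R) :
  (forall s : R, 0 <= s <= 1 -> hasd g (t + s * h) (g1 (t + s * h))) ->
  (forall s : R, 0 <= s <= 1 -> hasd g1 (t + s * h) (g2 (t + s * h))) ->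
  (forall s : R, 0 <= s <= 1 -> `|g2 (t + s * h)| <= A) ->
  `|g (t + h) - g t - h * g1 t| <= A * h ^+ 2.
Proof.
move=> H0 H1 H2.
pose G k s := match k with 0%N => g (t + s * h) | 1%N => h * g1 (t + s * h)
  | _ => h * (h * g2 (t + s * h)) end.
have A0 : 0 <= A by apply: le_trans (H2 0 _) => //; rewrite lexx ler01.
have := @taylor_bound 1 G (A * h ^+ 2) _ _ 1; rewrite ler01 lexx.
rewrite !big_ord_recr big_ord0 /= !expr1n !mulr1 !mul1r invr1 !mul1r !mul0r !addr0 add0r.
rewrite opprD addrA => H; apply: le_trans (H _ _ isT) _.
- case=> [|[|//]] s _ s01 /=; first exact/hasd_affine/H0.
  by apply: hasdZ; exact/hasd_affine/H1.
- move=> s s01; rewrite mulrA normrM -expr2 mulrC.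
  by rewrite (ger0_norm (sqr_ge0 h)) ler_wpM2r ?sqr_ge0// H2.
- have -> : (2`!%:R : R) = 2 by []; have := mulr_ge0 A0 (sqr_ge0 h); lra.
Qed.

End RealDerivatives.

Section WeakSmoothness.
Context (R : realType) (E : tvsType R).

Lemma smooth_curve_hasd (c : R -> E) : smooth_curve c ->
  exists2 d : nat -> R -> E, d 0%N = c &
    forall (l : cdual E) n t, hasd (fun t => l (d n t)) t (l (d n.+1 t)).
Proof.
move=> [d [d0 Hd]]; exists d => // l n t; apply/hasdP.
have cv : (h^-1 *: (l (d n (h *: 1 + t)) - l (d n t)) : R^o) @[h --> (0 : R)^'] --> (l (d n.+1 t) : R^o).
  rewrite (_ : (fun h => _) = l \o (fun h => h^-1 *: (d n (t + h) - d n t))).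
    by apply: cvg_comp (Hd n t) _; exact: (@cdual_continuous _ _ l).
  apply/funext => h /=; have -> : h *: 1 + t = t + h by rewrite /GRing.scale /= mulr1 addrC.
  by rewrite cdualZ cdualB.
have dv : derivable (fun t => l (d n t)) t 1 by apply/cvg_ex; eexists; exact: cv.
by apply: DeriveDef => //; exact: cvg_lim.
Qed.

(* Second order remainders are weakly bounded, hence bounded. *)
Theorem weak_smooth_curve (d : nat -> R -> E) :
  (forall (l : cdual E) n t, hasd (fun t => l (d n t)) t (l (d n.+1 t))) ->
  smooth_curve (d 0%N).
Proof.
move=> Hd; exists d; split=> // n t.
pose S := [set y | exists h, 0 < `|h| <= 1 /\
  y = h^-1 *: (h^-1 *: (d n (t + h) - d n t) - d n.+1 t)].
have wS : wbounded S.
  move=> l; have [C HC] := hasd_bounded (fun s (_ : t - 1 <= s <= t + 1) => Hd l n.+2 s).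
  exists C => _ [h [/andP[h0 h1] ->]]; have hn0 : h != 0 by rewrite -normr_gt0.
  have := @taylor2_bound R (fun t => l (d n t)) (fun t => l (d n.+1 t))
    (fun t => l (d n.+2 t)) t h C _ _ _.
  move=> /(_ (fun s _ => Hd l n _) (fun s _ => Hd l n.+1 _)) H.
  have {H}H : `|l (d n (t + h)) - l (d n t) - h * l (d n.+1 t)| <= C * h ^+ 2.
    apply: H => s /andP[s0 s1]; apply: HC.
    have : `|s * h| <= 1 by rewrite normrM (ger0_norm s0) mulr_ile1.
    by rewrite ler_norml => /andP[? ?]; apply/andP; split; lra.
  rewrite (_ : l _ = (h ^+ 2)^-1 * (l (d n (t + h)) - l (d n t) - h * l (d n.+1 t))).
    by rewrite normrM normfV (ger0_norm (sqr_ge0 h)) ler_pdivrMl ?exprn_even_gt0// [h ^+ 2 * C]mulrC.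
  by rewrite cdualZ linearB cdualZ linearB /=; field.
move=> A /(nbhsB (- d n.+1 t)); rewrite addNr => nA.
have [p p1 pA] := nbhs0_seminorm nA.
have [C SC] := bounded_seminorm (wbounded_bounded wS) p1.
have C1 : 0 < `|C| + 1 by rewrite ltr_wpDl.
rewrite /nbhs /=; near=> h.
have hn0 : h != 0 by near: h; exact: nbhs_dnbhs_neq.
have h0 : 0 < `|h| by rewrite normr_gt0.
have h1 : `|h| <= 1 by near: h; exact: dnbhs0_le.
have hC : `|h| < (`|C| + 1)^-1 by near: h; apply: dnbhs0_lt; rewrite invr_gt0.
set q := h^-1 *: (d n (t + h) - d n t).
have Sq : S (h^-1 *: (q - d n.+1 t)) by exists h; rewrite h0.
have : p (q - d n.+1 t) < 1.
  rewrite -[q - _](scalerK (invr_neq0 hn0)) invrK seminormZ.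
  apply: le_lt_trans (_ : `|h| * (`|C| + 1) < 1).
    by rewrite ler_wpM2l// (le_trans (SC _ Sq))// (le_trans (ler_norm _))// lerDl.
  by rewrite -ltr_pdivlMr// mul1r.
move=> /pA[z Az zq]; change (A q); suff <- : z = q by [].
by apply: (addrI (- d n.+1 t)); rewrite zq addrC.
Unshelve. all: by end_near. Qed.

End WeakSmoothness.

(** * Bump functions and flat sums of bumps *)

Section SmoothBump.
Context (R : realType).

Let polyexp_le (p : {poly R}) : exists2 C : R, 0 <= C &
  forall s : R, 0 <= s -> `|p.[s]| <= C * expR s.
Proof.
exists (\sum_(i < size p) `|p`_i| * i`!%:R).
  by apply: sumr_ge0 => i _; rewrite mulr_ge0.
move=> s s0; rewrite horner_coef mulr_suml; apply: le_trans (ler_norm_sum _ _ _) _.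
apply: ler_sum => i _; rewrite normrM normrX (ger0_norm s0) -mulrA ler_wpM2l//.
case: (nat_of_ord i) => [|k]; first by rewrite expr0 fact0 mul1r; have := expR_ge1Dx s; lra.
by rewrite -ler_pdivrMl ?ltr0n ?fact_gt0// mulrC; have := expR_ge1Dxn k s0; lra.
Qed.

Definition flat_exp (p : {poly R}) (t : R) : R :=
  if 0 < t then p.[t^-1] * expR (- t^-1) else 0.

(** The functions p(1/t) exp(-1/t), extended by 0 to t <= 0, are closed under differentiation, with
    p replaced by X^2 (p - p'). At 0 the bound s^2 |p(s)| <= C exp(s) at s = 1/h gives a quadratic
    remainder. *)
Lemma hasd_flat_exp p t : hasd (flat_exp p) t (flat_exp ('X^2 * (p - p^`())) t).
Proof.
have [t0|t0|->] := ltgtP t 0.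
- rewrite {2}/flat_exp ltNge (ltW t0)/=; apply: hasd_ext (hasd_cst 0 t).
  exists (- t); first by rewrite oppr_gt0.
  move=> h; rewrite ltr_norml => /andP[_ ht]; rewrite /flat_exp ifF//.
  by apply/negbTE; rewrite -leNgt; lra.
- have tn0 : t != 0 by rewrite gt_eqF.
  have inv : hasd (fun t : R => t^-1) t (- t^-1 ^+ 2).
    apply/hasdP; have := @is_deriveV R id t 1 1 tn0 (is_derive_id _ _).
    by rewrite /GRing.scale /= mulr1 exprVn.
  have pol (q : {poly R}) : hasd (fun t : R => q.[t^-1]) t (- t^-1 ^+ 2 * q^`().[t^-1]).
    elim/poly_ind: q => [|q c IH].
      rewrite deriv0 horner0 mulr0 (_ : (fun _ => _) = fun=> 0); first exact: hasd_cst.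
      by apply/funext => s; rewrite horner0.
    rewrite (_ : (fun _ => _) = fun s => q.[s^-1] * s^-1 + c).
      have := hasdD (hasdM IH inv) (hasd_cst c t); congr hasd.
      by rewrite derivD derivM derivX derivC mulr1 !hornerE; ring.
    by apply/funext => s; rewrite !hornerE.
  have ex : hasd (fun t : R => expR (- t^-1)) t (expR (- t^-1) * t^-1 ^+ 2).
    have Ni : hasd (fun t : R => - t^-1) t (t^-1 ^+ 2).
      have := hasdZ (-1) inv; rewrite mulN1r opprK.
      by rewrite (_ : (fun x => _) = (fun t : R => - t^-1))//; apply/funext => s; rewrite mulN1r.
    by apply/hasdP; move/hasdP: Ni => Ni; exact: is_derive1_comp.
  have := hasdM (pol p) ex; rewrite {2}/flat_exp t0 => H.
  apply: (@hasd_ext _ (fun t => p.[t^-1] * expR (- t^-1))).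
    exists t => // h; rewrite ltr_norml => /andP[ht _].
    by rewrite /flat_exp ifT//; lra.
  by congr hasd: H; rewrite hornerM hornerXn hornerD hornerN; move: (t^-1) => u; ring.
- have [C C0 HC] := polyexp_le ('X^2 * p).
  rewrite {2}/flat_exp ltxx; apply: (@hasd_quad _ _ _ _ 1 C) => // h _.
  rewrite add0r mulr0 subr0 /flat_exp ltxx subr0; case: ifPn => h0; last first.
    by rewrite normr0 mulr_ge0// sqr_ge0.
  have hV : 0 <= h^-1 by rewrite invr_ge0 ltW.
  have H := HC _ hV; rewrite hornerM hornerXn normrM (ger0_norm (_ : 0 <= h^-1 ^+ 2)) ?exprn_ge0// in H.
  rewrite normrM (gtr0_norm (expR_gt0 _)) expRN ler_pdivrMr ?expR_gt0//.
  move: H; rewrite exprVn ler_pdivrMl ?exprn_gt0//; lra.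
Qed.

(** The Leibniz rule without binomial coefficients: [L n] lists, with repetitions, the pairs of
    orders that occur in the n-th derivative. *)
Lemma tower_mul (f g : nat -> R -> R) :
  (forall n t, hasd (f n) t (f n.+1 t)) -> (forall n t, hasd (g n) t (g n.+1 t)) ->
  exists L : nat -> seq (nat * nat),
    L 0%N = [:: (0, 0)%N] /\
    let P n t := \sum_(k <- L n) f k.1 t * g k.2 t in
    forall n t, hasd (P n) t (P n.+1 t).
Proof.
move=> Hf Hg.
pose L := fix L n := if n is m.+1 then
  flatten [seq [:: (k.1.+1, k.2); (k.1, k.2.+1)] | k <- L m] else [:: (0, 0)%N].
exists L; split=> // P n t; have -> : P n.+1 t = \sum_(k <- L n) (f k.1.+1 t * g k.2 t + f k.1 t * g k.2.+1 t).
  by rewrite /P /= big_flatten big_map; apply: eq_bigr => k _; rewrite big_cons big_seq1.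
by apply: hasd_sum => k _; exact: hasdM.
Qed.

(** The product of exp(-1/t) and exp(-1/(1-t)), extended by 0 outside of [0, 1] and divided by its
    value at 1/2. *)
Lemma bump_tower : exists b : nat -> R -> R,
  [/\ forall n t, hasd (b n) t (b n.+1 t),
      forall n t, t <= 0 -> b n t = 0, forall n t, 1 <= t -> b n t = 0,
      forall n, exists C : R, forall t, `|b n t| <= C & b 0%N (1 / 2) = 1].
Proof.
pose p := fix p n : {poly R} := if n is m.+1 then 'X^2 * (p m - (p m)^`()) else 1.
pose f n := flat_exp (p n).
pose g n t := (-1) ^+ n * f n (1 + t * -1).
have Hf n t : hasd (f n) t (f n.+1 t) by exact: hasd_flat_exp.
have Hg n t : hasd (g n) t (g n.+1 t).
  rewrite {2}/g exprS -mulrA mulrCA; apply: hasdZ.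
  by apply: hasd_affine; exact: Hf.
have [L [L0 HP]] := tower_mul Hf Hg.
set P := fun n t => _ in HP.
have f0 n t : t <= 0 -> f n t = 0 by move=> t0; rewrite /f /flat_exp ltNge t0.
have P0 n t : t <= 0 -> P n t = 0 by move=> t0; rewrite /P big1// => k _; rewrite f0 ?mul0r.
have P1 n t : 1 <= t -> P n t = 0.
  move=> t1; have h : 1 + t * -1 <= 0 by rewrite mulrN1 subr_le0.
  by rewrite /P big1// => k _; rewrite /g (f0 k.2) ?mulr0.
have Pb n : exists C : R, forall t, `|P n t| <= C.
  have [C HC] := hasd_bounded (fun t (_ : 0 <= t <= 1) => HP n t); exists C => t.
  have C0 : 0 <= C by apply: le_trans (HC 0 _) => //; rewrite lexx ler01.
  have [t0|t0] := leP t 0; first by rewrite P0// normr0.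
  have [t1|t1] := leP 1 t; first by rewrite P1// normr0.
  by apply: HC; rewrite !ltW.
have Ph : P 0%N (1 / 2) != 0.
  rewrite /P L0 big_seq1 /g /= expr0 mul1r /f /flat_exp /= hornerC.
  rewrite (_ : 1 + 2^-1 * -1 = 2^-1 :> R); last by lra.
  by rewrite invr_gt0 ltr0n /= hornerC !mul1r mulf_neq0// gt_eqF// expR_gt0.
exists (fun n t => (P 0%N (1 / 2))^-1 * P n t); split.
- by move=> n t; exact: hasdZ.
- by move=> n t t0; rewrite (P0 n)// mulr0.
- by move=> n t t1; rewrite (P1 n)// mulr0.
- move=> n; have [C HC] := Pb n; exists (`|(P 0%N (1 / 2))^-1| * C) => t.
  by rewrite normrM ler_wpM2l.
- by rewrite mulVf.
Qed.

(* A sum of bumps supported in the intervals [2^-k, 2^(1-k)], flat at 0 when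
   the coefficients decay fast. *)
Let flat_sum_N (t : R) : nat := if 0 < t then (Num.truncn t^-1).+2 else 0.

Let flat_sum_NP t k : 0 < t -> (flat_sum_N t <= k)%N -> 2 <= 2 ^+ k * t.
Proof.
rewrite /flat_sum_N => t0; rewrite t0 => Nk.
have h : t^-1 <= (Num.truncn t^-1).+1%:R by exact/ltW/truncnS_gt.
have h2 : ((Num.truncn t^-1).+1%:R : R) <= 2 ^+ (Num.truncn t^-1).+1.
  by rewrite -natrX ler_nat ltnW// ltn_expl.
have h3 : (2 : R) ^+ (Num.truncn t^-1).+2 <= 2 ^+ k by rewrite ler_weXn2l// ler1n.
rewrite -ler_pdivrMr//; apply: le_trans h3; rewrite [leRHS]exprS ler_pM2l//.
exact: le_trans h h2.
Qed.

Variables (b : nat -> R -> R).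
Hypothesis bD : forall n t, hasd (b n) t (b n.+1 t).
Hypothesis b0 : forall n t, t <= 0 -> b n t = 0.
Hypothesis b1 : forall n t, 1 <= t -> b n t = 0.
Hypothesis bC : forall n, exists C : R, forall t, `|b n t| <= C.

Definition flat_sum_coef n (t : R) k : R := (2 ^+ k) ^+ n * b n (-1 + t * 2 ^+ k).

(** The n-th derivative of the sum of the b (2^k t - 1) a_k. It is a finite sum for each t, and
    hence makes sense without a topology on V: for t > 0 the terms with 2^k t >= 2 vanish, and for t
    <= 0 all of them do. *)
Definition flat_sum (V : lmodType R) (a : nat -> V) n t : V :=
  \sum_(k < flat_sum_N t) flat_sum_coef n t k *: a k.

Let coef_big n t k : 0 < t -> (flat_sum_N t <= k)%N -> flat_sum_coef n t k = 0.
Proof.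
move=> t0 /(flat_sum_NP t0) h; rewrite /flat_sum_coef b1 ?mulr0//.
by rewrite mulrC in h; lra.
Qed.

Let coef_neg n t k : 2 ^+ k * t < 1 -> flat_sum_coef n t k = 0.
Proof. by move=> h; rewrite /flat_sum_coef b0 ?mulr0// mulrC; lra. Qed.

Let flat_sum_widen (V : lmodType R) (a : nat -> V) n t M : (flat_sum_N t <= M)%N ->
  flat_sum a n t = \sum_(k < M) flat_sum_coef n t k *: a k.
Proof.
move=> NM; rewrite /flat_sum (big_ord_widen M (fun k => flat_sum_coef n t k *: a k))//.
rewrite big_mkcond; apply: eq_bigr => k _; case: ltnP => // Nk.
have [t0|t0] := ltP 0 t; first by rewrite coef_big ?scale0r.
rewrite coef_neg ?scale0r//; apply: le_lt_trans ltr01.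
by rewrite mulr_ge0_le0.
Qed.

(** Away from 0 the sum is locally finite. On the support of the k-th term 1 <= 2^k h, so a factor
    (2^k h)^2 may be inserted; this gives a quadratic remainder at 0, and the decay 2^(-k^2) of a_k
    outweighs the powers of 2^k that appear. *)
Lemma hasd_flat_sum (a : nat -> R) (A : R) : (forall k, `|a k| <= A * 2 ^- (k * k)) ->
  forall n t, hasd (flat_sum (a : nat -> R^o) n) t (flat_sum (a : nat -> R^o) n.+1 t).
Proof.
move=> aA n t; have [t0|t0|->] := ltgtP t 0.
- rewrite {2}/flat_sum /flat_sum_N ltNge (ltW t0)/= big_ord0.
  apply: hasd_ext (hasd_cst 0 t); exists (- t); first by rewrite oppr_gt0.
  move=> h; rewrite ltr_norml => /andP[_ ht]; rewrite /flat_sum /flat_sum_N ifF ?big_ord0//.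
  by apply/negbTE; rewrite -leNgt; lra.
- have t20 : 0 < t / 2 by rewrite divr_gt0.
  have Nmono s : t / 2 <= s -> (flat_sum_N s <= flat_sum_N (t / 2))%N.
    move=> ts; rewrite /flat_sum_N t20 (lt_le_trans t20 ts) !ltnS.
    by apply: le_truncn; rewrite lef_pV2// posrE// (lt_le_trans t20).
  have E m s : t / 2 <= s -> flat_sum (a : nat -> R^o) m s =
      \sum_(k < flat_sum_N (t / 2)) (2 ^+ k) ^+ m * b m (-1 + s * 2 ^+ k) * a k.
    by move=> /Nmono; exact: flat_sum_widen.
  rewrite E; last lra.
  apply: hasd_ext (_ : hasd (fun s => \sum_(k < flat_sum_N (t / 2)) (2 ^+ k) ^+ n * b n (-1 + s * 2 ^+ k) * a k) _ _).
    exists (t / 2) => // h; rewrite ltr_norml => /andP[ht _]; rewrite E//; lra.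
  apply: hasd_sum => k _.
  have := hasdZ (a k * (2 ^+ k) ^+ n) (hasd_affine (bD n (-1 + t * 2 ^+ k))).
  rewrite (_ : (fun x => (2 ^+ k) ^+ n * b n (-1 + x * 2 ^+ k) * a k) =
    (fun x => a k * (2 ^+ k) ^+ n * b n (-1 + x * 2 ^+ k))); last by apply/funext => s; ring.
  by congr hasd; rewrite exprS; ring.
- rewrite {2}/flat_sum /flat_sum_N ltxx big_ord0.
  have [C HC] := bC n; have C0 : 0 <= C by exact: le_trans (HC 0).
  have A0 : 0 <= A by have := aA 0%N; rewrite muln0 expr0 invr1 mulr1; exact: le_trans.
  (* By k (n+3) <= k^2 + (n+3)^2, the power 2^(k(n+2) - k^2) is at most 2^((n+3)^2 - k), which is
     summable in k. *)
  pose c : R := C * A * 2 ^+ (n.+3 * n.+3).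
  have c0 : 0 <= c by apply: mulr_ge0; [exact: mulr_ge0|exact: exprn_ge0].
  apply: (@hasd_quad _ _ _ _ 1 (c * 2)) => // h _.
  rewrite add0r mulr0 subr0 {2}/flat_sum /flat_sum_N ltxx big_ord0 subr0.
  have [h0|h0] := leP h 0.
    rewrite /flat_sum /flat_sum_N ltNge h0/= big_ord0 normr0.
    by apply: mulr_ge0; [exact: mulr_ge0|exact: sqr_ge0].
  apply: le_trans (ler_norm_sum _ _ _) _.
  have T k : `|flat_sum_coef n h k * a k| <= c * h ^+ 2 * 2^-1 ^+ k.
    have [hk|hk] := ltP (2 ^+ k * h) 1; first rewrite coef_neg// mul0r normr0.
      by apply: mulr_ge0; [apply: mulr_ge0 => //; exact: sqr_ge0|exact: exprn_ge0].
    rewrite /flat_sum_coef !normrM (ger0_norm (_ : 0 <= (2 ^+ k) ^+ n :> R)) ?exprn_ge0//.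
    have p2 m : 0 < (2:R) ^+ m by rewrite exprn_gt0.
    apply: (@le_trans _ _ ((2 ^+ k) ^+ n * C * (A * 2 ^- (k * k)) * (2 ^+ k * h) ^+ 2)).
      have x0 : 0 <= ((2 : R) ^+ k) ^+ n by rewrite exprn_ge0// exprn_ge0.
      have W0 : 0 <= A * 2 ^- (k * k) by exact: le_trans (aA k).
      have q1 : 1 <= (2 ^+ k * h) ^+ 2 by rewrite exprn_ege1.
      apply: (@le_trans _ _ ((2 ^+ k) ^+ n * C * (A * 2 ^- (k * k)))).
        by rewrite -!mulrA ler_wpM2l// ler_pM.
      by rewrite ler_peMr// mulr_ge0// mulr_ge0.
    have -> : (2 ^+ k) ^+ n * C * (A * 2 ^- (k * k)) * (2 ^+ k * h) ^+ 2 =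
        C * A * h ^+ 2 * ((2 ^+ k) ^+ n.+2 * 2 ^- (k * k)) by rewrite !exprS; ring.
    have -> : c * h ^+ 2 * 2^-1 ^+ k = C * A * h ^+ 2 * (2 ^+ (n.+3 * n.+3) * 2 ^- k).
      by rewrite /c exprVn; ring.
    apply: ler_wpM2l; first by apply: mulr_ge0; [exact: mulr_ge0|exact: sqr_ge0].
    rewrite ler_pdivrMr// mulrAC ler_pdivlMr// -!exprM -!exprD ler_weXn2l ?ler1n//.
    nia.
  have S2 j : \sum_(k < j) 2^-1 ^+ k = 2 - 2 * 2^-1 ^+ j :> R.
    elim: j => [|j IHj]; first by rewrite big_ord0 expr0; lra.
    by rewrite big_ord_recr/= IHj exprS; lra.
  apply: (@le_trans _ _ (\sum_(k < flat_sum_N h) c * h ^+ 2 * 2^-1 ^+ k)).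
    by apply: ler_sum => k _; exact: T.
  rewrite -mulr_sumr S2 [leRHS]mulrAC; apply: ler_wpM2l.
    by apply: mulr_ge0 => //; exact: sqr_ge0.
  by rewrite gerBl mulr_ge0// exprn_ge0.
Qed.

(** The point is the midpoint of the support [2^-k, 2^(1-k)] of the k-th bump, and the other
    supports meet this interval at most in its end points. *)
Lemma flat_sum_at (V : lmodType R) (a : nat -> V) k : b 0%N (1 / 2) = 1 ->
  flat_sum a 0 (3 / 2 * 2 ^- k) = a k.
Proof.
move=> bh; have p2 m : 0 < (2:R) ^+ m by rewrite exprn_gt0.
have ck : (3 / 2 * 2 ^- k) * 2 ^+ k = 3 / 2 :> R by rewrite -mulrA mulVf ?mulr1// gt_eqF.
have t0 : 0 < 3 / 2 * 2 ^- k :> R by rewrite mulr_gt0// invr_gt0.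
rewrite (@flat_sum_widen _ _ _ _ (flat_sum_N (3 / 2 * 2 ^- k) + k.+1)) ?leq_addr//.
have kN : (k < flat_sum_N (3 / 2 * 2 ^- k) + k.+1)%N by rewrite addnS ltnS leq_addl.
rewrite (bigD1 (Ordinal kN))//= big1 ?addr0 => [|j jk].
  by rewrite /flat_sum_coef ck expr0 mul1r (_ : -1 + _ = 1 / 2) ?bh ?scale1r//; lra.
have {}jk : (j : nat) != k by apply: contraNneq jk => jk; apply/eqP/val_inj.
move: (nat_of_ord j) jk => {}j jk.
rewrite (_ : flat_sum_coef _ _ _ = 0) ?scale0r//; rewrite /flat_sum_coef expr0 mul1r.
have [jk'|kj] := ltnP j k.
  apply: b0; have -> : k = (j.+1 + (k - j.+1))%N by rewrite subnKC.
  rewrite exprD exprS; have := p2 j; have := p2 (k - j.+1)%N.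
  have : 1 <= (2 : R) ^+ (k - j.+1) by rewrite exprn_ege1// ler1n.
  move: (2 ^+ j : R) (2 ^+ (k - j.+1) : R) => x y y1 y0 x0.
  have -> : 3 / 2 / (2 * x * y) * x = 3 / 4 / y by field; rewrite !gt_eqF.
  have : y^-1 <= 1 by rewrite invf_le1.
  lra.
apply: b1; have {}kj : (k < j)%N by rewrite ltn_neqAle eq_sym jk.
have -> : (j : nat) = (k + 1 + (j - k.+1))%N by lia.
rewrite !exprD !mulrA ck expr1.
have : 1 <= 2 ^+ (j - k.+1) :> R by rewrite exprn_ege1// ler1n.
lra.
Qed.

End SmoothBump.
(** * Banach disks *)

Section Triangle.
Context (R : realType).

Lemma ler_dist3 (V : normedModType R) (x y z : V) (a b : R) :
  `|x - y| <= a -> `|y - z| <= b -> `|x - z| <= a + b.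
Proof.
move=> h k; have -> : x - z = x - y + (y - z) by rewrite addrA subrK.
exact: le_trans (ler_normD _ _) (lerD h k).
Qed.

Lemma conv_itv01 (a b t : R) : 0 <= t <= 1 -> 0 <= a <= 1 -> 0 <= b <= 1 ->
  0 <= t * a + (1 - t) * b <= 1.
Proof. by move=> /andP[? ?] /andP[? ?] /andP[? ?]; apply/andP; split; nra. Qed.

Lemma tvs_cvgZ (E : tvsType R) T (F : set_system T) (FF : Filter F) (v : T -> E) (c : R) (u : E) :
  v @ F --> u -> (c *: v x) @[x --> F] --> c *: u.
Proof.
move=> vu A cA; have [[P Q] /= [Pc Qu] PQA] := @scale_continuous R E (c, u) A cA.
move: (vu Q Qu); rewrite /nbhs /=; apply: filterS => x Qx; apply: (PQA (c, v x)); split => //.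
exact: nbhs_singleton Pc.
Qed.

Lemma tvs_cvgDr (E : tvsType R) T (F : set_system T) (FF : Filter F) (v : T -> E) (c u : E) :
  v @ F --> u -> (v x + c) @[x --> F] --> u + c.
Proof.
move=> vu A cA; have [[P Q] /= [Pc Qu] PQA] := @add_continuous E (u, c) A cA.
move: (vu P Pc); rewrite /nbhs /=; apply: filterS => x Px; apply: (PQA (v x, c)); split => //.
exact: nbhs_singleton Qu.
Qed.

End Triangle.

Section DiskSpaceTopology.
Context (R : realType) (E : tvsType R) (B : disk E).
Implicit Types x y : disk_space B.

(** A c^oo-open set meets E_B in a norm-open set. Otherwise there are points x + w_k outside of U
    with |w_k| <= 2^(-k^2), and the flat sum of bumps puts them all on one smooth curve that passes
    through x at time 0, where it has to stay in U for a while. *)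
Theorem disk_slice_open (U : set E) x : cinf_open U -> U (disk_incl x) ->
  exists2 r : R, 0 < r & forall y, `|y - x| < r -> U (disk_incl y).
Proof.
move=> oU Ux; apply: contrapT => nr.
have far k : exists w : disk_space B, `|w| <= 2 ^- (k * k) /\ ~ U (disk_incl (x + w)).
  apply: contrapT => /forallNP far; apply: nr; exists (2 ^- (k * k)).
    by rewrite invr_gt0 exprn_gt0.
  move=> y yx; apply: contrapT => nUy; apply: (far (y - x)).
  by rewrite subrKC; split => //; exact: ltW.
pose w k := projT1 (cid (far k)).
have wk k : `|w k| <= 2 ^- (k * k) by have [] := projT2 (cid (far k)).
have nUw k : ~ U (disk_incl (x + w k)) by have [] := projT2 (cid (far k)).
have [b [bD b0 b1 bC bh]] := bump_tower R.
pose a k := disk_incl (w k).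
pose d n t := (if n is 0%N then disk_incl x else 0) + flat_sum b a n t.
have sd : smooth_curve (d 0%N).
  apply: weak_smooth_curve => l n t.
  have lsum m s : l (flat_sum b a m s) = flat_sum b ((fun k => l (a k)) : nat -> R^o) m s.
    by rewrite /flat_sum linear_sum; apply: eq_bigr => k _; rewrite linearZ.
  rewrite (_ : (fun t => _) = fun t => l (if n is 0%N then disk_incl x else 0) +
      flat_sum b ((fun k => l (a k)) : nat -> R^o) n t); last first.
    by apply/funext => s; rewrite /d cdualD lsum.
  rewrite /d add0r lsum -[X in hasd _ _ X]add0r; apply: hasdD; first exact: hasd_cst.
  have [C C0 lC] := disk_cdual B l.
  apply: (@hasd_flat_sum _ _ bD b0 b1 bC _ C) => k.
  by apply: le_trans (lC _) _; rewrite ler_wpM2l.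
have : nbhs (0:R) (d 0%N @^-1` U).
  apply: open_nbhs_nbhs; split; first exact: oU.
  rewrite /= /d (_ : flat_sum b a 0 0 = 0) ?addr0// /flat_sum.
  by rewrite big1// => k _; rewrite /flat_sum_coef mul0r addr0 b0 ?mulr0 ?scale0r//; lra.
move=> /nbhs_ballP[e /= e0 eU].
have [k ke] : exists k, 3 / 2 * 2 ^- k < e.
  exists (Num.truncn (2 / e)).+1.
  have h : 2 / e < 2 ^+ (Num.truncn (2 / e)).+1.
    apply: lt_trans (truncnS_gt _) _; rewrite -natrX ltr_nat; exact: ltn_expl.
  rewrite ltr_pdivrMr ?exprn_gt0//; move: h; rewrite ltr_pdivrMr//; lra.
apply: (nUw k); have := eU (3 / 2 * 2 ^- k).
rewrite /= /d flat_sum_at//; apply; rewrite /ball /= sub0r normrN ger0_norm//.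
Qed.

Lemma disk_closed_incl (u : E) (v : nat -> E) (e : R) : 0 < e -> v @ \oo --> u ->
  (\forall n \near \oo, disk_set B (e^-1 *: v n)) -> disk_set B (e^-1 *: u).
Proof.
move=> e0 vu Bv; apply: (closed_cvg (disk_set B) (@disk_closed _ _ B) Bv).
exact: tvs_cvgZ.
Qed.

(** The limit is taken in E, by Mackey completeness, and the Cauchy estimates pass to it because B
    is closed. The factor 2 in the Mackey-Cauchy rate provides the strict inequality that
    [disk_norm_lt] asks for. *)
Lemma disk_complete (u : nat -> disk_space B) : mackey_complete E ->
  (forall e : R, 0 < e -> exists N, forall m n, (N <= m)%N -> (N <= n)%N -> `|u m - u n| <= e) ->
  exists y, forall e : R, 0 < e -> exists N, forall n, (N <= n)%N -> `|y - u n| <= e.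
Proof.
move=> cE uC; have [b0|/forallNP nB] := pselect (exists b, disk_set B b); last first.
  have triv x : x = 0.
    have x1 : `|x| < `|x| + 1 by rewrite ltrDl.
    by case: (disk_norm_lt x1) => [x0|/nB//]; exact: disk_incl_inj.
  by exists 0 => e e0; exists 0%N => n _; rewrite (triv (u n)) subr0 normr0 ltW.
have {}b0 : disk_set B 0 by have [b Bb] := b0; rewrite -(scale0r b); apply: diskZ => //; rewrite normr0.
have [l ul] : exists l : E, (fun n => disk_incl (u n)) @ \oo --> l.
  apply: cE; exists (disk_set B), (fun m n => 2 * `|u m - u n|); split.
  - exact: disk_bounded.
  - exact: disk_absconvex.
  - move=> e e0; have e20 : 0 < e / 2 by rewrite divr_gt0.
    have [N HN] := uC _ e20.
    exists N => m n Nm Nn; rewrite normrM normr_id ger0_norm//.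
    by rewrite mulrC -ler_pdivlMr//; exact: HN.
  - move=> m n; have [/eqP|umn] := eqVneq (u m - u n) 0.
      rewrite subr_eq0 => /eqP ->; exists 0 => //=.
      by rewrite !subrr scaler0.
    have un0 : 0 < `|u m - u n| by rewrite normr_gt0.
    have h : `|u m - u n| < 2 * `|u m - u n| by rewrite ltr_pMl// ltr1n.
    have [|Bu] := disk_norm_lt h.
      by move=> /(@disk_incl_inj _ _ B (u m - u n) 0) /eqP; rewrite (negbTE umn).
    exists ((2 * `|u m - u n|)^-1 *: disk_incl (u m - u n)) => //.
    by rewrite scalerA mulfV ?scale1r// mulf_neq0// gt_eqF.
have key e : 0 < e -> exists N, forall n, (N <= n)%N -> disk_set B (e^-1 *: (l - disk_incl (u n))).
  move=> e0; have e20 : 0 < e / 2 by rewrite divr_gt0.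
    have [N HN] := uC _ e20.
  exists N => n Nn; apply: (@disk_closed_incl _ (fun m => disk_incl (u m) - disk_incl (u n))) => //.
    exact: tvs_cvgDr.
  exists N => // m /= Nm; have : `|u m - u n| < e.
    by apply: le_lt_trans (HN m n Nm Nn) _; rewrite ltr_pdivrMr// ltr_pMr// ltr1n.
  by move=> /disk_norm_lt[|//]; rewrite disk_inclB => ->; rewrite scaler0.
have [N1 HN1] := key 1 ltr01.
have [y0 y0E _] := disk_lift ltr01 (HN1 N1 (leqnn _)).
exists (y0 + u N1) => e e0; have [N HN] := key e e0; exists N => n Nn.
have [z zE ze] := disk_lift e0 (HN n Nn).
rewrite (_ : y0 + u N1 - u n = z)//; apply: disk_incl_inj.
by rewrite zE disk_inclB disk_inclD y0E subrK.
Qed.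

Lemma convex_setP (K : set (disk_space B)) :
  convex_set (K : set (convex_lmodType (disk_space B))) <->
  forall x y (t : R), K x -> K y -> 0 <= t <= 1 -> K (t *: x + (1 - t) *: y).
Proof.
split=> [cK x y t Kx Ky /andP[t0 t1]|H x y t].
  have t01 : 0 <= t <= 1 by rewrite t0.
  by have := cK x y (Itv01 t0 t1) (mem_set Kx) (mem_set Ky); rewrite inE.
rewrite !inE => Kx Ky; apply: (H x y t%:num Kx Ky).
by apply/andP; split.
Qed.

(* The cube {x + sum_k a_k w_k : a_k in [0, 1]}. *)
Theorem compact_cube x (w : nat -> disk_space B) (r : R) : mackey_complete E ->
  0 <= r -> (forall k, `|w k| <= r * 2^-1 ^+ k.+1) ->
  exists K : set (disk_space B), [/\ compact K,
    convex_set (K : set (convex_lmodType (disk_space B))), K x,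
    forall k, K (x + w k) & forall y, K y -> `|y - x| <= r].
Proof.
move=> cE r0 wr.
pose T := prod_topology (fun _ : nat => R^o : topologicalType).
(* The cube of coefficients is compact by Tychonoff's theorem, and K is its image under the
   continuous map [L], translated by x. *)
pose cube : set T := [set f | forall k, `[0, 1]%classic (f k : R)].
pose S (f : T) n : disk_space B := \sum_(k < n) (f k : R) *: w k.
have two0 n : 0 <= 2^-1 ^+ n :> R by rewrite exprn_ge0.
have Sdist f m n : cube f -> (m <= n)%N -> `|S f n - S f m| <= r * (2^-1 ^+ m - 2^-1 ^+ n).
  move=> cf; elim: n => [|n IH]; first by rewrite leqn0 => /eqP ->; rewrite !subrr normr0 mulr0.
  rewrite leq_eqVlt => /predU1P[->|/IH h]; first by rewrite !subrr normr0 mulr0.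
  rewrite /S big_ord_recr /= -/(S f n) addrAC; apply: le_trans (ler_normD _ _) _.
  have := cf n; rewrite /= in_itv /= => /andP[f0 f1].
  have hw : `|(f n : R) *: w n| <= r * 2^-1 ^+ n.+1.
    by rewrite normrZ ger0_norm// (le_trans _ (wr n))// ler_piMl.
  apply: le_trans (lerD h hw) _; rewrite exprS; move: (2^-1 ^+ m) (2^-1 ^+ n) => a b.
  by clear; lra.
have small e : 0 < e -> exists N, r * 2^-1 ^+ N <= e.
  move=> e0; exists (Num.truncn (r / e)).+1.
  rewrite exprVn ler_pdivrMr ?exprn_gt0// mulrC -ler_pdivrMr//.
  apply: ltW; apply: lt_trans (truncnS_gt _) _; rewrite -natrX ltr_nat; exact: ltn_expl.
have Slim f : exists y, cube f -> forall n, `|y - S f n| <= r * 2^-1 ^+ n.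
  have [cf|ncf] := pselect (cube f); last by exists 0.
  have [|y Hy] := @disk_complete (S f) cE.
    move=> e e0; have [N HN] := small e e0; exists N => m n Nm Nn.
    wlog mn : m n Nm Nn / (m <= n)%N.
      by move=> H; have [|/ltnW] := leqP m n; [exact: H|rewrite distrC; exact: H].
    rewrite distrC; apply: le_trans (Sdist f m n cf mn) _; apply: le_trans HN.
    rewrite ler_wpM2l// lerBlDr; apply: (@le_trans _ _ (2^-1 ^+ N)); last by rewrite lerDl.
    by apply: ler_wiXn2l => //; lra.
  exists y => _ n; apply/ler_addgt0Pr => e e0; have [N HN] := Hy e e0.
  have h1 := HN (maxn N n) (leq_maxl _ _).
  have h2 := Sdist f n (maxn N n) cf (leq_maxr _ _).
  apply: le_trans (ler_dist3 h1 h2) _; rewrite addrC lerD2r ler_wpM2l// gerBl; exact: two0.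
pose L f := projT1 (cid (Slim f)).
have LP f n : cube f -> `|L f - S f n| <= r * 2^-1 ^+ n by move=> cf; exact: (projT2 (cid (Slim f))).
(* The rate of approximation determines the limit. This identifies [L] at convex combinations, at 0
   and at the unit vectors. *)
have Luniq f y : cube f -> (forall n, `|y - S f n| <= 2 * (r * 2^-1 ^+ n)) -> L f = y.
  move=> cf Hy; apply/eqP; rewrite -subr_eq0 -normr_le0; apply/ler_addgt0Pr => e e0.
  rewrite add0r; have e30 : 0 < e / 3 by rewrite divr_gt0.
  have [N HN] := small _ e30.
  have h := Hy N; rewrite distrC in h; apply: le_trans (ler_dist3 (LP f N cf) h) _.
  by move: HN; move: (r * _) => a; clear; lra.
exists [set x + L f | f in cube]; split.
- apply: continuous_compact; last first.
    exact: (@tychonoff nat (fun=> R^o : topologicalType) (fun=> `[0, 1]%classic : set R)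
      (fun=> @segment_compact R 0 1)).
  apply/subspace_continuousP => f cf; apply/cvgrPdist_le => e e0.
  have e20 : 0 < e / 4 by rewrite divr_gt0.
  have [N HN] := small (e / 4) e20.
  have r1 : 0 < r + 1 by rewrite ltr_wpDl.
  have near_f : nbhs f [set g : prod_topology (fun _ : nat => R^o) | forall k : 'I_N,
      `|(f k : R) - g k| <= e / 4 / (r + 1) / N.+1%:R].
    apply: (@filter_forall (prod_topology (fun _ : nat => R^o)) 'I_N
      (fun k g => `|(f k : R) - g k| <= e / 4 / (r + 1) / N.+1%:R) (nbhs f)) => k.
    have : nbhs (f k : R^o) [set s : R^o | `|(f k : R) - s| <= e / 4 / (r + 1) / N.+1%:R].
      apply/nbhs_ballP; exists (e / 4 / (r + 1) / N.+1%:R) => /=; first by rewrite !divr_gt0.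
      by move=> s; rewrite /ball /=; exact: ltW.
    exact: (@prodfun_proj_nbhs R nat (fun=> R^o) f k).
  rewrite /nbhs /=; apply: filterS near_f => g fg cg.
  rewrite opprD addrACA subrr add0r.
  have h1 := LP f N cf; have h2 := LP g N cg.
  have h3 : `|S f N - S g N| <= e / 4.
    rewrite /S -sumrB; apply: le_trans (ler_norm_sum _ _ _) _.
    apply: (@le_trans _ _ (\sum_(k < N) e / 4 / N.+1%:R)).
      apply: ler_sum => k _; rewrite -scalerBl normrZ.
      have w1 : `|w k| <= r + 1.
        apply: le_trans (wr k) _; have : 2^-1 ^+ k.+1 <= 1 :> R by rewrite exprn_ile1//; lra.
        by move: r0 (two0 k.+1); move: (2^-1 ^+ k.+1) => a; clear; nra.
      apply: (@le_trans _ _ (e / 4 / (r + 1) / N.+1%:R * (r + 1))); first by rewrite ler_pM.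
      by rewrite mulrAC divfK// gt_eqF.
    rewrite sumr_const card_ord -[_ *+ N]mulr_natr -[_ * N%:R]mulrA ler_piMr ?(ltW e20)//.
    by rewrite mulrC ler_pdivrMr// mul1r ler_nat.
  rewrite distrC in h2; apply: le_trans (ler_dist3 (ler_dist3 h1 h3) h2) _.
  by move: HN e0; move: (r * _) => a; clear; lra.
- apply/convex_setP => _ _ t [f cf <-] [g cg <-] /andP[t0 t1].
  pose h : T := fun k => t * (f k : R) + (1 - t) * (g k : R).
  have ch : cube h.
    move=> k; have := cf k; have := cg k; rewrite /= !in_itv /= => g01 f01.
    by apply: conv_itv01 => //; rewrite t0.
  exists h => //; rewrite !scalerDr addrACA -scalerDl subrKC scale1r; congr (_ + _).
  apply: Luniq => // n.
  have -> : S h n = t *: S f n + (1 - t) *: S g n.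
    rewrite /S !scaler_sumr -big_split /=; apply: eq_bigr => k _.
    by rewrite /h scalerDl !scalerA.
  rewrite opprD addrACA -!scalerBr; apply: le_trans (ler_normD _ _) _.
  rewrite !normrZ (ger0_norm t0) ger0_norm ?subr_ge0//.
  have hf := LP f n cf; have hg := LP g n cg; have hr := le_trans (normr_ge0 _) hf.
  apply: (@le_trans _ _ (t * (r * 2^-1 ^+ n) + (1 - t) * (r * 2^-1 ^+ n))).
    by apply: lerD; apply: ler_wpM2l => //; rewrite subr_ge0.
  by move: hr; move: (r * _) => a; clear; lra.
- exists (fun=> 0 : R^o); first by move=> k; rewrite /= in_itv /= lexx ler01.
  rewrite (_ : L _ = 0) ?addr0//; apply: Luniq => [k|n]; first by rewrite /= in_itv /= lexx ler01.
  rewrite (_ : S _ n = 0) ?subr0 ?normr0 ?mulr_ge0//.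
  by rewrite /S big1// => k _; rewrite scale0r.
- move=> k; pose f : T := fun j => (j == k)%:R : R^o.
  have cf : cube f by move=> j; rewrite /= in_itv /= /f; case: eqP; rewrite ?lexx ?ler01.
  exists f => //; congr (_ + _); apply: Luniq => // n.
  rewrite /S; have [kn|nk] := ltnP k n.
    rewrite (bigD1 (Ordinal kn))//= big1 => [|j jk].
      by rewrite /f eqxx scale1r addr0 subrr normr0 mulr_ge0// mulr_ge0.
    by rewrite /f (_ : (_ == _) = false) ?scale0r//; apply/negbTE.
  rewrite big1 => [|j _]; last first.
    by rewrite /f (_ : (_ == _) = false) ?scale0r//; apply/negbTE; rewrite ltn_eqF// (leq_trans _ nk).
  rewrite subr0; apply: le_trans (wr k) _.
  have : 2^-1 ^+ k.+1 <= 2^-1 ^+ n :> R by apply: ler_wiXn2l; [lra|lra|exact: leq_trans nk _].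
  move: r0 (two0 n); move: (2^-1 ^+ n) (2^-1 ^+ k.+1) => a b; clear; nra.
- move=> _ [f cf <-]; have := LP f 0%N cf.
  by rewrite /S big_ord0 subr0 expr0 mulr1 addrAC subrr add0r.
Qed.

End DiskSpaceTopology.
(** * Jet families *)

Lemma third_lt (R : realType) (h d : R) : 0 < d -> h <= d / 3 -> h + h < d.
Proof. lra. Qed.

Lemma half_lt (R : realType) (h d : R) : h < d / 2 -> h + h < d.
Proof. lra. Qed.

Section LocalBounds.
Context (R : realType) (E : tvsType R) (cE : convenient E) (B : disk E).
Context (U : set E) (oU : cinf_open U) (Phi : disk_space B -> set R).
Hypothesis PhiK : forall K : set (disk_space B), compact K ->
  convex_set (K : set (convex_lmodType (disk_space B))) ->
  (forall y, K y -> U (disk_incl y)) ->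
  exists C : R, forall y a, K y -> Phi y a -> a <= C.

(* A sequence of counterexamples may be chosen to converge fast, and then it
   lies in a compact convex set. *)
Lemma local_bound (x : disk_space B) : U (disk_incl x) ->
  exists2 r : R, 0 < r & exists C : R, forall y, `|y - x| < r ->
    U (disk_incl y) /\ forall a, Phi y a -> a <= C.
Proof.
move=> Ux; have [r r0 rU] := disk_slice_open oU Ux.
have r20 : 0 < r / 2 by rewrite divr_gt0.
apply: contrapT => nb.
have bad k : exists w : disk_space B, `|w| <= r / 2 * 2^-1 ^+ k.+1 /\
    exists2 a, Phi (x + w) a & k%:R < a.
  apply: contrapT => /forallNP bad; apply: nb.
  have p0 : 0 < r / 2 * 2^-1 ^+ k.+1 by rewrite mulr_gt0// exprn_gt0// invr_gt0.
  exists (r / 2 * 2^-1 ^+ k.+1) => //; exists k%:R => y yx; split.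
    apply: rU; apply: lt_le_trans yx _.
    have : 2^-1 ^+ k.+1 <= 1 :> R by rewrite exprn_ile1// invf_le1// ler1n.
    move=> /(ler_wpM2l (ltW r20))/le_trans; apply.
    by rewrite mulr1 ler_pdivrMr// ler_peMr ?(ltW r0)// ler1n.
  move=> a ya; rewrite leNgt; apply/negP => ka; apply: (bad (y - x)).
  by rewrite subrKC ltW//; split => //; exists a.
pose w k := projT1 (cid (bad k)).
have wk k : `|w k| <= r / 2 * 2^-1 ^+ k.+1 by have [] := projT2 (cid (bad k)).
have wbad k : exists2 a, Phi (x + w k) a & k%:R < a by have [] := projT2 (cid (bad k)).
have [K [cK vK Kx Kw Kr]] := @compact_cube _ _ _ x w _ cE.2 (ltW r20) wk.
have [|C HC] := PhiK cK vK.
  move=> y Ky; apply: rU; apply: le_lt_trans (Kr y Ky) _.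
  by rewrite ltr_pdivrMr// ltr_pMr// ltr1n.
have [a Pa Ca] := wbad (Num.truncn C).+1.
have := lt_le_trans (truncnS_gt C) (le_trans (ltW Ca) (HC _ _ (Kw _) Pa)).
by rewrite ltxx.
Qed.

(** A covering by the neighbourhoods of [local_bound] removes convexity from the hypothesis on
    compact sets. Composition depends on this, since there the outer map is bounded on the image of
    a convex set. *)
Lemma compact_bound (K : set (disk_space B)) : compact K ->
  (forall y, K y -> U (disk_incl y)) ->
  exists C : R, forall y a, K y -> Phi y a -> a <= C.
Proof.
move=> /compact_near_coveringP cK KU.
have : \forall C \near +oo, K `<=` (fun y => forall a, Phi y a -> a <= C).
  apply: (cK R +oo (fun C y => forall a, Phi y a -> a <= C)) => x /KU Ux.
  have [r r0 [C HC]] := local_bound Ux.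
  exists (ball x r, [set c | C <= c]) => /=.
    by split; [exact: nbhsx_ballx|apply: nbhs_pinfty_ge; exact: num_real].
  move=> [y c] /= [xy Cc] a ya; apply: le_trans Cc; have [|_] := HC y; last exact.
  by move: xy; rewrite -ball_normE /= distrC.
by move=> /filter_ex[C HC]; exists C => y a Ky; exact: HC.
Qed.

End LocalBounds.

Section TestWeights.
Context (R : realType) (md : umode) (M : weight_sequence R).

(* The weights r for which every C^[M] jet J satisfies
   sup_k r_k |J^k| / (k! M_k) < oo; conversely these conditions characterize
   C^[M], uniformly in the two cases. *)
Definition test_weight (r : nat -> R) := (forall k, 0 <= r k) /\
  match md with
  | Beurling => exists2 rho, 0 < rho & exists C : R, forall k, r k <= C * rho ^+ k
  | Roumieu => forall rho, 0 < rho -> exists C : R, forall k, rho ^+ k * r k <= C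
  end.

Definition factM k : R := k`!%:R * M k.

Lemma factM_gt0 k : 0 < factM k.
Proof. by rewrite mulr_gt0 ?weight_gt0// ltr0n fact_gt0. Qed.

Lemma finite_bound (g : nat -> R) N : exists2 C, 0 <= C & forall k, (k <= N)%N -> g k <= C.
Proof.
elim: N => [|N [C C0 HC]].
  by exists `|g 0%N| => // k; rewrite leqn0 => /eqP ->; exact: ler_norm.
exists (Num.max C `|g N.+1|); first by rewrite le_max C0.
move=> k; rewrite leq_eqVlt le_max => /predU1P[->|/HC ->//].
by rewrite ler_norm orbT.
Qed.

Lemma test_weight_finite (r : nat -> R) N : (forall k, 0 <= r k) ->
  (forall k, (N < k)%N -> r k = 0) -> test_weight r.
Proof.
move=> r0 rN; split=> //; case: md.
  have [C C0 HC] := finite_bound r N; exists 1 => //; exists C => k.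
  by rewrite expr1n mulr1; case: (leqP k N) => [/HC//|/rN ->].
move=> rho rho0; have [C C0 HC] := finite_bound (fun k => rho ^+ k * r k) N; exists C => k.
by case: (leqP k N) => [/HC//|/rN ->]; rewrite mulr0.
Qed.

(** With this weight the normalizing factor r_k / (k! M_k) is 1 up to order N, so that weighted
    bounds become plain bounds for the derivatives of order at most N. *)
Definition trunc_weight N k : R := if (k <= N)%N then factM k else 0.

Lemma test_trunc_weight N : test_weight (trunc_weight N).
Proof.
apply: (@test_weight_finite _ N) => k; rewrite /trunc_weight.
  by case: ifP => // _; exact/ltW/factM_gt0.
by rewrite ltnNge => /negbTE ->.
Qed.

End TestWeights.

(** * Iterated directional derivatives: local bounds, linearity, symmetry *)

Section JetFamilies.
Context (R : realType) (md : umode) (M : weight_sequence R).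

Definition in_disk (E : tvsType R) (B : disk E) (s : seq E) :=
  forall v, v \in s -> disk_set B v.

(* D (v1 :: .. :: vk) x is the iterated directional derivative of f at x. *)
Definition ujets (E F : tvsType R) (U : set E) (f : E -> F) (D : seq E -> E -> F) :=
  [/\ forall x, U x -> D [::] x = f x,
      forall (l : cdual F) s x w, U x ->
        hasd (fun h => l (D s (x + h *: w))) 0 (l (D (w :: s) x))
    & forall (r : nat -> R) (B : disk E) (K : set (disk_space B)), test_weight md r ->
        compact K -> convex_set (K : set (convex_lmodType (disk_space B))) ->
        (forall y, K y -> U (disk_incl y)) ->
        wbounded [set z : F | exists y s, [/\ K y, in_disk B s &
          z = (r (size s) / factM M (size s)) *: D s (disk_incl y)]]].

Definition ultra_on (E F : tvsType R) (U : set E) (f : E -> F) := exists D, ujets U f D.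

Context (E F : tvsType R) (cE : convenient E) (U : set E) (oU : cinf_open U).
Context (f : E -> F) (D : seq E -> E -> F) (HD : ujets U f D).
Implicit Types (l : cdual F) (x v w : E) (s : seq E) (B : disk E).

Let jbound l B (r : nat -> R) (y : disk_space B) : set R :=
  [set a | exists2 s, in_disk B s & a = r (size s) / factM M (size s) * `|l (D s (disk_incl y))|].

Let jboundK l B r : test_weight md r -> forall K : set (disk_space B), compact K ->
  convex_set (K : set (convex_lmodType (disk_space B))) ->
  (forall y, K y -> U (disk_incl y)) ->
  exists C : R, forall y a, K y -> jbound l r y a -> a <= C.
Proof.
move=> tr K cK vK KU; have [_ _ Hb] := HD; have [C HC] := Hb r B K tr cK vK KU l.
exists C => y _ Ky [s sB ->].
have := HC ((r (size s) / factM M (size s)) *: D s (disk_incl y)).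
rewrite cdualZ normrM ger0_norm; last by rewrite divr_ge0 ?tr.1// ltW// factM_gt0.
by apply; exists y, s.
Qed.

Lemma ujets_compact l B r (K : set (disk_space B)) : test_weight md r -> compact K ->
  (forall y, K y -> U (disk_incl y)) -> exists C : R, forall y s, K y -> in_disk B s ->
    r (size s) / factM M (size s) * `|l (D s (disk_incl y))| <= C.
Proof.
move=> tr cK KU; have [C HC] := compact_bound cE oU (jboundK l tr) cK KU.
by exists C => y s Ky sB; apply: (HC y) => //; exists s.
Qed.

Lemma ujets_local l B N (x : disk_space B) : U (disk_incl x) ->
  exists2 d : R, 0 < d & exists2 C : R, 0 <= C & forall y, `|y - x| < d ->
    U (disk_incl y) /\ forall s, in_disk B s -> (size s <= N)%N -> `|l (D s (disk_incl y))| <= C.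
Proof.
move=> Ux; have [d d0 [C HC]] := local_bound cE oU (jboundK l (test_trunc_weight md M N)) Ux.
exists d => //; exists `|C| => // y yx; have [Uy h] := HC y yx; split=> // s sB sN.
apply: le_trans (ler_norm C); have := h _ (ex_intro2 _ _ s sB erefl).
by rewrite /trunc_weight sN mulfV ?mul1r// gt_eqF// factM_gt0.
Qed.

Lemma ujets_compactN l B N (K : set (disk_space B)) : compact K ->
  (forall y, K y -> U (disk_incl y)) -> exists2 C : R, 0 <= C & forall y s, K y ->
    in_disk B s -> (size s <= N)%N -> `|l (D s (disk_incl y))| <= C.
Proof.
move=> cK KU; have [C HC] := ujets_compact l (test_trunc_weight md M N) cK KU.
exists `|C| => // y s Ky sB sN; apply: le_trans (ler_norm C); have := HC y s Ky sB.
by rewrite /trunc_weight sN mulfV ?mul1r// gt_eqF// factM_gt0.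
Qed.

Lemma ujets_hasd l s x w t : U (x + t *: w) ->
  hasd (fun t => l (D s (x + t *: w))) t (l (D (w :: s) (x + t *: w))).
Proof.
move=> Uxt; have [_ Hd _] := HD; move=> e e0; have [r r0 rH] := Hd l s _ w Uxt e e0.
exists r => // h hr; have := rH h hr; rewrite add0r scale0r addr0 scalerDl addrA.
exact.
Qed.

(** Finitely many vectors lie in one disk. Questions about a point and finitely many directions thus
    reduce to a single Banach space E_B. *)
Lemma disk_frame (ps : seq E) x : exists B, exists2 X : disk_space B, disk_incl X = x &
  forall v, v \in ps -> disk_set B v /\ exists2 V : disk_space B, disk_incl V = v & `|V| <= 1.
Proof.
have [B HB] := wbounded_disk cE.1 (wbounded_seq (x :: ps)).
have [X XE _] := disk_lift1 (HB x (mem_head x ps)).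
exists B, X => // v vps; have Bv : disk_set B v by apply: HB; rewrite /= inE vps orbT.
by split => //; exact: disk_lift1.
Qed.

Lemma ujets_frame l N (ps : seq E) x : U x ->
  exists2 d : R, 0 < d & exists2 C : R, 0 <= C & forall (a b : R) v w, v \in ps -> w \in ps ->
    `|a| + `|b| < d -> U (x + a *: v + b *: w) /\
    forall s, {subset s <= ps} -> (size s <= N)%N -> `|l (D s (x + a *: v + b *: w))| <= C.
Proof.
move=> Ux; have [B [X XE HB]] := disk_frame ps x.
rewrite -XE in Ux; have [d d0 [C C0 H]] := ujets_local l N Ux.
exists d => //; exists C => // a b v w /HB[_ [V VE V1]] /HB[_ [W WE W1]] ab.
have -> : x + a *: v + b *: w = disk_incl (X + a *: V + b *: W).
  by rewrite !disk_inclD !disk_inclZ XE VE WE.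
have [|Uy h] := H (X + a *: V + b *: W).
  rewrite -[X + _ + _]addrA addrAC subrr add0r; apply: le_lt_trans ab.
  apply: le_trans (ler_normD _ _) _; rewrite !normrZ.
  by apply: lerD; apply: ler_piMr.
by split => // s sp sN; apply: h => // u /sp /HB[].
Qed.

Lemma ujets_taylor1 l s x w (c C : R) :
  (forall t, 0 <= t <= 1 -> U (x + (t * c) *: w)) ->
  (forall t, 0 <= t <= 1 -> `|l (D (w :: s) (x + (t * c) *: w))| <= C) ->
  `|l (D s (x + c *: w)) - l (D s x)| <= C * `|c|.
Proof.
move=> HU HC; have := @taylor1_bound R (fun t => l (D s (x + t *: w)))
  (fun t => l (D (w :: s) (x + t *: w))) 0 c C.
rewrite add0r scale0r addr0; apply=> t t01; first by apply: ujets_hasd; rewrite add0r; exact: HU.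
by rewrite add0r; exact: HC.
Qed.

Lemma ujets_taylor2 l s x w (c C : R) :
  (forall t, 0 <= t <= 1 -> U (x + (t * c) *: w)) ->
  (forall t, 0 <= t <= 1 -> `|l (D (w :: w :: s) (x + (t * c) *: w))| <= C) ->
  `|l (D s (x + c *: w)) - l (D s x) - c * l (D (w :: s) x)| <= C * c ^+ 2.
Proof.
move=> HU HC; have := @taylor2_bound R (fun t => l (D s (x + t *: w)))
  (fun t => l (D (w :: s) (x + t *: w))) (fun t => l (D (w :: w :: s) (x + t *: w))) 0 c C.
rewrite add0r scale0r addr0; apply=> t t01.
- by apply: ujets_hasd; rewrite add0r; exact: HU.
- by apply: ujets_hasd; rewrite add0r; exact: HU.
- by rewrite add0r; exact: HC.
Qed.

Let unit_abs (t c : R) : 0 <= t <= 1 -> `|t * c| <= `|c|.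
Proof. by move=> /andP[t0 t1]; rewrite normrM (ger0_norm t0) ler_piMl. Qed.

Lemma ujets_headZ l s x a v : U x -> l (D (a *: v :: s) x) = a * l (D (v :: s) x).
Proof.
move=> Ux; have Ux0 u : U (x + 0 *: u) by rewrite scale0r addr0.
have H1 := ujets_hasd l s (Ux0 (a *: v)).
have H2 : hasd (fun t => l (D s (x + t *: (a *: v)))) 0 (a * l (D (v :: s) (x + 0 *: v))).
  rewrite (_ : (fun t => _) = fun t => l (D s (x + (0 + t * a) *: v))); last first.
    by apply/funext => t; rewrite add0r scalerA.
  apply: (@hasd_affine R (fun t => l (D s (x + t *: v)))); rewrite mul0r addr0.
  exact: ujets_hasd.
by have := hasd_uniq H1 H2; rewrite !scale0r !addr0.
Qed.

(** The step along h (v + w) is a step along h v followed by one along h w. By the local bounds on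
    second derivatives both have remainders O(h^2), and moving the base point of D (w :: s) from x +
    h v back to x costs O(h^2) as well; uniqueness of the derivative concludes. *)
Lemma ujets_headD l s x v w : U x -> l (D (v + w :: s) x) = l (D (v :: s) x) + l (D (w :: s) x).
Proof.
move=> Ux; have Ux0 u : U (x + 0 *: u) by rewrite scale0r addr0.
have [d d0 [C C0 H]] := @ujets_frame l (size s).+2 [:: v, w & s] x Ux.
have vp : v \in [:: v, w & s] by rewrite mem_head.
have wp : w \in [:: v, w & s] by rewrite !inE eqxx orbT.
have sp : {subset s <= [:: v, w & s]} by move=> u us; rewrite !inE us !orbT.
have s2 a b : a \in [:: v, w & s] -> b \in [:: v, w & s] -> {subset [:: a, b & s] <= [:: v, w & s]}.
  by move=> ap bp u; rewrite !inE => /predU1P[->|/predU1P[->|/sp]]; rewrite -?in_cons// inE.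
have H1 := ujets_hasd l s (Ux0 (v + w)); rewrite scale0r addr0 in H1.
apply: (hasd_uniq H1); apply: (@hasd_quad _ _ _ _ (d / 3) (C + C + C)); first by rewrite divr_gt0.
move=> h hd; rewrite add0r scale0r addr0 scalerDr addrA.
have hd2 : `|h| + `|h| < d by exact: third_lt.
have T1 : `|l (D s (x + h *: v + h *: w)) - l (D s (x + h *: v)) - h * l (D (w :: s) (x + h *: v))| <= C * h ^+ 2.
  have Q t : 0 <= t <= 1 -> `|h| + `|t * h| < d.
    by move=> /(unit_abs h) th; apply: le_lt_trans hd2; rewrite lerD2l.
  apply: ujets_taylor2 => t /Q Qt; have [Ut HC] := H h (t * h) v w vp wp Qt; first exact: Ut.
  by apply: HC => //; exact: s2.
have Q t : 0 <= t <= 1 -> `|t * h| + `|0 : R| < d.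
  move=> /(unit_abs h) th; rewrite normr0 addr0; apply: le_lt_trans th _.
  by apply: le_lt_trans hd2; rewrite lerDl.
have T2 : `|l (D (w :: s) (x + h *: v)) - l (D (w :: s) x)| <= C * `|h|.
  apply: ujets_taylor1 => t /Q Qt; have := H (t * h) 0 v w vp wp Qt; rewrite scale0r addr0 => -[Ut HC]; first exact: Ut.
  by apply: HC => //; exact: s2.
have T3 : `|l (D s (x + h *: v)) - l (D s x) - h * l (D (v :: s) x)| <= C * h ^+ 2.
  apply: ujets_taylor2 => t /Q Qt; have := H (t * h) 0 v w vp wp Qt; rewrite scale0r addr0 => -[Ut HC]; first exact: Ut.
  by apply: HC => //; exact: s2.
set A := l (D s (x + h *: v + h *: w)) in T1 *; set A1 := l (D s (x + h *: v)) in T1 T3 *.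
set A0 := l (D s x) in T3 *; set W := l (D (w :: s) x) in T2 *.
set V := l (D (v :: s) x) in T3 *; set W1 := l (D (w :: s) _) in T1 T2.
have -> : A - A0 - h * (V + W) = (A - A1 - h * W1) + h * (W1 - W) + (A1 - A0 - h * V) by ring.
have {}T2 : `|h * (W1 - W)| <= C * h ^+ 2.
  rewrite normrM -real_normK ?num_real// expr2 mulrCA; exact: ler_wpM2l.
rewrite !mulrDl; apply: le_trans (ler_normD _ _) _; apply: lerD => //.
by apply: le_trans (ler_normD _ _) _; exact: lerD.
Qed.

(* The second difference of [l \o D s] along v and w is h^2 D (v :: w :: s) x + O(h^3). *)
Let second_difference l s x v w : U x ->
  exists2 d : R, 0 < d & exists C : R, forall h, 0 < h -> h < d ->
    `|l (D s (x + h *: v + h *: w)) - l (D s (x + h *: v)) - (l (D s (x + h *: w)) - l (D s x))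
      - h ^+ 2 * l (D (v :: w :: s) x)| <= C * h ^+ 3.
Proof.
move=> Ux; have [d d0 [C C0 H]] := @ujets_frame l (size s).+3 [:: v, w & s] x Ux.
have vp : v \in [:: v, w & s] by rewrite mem_head.
have wp : w \in [:: v, w & s] by rewrite !inE eqxx orbT.
have sp : {subset s <= [:: v, w & s]} by move=> u us; rewrite !inE us !orbT.
have s3 a b c : a \in [:: v, w & s] -> b \in [:: v, w & s] -> c \in [:: v, w & s] ->
    {subset [:: a, b, c & s] <= [:: v, w & s]}.
  by move=> ap bp cp u; rewrite [in X in X -> _]inE => /predU1P[->//|]; rewrite [in X in X -> _]inE =>
   /predU1P[->//|]; rewrite [in X in X -> _]inE => /predU1P[->//|/sp].
exists (d / 2); first by rewrite divr_gt0.
exists (C + C) => h h0 hd.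
have hd2 : h + h < d by exact: half_lt.
have tt t : 0 <= t <= 1 -> `|t * h| <= h.
  by move=> t01; rewrite -[leRHS](gtr0_norm h0); exact: unit_abs.
have bnd (a b : R) u : `|a| <= h -> `|b| <= h -> u \in [:: v, w & s] ->
    U (x + a *: v + b *: w) /\ `|l (D [:: u, v, w & s] (x + a *: v + b *: w))| <= C.
  move=> ah bh up; have [|Ut HC] := H a b v w vp wp; first exact: le_lt_trans (lerD ah bh) hd2.
  by split => //; apply: HC => //; exact: s3.
pose V := l (D (v :: w :: s) x).
(* [phi h - phi 0] is the quantity to be bounded, and [phi1], the derivative of [phi], is O(h^2). *)
pose phi t := l (D s (x + h *: v + t *: w)) - l (D s (x + t *: w)) - t * (h * V).
pose phi1 t := l (D (w :: s) (x + h *: v + t *: w)) - l (D (w :: s) (x + t *: w)) - h * V.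
have hh : `|h| <= h by rewrite gtr0_norm.
have hz : `|0 : R| <= h by rewrite normr0 ltW.
have Uw b : `|b| <= h -> U (x + b *: w).
  by move=> bh; have [+ _] := bnd 0 b v hz bh vp; rewrite scale0r addr0.
have phiD t : 0 <= t <= 1 -> hasd phi (0 + t * h) (phi1 (0 + t * h)).
  move=> /tt th; rewrite add0r /phi /phi1; apply: hasdD.
    apply: hasdD; first by apply: ujets_hasd; have [] := bnd h _ v hh th vp.
    rewrite -mulN1r (_ : (fun t => - _) = (fun t => -1 * l (D s (x + t *: w)))); last first.
      by apply/funext => u; rewrite mulN1r.
    by apply: hasdZ; apply: ujets_hasd; exact: Uw.
  have := hasdM (hasd_id (t * h)) (hasd_cst (- (h * V)) (t * h)).
  rewrite mulr0 addr0 mul1r; congr hasd; apply/funext => u; rewrite mulrN//.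
have := @taylor1_bound R phi phi1 0 h ((C + C) * h ^+ 2) phiD.
rewrite add0r /phi scale0r mul0r !addr0 subr0 => TB.
have -> : (C + C) * h ^+ 3 = (C + C) * h ^+ 2 * `|h| by rewrite (gtr0_norm h0) -mulrA -exprSr.
set Z := (X in `|X| <= _) in TB; set Z' := (X in `|X| <= _).
have -> : Z' = Z by rewrite /Z' /Z -/V; ring.
apply: TB => t /tt th; rewrite add0r /phi1.
have A1 : `|l (D (w :: s) (x + h *: v + (t * h) *: w)) - l (D (w :: s) (x + (t * h) *: w))
    - h * l (D (v :: w :: s) (x + (t * h) *: w))| <= C * h ^+ 2.
  rewrite [x + h *: v + _]addrAC; apply: ujets_taylor2 => u /tt uh; rewrite addrAC;
    by have [] := bnd (u * h) (t * h) v uh th vp.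
have A2 : `|l (D (v :: w :: s) (x + (t * h) *: w)) - V| <= C * `|t * h|.
  apply: ujets_taylor1 => u /unit_abs uh.
    by apply: Uw; exact: le_trans (uh _) th.
  have [_] := bnd 0 (u * (t * h)) w hz (le_trans (uh _) th) wp.
  by rewrite scale0r addr0.
move: A1 A2; set a := l _; set b := l _; set c := l _ => A1 A2.
have -> : a - b - h * V = (a - b - h * c) + h * (c - V) by ring.
rewrite mulrDl; apply: le_trans (ler_normD _ _) _; apply: lerD => //.
rewrite normrM (gtr0_norm h0) expr2 mulrCA; apply: ler_wpM2l; first exact: ltW.
by apply: le_trans A2 _; rewrite ler_wpM2l.
Qed.

(** The second difference along v and w is symmetric in v and w, so both derivatives are its limit
    after division by h^2. *)
Lemma ujets_swap l s x v w : U x -> l (D (v :: w :: s) x) = l (D (w :: v :: s) x).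
Proof.
move=> Ux; have [d1 d10 [C1 H1]] := second_difference l s v w Ux.
have [d2 d20 [C2 H2]] := second_difference l s w v Ux.
set A := l _; set B := l _; apply/eqP; rewrite -subr_eq0 -normr_le0.
apply/ler_addgt0Pr => e e0; rewrite add0r.
have C0 : 0 < `|C1| + `|C2| + 1 by rewrite ltr_wpDl// addr_ge0.
pose h := Num.min (Num.min d1 d2) (e / (`|C1| + `|C2| + 1)) / 2.
have m0 : 0 < Num.min (Num.min d1 d2) (e / (`|C1| + `|C2| + 1)) by rewrite !lt_min d10 d20 divr_gt0.
have h0 : 0 < h by rewrite divr_gt0.
have : h < Num.min (Num.min d1 d2) (e / (`|C1| + `|C2| + 1)).
  by rewrite ltr_pdivrMr// ltr_pMr// ltr1n.
rewrite !lt_min => /andP[/andP[hd1 hd2] he].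
have := H1 h h0 hd1; have := H2 h h0 hd2; rewrite -/A -/B.
rewrite [x + h *: w + h *: v]addrAC.
set a := l _; set b := l _; set c := l _; set g := l _ => T2 T1.
have h2 : 0 < h ^+ 2 by rewrite exprn_gt0.
rewrite -(ler_pM2l h2) -{1}(gtr0_norm h2) -normrM.
have -> : h ^+ 2 * (A - B) = (a - b - (c - g) - h ^+ 2 * B) - (a - c - (b - g) - h ^+ 2 * A) by ring.
apply: le_trans (ler_normB _ _) _; apply: le_trans (lerD T2 T1) _.
have {}he : (C2 + C1) * h <= e.
  move: he; rewrite ltr_pdivlMr// => /ltW; apply: le_trans; rewrite mulrC ler_wpM2l ?(ltW h0)//.
  by rewrite addrC; apply: le_trans (lerD (ler_norm C1) (ler_norm C2)) _; rewrite lerDl.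
have -> : C2 * h ^+ 3 + C1 * h ^+ 3 = h ^+ 2 * ((C2 + C1) * h) by ring.
by rewrite ler_wpM2l// ltW.
Qed.

(** An identity that holds on all of U may be differentiated, since U contains a piece of each line
    through x. This carries facts about the head of a list of directions to the later positions. *)
Lemma ujets_cons_congr l s t (c : R) w :
  (forall x, U x -> l (D s x) = c * l (D t x)) ->
  forall x, U x -> l (D (w :: s) x) = c * l (D (w :: t) x).
Proof.
move=> st x Ux; have Ux0 : U (x + 0 *: w) by rewrite scale0r addr0.
have H1 := ujets_hasd l s Ux0.
have H2 := hasdZ c (ujets_hasd l t Ux0).
rewrite scale0r addr0 in H1 H2; apply: hasd_uniq H1 _; apply: hasd_ext H2.
have [d d0 [C C0 H]] := @ujets_frame l 0 [:: w] x Ux.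
exists d => // h hd; rewrite add0r st//.
have [|+ _] := H h 0 w w (mem_head _ _) (mem_head _ _); first by rewrite normr0 addr0.
by rewrite scale0r addr0.
Qed.

Lemma ujets_cons_congr1 l s t w : (forall x, U x -> l (D s x) = l (D t x)) ->
  forall x, U x -> l (D (w :: s) x) = l (D (w :: t) x).
Proof.
move=> st x Ux; have := @ujets_cons_congr l s t 1 w _ x Ux; rewrite mul1r; apply.
by move=> y Uy; rewrite mul1r st.
Qed.

Lemma ujets_perm l s t : perm_eq s t -> forall x, U x -> l (D s x) = l (D t x).
Proof.
elim: s t => [|a s IH] t; first by rewrite perm_sym => /perm_nilP ->.
move=> st; have at_ : a \in t by rewrite -(perm_mem st) mem_head.
case/splitPr: at_ st => t1 t2; rewrite perm_sym perm_catC perm_cons perm_catC perm_sym => /IH {}IH.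
move=> x Ux; rewrite (ujets_cons_congr1 _ IH)//.
elim: t1 x Ux {IH} => [//|b t1 IHt] x Ux /=.
by rewrite ujets_swap//; exact: ujets_cons_congr1.
Qed.

Lemma ujets_scale l (ps : seq (R * E)) x : U x ->
  l (D [seq p.1 *: p.2 | p <- ps] x) = (\prod_(p <- ps) p.1) * l (D [seq p.2 | p <- ps] x).
Proof.
elim: ps x => [|p ps IH] x Ux; first by rewrite big_nil mul1r.
by rewrite big_cons /= ujets_headZ// (ujets_cons_congr _ IH)// mulrA.
Qed.

End JetFamilies.

(** * Test weights and rates of growth *)

Section WeightCalculus.
Context (R : realType) (md : umode).
Implicit Types (r : nat -> R) (A : nat -> R -> Prop).

(** The growth condition of C^[M], for quantities a of order k that are already divided by k! M_k.
    [A] is a relation because each order carries many values, one for each point and list of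
    directions. *)
Definition mode_bounded A :=
  match md with
  | Beurling => forall rho, 0 < rho -> exists C : R, forall k a, A k a -> a <= C * rho ^+ k
  | Roumieu => exists2 rho, 0 < rho & exists C : R, forall k a, A k a -> a <= C * rho ^+ k
  end.

Lemma nat_pow_bounded (rho : R) (N : nat -> nat) : 0 < rho ->
  (forall K, exists m0, forall m, (m0 <= m)%N -> (K <= N m)%N) ->
  exists2 C : R, 0 < C & forall m, rho ^+ m <= C * (N m).+1%:R ^+ m.
Proof.
move=> rho0 Ninf; have [m0 Hm0] := Ninf (Num.truncn rho).
have [C C0 HC] := finite_bound (fun m => rho ^+ m / (N m).+1%:R ^+ m) m0.
exists (C + 1) => [|m]; first by rewrite ltr_wpDl.
have p0 : 0 < (N m).+1%:R ^+ m :> R by rewrite exprn_gt0.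
rewrite -ler_pdivrMr//; have [/HC h|/ltnW/Hm0 h] := leqP m m0.
  by apply: le_trans h _; rewrite lerDl.
rewrite ler_wpDl// ler_pdivrMr// mul1r; apply: lerXn2r; rewrite ?nnegrE ?(ltW rho0)//.
by apply: (le_trans (ltW (truncnS_gt rho))); rewrite ler_nat ltnS.
Qed.

Lemma mode_bounded_test A r : (forall k a, A k a -> 0 <= a) -> mode_bounded A ->
  test_weight md r -> exists2 C : R, 0 <= C & forall k a, A k a -> r k * a <= C.
Proof.
rewrite /mode_bounded /test_weight => A0; case: md => bA [r0 rr].
  have [rho rho0 [C HC]] := rr; have [D HD] := bA rho^-1 (ltac:(by rewrite invr_gt0)).
  exists `|C * D| => // k a Aka; have p0 : 0 < rho ^+ k by rewrite exprn_gt0.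
  apply: le_trans (ler_norm _); apply: le_trans (ler_pM (r0 k) (A0 k a Aka) (HC k) (HD k a Aka)) _.
  by rewrite exprVn mulrACA mulfV ?gt_eqF// mulr1.
have [rho rho0 [D HD]] := bA; have [C HC] := rr rho rho0.
exists `|C * `|D| | => // k a Aka; have p0 : 0 < rho ^+ k by rewrite exprn_gt0.
have aD : a <= `|D| * rho ^+ k.
  by apply: le_trans (HD k a Aka) _; rewrite ler_pM2r// ler_norm.
apply: le_trans (ler_norm _); apply: le_trans (ler_wpM2l (r0 k) aD) _.
by rewrite mulrCA mulrC [r k * _]mulrC; apply: ler_wpM2r.
Qed.

(* For Roumieu: the k_j-th entry of the weight is about j^-k_j, where (k_j, a_j)
   are counterexamples for the rate j. *)
Lemma test_mode_bounded A : (forall k a, A k a -> 0 <= a) ->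
  (forall r, test_weight md r -> exists C : R, forall k a, A k a -> r k * a <= C) ->
  mode_bounded A.
Proof.
rewrite /mode_bounded /test_weight => A0; case: md => H.
  move=> rho rho0; have [|C HC] := H (fun k => rho^-1 ^+ k).
    split=> [k|]; first by rewrite exprn_ge0// invr_ge0 ltW.
    by exists rho^-1; rewrite ?invr_gt0//; exists 1 => k; rewrite mul1r.
  exists C => k a Aka; have := HC k a Aka.
  by rewrite exprVn ler_pdivrMl ?exprn_gt0// mulrC.
apply: contrapT => nb.
have bad j : exists k, exists2 a, A k a & j.+1%:R * j.+1%:R ^+ k < a.
  apply: contrapT => /forallNP bad; apply: nb; exists j.+1%:R => //; exists j.+1%:R => k a Aka.
  by rewrite leNgt; apply/negP => h; apply: (bad k); exists a.
pose k j := projT1 (cid (bad j)).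
have kP j : exists2 a, A (k j) a & j.+1%:R * j.+1%:R ^+ (k j) < a by exact: projT2 (cid (bad j)).
(* Several j may share the order k j; the weight is the supremum over them, and it is 0 at orders
   that do not occur. *)
pose Q i := [set x : R | exists2 j, k j = i & x = j.+1%:R^-1 ^+ i].
have Q01 i x : Q i x -> 0 <= x <= 1.
  move=> [j _ ->]; rewrite exprn_ge0 ?invr_ge0//= exprn_ile1 ?invr_ge0//.
  by rewrite invf_le1// ler1n.
have Qs i x : Q i x -> x <= sup (Q i).
  by move=> Qx; apply: sup_upper_bound => //; split; [exists x|exists 1 => y /Q01/andP[]].
have sup_le i b : 0 <= b -> (forall x, Q i x -> x <= b) -> sup (Q i) <= b.
  move=> b0 Qb; have [ne|/nonemptyPn E] := pselect (Q i !=set0); first exact: ge_sup.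
  by rewrite E sup0.
have [|C HC] := H (fun i => sup (Q i)).
  split=> [i|rho rho0].
    have [[x Qx]|/nonemptyPn ->] := pselect (Q i !=set0); last by rewrite sup0.
    by apply: le_trans (Qs _ _ Qx); have /andP[] := Q01 _ _ Qx.
  have [C C0 HC] := finite_bound (fun j => rho ^+ (k j)) (Num.truncn rho).
  exists (C + 1) => i; rewrite -ler_pdivlMl ?exprn_gt0//; apply: sup_le => [|_ [j <- ->]].
    by rewrite mulr_ge0// ?invr_ge0 ?exprn_ge0 ?addr_ge0// ltW.
  rewrite ler_pdivlMl ?exprn_gt0//; have [/HC h|jr] := leqP j (Num.truncn rho).
    apply: le_trans (_ : rho ^+ (k j) <= _).
      by rewrite ler_piMr ?exprn_ge0 ?(ltW rho0)// exprn_ile1 ?invr_ge0// invf_le1// ler1n.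
    by apply: le_trans h _; rewrite lerDl.
  apply: le_trans (_ : 1 <= _); last by rewrite lerDr.
  rewrite exprVn ler_pdivrMr ?exprn_gt0// mul1r; apply: lerXn2r; rewrite ?nnegrE ?(ltW rho0)//.
  by apply: le_trans (ltW (truncnS_gt rho)) _; rewrite ler_nat ltnW.
have [a Aa ja] := kP (Num.truncn C).
have := HC _ _ Aa; rewrite leNgt => /negP; apply; apply: lt_le_trans (truncnS_gt C) _.
have p0 : 0 < (Num.truncn C).+1%:R ^+ (k (Num.truncn C)) :> R by rewrite exprn_gt0.
have h : (Num.truncn C).+1%:R^-1 ^+ (k (Num.truncn C)) <= sup (Q (k (Num.truncn C))).
  by apply: Qs; exists (Num.truncn C).
apply: le_trans (ler_wpM2r (A0 _ _ Aa) h).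
by rewrite exprVn ler_pdivlMl// mulrC ltW.
Qed.

Let natS_le_exp2 n : (n.+1%:R : R) <= 2 ^+ n.
Proof. by rewrite -natrX ler_nat ltn_expl. Qed.

(** r is the convolution of r1 and r2, multiplied by A^n. The number n + 1 of summands is at most
    2^n and is absorbed by the rate. *)
Lemma test_weight_mul r1 r2 (A : R) : test_weight md r1 -> test_weight md r2 -> 0 <= A ->
  exists2 r, test_weight md r & forall j k, r1 j * r2 k * A ^+ (j + k) <= r (j + k)%N.
Proof.
move=> t1 t2 A0; pose r n := \sum_(j < n.+1) r1 j * r2 (n - j)%N * A ^+ n.
have r10 := t1.1; have r20 := t2.1.
have T n (j : 'I_n.+1) : 0 <= r1 j * r2 (n - j)%N * A ^+ n.
  by rewrite mulr_ge0 ?exprn_ge0// mulr_ge0.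
exists r => [|j k]; last first.
  rewrite /r (bigD1 (inord j))//= inordK ?ltnS ?leq_addr// addKn.
  by rewrite lerDl; apply: sumr_ge0.
split=> [n|]; first exact: sumr_ge0.
move: t1.2 t2.2 => {t1 t2}; case: md => [[rho1 p1 [C1 H1]] [rho2 p2 [C2 H2]]|H1 H2].
  pose q := Num.max rho1 rho2 * (A + 1).
  have q0 : 0 < Num.max rho1 rho2 by rewrite lt_max p1.
  have A1 : 0 < A + 1 by rewrite ltr_wpDl.
  have C10 : 0 <= C1 by have := le_trans (r10 0%N) (H1 0%N); rewrite expr0 mulr1.
  have C20 : 0 <= C2 by have := le_trans (r20 0%N) (H2 0%N); rewrite expr0 mulr1.
  exists (2 * q); first by rewrite !mulr_gt0.
  exists (C1 * C2) => n; rewrite exprMn mulrA.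
  have -> : C1 * C2 * 2 ^+ n * q ^+ n = 2 ^+ n * (C1 * C2 * q ^+ n) by ring.
  apply: (@le_trans _ _ (\sum_(j < n.+1) C1 * C2 * q ^+ n)); last first.
    rewrite sumr_const card_ord -[_ *+ n.+1]mulr_natl; apply: ler_wpM2r; last exact: natS_le_exp2.
    by apply: mulr_ge0; [exact: mulr_ge0|rewrite exprn_ge0// mulr_ge0// ltW].
  apply: ler_sum => j _; have jn : (j <= n)%N by rewrite -ltnS.
  rewrite /q exprMn mulrA; apply: ler_pM; rewrite ?mulr_ge0 ?exprn_ge0//; last first.
    by rewrite lerXn2r ?nnegrE ?(ltW A1)// lerDl.
  have -> : C1 * C2 * Num.max rho1 rho2 ^+ n =
      (C1 * Num.max rho1 rho2 ^+ j) * (C2 * Num.max rho1 rho2 ^+ (n - j)).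
    by rewrite mulrACA -exprD subnKC.
  apply: ler_pM => //; apply: (le_trans (H1 _)) || apply: (le_trans (H2 _));
    apply: ler_wpM2l => //; apply: lerXn2r; rewrite ?nnegrE ?(ltW p1) ?(ltW p2) ?(ltW q0)//;
    by rewrite le_max lexx ?orbT.
move=> rho rho0; have q0 : 0 < 2 * rho * (A + 1) by rewrite !mulr_gt0// ltr_wpDl.
have [C1 HC1] := H1 _ q0; have [C2 HC2] := H2 _ q0.
exists (C1 * C2) => n; rewrite -(ler_pM2l (_ : 0 < 2 ^+ n :> R)) ?exprn_gt0//.
have C10 : 0 <= C1 by have := HC1 0%N; rewrite expr0 mul1r; exact: le_trans (r10 0%N).
have C20 : 0 <= C2 by have := HC2 0%N; rewrite expr0 mul1r; exact: le_trans (r20 0%N).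
apply: (@le_trans _ _ (\sum_(j < n.+1) C1 * C2)); last first.
  rewrite sumr_const card_ord -[_ *+ n.+1]mulr_natl; apply: ler_wpM2r; last exact: natS_le_exp2.
  exact: mulr_ge0.
rewrite mulrA -exprMn /r mulr_sumr; apply: ler_sum => j _.
have jn : (j <= n)%N by rewrite -ltnS.
apply: (@le_trans _ _ ((2 * rho * (A + 1)) ^+ j * r1 j * ((2 * rho * (A + 1)) ^+ (n - j) * r2 (n - j)%N))).
  rewrite mulrACA -exprD subnKC// [_ ^+ n * (_ * _)]mulrC [(2 * rho * _) ^+ n]exprMn.
  rewrite mulrCA; apply: ler_wpM2l; first exact: mulr_ge0.
  apply: ler_wpM2l; first by rewrite exprn_ge0// mulr_ge0// ltW.
  by rewrite lerXn2r ?nnegrE ?addr_ge0// lerDl.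
by apply: ler_pM; rewrite ?mulr_ge0 ?exprn_ge0// ltW.
Qed.

(* In the Roumieu case r' k = (N k + 1)^-k where N tends to infinity so slowly
   that r k <= (N k + 1)^(-2 k). *)
Lemma composition_weight r (c : R) : test_weight md r -> 0 <= c ->
  exists r' : nat -> R, [/\ test_weight md r', forall k, 0 < r' k &
    forall A, mode_bounded A -> exists x : R, [/\ 0 <= x,
      exists C : R, forall k a, A k a -> a <= C * x ^+ k &
      exists C : R, forall bs : seq nat,
        r (sumn bs) * (2 + c * x) ^+ (sumn bs) <= C * \prod_(b <- bs) r' b]].
Proof.
move=> tr c0; have r0 := tr.1; move: tr; rewrite /test_weight /mode_bounded; case: md => -[_].
  move=> [rho rho0 [C HC]]; have q0 : 0 < rho * (2 + c) by rewrite mulr_gt0// ltr_wpDr.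
  exists (fun k => (rho * (2 + c)) ^+ k); split=> [|k|A bA]; last 2 first.
  - by rewrite exprn_gt0.
  - exists 1; split => //; first exact: bA.
    exists C => bs; rewrite mulr1.
    have -> : \prod_(b <- bs) (rho * (2 + c)) ^+ b = (rho * (2 + c)) ^+ sumn bs.
      elim: bs => [|b bs IH]; first by rewrite big_nil expr0.
      by rewrite big_cons IH -exprD.
    by rewrite exprMn mulrA ler_wpM2r// exprn_ge0// addr_ge0.
  split=> [k|]; first by rewrite exprn_ge0// ltW.
  by exists (rho * (2 + c)) => //; exists 1 => k; rewrite mul1r.
move=> Hr; have [C0' HC0'] := Hr 1 ltr01; pose C0 := Num.max C0' 1.
have HC0 k : r k <= C0 by have := HC0' k; rewrite expr1n mul1r le_max => ->.
have thr j : exists n, forall m, (n <= m)%N -> r m * (j.+1%:R ^+ 2) ^+ m <= C0.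
  have p0 : 0 < 2 * j.+1%:R ^+ 2 :> R by rewrite mulr_gt0// exprn_gt0.
  have [C HC] := Hr _ p0; exists (Num.truncn C).+1 => m Cm.
  have := HC m; rewrite exprMn -mulrA => h.
  have : 2 ^+ m * ((j.+1%:R ^+ 2) ^+ m * r m) <= 2 ^+ m * 1.
    apply: le_trans h _; rewrite mulr1; apply: le_trans (ltW (truncnS_gt C)) _.
    by rewrite -natrX ler_nat (leq_trans Cm)// ltnW// ltn_expl.
  rewrite ler_pM2l ?exprn_gt0// mulrC => /le_trans; apply.
  by rewrite le_max lexx orbT.
pose n j := if j is i.+1 then projT1 (cid (thr i.+1)) else 0%N.
have nP j m : (n j <= m)%N -> r m * (j.+1%:R ^+ 2) ^+ m <= C0.
  case: j => [|j]; first by rewrite expr1n expr1n mulr1.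
  exact: (projT2 (cid (thr j.+1))).
(* The largest j <= m whose threshold n j is at most m; n 0 = 0 ensures that there is one. It is
   monotone in m and tends to infinity. *)
pose N m : nat := [arg max_(j > (ord0 : 'I_m.+1) | (n j <= m)%N) (j : nat)].
have NP m : r m * ((N m).+1%:R ^+ 2) ^+ m <= C0.
  by rewrite /N; case: arg_maxnP => // j jm _; exact: nP.
have Nub m j : (j <= m)%N -> (n j <= m)%N -> (j <= N m)%N.
  move=> jm nj; rewrite /N; case: arg_maxnP => // i im; have := inordK (_ : (j < m.+1)%N).
  by rewrite ltnS => /(_ jm) e /(_ (inord j)); rewrite e; exact.
have Nmono m m' : (m <= m')%N -> (N m <= N m')%N.
  move=> mm'; rewrite {1}/N; case: arg_maxnP => // j jm _; apply: Nub; last exact: leq_trans mm'.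
  by apply: leq_trans mm'; rewrite -ltnS.
have Ninf K : exists m0, forall m, (m0 <= m)%N -> (K <= N m)%N.
  by exists (maxn K (n K)) => m; rewrite geq_max => /andP[Km nK]; exact: Nub.
have p0 m k : 0 < (N m).+1%:R ^+ k :> R by rewrite exprn_gt0.
exists (fun k => ((N k).+1%:R ^+ k)^-1); split=> [|k|A [x x0 HA]].
- split=> [k|rho rho0]; first by rewrite invr_ge0 ltW.
  have [C _ HC] := nat_pow_bounded rho0 Ninf; exists C => k.
  by rewrite ler_pdivrMr.
- by rewrite invr_gt0.
- exists x; split=> //; first exact: ltW.
  have X0 : 0 < 2 + c * x by rewrite ltr_wpDr// mulr_ge0// ltW.
  have [C C00 HC] := nat_pow_bounded X0 Ninf; exists (C0 * C) => bs.
  set m := sumn bs.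
  (* Of the two factors (N m + 1)^m in [NP], one pays for the power of 2 + c x, where x was not
     known when r' was chosen. The other is distributed over the blocks, by monotonicity of N. *)
  have prod : ((N m).+1%:R ^+ m)^-1 <= \prod_(b <- bs) ((N b).+1%:R ^+ b)^-1 :> R.
    have H b : (b <= m)%N -> ((N m).+1%:R ^+ b)^-1 <= ((N b).+1%:R ^+ b)^-1 :> R.
      move=> bm; rewrite lef_pV2 ?posrE// lerXn2r ?nnegrE// ler_nat ltnS; exact: Nmono.
    suff G t : (sumn t <= m)%N -> ((N m).+1%:R ^+ sumn t)^-1 <= \prod_(b <- t) ((N b).+1%:R ^+ b)^-1 :> R.
      exact: G.
    elim: t => [|b t IH] /= tm; first by rewrite big_nil expr0 invr1.
    rewrite big_cons exprD invfM; apply: ler_pM; rewrite ?invr_ge0 ?(ltW (p0 _ _))//.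
      by apply: H; apply: leq_trans tm; rewrite leq_addr.
    by apply: IH; apply: leq_trans tm; rewrite leq_addl.
  have C0p : 0 <= C0 by apply: le_trans (HC0 0%N).
  apply: le_trans (ler_wpM2l (_ : 0 <= C0 * C) prod); last by rewrite mulr_ge0// ltW.
  rewrite ler_pdivlMr//; apply: (@le_trans _ _ (r m * (C * (N m).+1%:R ^+ m) * (N m).+1%:R ^+ m)).
    by rewrite ler_wpM2r ?(ltW (p0 _ _))// ler_wpM2l.
  have := NP m; rewrite -exprM mulnC exprM expr2 => h.
  have -> : r m * (C * (N m).+1%:R ^+ m) * (N m).+1%:R ^+ m =
      r m * ((N m).+1%:R ^+ m * (N m).+1%:R ^+ m) * C by ring.
  by rewrite ler_wpM2r// ltW.
Qed.

End WeightCalculus.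

Section WeightSequences.
Context (R : realType) (M : weight_sequence R).

Lemma log_convex_ratio : log_convex M -> forall k n, (k <= n)%N ->
  M k.+1 * M n <= M k * M n.+1.
Proof.
move=> lcM k n kn.
have step i : M i.+1 / M i <= M i.+2 / M i.+1.
  rewrite ler_pdivrMr ?weight_gt0// mulrAC ler_pdivlMr ?weight_gt0//.
  have := lcM i; rewrite mulr2n mulrDl !mul1r -!lnM ?posrE ?weight_gt0//.
  by rewrite ler_ln ?posrE ?mulr_gt0 ?weight_gt0// [M i.+2 * _]mulrC.
have : M k.+1 / M k <= M n.+1 / M n.
  move: kn; elim: n => [|n IH]; first by rewrite leqn0 => /eqP ->.
  by rewrite leq_eqVlt => /predU1P[->//|]; rewrite ltnS => /IH h; exact: le_trans h (step n).
by rewrite ler_pdivrMr ?weight_gt0// mulrAC ler_pdivlMr ?weight_gt0// [M n.+1 * _]mulrC.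
Qed.

(** Moderate growth passes to k! M_k by (j+k)! <= 2^(j+k) j! k!. The constant is taken at least 1 to
    include j = 0 and k = 0, over which the supremum in the definition does not range. *)
Lemma moderate_growth_factM : moderate_growth M -> exists2 A : R, 0 <= A &
  forall j k, factM M (j + k) <= A ^+ (j + k) * (factM M j * factM M k).
Proof.
rewrite /moderate_growth; set S := (X in ereal_sup X); move=> Sfin.
have [A A1 HA] : exists2 A : R, 1 <= A & forall j k, M (j + k)%N <= A ^+ (j + k) * (M j * M k).
  pose A := Num.max 1 (fine (ereal_sup S)).
  exists A => [|j k]; first by rewrite le_max lexx.
  have A1 : 1 <= A by rewrite le_max lexx.
  have A0 : 0 <= A by exact: le_trans A1.
  case: j => [|j]; first by rewrite add0n weight0 mul1r ler_peMl ?exprn_ege1// ltW// weight_gt0.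
  case: k => [|k]; first by rewrite addn0 weight0 mulr1 ler_peMl ?exprn_ege1// ltW// weight_gt0.
  have MM : 0 < M j.+1 * M k.+1 by rewrite mulr_gt0 ?weight_gt0.
  have q0 : 0 <= M (j.+1 + k.+1)%N / (M j.+1 * M k.+1) by rewrite divr_ge0// ltW// weight_gt0.
  rewrite -ler_pdivrMr//; set q := _ / _ in q0 *.
  have le_sup : ((q `^ (j.+1 + k.+1)%:R^-1)%:E <= ereal_sup S)%E.
    by apply: ereal_sup_ubound; exists j.+1 => //; exists k.+1.
  have fin : ereal_sup S \is a fin_num.
    by rewrite fin_numE -ltNye -ltey Sfin andbT (lt_le_trans _ le_sup) ?ltNyr.
  have {}le_sup : q `^ (j.+1 + k.+1)%:R^-1 <= A.
    by rewrite le_max -[X in _ || X]lee_fin fineK// le_sup orbT.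
  have -> : q = (q `^ (j.+1 + k.+1)%:R^-1) ^+ (j.+1 + k.+1).
    by rewrite -powR_mulrn ?powR_ge0// -powRrM mulVf ?powRr1// pnatr_eq0.
  by rewrite lerXn2r ?nnegrE ?powR_ge0.
exists (2 * A) => [|j k]; first by rewrite mulr_ge0// (le_trans _ A1).
have jk : ((j + k)`!%:R : R) <= 2 ^+ (j + k) * (j`!%:R * k`!%:R).
  rewrite -natrX -!natrM ler_nat -(bin_fact (leq_addr k j)) addKn leq_mul2r; apply/orP; right.
  have jlt : (j < (j + k).+1)%N by rewrite ltnS leq_addr.
  rewrite (_ : 2 = 1 + 1)%N// expnDn (bigD1 (Ordinal jlt))//= !exp1n !muln1.
  exact: leq_addr.
rewrite /factM exprMn; apply: le_trans (ler_pM _ _ jk (HA j k)) _ => //.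
  by rewrite ltW// weight_gt0.
by rewrite le_eqVlt; apply/orP; left; apply/eqP; ring.
Qed.

End WeightSequences.

(** * Partitions and the combinatorial estimate for Faa di Bruno's formula *)

Section Partitions.
Context (T : Type).
Implicit Types (w : T) (b : seq T) (p : seq (seq T)).

(** All ways to put w into one of the existing blocks of p, in the order in which the Leibniz rule
    produces them, see [leibniz_adjoin]. *)
Fixpoint adjoin w p : seq (seq (seq T)) :=
  if p is b :: p' then ((w :: b) :: p') :: [seq b :: q | q <- adjoin w p'] else [::].

(* The partitions of (the positions of) s into non-empty blocks. *)
Fixpoint partitions s : seq (seq (seq T)) :=
  if s is w :: s' then flatten [seq ([:: w] :: p) :: adjoin w p | p <- partitions s']
  else [:: [::]].

End Partitions.

Section PartitionBounds.
Context (R : realType) (M : weight_sequence R) (lcM : log_convex M) (T : eqType).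
Implicit Types (w : T) (b s : seq T) (p q : seq (seq T)).

Definition partition_weight p : R := (size p)`!%:R * \prod_(b <- p) (size b)`!%:R.

(** Putting w into the block b multiplies its factorial by size b + 1, and these factors add up to
    the number of entries plus the number of blocks. *)
Lemma adjoin_sum w p :
  \sum_(q <- adjoin w p) \prod_(b <- q) ((size b)`!%:R : R) =
  (sumn (map size p) + size p)%:R * \prod_(b <- p) (size b)`!%:R.
Proof.
elim: p => [|b p IH]; first by rewrite /= big_nil mul0r.
rewrite /= !big_cons big_map.
rewrite (eq_bigr (fun q => (size b)`!%:R * \prod_(c <- q) (size c)`!%:R)); last first.
  by move=> q _; rewrite big_cons.
by rewrite -mulr_sumr IH /= factS !natrM !natrD -[_.+1%:R]natr1 -[(size p).+1%:R]natr1; ring.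
Qed.

Lemma adjoin_size w p q : q \in adjoin w p -> size q = size p.
Proof.
elim: p q => [//|b p IH] q /=; rewrite inE => /predU1P[->//|/mapP[q' /IH q'p ->]].
by rewrite /= q'p.
Qed.

Lemma adjoin_sumn w p q : q \in adjoin w p -> sumn (map size q) = (sumn (map size p)).+1.
Proof.
elim: p q => [//|b p IH] q /=; rewrite inE => /predU1P[->//|/mapP[q' /IH q'p ->]].
by rewrite /= q'p addnS.
Qed.

(** The enlarged block turns M_|b| into M_(|b|+1). As |b| <= n, log-convexity bounds this ratio by
    M_(n+1) / M_n. *)
Lemma adjoin_M w p q n : q \in adjoin w p -> (sumn (map size p) <= n)%N ->
  M n * \prod_(b <- q) M (size b) <= M n.+1 * \prod_(b <- p) M (size b).
Proof.
have prod0 p' : 0 <= \prod_(b <- p') M (size b).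
  by apply: prodr_ge0 => b _; exact/ltW/weight_gt0.
elim: p q => [//|b p IH] q /=; rewrite inE => /predU1P[->|/mapP[q' q'p ->]] pn.
  rewrite !big_cons !mulrA ler_wpM2r//= mulrC [leRHS]mulrC.
  by apply: log_convex_ratio => //; apply: leq_trans pn; rewrite leq_addr.
rewrite !big_cons mulrCA [leRHS]mulrCA ler_wpM2l ?(ltW (weight_gt0 _ _))//.
by apply: IH => //; apply: leq_trans pn; rewrite leq_addl.
Qed.

(** The third condition is the form in which log-convexity enters Faa di Bruno's formula. Each
    singleton block contributes a factor M_1 when it is created, whence the power of M_1. *)
Definition good_partition s p := [/\ sumn (map size p) = size s, (size p <= size s)%N,
  M (size p) * \prod_(b <- p) M (size b) <= M 1%N ^+ size p * M (size s) &
  forall b v, b \in p -> v \in b -> v \in s].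

Lemma partitions_good s p : p \in partitions s -> good_partition s p.
Proof.
elim: s p => [|w s IH] p /=.
  by rewrite inE => /eqP ->; split; rewrite //= big_nil expr0 mulr1 mul1r.
move=> /flattenP[_ /mapP[q /IH[qs sq qM qin] ->]]; rewrite inE => /predU1P[->|pq].
  split; [by rewrite /= qs|by []| |]; last first.
    move=> b v bq vb; have : (b == [:: w]) || (b \in q) by [].
    move=> /predU1P[bE|{}bq]; last by apply/orP; right; exact: qin bq vb.
    by move: vb; rewrite bE mem_seq1 => /eqP ->; exact: mem_head.
  rewrite big_cons exprS /= mulrCA -[leRHS]mulrA ler_wpM2l ?(ltW (weight_gt0 _ _))//.
  rewrite -(ler_pM2l (weight_gt0 M (size q))) mulrCA.
  apply: le_trans (ler_wpM2l (ltW (weight_gt0 M _)) qM) _.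
  rewrite mulrCA [leRHS]mulrCA; apply: ler_wpM2l; last exact: log_convex_ratio.
  by rewrite exprn_ge0// ltW// weight_gt0.
have zp := adjoin_size pq; have np := adjoin_sumn pq.
split; rewrite ?zp /=; [by rewrite np qs|exact: leqW| |].
  have h := adjoin_M pq (eq_leq qs).
  rewrite -(ler_pM2l (weight_gt0 M (size s))) mulrCA.
  apply: le_trans (ler_wpM2l (ltW (weight_gt0 M _)) h) _.
  rewrite mulrCA; apply: le_trans (ler_wpM2l (ltW (weight_gt0 M _)) qM) _.
  by rewrite le_eqVlt; apply/orP; left; apply/eqP; ring.
move=> b v bp vb; rewrite in_cons; move: bp vb; clear -pq qin.
have H q' b' : b' \in p -> p \in adjoin w q' -> (exists2 c, c \in q' & b' = w :: c) \/ b' \in q'.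
  elim: q' p {pq} => [//|c q' IH] p; rewrite /= in_cons => bp /predU1P[pE|/mapP[p' p'q pE]].
    move: bp; rewrite pE in_cons => /predU1P[->|bq]; first by left; exists c => //; exact: mem_head.
    by right; rewrite in_cons bq orbT.
  move: bp; rewrite pE in_cons => /predU1P[->|bp']; first by right; exact: mem_head.
  have [[b'' h1 h2]|h] := IH p' bp' p'q.
    by left; exists b'' => //; rewrite in_cons h1 orbT.
  by right; rewrite in_cons h orbT.
move=> bp vb; have [[b' b'q bE]|bq] := H q b bp pq.
  by move: vb; rewrite bE in_cons => /predU1P[->|vb]; rewrite ?eqxx// (qin b')// orbT.
by rewrite (qin b)// orbT.
Qed.

(** For a partition of n entries into k blocks, a further entry contributes the factor (k+1) y as a
    new block, and n + k inside the old ones by [adjoin_sum]. Since k <= n, the total is at most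
    (n+1) (2+y). This is the origin of 2 + c x in [composition_weight], with y = c x and c = M_1. *)
Lemma partitions_sum (y : R) s : 0 <= y ->
  \sum_(p <- partitions s) y ^+ size p * partition_weight p <= (size s)`!%:R * (2 + y) ^+ size s.
Proof.
move=> y0; elim: s => [|w s IH].
  by rewrite big_seq1 /partition_weight big_nil /= !expr0 !fact0 !mulr1.
rewrite /= big_flatten big_map /= factS natrM exprS.
have -> : (size s).+1%:R * (size s)`!%:R * ((2 + y) * (2 + y) ^+ size s) =
  (size s).+1%:R * (2 + y) * ((size s)`!%:R * (2 + y) ^+ size s) by ring.
apply: le_trans (ler_wpM2l _ IH); last by rewrite mulr_ge0// addr_ge0.
rewrite mulr_sumr !big_seq; apply: ler_sum => p ps.
have [sp zp _ _] := partitions_good ps.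
have P0 : 0 <= \prod_(b <- p) ((size b)`!%:R : R) by apply: prodr_ge0 => b _; exact: ler0n.
rewrite big_cons /partition_weight /= big_cons factS natrM mul1r.
have -> : \sum_(q <- adjoin w p) y ^+ size q * ((size q)`!%:R * \prod_(b <- q) (size b)`!%:R) =
    y ^+ size p * (size p)`!%:R * ((size s + size p)%:R * \prod_(b <- p) (size b)`!%:R).
  rewrite -sp -(adjoin_sum w) mulr_sumr !big_seq; apply: eq_bigr => q /adjoin_size ->.
  by rewrite mulrA.
have -> : y ^+ (size p).+1 * ((size p).+1%:R * (size p)`!%:R * \prod_(b <- p) (size b)`!%:R) +
    y ^+ size p * (size p)`!%:R * ((size s + size p)%:R * \prod_(b <- p) (size b)`!%:R) =
    ((size p).+1%:R * y + (size s + size p)%:R) * (y ^+ size p * ((size p)`!%:R * \prod_(b <- p) (size b)`!%:R)).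
  by rewrite exprS; ring.
apply: ler_wpM2r; first by rewrite mulr_ge0 ?exprn_ge0// mulr_ge0.
rewrite mulrDr addrC; apply: lerD; last by rewrite ler_wpM2r// ler_nat.
have h : (size s + size p <= (size s).+1 * 2)%N by move: (size p) (size s) zp => a b; lia.
by rewrite -natrM ler_nat.
Qed.

End PartitionBounds.
(** * Composition *)

Section SecondOrder.
Context (R : realType).
Implicit Type E : tvsType R.

(** Differentiability at 0 with a remainder O(h^2) that is controlled in the space itself: the
    normalized remainders are weakly bounded, so in a Hausdorff space they lie in a disk. Weak
    differentiability alone would not allow e to be substituted into derivatives of another map. *)
Definition quadr E (e : R -> E) (e' : E) (d : R) :=
  wbounded [set z | exists h, 0 < `|h| <= d /\ z = (h ^+ 2)^-1 *: (e h - e 0 - h *: e')].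

Lemma wbounded_bigU E (T : eqType) (p : seq T) (S : T -> set E) :
  (forall i, i \in p -> wbounded (S i)) -> wbounded [set x | exists2 i, i \in p & S i x].
Proof.
elim: p => [|i p IH] H; first by move=> l; exists 0 => x [].
apply: wboundedS (wboundedU (H i (mem_head _ _)) (IH _)) => [x [j]|j jp].
  by rewrite in_cons => /predU1P[->|jp]; [left|right; exists j].
by apply: H; rewrite in_cons jp orbT.
Qed.

Lemma quadr_eq E (e : R -> E) e' d h : 0 < `|h| <= d -> exists eta,
  [set z | exists h, 0 < `|h| <= d /\ z = (h ^+ 2)^-1 *: (e h - e 0 - h *: e')] eta /\
  e h = e 0 + h *: e' + h ^+ 2 *: eta.
Proof.
move=> hd; exists ((h ^+ 2)^-1 *: (e h - e 0 - h *: e')); split; first by exists h.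
have h0 : h ^+ 2 != 0 by rewrite sqrf_eq0 -normr_gt0; case/andP: hd.
by rewrite scalerA mulfV// scale1r -addrA subrKC subrKC.
Qed.

Lemma quadr_values E (e : R -> E) e' d : quadr e e' d ->
  wbounded [set z | exists2 h, `|h| <= d & z = e h].
Proof.
move=> qe l; have [C HC] := qe l; exists (`|l (e 0)| + d * `|l e'| + d ^+ 2 * `|C|).
move=> _ [h hd ->]; have d0 : 0 <= d by exact: le_trans hd.
have [->|hn] := eqVneq h 0; first by rewrite -addrA lerDl addr_ge0 ?mulr_ge0// exprn_ge0.
have [|eta [/HC etaC ->]] := @quadr_eq E e e' d h; first by rewrite normr_gt0 hn.
rewrite !cdualD !cdualZ; apply: le_trans (ler_normD _ _) _; apply: lerD.
  by apply: le_trans (ler_normD _ _) _; rewrite lerD2l normrM ler_wpM2r.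
rewrite normrM normrX; apply: ler_pM => //; first by rewrite lerXn2r.
exact: le_trans etaC (ler_norm _).
Qed.

Lemma quadr_slopes E (e : R -> E) e' d : quadr e e' d ->
  wbounded [set z | exists h, 0 < `|h| <= d /\ z = h^-1 *: (e h - e 0)].
Proof.
move=> qe l; have [C HC] := qe l; exists (`|l e'| + d * `|C|) => _ [h [hd ->]].
have d0 : 0 <= d by case/andP: hd => _; exact: le_trans.
have hn : h != 0 by rewrite -normr_gt0; case/andP: hd.
have [eta [/HC etaC ->]] := @quadr_eq E e e' d h hd.
have -> : e 0 + h *: e' + h ^+ 2 *: eta - e 0 = h *: (e' + h *: eta).
  by rewrite -[e 0 + _ + _]addrA addrAC subrr add0r scalerDr scalerA expr2.
rewrite scalerA mulVf// scale1r cdualD cdualZ; apply: le_trans (ler_normD _ _) _.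
rewrite lerD2l normrM; apply: ler_pM => //; first by case/andP: hd.
exact: le_trans etaC (ler_norm _).
Qed.

Lemma compact_segment E (B : disk E) (X V : disk_space B) (d : R) :
  compact [set X + h *: V | h in `[- d, d]%classic].
Proof.
apply: continuous_compact; last exact: segment_compact.
apply: continuous_subspaceT => h; apply: cvgD; first exact: cvg_cst.
by apply: cvgZl; exact: cvg_id.
Qed.

Lemma convex_segment E (B : disk E) (X V : disk_space B) (d : R) :
  convex_set ([set X + h *: V | h in `[- d, d]%classic] : set (convex_lmodType (disk_space B))).
Proof.
apply/convex_setP => _ _ t [h hd <-] [k kd <-] /andP[t0 t1].
exists (t * h + (1 - t) * k).
  move: hd kd; rewrite /= !in_itv /= -!ler_norml => hd kd.
  apply: le_trans (ler_normD _ _) _; rewrite !normrM (ger0_norm t0) [`|1 - t|]ger0_norm ?subr_ge0//.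
  have -> : d = t * d + (1 - t) * d by ring.
  by apply: lerD; rewrite ler_wpM2l// subr_ge0.
by rewrite !scalerDr addrACA -scalerDl subrKC scale1r !scalerA -scalerDl.
Qed.

End SecondOrder.

Lemma cinf_open_line (R : realType) (E : tvsType R) (cE : convenient E) (U : set E) (oU : cinf_open U)
  (x w : E) : U x -> exists2 d : R, 0 < d & forall h, `|h| <= d -> U (x + h *: w).
Proof.
move=> Ux; have [B [X XE HB]] := disk_frame cE [:: w] x.
have [_ [V VE V1]] := HB w (mem_head _ _).
rewrite -XE in Ux; have [r r0 rU] := disk_slice_open oU Ux.
exists (r / 2) => [|h hr]; first by rewrite divr_gt0.
have := rU (X + h *: V); rewrite disk_inclD disk_inclZ XE VE; apply.
rewrite addrAC subrr add0r normrZ; apply: le_lt_trans (_ : `|h| < r); first by rewrite ler_piMr.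
by apply: le_lt_trans hr _; rewrite ltr_pdivrMr// ltr_pMr// ltr1n.
Qed.

Section ChainRule.
Context (R : realType) (md : umode) (M : weight_sequence R).
Context (E F : tvsType R) (cE : convenient E) (U : set E) (oU : cinf_open U).
Context (f : E -> F) (D : seq E -> E -> F) (HD : ujets md M U f D).

(** The weak derivatives of a jet family are derivatives in the stronger sense of [quadr]: on the
    compact segment the second derivative along w is bounded, for each functional. *)
Lemma ujets_quadr_line x w s (d : R) : (forall h, `|h| <= d -> U (x + h *: w)) ->
  quadr (fun h => D s (x + h *: w)) (D (w :: s) x) d.
Proof.
move=> dU l; have [B [X XE HB]] := disk_frame cE (w :: s) x.
have [_ [V VE _]] := HB w (mem_head _ _).
have KU y : [set X + h *: V | h in `[- d, d]%classic] y -> U (disk_incl y).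
  move=> [h]; rewrite /= in_itv /= -ler_norml => hd <-.
  by rewrite disk_inclD disk_inclZ XE VE; exact: dU.
have [C C0 HC] := ujets_compactN cE oU HD l (size s).+2 (@compact_segment R E B X V d) KU.
exists C => _ [h [/andP[h0 hd] ->]]; rewrite cdualZ !cdualB cdualZ scale0r addr0.
rewrite normrM normfV (ger0_norm (sqr_ge0 h)) ler_pdivrMl ?exprn_even_gt0 -?normr_gt0//.
rewrite [h ^+ 2 * C]mulrC; have th t : 0 <= t <= 1 -> `|t * h| <= d.
  by move=> /andP[t0 t1]; apply: le_trans hd; rewrite normrM (ger0_norm t0) ler_piMl.
apply: (ujets_taylor2 HD) => t /th thd; first exact: dU.
have := HC (X + (t * h) *: V) [:: w, w & s]; rewrite disk_inclD disk_inclZ XE VE; apply => //.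
  by exists (t * h) => //; rewrite /= in_itv /= -ler_norml.
move=> v; rewrite in_cons => /predU1P[->|vs]; first by have [] := HB w (mem_head _ _).
by have [] := HB v vs.
Qed.

Lemma ujets_quadr x w : U x -> exists2 d : R, 0 < d & forall s,
  quadr (fun h => D s (x + h *: w)) (D (w :: s) x) d.
Proof.
move=> Ux; have [d d0 dU] := cinf_open_line cE oU w Ux.
by exists d => // s; exact: ujets_quadr_line.
Qed.

Context (T : eqType) (e : T -> R -> E) (e' : T -> E).

(* The terms of the Leibniz rule for a product over p at 0. *)
Fixpoint leibniz (p : seq T) : seq (seq E) :=
  if p is i :: p' then (e' i :: [seq e j 0 | j <- p']) :: [seq e i 0 :: q | q <- leibniz p']
  else [::].

(** Chain rule in the base point and Leibniz rule in the directions at once. All values, slopes and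
    remainders of g and of the e i lie in one disk B, so that the estimates take place near g 0 in
    E_B, where the derivatives are bounded. *)
Theorem ujets_chain (l : cdual F) (p : seq T) (g : R -> E) (g' : E) (d : R) : 0 < d ->
  U (g 0) -> quadr g g' d -> (forall i, i \in p -> quadr (e i) (e' i) d) ->
  hasd (fun h => l (D [seq e i h | i <- p] (g h))) 0
    (l (D (g' :: [seq e i 0 | i <- p]) (g 0)) + \sum_(q <- leibniz p) l (D q (g 0))).
Proof.
move=> d0 Ug qg qe.
pose S := [set g 0] `|` ([set g'] `|` [set z | exists h, 0 < `|h| <= d /\ z = h^-1 *: (g h - g 0)])
  `|` [set z | exists h, 0 < `|h| <= d /\ z = (h ^+ 2)^-1 *: (g h - g 0 - h *: g')].
pose Se := [set z | exists2 i, i \in p & ([set z | exists2 h, `|h| <= d & z = e i h] `|` [set e' i]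
  `|` [set z | exists h, 0 < `|h| <= d /\ z = (h ^+ 2)^-1 *: (e i h - e i 0 - h *: e' i)]) z].
have wS : wbounded (S `|` Se).
  apply: wboundedU; last first.
    apply: wbounded_bigU => i /qe qi; apply: wboundedU => //.
    by apply: wboundedU; [exact: quadr_values qi|exact: wbounded1].
  apply: wboundedU => //; apply: wboundedU; first exact: wbounded1.
  by apply: wboundedU; [exact: wbounded1|exact: quadr_slopes qg].
have [B SB] := wbounded_disk cE.1 wS.
have Bg0 : disk_set B (g 0) by apply: SB; left; left; left.
have Bg' : disk_set B g' by apply: SB; left; left; right; left.
have Bsl h : 0 < `|h| <= d -> disk_set B (h^-1 *: (g h - g 0)).
  by move=> hd; apply: SB; left; left; right; right; exists h.
have Bgq z : [set z | exists h, 0 < `|h| <= d /\ z = (h ^+ 2)^-1 *: (g h - g 0 - h *: g')] z -> disk_set B z.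
  by move=> zS; apply: SB; left; right.
have Be i h : i \in p -> `|h| <= d -> disk_set B (e i h).
  by move=> ip hd; apply: SB; right; exists i => //; left; left; exists h.
have Be' i : i \in p -> disk_set B (e' i).
  by move=> ip; apply: SB; right; exists i => //; left; right.
have Beq i z : i \in p ->
    [set z | exists h, 0 < `|h| <= d /\ z = (h ^+ 2)^-1 *: (e i h - e i 0 - h *: e' i)] z -> disk_set B z.
  by move=> ip zS; apply: SB; right; exists i => //; right.
have [X XE _] := disk_lift1 Bg0; rewrite -XE in Ug.
have [d1 d10 [C C0 HC]] := ujets_local cE oU HD l (size p).+2 Ug; rewrite XE in Ug.
pose d2 := Num.min d (d1 / 2).
have d20 : 0 < d2 by rewrite lt_min d0 divr_gt0.
have d2d (h : R) : `|h| <= d2 -> `|h| <= d by rewrite le_min => /andP[].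
have d2p (h : R) : 0 < `|h| <= d2 -> 0 < `|h| <= d by move=> /andP[-> /d2d].
have near (h t : R) : 0 < `|h| <= d2 -> 0 <= t <= 1 ->
    U (g 0 + (t * h) *: (h^-1 *: (g h - g 0))) /\ forall s, in_disk B s -> (size s <= (size p).+2)%N ->
      `|l (D s (g 0 + (t * h) *: (h^-1 *: (g h - g 0))))| <= C.
  move=> hd /andP[t0 t1]; have [V VE V1] := disk_lift1 (Bsl h (d2p _ hd)).
  have := HC (X + (t * h) *: V); rewrite disk_inclD disk_inclZ XE VE; apply.
  rewrite addrAC subrr add0r normrZ; apply: le_lt_trans (_ : `|h| < d1).
    apply: le_trans (ler_piMr _ V1) _ => //.
    by rewrite normrM (ger0_norm t0) ler_piMl.
  case/andP: hd => _; rewrite le_min => /andP[_ h1]; apply: le_lt_trans h1 _.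
  by rewrite ltr_pdivrMr// ltr_pMr// ltr1n.
have gh (h : R) : 0 < `|h| -> g 0 + (1 * h) *: (h^-1 *: (g h - g 0)) = g h.
  by rewrite normr_gt0 => hn; rewrite mul1r scalerA mulfV// scale1r subrKC.
have atg (h : R) : 0 < `|h| <= d2 -> U (g h) /\ forall s, in_disk B s -> (size s <= (size p).+2)%N ->
    `|l (D s (g h))| <= C.
  move=> hd; have := near h 1 hd; rewrite ler01 lexx gh; last by case/andP: hd.
  exact.
(* The directions from p' move with h, those in r are fixed. Expanding e i h = e i 0 + h e' i + h^2
   eta moves one entry from p' to r, as e i 0 or as e' i. *)
have key (p' : seq T) (r : seq E) : (forall i, i \in p' -> i \in p) -> in_disk B r ->
    (size p' + size r <= size p)%N -> exists2 C' : R, 0 <= C' & forall h, 0 < `|h| <= d2 ->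
    `|l (D ([seq e i h | i <- p'] ++ r) (g h)) - l (D ([seq e i 0 | i <- p'] ++ r) (g 0)) -
      h * (l (D (g' :: [seq e i 0 | i <- p'] ++ r) (g 0)) + \sum_(q <- leibniz p') l (D (q ++ r) (g 0)))|
      <= C' * h ^+ 2.
  elim: p' r => [|i p' IH] r p'p rB pr.
    exists (C + C) => [|h hd]; first exact: addr_ge0.
    have h0 : 0 < `|h| by case/andP: hd.
    rewrite /= big_nil addr0; set u := h^-1 *: (g h - g 0).
    have Bu : disk_set B u by exact/Bsl/d2p.
    have T2 : `|l (D r (g h)) - l (D r (g 0)) - h * l (D (u :: r) (g 0))| <= C * h ^+ 2.
      rewrite -{1}(gh h h0) mul1r; apply: (ujets_taylor2 HD) => t t01; have [Ut Ct] := near h t hd t01 => //.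
      apply: Ct; last by rewrite /= !ltnS.
      by move=> v; rewrite !in_cons => /predU1P[->//|/predU1P[->//|/rB]].
    have [eta [etaS gE]] := @quadr_eq R E g g' d h (d2p _ hd).
    have uE : u = g' + h *: eta.
      rewrite /u gE -[g 0 + _ + _]addrA addrAC subrr add0r expr2 -scalerA -scalerDr scalerA mulVf ?scale1r//.
      by rewrite -normr_gt0.
    have lu : l (D (u :: r) (g 0)) = l (D (g' :: r) (g 0)) + h * l (D (eta :: r) (g 0)).
      by rewrite uE (ujets_headD cE oU HD)// (ujets_headZ HD).
    have Ceta : `|l (D (eta :: r) (g 0))| <= C.
      have := near h 0 hd; rewrite lexx ler01 mul0r scale0r addr0 => -[//|_]; apply.
        by move=> v; rewrite in_cons => /predU1P[->|/rB//]; exact: Bgq.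
      by rewrite /= ltnS; apply: leq_trans (leqnSn _); exact: pr.
    move: T2; rewrite lu; set a := l _; set b := l _; set c := l _; move: Ceta; set k := l _ => Ceta T2.
    have -> : a - b - h * c = (a - b - h * (c + h * k)) + h ^+ 2 * k by ring.
    rewrite mulrDl; apply: le_trans (ler_normD _ _) _; apply: lerD => //.
    by rewrite normrM (ger0_norm (sqr_ge0 h)) mulrC ler_wpM2r// sqr_ge0.
  have ip : i \in p by apply: p'p; exact: mem_head.
  have p'p' j : j \in p' -> j \in p by move=> jp; apply: p'p; rewrite in_cons jp orbT.
  have z0 : `|0 : R| <= d by rewrite normr0 ltW.
  have rB0 : in_disk B (e i 0 :: r) by move=> v; rewrite in_cons => /predU1P[->|/rB//]; exact: Be.
  have rB1 : in_disk B (e' i :: r) by move=> v; rewrite in_cons => /predU1P[->|/rB//]; exact: Be'.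
  have sz a : (size p' + size (a :: r : seq E) <= size p)%N by rewrite /= addnS.
  have [C1 C10 H1] := IH (e i 0 :: r) p'p' rB0 (sz _).
  have [C2 C20 H2] := IH (e' i :: r) p'p' rB1 (sz _).
  (* This term already carries a factor h, so it only has to vary by O(h); the induction hypothesis
     gives that. *)
  have [A A0 HA] : exists2 A : R, 0 <= A & forall h, 0 < `|h| <= d2 ->
     `|l (D ([seq e i h | i <- p'] ++ e' i :: r) (g h)) - l (D ([seq e i 0 | i <- p'] ++ e' i :: r) (g 0))| <= A * `|h|.
    set K := _ + _ in H2; exists (`|K| + C2 * d2) => [|h hd].
      by rewrite addr_ge0// mulr_ge0// ltW.
    have := H2 h hd; set a := l _; set b := l _ => H.
    have -> : a - b = (a - b - h * K) + h * K by ring.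
    apply: le_trans (ler_normD _ _) _; rewrite normrM addrC mulrDl [`|h| * _]mulrC lerD2l.
    apply: le_trans H _; rewrite -real_normK ?num_real// expr2 mulrA ler_wpM2r//.
    by rewrite ler_wpM2l//; case/andP: hd.
  exists (C1 + A + C) => [|h hd]; first by rewrite !addr_ge0.
  have [Uh Ch] := atg h hd; have h0 : 0 < `|h| by case/andP: hd.
  have [eta [etaS eE]] := @quadr_eq R E (e i) (e' i) d h (d2p _ hd).
  set ph := [seq e j h | j <- p']; set p0 := [seq e j 0 | j <- p'].
  have perm1 a (q : seq E) y : U y -> l (D (q ++ a :: r) y) = l (D (a :: q ++ r) y).
    move=> Uy; apply: (ujets_perm cE oU HD) => //.
    by rewrite -cat1s -cat_cons -[a :: q]cat1s perm_catCA catA perm_cat2r.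
  have E1 : l (D (e i h :: ph ++ r) (g h)) = l (D (ph ++ e i 0 :: r) (g h)) +
      h * l (D (ph ++ e' i :: r) (g h)) + h ^+ 2 * l (D (eta :: ph ++ r) (g h)).
    by rewrite eE !(ujets_headD cE oU HD)// !(ujets_headZ HD)// !perm1.
  have E3 : `|l (D (eta :: ph ++ r) (g h))| <= C.
    apply: Ch; last by rewrite /= size_cat size_map !ltnS; apply: leq_trans (leqnSn _); exact: leq_trans (leqnSn _) pr.
    move=> v; rewrite in_cons mem_cat => /predU1P[->|/orP[/mapP[j jp ->]|/rB//]].
      exact: Beq ip etaS.
    by apply: Be; [exact: p'p'|case/andP: hd => _ /d2d].
  have E2 : \sum_(q <- leibniz (i :: p')) l (D (q ++ r) (g 0)) =
      l (D (p0 ++ e' i :: r) (g 0)) + \sum_(q <- leibniz p') l (D (q ++ e i 0 :: r) (g 0)).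
    rewrite /= big_cons big_map perm1//; congr (_ + _); apply: eq_bigr => q _.
    by rewrite perm1.
  have E4 : l (D (g' :: (e i 0 :: p0) ++ r) (g 0)) = l (D (g' :: p0 ++ e i 0 :: r) (g 0)).
    apply: (ujets_cons_congr1 cE oU HD) => // y Uy; by rewrite perm1.
  have := H1 h hd; have := HA h hd; rewrite -/ph -/p0 [LHS in LHS - _]/= E2.
  rewrite /= E1 E4 -(perm1 (e i 0) p0)//; move: E3.
  set a1 := l _; set a2 := l _; set a3 := l _; set a4 := l _; set a5 := l _; set a6 := l _.
  set s1 := \sum_(_ <- _) _ => T3 T2 T1.
  have -> : a4 + h * a2 + h ^+ 2 * a1 - a5 - h * (a6 + (a3 + s1)) =
     (a4 - a5 - h * (a6 + s1)) + h * (a2 - a3) + h ^+ 2 * a1 by ring.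
  rewrite !mulrDl; apply: le_trans (ler_normD _ _) _; apply: lerD; last first.
    by rewrite normrM (ger0_norm (sqr_ge0 h)) mulrC ler_wpM2r// sqr_ge0.
  apply: le_trans (ler_normD _ _) _; apply: lerD => //.
  by rewrite normrM -[h ^+ 2]real_normK ?num_real// expr2 mulrCA ler_wpM2l.
have [|||C' C'0 H] := key p [::] => //; first by rewrite addn0.
apply: (@hasd_quad _ _ _ _ d2 C') => // h hd; rewrite add0r.
have [->|hn] := eqVneq h 0; first by rewrite subrr mul0r subr0 normr0 mulr_ge0// sqr_ge0.
have := H h; rewrite normr_gt0 hn hd !cats0 => /(_ isT).
by under [X in h * (_ + X)]eq_bigr do rewrite cats0.
Qed.

End ChainRule.
Section CompactImage.
Context (R : realType) (md : umode) (M : weight_sequence R).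
Context (E F : tvsType R) (cE : convenient E) (U : set E) (oU : cinf_open U).
Context (f : E -> F) (D : seq E -> E -> F) (HD : ujets md M U f D) (B : disk E).

Lemma disk_slopes (y y' : disk_space B) : y != y' ->
  disk_set B ((2 * `|y' - y|)^-1 *: disk_incl (y' - y)).
Proof.
move=> yy; have d0 : 0 < `|y' - y| by rewrite normr_gt0 subr_eq0 eq_sym.
have d2 : `|y' - y| < 2 * `|y' - y| by rewrite ltr_pMl// ltr1n.
have [e|//] := disk_norm_lt d2.
by move: yy; rewrite eq_sym -subr_eq0 => /eqP; case; exact: disk_incl_inj.
Qed.

Lemma ujets_slopes (K : set (disk_space B)) s : compact K ->
  convex_set (K : set (convex_lmodType (disk_space B))) -> (forall y, K y -> U (disk_incl y)) ->
  in_disk B s ->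
  wbounded [set z | exists y y', [/\ K y, K y', y != y' &
    z = `|y' - y|^-1 *: (D s (disk_incl y') - D s (disk_incl y))]].
Proof.
move=> cK /convex_setP vK KU sB l; have [C C0 HC] := ujets_compactN cE oU HD l (size s).+1 cK KU.
exists (C * 2) => _ [y [y' [Ky Ky' yy ->]]].
have d0 : 0 < `|y' - y| by rewrite normr_gt0 subr_eq0 eq_sym.
have d20 : 0 < 2 * `|y' - y| by rewrite mulr_gt0.
rewrite cdualZ cdualB normrM normfV normr_id ler_pdivrMl//.
set w := (2 * `|y' - y|)^-1 *: disk_incl (y' - y).
have yE : disk_incl y' = disk_incl y + (2 * `|y' - y|) *: w.
  by rewrite scalerA mulfV ?gt_eqF// scale1r disk_inclB subrKC.
have -> : `|y' - y| * (C * 2) = C * `|2 * `|y' - y| | by rewrite (gtr0_norm d20); ring.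
rewrite yE.
have seg t : 0 <= t <= 1 -> exists2 z, K z & disk_incl y + (t * (2 * `|y' - y|)) *: w = disk_incl z.
  move=> t01; exists (t *: y' + (1 - t) *: y); first exact: vK.
  rewrite scalerA mulfK ?gt_eqF// disk_inclB disk_inclD !disk_inclZ.
  by rewrite scalerBr scalerBl scale1r addrCA [disk_incl y - _]addrC.
apply: (ujets_taylor1 HD) => t /seg[z Kz ->]; first exact: KU.
by apply: HC => // v; rewrite in_cons => /predU1P[->|/sB//]; exact: disk_slopes.
Qed.

(** If B' contains the slopes of the map on K, then the map is 1-Lipschitz from K to E_B', and its
    image is compact there. *)
Lemma ujets_image (K : set (disk_space B)) (B' : disk F) : compact K ->
  [set z | exists y y', [/\ K y, K y', y != y' &
    z = `|y' - y|^-1 *: (D [::] (disk_incl y') - D [::] (disk_incl y))]] `<=` B' ->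
  [set z | exists2 y, K y & z = D [::] (disk_incl y)] `<=` B' ->
  exists2 K' : set (disk_space B'), compact K' & (forall y, K y -> exists2 z, K' z & disk_incl z = D [::] (disk_incl y))
    /\ forall z, K' z -> exists2 y, K y & disk_incl z = D [::] (disk_incl y).
Proof.
move=> cK SB VB; have lift y : exists z : disk_space B', K y -> disk_incl z = D [::] (disk_incl y).
  have [Ky|nK] := pselect (K y); last by exists 0.
  by have [|z zE _] := @disk_lift1 _ _ B' (D [::] (disk_incl y)); [apply: VB; exists y|exists z].
pose G y := projT1 (cid (lift y)).
have GE y : K y -> disk_incl (G y) = D [::] (disk_incl y) := projT2 (cid (lift y)).
have Glip y y' : K y -> K y' -> `|G y' - G y| <= `|y' - y|.
  move=> Ky Ky'; have [->|yy] := eqVneq y y'; first by rewrite !subrr normr0.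
  have d0 : 0 < `|y' - y| by rewrite normr_gt0 subr_eq0 eq_sym.
  have [|z zE z1] := @disk_lift _ _ B' `|y' - y| (D [::] (disk_incl y') - D [::] (disk_incl y)) d0.
    by apply: SB; exists y, y'.
  by rewrite (_ : G y' - G y = z)//; apply: disk_incl_inj; rewrite disk_inclB !GE.
exists (G @` K); last first.
  split=> [y Ky|_ [y Ky <-]]; last by exists y => //; exact: GE.
  by exists (G y); [exists y|exact: GE].
apply: continuous_compact => //; apply/subspace_continuousP => y Ky.
apply/cvgrPdist_lt => e e0; rewrite near_withinE; apply/nbhs_ballP; exists e => //= y'.
rewrite -ball_normE /= => yy' Ky'; apply: le_lt_trans yy'; exact: Glip.
Qed.

End CompactImage.

Section Composition.
Context (R : realType) (md : umode) (M : weight_sequence R) (lcM : log_convex M).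
Context (E0 E F : tvsType R) (cE0 : convenient E0) (cE : convenient E).
Context (W : set E0) (U : set E) (oW : cinf_open W) (oU : cinf_open U).
Context (g : E0 -> E) (Dg : seq E0 -> E0 -> E) (Hg : ujets md M W g Dg).
Context (f : E -> F) (Df : seq E -> E -> F) (Hf : ujets md M U f Df).
Hypothesis WU : forall x, W x -> U (g x).

(* Faa di Bruno's formula. *)
Definition comp_jet s x := \sum_(p <- partitions s) Df [seq Dg b x | b <- p] (Dg [::] x).

Lemma leibniz_adjoin w x p :
  leibniz (fun b h => Dg b (x + h *: w)) (fun b => Dg (w :: b) x) p =
  [seq [seq Dg b x | b <- q] | q <- adjoin w p].
Proof.
elim: p => [//|b p IH] /=; by rewrite IH -!map_comp scale0r addr0.
Qed.

Let WUg x : W x -> U (Dg [::] x).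
Proof. by move=> Wx; have [-> // _ _] := Hg; exact: WU. Qed.

(** Differentiating the summand of a partition p along w yields the partitions of w :: s that extend
    p: the moving base point creates the block [:: w], and the Leibniz terms put w into the blocks
    of p. *)
Lemma comp_jet_hasd (l : cdual F) s x w : W x ->
  hasd (fun h => l (comp_jet s (x + h *: w))) 0 (l (comp_jet (w :: s) x)).
Proof.
move=> Wx; have [d d0 qd] := ujets_quadr cE0 oW Hg w Wx.
rewrite /comp_jet /= big_flatten big_map (_ : (fun _ => _) = fun h =>
    \sum_(p <- partitions s) l (Df [seq Dg b (x + h *: w) | b <- p] (Dg [::] (x + h *: w)))); last first.
  by apply/funext => h; rewrite linear_sum.
rewrite linear_sum; apply: hasd_sum => p _.
have Ux : U (Dg [::] (x + 0 *: w)) by rewrite scale0r addr0; exact: WUg.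
by have := ujets_chain cE oU Hf l d0 Ux (qd [::]) (fun b (_ : b \in p) => qd b);
  rewrite leibniz_adjoin big_map scale0r addr0 big_cons linearD linear_sum.
Qed.

(** The order of choices matters. The weight r' comes from r alone; the derivatives of g, scaled by
    r', and the image of K determine a disk B' and a compact set K'; only then is the rate x of f on
    K' with directions in B' known. [composition_weight] provides an r' that serves for every such
    x. *)
Lemma comp_jet_bound r (B : disk E0) (K : set (disk_space B)) : test_weight md r -> compact K ->
  convex_set (K : set (convex_lmodType (disk_space B))) ->
  (forall y, K y -> W (disk_incl y)) ->
  wbounded [set z : F | exists y s, [/\ K y, in_disk B s &
    z = (r (size s) / factM M (size s)) *: comp_jet s (disk_incl y)]].
Proof.
move=> tr cK vK KW l.
have [r' [tr' r'0 Hr']] := composition_weight tr (ltW (weight_gt0 M 1%N)).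
have wK : wbounded [set z | exists2 y, K y & z = Dg [::] (disk_incl y)].
  move=> k; have [C C0 HC] := ujets_compactN cE0 oW Hg k 0 cK KW.
  by exists C => _ [y Ky ->]; apply: HC.
have [_ _ Hb] := Hg.
have [B' SB] := wbounded_disk cE.1 (wboundedU (Hb r' B K tr' cK vK KW)
  (wboundedU (ujets_slopes cE0 oW Hg (s := [::]) cK vK KW (fun _ _ => ltac:(done))) wK)).
have [K' cK' [K'g K'i]] := @ujets_image _ _ _ Dg B K B' cK (fun z Sz => SB z (or_intror (or_introl Sz)))
   (fun z Sz => SB z (or_intror (or_intror Sz))).
have K'U z : K' z -> U (disk_incl z).
  by move=> /K'i[y Ky ->]; exact/WUg/KW.
pose A k a := exists z s, [/\ K' z, in_disk B' s, size s = k & a = `|l (Df s (disk_incl z))| / factM M k].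
have A0 k a : A k a -> 0 <= a.
  by move=> [z [s [_ _ _ ->]]]; rewrite divr_ge0// ltW// factM_gt0.
have bA : mode_bounded md A.
  apply: test_mode_bounded => // t tt; have [C HC] := ujets_compact cE oU Hf l tt cK' K'U.
  exists C => k _ [z [s [K'z sB <- ->]]]; have := HC z s K'z sB.
  by rewrite mulrAC -mulrA.
have [x [x0 [C1' HC1] [C2 HC2]]] := Hr' A bA; pose C1 := `|C1'|.
have {}HC1 k a : A k a -> a <= C1 * x ^+ k.
  by move=> /HC1/le_trans; apply; rewrite ler_wpM2r ?exprn_ge0// ler_norm.
have C20 : 0 <= C2.
  have := HC2 [::]; rewrite big_nil mulr1 /= expr0 mulr1; apply: le_trans; exact: tr.1.
exists (C1 * C2) => _ [y [s [Ky sB ->]]].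
rewrite cdualZ normrM ger0_norm; last by rewrite divr_ge0 ?tr.1// ltW// factM_gt0.
set n := size s; set c := M 1%N in HC2.
have c0 : 0 <= c by exact/ltW/weight_gt0.
have q0 : 0 < (2 + c * x) ^+ n by rewrite exprn_gt0// ltr_wpDr// mulr_ge0.
have [z K'z zE] := K'g y Ky.
have term p : p \in partitions s ->
    r n * (2 + c * x) ^+ n * `|l (Df [seq Dg b (disk_incl y) | b <- p] (Dg [::] (disk_incl y)))| <=
    C1 * C2 * M n * ((c * x) ^+ size p * partition_weight R p).
  move=> /(partitions_good lcM)[sp zp Mp pin].
  (* Each direction Dg b is the multiple [k b] of the vector [b' b], which lies in B';
     multilinearity pulls these scalars out of Df. *)
  pose b' (b : seq E0) := (r' (size b) / factM M (size b)) *: Dg b (disk_incl y).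
  pose k (b : seq E0) := factM M (size b) / r' (size b).
  have k0 b : 0 <= k b by rewrite divr_ge0// ltW// factM_gt0.
  have -> : [seq Dg b (disk_incl y) | b <- p] = [seq q.1 *: q.2 | q <- [seq (k b, b' b) | b <- p]].
    rewrite -map_comp; apply: eq_map => b /=; rewrite /k /b' scalerA mulrA divfK ?gt_eqF//.
    by rewrite mulfV ?scale1r// gt_eqF// factM_gt0.
  rewrite (ujets_scale cE oU Hf); last exact/WUg/KW.
  rewrite big_map /= -map_comp normrM ger0_norm; last exact: prodr_ge0.
  have := HC1 (size p) (`|l (Df [seq b' b | b <- p] (disk_incl z))| / factM M (size p)).
  rewrite ler_pdivrMr ?factM_gt0// zE => H.
  have {}H : `|l (Df [seq b' b | b <- p] (Dg [::] (disk_incl y)))| <= C1 * x ^+ size p * factM M (size p).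
    apply: H; exists z, [seq b' b | b <- p]; rewrite size_map zE; split=> // v /mapP[b bp ->].
    apply: SB; left; exists y, b; split=> // u ub; exact/sB/(pin b).
  have Pr : 0 < \prod_(b <- p) r' (size b) by apply: prodr_gt0.
  have -> : \prod_(b <- p) k b = (\prod_(b <- p) factM M (size b)) / \prod_(b <- p) r' (size b).
    by rewrite -prodfV -big_split.
  have Hp : r n * (2 + c * x) ^+ n / \prod_(b <- p) r' (size b) <= C2.
    rewrite ler_pdivrMr//; have := HC2 [seq size b | b <- p]; rewrite sp big_map; exact.
  have fM0 : 0 <= \prod_(b <- p) factM M (size b) by apply: prodr_ge0 => b _; exact/ltW/factM_gt0.
  set L := `|_| in H *; set P := \prod_(b <- p) _ in fM0 *; set Q := \prod_(b <- p) _ in Hp *.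
  have -> : r n * (2 + c * x) ^+ n * (P / Q * L) = (r n * (2 + c * x) ^+ n / Q) * (P * L) by ring.
  have PL0 : 0 <= P * L by rewrite mulr_ge0 ?normr_ge0.
  apply: le_trans (ler_wpM2r PL0 Hp) _.
  have -> : C1 * C2 * M n * ((c * x) ^+ size p * partition_weight R p) =
    C2 * (C1 * x ^+ size p * (partition_weight R p * (c ^+ size p * M n))) by rewrite exprMn; ring.
  apply: ler_wpM2l => //; apply: le_trans (ler_wpM2l fM0 H) _.
  have PE : P * factM M (size p) = partition_weight R p * (M (size p) * \prod_(b <- p) M (size b)).
    by rewrite /P /factM big_split /partition_weight /=; ring.
  have -> : P * (C1 * x ^+ size p * factM M (size p)) = C1 * x ^+ size p * (P * factM M (size p)) by ring.
  rewrite PE; apply: ler_wpM2l; first exact: mulr_ge0 (normr_ge0 _) (exprn_ge0 _ x0).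
  apply: ler_wpM2l => //; apply: mulr_ge0; [exact: ler0n|apply: prodr_ge0 => b _; exact: ler0n].
rewrite -(ler_pM2l q0) -(ler_pM2l (factM_gt0 M n)).
have -> : factM M n * ((2 + c * x) ^+ n * (r n / factM M n * `|l (comp_jet s (disk_incl y))|)) =
  r n * (2 + c * x) ^+ n * `|l (comp_jet s (disk_incl y))|.
  by field; rewrite gt_eqF// factM_gt0.
apply: (@le_trans _ _ (\sum_(p <- partitions s) r n * (2 + c * x) ^+ n *
    `|l (Df [seq Dg b (disk_incl y) | b <- p] (Dg [::] (disk_incl y)))|)).
  rewrite -mulr_sumr; apply: ler_wpM2l; first by rewrite mulr_ge0 ?tr.1// ltW.
  by rewrite linear_sum; exact: ler_norm_sum.
apply: (@le_trans _ _ (\sum_(p <- partitions s) C1 * C2 * M n * ((c * x) ^+ size p * partition_weight R p))).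
  by rewrite !big_seq; apply: ler_sum => p /term.
rewrite -mulr_sumr; apply: le_trans (ler_wpM2l _ (partitions_sum lcM s (mulr_ge0 c0 x0))) _.
  exact: mulr_ge0 (mulr_ge0 (normr_ge0 _) C20) (ltW (weight_gt0 M n)).
by rewrite le_eqVlt; apply/orP; left; apply/eqP; rewrite /factM -/n; ring.
Qed.

Theorem ujets_comp : ujets md M W (f \o g) comp_jet.
Proof.
split; [|exact: comp_jet_hasd|exact: comp_jet_bound] => x Wx.
have [Dg0 _ _] := Hg; have [Df0 _ _] := Hf.
by rewrite /comp_jet big_seq1 /= Df0 ?Dg0//; exact: WU.
Qed.

End Composition.

Theorem ultra_on_comp (R : realType) (md : umode) (M : weight_sequence R) (E0 E F : tvsType R)
  (W : set E0) (U : set E) (g : E0 -> E) (f : E -> F) : log_convex M ->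
  convenient E0 -> convenient E -> cinf_open W -> cinf_open U -> (forall x, W x -> U (g x)) ->
  ultra_on md M W g -> ultra_on md M U f -> ultra_on md M W (f \o g).
Proof.
move=> lcM cE0 cE oW oU WU [Dg Hg] [Df Hf]; exists (comp_jet Dg Df).
exact: (ujets_comp lcM cE0 cE oW oU Hg Hf WU).
Qed.
(** * Jet families characterize C^[M] *)

Section Codom.
Context (T : Type).

Lemma codom_ordS n (v : 'I_n.+1 -> T) : codom v = v ord0 :: codom (fun i => v (lift ord0 i)).
Proof. by rewrite !codomE enum_ordSl /= -map_comp. Qed.

Lemma codom_ord0 (v : 'I_0 -> T) : codom v = [::].
Proof. by apply: size0nil; rewrite size_codom card_ord. Qed.

Lemma codom_split j k (a : 'I_j -> T) (b : 'I_k -> T) :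
  codom (fun i : 'I_(j + k) => match fintype.split i with inl p => a p | inr q => b q end) =
  codom a ++ codom b.
Proof.
elim: j a => [|j IH] a.
  rewrite codom_ord0; apply: eq_codom => i; case: splitP => [[]//|q iq].
  by congr b; exact/val_inj.
rewrite !codom_ordS /= -IH; congr (_ :: _).
  by case: splitP => [p p0|q //]; congr a; exact/val_inj.
apply: eq_codom => i; case: splitP => [p /= ip|q /= iq]; case: splitP => [p' /= ip'|q' /= iq'].
- by congr a; apply/val_inj; rewrite /= -ip ip'.
- by move: (ltn_ord p); rewrite -ip /bump /= iq'; lia.
- by move: (ltn_ord p') iq; rewrite /bump /= ip'; lia.
- by congr b; apply/val_inj => /=; move: iq; rewrite /bump /= iq'; lia.
Qed.

Lemma codom_cst n (a : T) : codom (fun _ : 'I_n => a) = nseq n a.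
Proof. by elim: n => [|n IH]; [exact: codom_ord0|rewrite codom_ordS IH]. Qed.

End Codom.

Lemma codom_perm (T : eqType) n (v : 'I_n -> T) (s : 'S_n) : perm_eq (codom (v \o s)) (codom v).
Proof.
rewrite !codomE map_comp; apply: perm_map; apply: uniq_perm; rewrite ?enum_uniq//.
  by rewrite map_inj_uniq ?enum_uniq//; exact: perm_inj.
by move=> i; rewrite mem_enum; apply/mapP; exists ((s^-1)%g i); rewrite ?mem_enum// permKV.
Qed.

Section DiskVectors.
Context (R : realType) (E : tvsType R) (B : disk E).

(* Only for B empty is the origin of E_B outside of B. *)
Definition in_ball (s : seq E) := forall v, v \in s -> v = 0 \/ disk_set B v.

(** B is closed: if a nonzero y with |y| <= 1 were outside of B, then so would be c y for some c < 1
    close to 1, although [disk_norm_lt] puts c y into B. *)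
Lemma disk_ball (y : disk_space B) : `|y| <= 1 -> disk_incl y = 0 \/ disk_set B (disk_incl y).
Proof.
move=> y1; apply: contrapT => /not_orP[y0 nB].
have : nbhs (disk_incl y) (~` B) by apply: open_nbhs_nbhs; split=> //; exact/closed_openC/disk_closed.
rewrite -{1}[disk_incl y]scale1r => /(@scale_continuous R E (1, disk_incl y)).
move=> -[[A C] /= [/nbhs_ballP[d d0 dA] Cy] ACB].
pose c := (1 + d / 2)^-1 : R.
have d20 : 0 < d / 2 by rewrite divr_gt0.
have c0 : 0 < 1 + d / 2 by rewrite ltr_wpDl.
have yd : `|y| < 1 + d / 2 by rewrite (le_lt_trans y1)// ltrDl.
have [//|By] := disk_norm_lt yd.
have : (~` B) (c *: disk_incl y).
  apply: (ACB (c, disk_incl y)); split => /=; last exact: nbhs_singleton.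
  apply: dA; rewrite -ball_normE /=.
  have -> : 1 - c = (d / 2) / (1 + d / 2) by rewrite /c -{1}(mulfV (lt0r_neq0 c0)) -[X in _ - X]mul1r -mulrBl addrAC subrr add0r.
  rewrite ger0_norm ?divr_ge0 ?ltW// ltr_pdivrMr// mulrDr mulr1.
  by apply: ltr_wpDr; [rewrite mulr_ge0// ltW|rewrite ltr_pdivrMr// ltr_pMr// ltr1n].
exact.
Qed.

Definition dirs k (v : 'I_k -> disk_space B) : seq E := codom (fun i => disk_incl (v i)).

Lemma dirs_cons k (h : disk_space B) (v : 'I_k -> disk_space B) :
  dirs (cons_vec h v) = disk_incl h :: dirs v.
Proof.
rewrite /dirs codom_ordS {1}/cons_vec unlift_none; congr (_ :: _).
by apply: eq_codom => i; rewrite /cons_vec liftK.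
Qed.

Lemma size_dirs k (v : 'I_k -> disk_space B) : size (dirs v) = k.
Proof. by rewrite size_codom card_ord. Qed.

Lemma dirs_in k (v : 'I_k -> disk_space B) : (forall i, `|v i| <= 1) -> in_ball (dirs v).
Proof. by move=> v1 _ /codomP[i ->]; exact: disk_ball. Qed.

Lemma dirs_set_coord k (v : 'I_k -> disk_space B) i x : perm_eq (dirs (set_coord v i x))
  (disk_incl x :: [seq disk_incl (v j) | j <- rem i (enum 'I_k)]).
Proof.
rewrite /dirs codomE; have iI : i \in enum 'I_k by rewrite mem_enum.
apply: perm_trans (perm_map _ (perm_to_rem iI)) _ => /=.
rewrite {1}/set_coord eqxx perm_cons (_ : map _ _ = [seq disk_incl (v j) | j <- rem i (enum 'I_k)])//.
apply/eq_in_map => j; rewrite mem_rem_uniq ?enum_uniq// inE => /andP[/negbTE ji _].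
by rewrite /set_coord ji.
Qed.

Lemma dirs_lift (s : seq E) : in_disk B s -> exists v : 'I_(size s) -> disk_space B,
  (forall i, `|v i| <= 1) /\ dirs v = s.
Proof.
elim: s => [|a s IH] sB.
  by exists (fun=> 0); split=> [i|]; [rewrite normr0|exact: codom_ord0].
have [v [v1 vs]] := IH (fun u us => sB u (@mem_behead _ (a :: s) u us)).
have [X XE X1] := disk_lift1 (sB a (mem_head _ _)).
exists (cons_vec X v); split; last by rewrite dirs_cons XE vs.
by move=> i; rewrite /cons_vec; case: unlift.
Qed.

End DiskVectors.

Lemma opnorm_le (R : realType) (V : normedModType R) k (T : ('I_k -> V) -> R^o) (C : R) : 0 <= C ->
  (forall v, (forall i, `|v i| <= 1) -> `|T v| <= C) -> (opnorm T <= C%:E)%E.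
Proof. by move=> C0 H; apply: nnsup_le => // _ [v v1 <-]; rewrite lee_fin; exact: H. Qed.

Section ScalarJets.
Context (R : realType) (md : umode) (M : weight_sequence R).
Context (E F : tvsType R) (cE : convenient E) (U : set E) (oU : cinf_open U).
Context (f : E -> F) (D : seq E -> E -> F) (HD : ujets md M U f D).
Context (l : cdual F) (B : disk E).

Definition scalar_jet (K : set (disk_space B)) : jets K R^o :=
  fun s => l (D (dirs (projT2 s).2) (disk_incl (val (projT2 s).1))).

Arguments scalar_jet : clear implicits.

Lemma scalar_jetE (K : set (disk_space B)) k (x : K) (v : 'I_k -> disk_space B) :
  jet_coef (scalar_jet K) x v = l (D (dirs v) (disk_incl (val x))).
Proof. by []. Qed.

Lemma ujets_powers x n a w s : U x ->
  l (D (nseq n (a *: w) ++ s) x) = a ^+ n * l (D (nseq n w ++ s) x).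
Proof.
elim: n x => [|n IH] x Ux; first by rewrite expr0 mul1r.
by rewrite /= (ujets_headZ HD)// (ujets_cons_congr cE oU HD _ IH)// mulrA -exprS.
Qed.

(** A zero direction makes the derivative vanish, so that bounds for directions in B extend to those
    of [in_ball]. *)
Lemma ujets_in_ball x s C : U x -> 0 <= C -> in_ball B s ->
  (forall s', size s' = size s -> in_disk B s' -> `|l (D s' x)| <= C) -> `|l (D s x)| <= C.
Proof.
move=> Ux C0 sB HC; have [s0|ns0] := boolP (0 \in s); last first.
  apply: HC => // v vs; have [v0|//] := sB v vs.
  by move: ns0; rewrite -v0 vs.
rewrite (ujets_perm cE oU HD _ (perm_to_rem s0))// -[X in D (X :: _)](scale0r 0).
by rewrite (ujets_headZ HD)// mul0r normr0.
Qed.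

Lemma scalar_jet_multilinear (K : set (disk_space B)) k (x : K) : U (disk_incl (val x)) ->
  bounded_sym_multilinear (@jet_coef _ _ _ _ (scalar_jet K) k x).
Proof.
move=> Ux; split.
- move=> v i a y z; rewrite !scalar_jetE !(ujets_perm cE oU HD _ (dirs_set_coord _ _ _) Ux).
  by rewrite disk_inclD disk_inclZ (ujets_headD cE oU HD)// (ujets_headZ HD).
- move=> v s; rewrite !scalar_jetE; apply: (ujets_perm cE oU HD) => //.
  exact: (codom_perm (fun i => disk_incl (v i)) s).
have [d d0 [C C0 HC]] := ujets_local cE oU HD l k Ux.
apply: le_lt_trans (ltry C); apply: opnorm_le => // v v1; rewrite scalar_jetE.
have [|_] := HC (val x); first by rewrite subrr normr0.
move=> H; apply: (ujets_in_ball Ux C0 (dirs_in v1)) => s' ss' sB.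
by apply: H; rewrite // ss' size_dirs.
Qed.

Lemma disk_unit (w : disk_space B) : exists2 u : disk_space B, `|u| <= 1 & w = `|w| *: u.
Proof.
have [->|w0] := eqVneq w 0; first by exists 0; rewrite ?normr0 ?scaler0.
exists (`|w|^-1 *: w); last by rewrite scalerA mulfV ?normr_eq0// scale1r.
by rewrite normrZ normfV normr_id mulVf ?normr_eq0.
Qed.

Lemma ujets_local_taylor N (x : disk_space B) : U (disk_incl x) ->
  exists2 d : R, 0 < d & exists2 C : R, 0 <= C & forall (y : disk_space B), `|y - x| < d ->
    forall s, in_ball B s -> (size s <= N)%N ->
    `|l (D s (disk_incl y)) - l (D s (disk_incl x))| <= C * `|y - x| /\
    `|l (D s (disk_incl y)) - l (D s (disk_incl x)) - l (D (disk_incl (y - x) :: s) (disk_incl x))|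
      <= C * `|y - x| ^+ 2.
Proof.
move=> Ux; have [d d0 [C C0 HC]] := ujets_local cE oU HD l N.+2 Ux.
exists d => //; exists C => // y yd s sB sN; have [u u1 uE] := disk_unit (y - x).
have yE : disk_incl y = disk_incl x + `|y - x| *: disk_incl u.
  by rewrite -disk_inclZ -uE disk_inclB subrKC.
have seg (t : R) : 0 <= t <= 1 -> U (disk_incl x + (t * `|y - x|) *: disk_incl u) /\
    forall s, in_ball B s -> (size s <= N.+2)%N ->
      `|l (D s (disk_incl x + (t * `|y - x|) *: disk_incl u))| <= C.
  move=> /andP[t0 t1]; have := HC (x + (t * `|y - x|) *: u); rewrite disk_inclD disk_inclZ => -[|Ut HCt].
    rewrite addrAC subrr add0r normrZ; apply: le_lt_trans yd; rewrite normrM normr_id (ger0_norm t0).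
    by rewrite -[leRHS]mulr1 -mulrA mulrCA; apply: ler_wpM2l => //; rewrite mulr_ile1.
  split=> // s' sB' sN'; apply: (ujets_in_ball Ut C0 sB') => s'' ss' sB''.
  by apply: HCt; rewrite // ss'.
have uB : disk_incl u = 0 \/ disk_set B (disk_incl u) by exact: disk_ball.
split.
  rewrite yE -[X in _ <= _ * X]normr_id; apply: (ujets_taylor1 HD) => t /seg[Ut HCt] //.
  apply: HCt; last exact: leq_trans sN _.
  by move=> v; rewrite in_cons => /predU1P[->|/sB].
rewrite [in X in D (X :: s)]uE disk_inclZ (ujets_headZ HD)// [in X in D s X]yE.
apply: (ujets_taylor2 HD) => t /seg[Ut HCt] //.
apply: HCt; last by rewrite /= !ltnS.
by move=> v; rewrite !in_cons => /predU1P[->//|/predU1P[->//|/sB]].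
Qed.

Lemma scalar_jet_continuous (K : set (disk_space B)) : (forall x, K x -> U (disk_incl x)) -> continuous_jet (scalar_jet K).
Proof.
move=> KU k; split=> [x|x e e0]; first exact/scalar_jet_multilinear/KU/set_valP.
have [d d0 [C C0 HC]] := ujets_local_taylor k (KU _ (set_valP x)).
have C1 : 0 < C + 1 by rewrite ltr_wpDl.
exists (Num.min d (e / (C + 1))) => [|y]; first by rewrite lt_min d0 divr_gt0.
rewrite lt_min => /andP[yd ye]; apply: opnorm_le; first exact: ltW.
move=> v v1; rewrite !scalar_jetE.
have [h _] := HC (val y) yd (dirs v) (dirs_in v1) (eq_leq (size_dirs v)).
apply: le_trans h _; move: ye; rewrite ltr_pdivlMr// => /ltW; apply: le_trans.
by rewrite mulrC ler_wpM2l// lerDl.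
Qed.

Lemma scalar_jet_frechet (g : @disk_slice R E U B -> R^o) :
  (forall x, g x = l (f (disk_incl (val x)))) -> frechet_jet g (scalar_jet (@disk_slice R E U B)).
Proof.
move=> gf; split=> [x v|k x|k x e e0].
- rewrite scalar_jetE gf /dirs codom_ord0; have [-> //] := HD; exact: set_valP x.
- exact/scalar_jet_multilinear/(set_valP x).
have Ux : U (disk_incl (val x)) := set_valP x.
have [d d0 [C C0 HC]] := ujets_local_taylor k Ux.
have C1 : 0 < C + 1 by rewrite ltr_wpDl.
exists (Num.min d (e / (C + 1))) => [|y]; first by rewrite lt_min d0 divr_gt0.
rewrite lt_min => /andP[yd ye]; apply: opnorm_le; first by rewrite mulr_ge0// ltW.
move=> v v1; rewrite !scalar_jetE dirs_cons.
have [_ h] := HC (val y) yd (dirs v) (dirs_in v1) (eq_leq (size_dirs v)).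
apply: le_trans h _; rewrite expr2 mulrA; apply: ler_wpM2r => //.
move: ye; rewrite ltr_pdivlMr// => /ltW; apply: le_trans.
by rewrite mulrC ler_wpM2l// lerDl.
Qed.

(** Bounds on the derivatives also control the remainders |||f|||_(n,k): K is convex, and Taylor's
    formula along the segment from y to x bounds the remainder by the derivatives of order n + k +
    1, with exactly the factor 1 / (n+1)! that the definition compensates. *)
Lemma scalar_jet_rho_norm (K : set (disk_space B)) (rho C : R) :
  convex_set (K : set (convex_lmodType (disk_space B))) -> (forall x, K x -> U (disk_incl x)) ->
  0 < rho -> 0 <= C -> (forall y s, K y -> in_disk B s ->
    `|l (D s (disk_incl y))| <= C * (rho ^+ size s * factM M (size s))) ->
  (jet_rho_norm M rho (scalar_jet K) <= C%:E)%E.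
Proof.
move=> /convex_setP vK KU rho0 C0 HC.
have jw m : jet_weight M rho m = rho ^+ m * factM M m by rewrite /jet_weight /factM; ring.
have jw0 m : 0 < jet_weight M rho m by exact: jet_weight_gt0.
have HCb y s : K y -> in_ball B s -> `|l (D s (disk_incl y))| <= jet_weight M rho (size s) * C.
  move=> Ky sB; apply: (ujets_in_ball (KU y Ky) _ sB) => [|s' <- sB']; first by rewrite mulr_ge0// ltW.
  by rewrite jw mulrC; exact: HC.
rewrite ge_max; apply/andP; split; apply: nnsup_le => //.
  move=> _ [m _ <-]; rewrite lee_pdivrMl// -EFinM; apply: nnsup_le.
    by rewrite lee_fin mulr_ge0// ltW.
  move=> _ [x _ <-]; apply: opnorm_le => [|v v1]; first by rewrite mulr_ge0// ltW.
  have := HCb (val x) (dirs v) (set_valP x) (dirs_in v1).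
  by rewrite size_dirs.
move=> _ [[n k] _ <-]; rewrite /= lee_pdivrMl// -EFinM; apply: nnsup_le.
  by rewrite lee_fin mulr_ge0// ltW.
move=> _ [[x y] /= xy <-].
have [u u1 uE] := disk_unit (val x - val y).
set c := `|val x - val y| in uE *.
have c0 : 0 < c by rewrite normr_gt0 subr_eq0; apply: contra xy => /eqP/val_inj ->.
have cn : 0 < c ^+ n.+1 by rewrite exprn_gt0.
have fn : 0 < n.+1`!%:R :> R by rewrite ltr0n fact_gt0.
rewrite -lee_pdivlMl ?divr_gt0// -EFinM; apply: opnorm_le => [|v v1].
  apply: mulr_ge0; last by rewrite mulr_ge0// ltW.
  by rewrite invr_ge0 ltW// divr_gt0.
have KUs (t : R) : 0 <= t <= 1 -> exists2 z, K z & disk_incl (val y) + (t * c) *: disk_incl u = disk_incl z.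
  move=> t01; exists (t *: val x + (1 - t) *: val y); first exact: vK (set_valP x) (set_valP y) t01.
  rewrite -scalerA -disk_inclZ -uE disk_inclB disk_inclD !disk_inclZ.
  by rewrite scalerBr scalerBl scale1r addrCA [disk_incl (val y) - _]addrC.
pose g j t := c ^+ j * l (D (nseq j (disk_incl u) ++ dirs v) (disk_incl (val y) + (t * c) *: disk_incl u)).
have gD j (t : R) : (j <= n)%N -> 0 <= t <= 1 -> hasd (g j) t (g j.+1 t).
  move=> _ /KUs[z /KU Uz zE]; rewrite /g exprSr -mulrA; apply: hasdZ.
  have := @hasd_affine R (fun t => l (D (nseq j (disk_incl u) ++ dirs v)
    (disk_incl (val y) + t *: disk_incl u))) t _ 0 c.
  rewrite -zE in Uz; rewrite add0r => H; have := H _ (ujets_hasd HD l _ Uz).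
  by apply: hasd_ext; exists 1 => // a _; rewrite add0r.
set A := jet_weight M rho (n + k + 1) * C.
have gA (t : R) : 0 <= t <= 1 -> `|g n.+1 t| <= c ^+ n.+1 * A.
  move=> /KUs[z Kz zE]; rewrite /g zE normrM (gtr0_norm cn); apply: ler_wpM2l; first exact: ltW.
  have := HCb z (nseq n.+1 (disk_incl u) ++ dirs v) Kz.
  rewrite size_cat size_nseq size_dirs /A addnAC addn1; apply.
  move=> w; rewrite mem_cat mem_nseq => /orP[/andP[_ /eqP ->]|]; first exact: disk_ball.
  exact: dirs_in.
have := taylor_bound gD gA (t := 1); rewrite ler01 lexx => /(_ isT).
rewrite expr1n mul1r => H; apply: le_trans (_ : c ^+ n.+1 * A * n.+1`!%:R^-1 <= _); last first.
  by rewrite invfM invrK [_ * c ^+ _]mulrC -mulrA [X in _ <= X]mulrAC -mulrA.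
apply: le_trans H; rewrite le_eqVlt /taylor_remainder; apply/orP; left; apply/eqP; congr (`|_ - _|).
  by rewrite scalar_jetE /g /= expr0 !mul1r -disk_inclZ -uE disk_inclB subrKC.
apply: eq_bigr => j _; rewrite expr1n mulr1 scalar_jetE [LHS]/GRing.scale /=; congr (_ * _).
rewrite /g mul0r scale0r addr0 -(ujets_powers _ _ _ _ (KU _ (set_valP y))) -disk_inclZ -uE.
rewrite /dirs -codom_cst -codom_split; congr (l (D _ _)).
by apply: eq_codom => i; case: fintype.split.
Qed.

End ScalarJets.
Arguments scalar_jet {R E F} D l {B} K.

Section JetFamiliesAreUltra.
Context (R : realType) (md : umode) (M : weight_sequence R).
Context (E F : tvsType R) (cE : convenient E) (U : set E) (oU : cinf_open U).
Context (f : E -> F) (D : seq E -> E -> F) (HD : ujets md M U f D).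

Lemma ujets_mode_bounded (l : cdual F) (B : disk E) (K : set (disk_space B)) : compact K ->
  (forall y, K y -> U (disk_incl y)) -> mode_bounded md (fun k a => exists y s,
    [/\ K y, in_disk B s, size s = k & a = `|l (D s (disk_incl y))| / factM M k]).
Proof.
move=> cK KU; apply: test_mode_bounded => [k _ [y [s [_ _ _ ->]]]|r tr].
  by rewrite divr_ge0// ltW// factM_gt0.
have [C HC] := ujets_compact cE oU HD l tr cK KU; exists C => _ _ [y [s [Ky sB <- ->]]].
by rewrite mulrCA mulrC; exact: HC.
Qed.

Lemma scalar_jet_ujet (l : cdual F) (B : disk E) (K : set (disk_space B)) : compact K ->
  convex_set (K : set (convex_lmodType (disk_space B))) -> (forall y, K y -> U (disk_incl y)) ->
  is_ujet md M (scalar_jet D l K).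
Proof.
move=> cK vK KU; split; first exact: scalar_jet_continuous HD _ _ _ KU.
have H rho C : 0 < rho -> (forall k a, (exists y s, [/\ K y, in_disk B s, size s = k &
    a = `|l (D s (disk_incl y))| / factM M k]) -> a <= C * rho ^+ k) ->
    (jet_rho_norm M rho (scalar_jet D l K) < +oo)%E.
  move=> rho0 HC; apply: le_lt_trans (ltry `|C|).
  apply: (scalar_jet_rho_norm cE oU HD) => // y s Ky sB.
  have := HC (size s) _ (ex_intro _ y (ex_intro _ s (And4 Ky sB erefl erefl))).
  rewrite ler_pdivrMr ?factM_gt0// => /le_trans; apply; rewrite mulrA ler_wpM2r//.
    exact/ltW/factM_gt0.
  by rewrite ler_wpM2r ?exprn_ge0 ?ler_norm// ltW.
have := ujets_mode_bounded l cK KU; rewrite /mode_bounded; case: md => [bd rho rho0|[rho rho0 [C HC]]].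
  by have [C HC] := bd rho rho0; exact: H HC.
by exists rho => //; exact: H HC.
Qed.

Lemma ujets_ubanach (l : cdual F) (B : disk E) (g : @disk_slice R E U B -> R^o) :
  (forall x, g x = l (f (disk_incl (val x)))) ->
  is_ubanach_jet md M g (scalar_jet D l (@disk_slice R E U B)).
Proof.
move=> gf; split; first exact: scalar_jet_frechet HD _ _ _ gf.
move=> K; have KU y : ccset K y -> U (disk_incl y) by exact: (@ccset_sub _ _ _ K).
exact: (scalar_jet_ujet l (@ccset_compact _ _ _ K) (@ccset_convex _ _ _ K) KU).
Qed.

Lemma quadr_curve (d : nat -> R -> E) n t :
  (forall (l : cdual E) n t, hasd (fun t => l (d n t)) t (l (d n.+1 t))) ->
  quadr (fun h => d n (t + h)) (d n.+1 t) 1.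
Proof.
move=> Hd l; have [C HC] := hasd_bounded (fun s (_ : t - 1 <= s <= t + 1) => Hd l n.+2 s).
exists C => _ [h [/andP[h0 h1] ->]]; rewrite cdualZ !cdualB cdualZ addr0.
rewrite normrM normfV (ger0_norm (sqr_ge0 h)) ler_pdivrMl ?exprn_even_gt0 -?normr_gt0//.
rewrite [h ^+ 2 * C]mulrC; apply: (@taylor2_bound R (fun t => l (d n t)) (fun t => l (d n.+1 t))
    (fun t => l (d n.+2 t))) => // s /andP[s0 s1].
apply: HC; have : `|s * h| <= 1 by rewrite normrM (ger0_norm s0) mulr_ile1.
by rewrite ler_norml => /andP[? ?]; apply/andP; split; lra.
Qed.

Lemma hasd_at (g : R -> R) t d : hasd (fun h => g (t + h)) 0 d -> hasd g t d.
Proof.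
by move=> H e e0; have [r r0 rH] := H e e0; exists r => // h /rH; rewrite add0r addr0.
Qed.

(** Faa di Bruno's formula along a curve. A block contributes the derivative of c whose order is its
    size, so the partitions of n copies of [tt] suffice. Weak smoothness of the resulting tower then
    gives smoothness. *)
Lemma ujets_smooth_curve (c : R -> E) : smooth_curve c -> (forall t, U (c t)) ->
  smooth_curve (fun t => D [::] (c t)).
Proof.
move=> /smooth_curve_hasd[d <- Hd] Uc.
pose J n t := \sum_(p <- partitions (nseq n tt)) D [seq d (size b) t | b <- p] (d 0%N t).
suff : smooth_curve (J 0%N) by rewrite /J; congr smooth_curve; apply/funext => t; rewrite /= big_seq1.
apply: weak_smooth_curve => l n t; apply: hasd_at.
rewrite /J /= big_flatten big_map (_ : (fun _ => _) = fun h =>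
    \sum_(p <- partitions (nseq n tt)) l (D [seq d (size b) (t + h) | b <- p] (d 0%N (t + h)))); last first.
  by apply/funext => h; rewrite linear_sum.
rewrite linear_sum; apply: hasd_sum => p _.
have Ux : U (d 0%N (t + 0)) by [].
have := ujets_chain cE oU HD l ltr01 Ux (quadr_curve 0 t Hd)
  (e := fun (b : seq unit) h => d (size b) (t + h)) (fun b (_ : b \in p) => quadr_curve (size b) t Hd).
have -> : leibniz (fun (b : seq unit) h => d (size b) (t + h)) (fun b => d (size b).+1 t) p =
    [seq [seq d (size b) t | b <- q] | q <- adjoin tt p].
  by elim: (p) => [//|b q IH] /=; rewrite IH -!map_comp addr0.
by rewrite big_map addr0 big_cons linearD linear_sum.
Qed.

Theorem ujets_is_ultra (g : U -> F) : (forall x, g x = f (val x)) -> is_ultra md M g.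
Proof.
move=> gf; split=> [c cs|l B cl].
  have -> : g \o c = fun t => D [::] (val (c t)).
    by apply/funext => t /=; rewrite gf; have [-> //] := HD; exact: set_valP.
  by apply: ujets_smooth_curve => // t; exact: set_valP.
exists (scalar_jet D (Cdual cl) (@disk_slice R E U B)); apply: ujets_ubanach => x.
by rewrite /= gf.
Qed.

End JetFamiliesAreUltra.

(** * Vector-valued derivatives from scalar ones *)

Section WeakLimits.
Context (R : realType) (F : tvsType R) (cF : convenient F).

(** Weak estimates with one rate mu for all functionals make u Mackey-Cauchy: the quotients by mu
    are weakly bounded and hence lie in a disk. The point 0 is added for the pairs with mu m n = 0,
    where u m = u n. *)
Lemma weak_mackey_cvg (u : nat -> F) (mu : nat -> nat -> R) :
  (forall e : R, 0 < e -> exists N, forall m n, (N <= m)%N -> (N <= n)%N -> `|mu m n| <= e) ->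
  (forall l : cdual F, exists C : R, forall m n, `|l (u m) - l (u n)| <= C * `|mu m n|) ->
  exists e : F, u @ \oo --> e.
Proof.
move=> mu0 Hu; pose S := [set z | exists m n, mu m n != 0 /\ z = (mu m n)^-1 *: (u m - u n)].
have wS : wbounded (S `|` [set 0]).
  apply: wboundedU (wbounded1 _) => l; have [C HC] := Hu l.
  exists C => _ [m [n [mn ->]]]; rewrite cdualZ cdualB normrM normfV.
  by rewrite ler_pdivrMl ?normr_gt0// mulrC.
have [B SB] := wbounded_disk cF.1 wS.
apply: cF.2; exists B, mu; split=> [| |//|m n].
- exact: disk_bounded.
- exact: disk_absconvex.
have [mn|mn] := eqVneq (mu m n) 0; last first.
  exists ((mu m n)^-1 *: (u m - u n)); first by apply: SB; left; exists m, n.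
  by rewrite scalerA mulfV// scale1r.
exists 0; first by apply: SB; right.
rewrite scaler0; apply: cdual_ext cF.1 _ => l; have [C HC] := Hu l.
have := HC m n; rewrite mn normr0 mulr0 normr_le0 cdualB => /eqP ->.
by rewrite linear0.
Qed.

Lemma cdual_cvg (l : cdual F) (u : nat -> F) (e : F) : u @ \oo --> e -> (l (u n) : R^o) @[n --> \oo] --> (l e : R^o).
Proof. by move=> ue; apply: cvg_comp ue _; exact: (@cdual_continuous _ _ l). Qed.

Lemma harmonic_small (e : R) : 0 < e -> exists N, forall n, (N <= n)%N -> n.+1%:R^-1 <= e.
Proof.
move=> e0; exists (Num.truncn e^-1) => n Nn.
rewrite -[e]invrK lef_pV2 ?posrE ?invr_gt0//; apply: ltW; apply: lt_le_trans (truncnS_gt _) _.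
by rewrite ler_nat.
Qed.

Lemma cvg_harmonic_bound (a : nat -> R) (b C : R) : (forall n, `|a n - b| <= C * n.+1%:R^-1) ->
  (a n : R^o) @[n --> \oo] --> (b : R^o).
Proof.
move=> H; apply/cvgrPdist_le => e e0.
have C1 : 0 < `|C| + 1 by rewrite ltr_wpDl.
have [N HN] := harmonic_small (divr_gt0 e0 C1).
exists N => // n /= /HN h; rewrite distrC; apply: le_trans (H n) _.
apply: le_trans (ler_wpM2r _ (ler_norm C)) _; first by rewrite invr_ge0.
move: h; rewrite ler_pdivlMr// mulrC; apply: le_trans.
by rewrite ler_wpM2r ?invr_ge0// lerDl.
Qed.

Lemma cdual_limit (l : cdual F) (u : nat -> F) (e : F) (b C : R) : u @ \oo --> e ->
  (forall n, `|l (u n) - b| <= C * n.+1%:R^-1) -> l e = b.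
Proof.
move=> /(@cdual_cvg l) le /cvg_harmonic_bound.
exact: (@norm_cvg_unique R R^o ((fun n => l (u n) : R^o) @ \oo) _ _ _ le).
Qed.

End WeakLimits.

Section RealizeJets.
Context (R : realType) (E F : tvsType R) (cE : convenient E) (cF : convenient F).
Context (U : set E) (oU : cinf_open U) (f : E -> F) (Phi : cdual F -> seq E -> E -> R).
Hypothesis Phi0 : forall (l : cdual F) x, U x -> Phi l [::] x = l (f x).
Hypothesis Phi_hasd : forall l s x w, U x ->
  hasd (fun h => Phi l s (x + h *: w)) 0 (Phi l (w :: s) x).

Lemma line_hasd (g : E -> R) (g' : E -> R) x w t :
  hasd (fun h => g (x + t *: w + h *: w)) 0 (g' (x + t *: w)) ->
  hasd (fun t => g (x + t *: w)) t (g' (x + t *: w)).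
Proof.
by move=> H; apply: hasd_at; move: H; congr hasd; apply/funext => h; rewrite scalerDl addrA.
Qed.

(* The derivatives of scalar compositions come from vectors, since difference
   quotients are Mackey-Cauchy. *)
Lemma jets_realize : exists D : seq E -> E -> F, forall (l : cdual F) s x, U x -> l (D s x) = Phi l s x.
Proof.
suff H s : forall x, exists e, U x -> forall l : cdual F, l e = Phi l s x.
  by exists (fun s x => projT1 (cid (H s x))) => l s x Ux; exact: (projT2 (cid (H s x))).
elim: s => [|w s IH] x; first by exists (f x) => Ux l; rewrite Phi0.
have [Ux|nU] := pselect (U x); last by exists 0.
pose q y := projT1 (cid (IH y)).
have qP y : U y -> forall l : cdual F, l (q y) = Phi l s y := projT2 (cid (IH y)).
have [d d0 dU] := cinf_open_line cE oU w Ux.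
pose h n : R := d * n.+1%:R^-1.
have h0 n : 0 < h n by rewrite mulr_gt0 ?invr_gt0.
have hd n : `|h n| <= d.
  by rewrite gtr0_norm// ler_piMr ?(ltW d0)// invf_le1// ler1n.
pose u n := (h n)^-1 *: (q (x + h n *: w) - q x).
have Hu (l : cdual F) : exists2 C : R, 0 <= C & forall n, `|l (u n) - Phi l (w :: s) x| <= C * h n.
  have line v (t : R) : `|t| <= d -> hasd (fun t => Phi l v (x + t *: w)) t (Phi l (w :: v) (x + t *: w)).
    by move=> td; apply: (line_hasd (g' := Phi l (w :: v))); apply: Phi_hasd; exact: dU.
  have [C HC] : exists C : R, forall t, `|t| <= d -> `|Phi l (w :: w :: s) (x + t *: w)| <= C.
    have [C HC] := hasd_bounded (fun t (td : - d <= t <= d) =>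
      line [:: w, w & s] t (ltac:(by rewrite ler_norml))).
    by exists C => t; rewrite ler_norml; exact: HC.
  exists C => [|n]; first by apply: le_trans (HC 0 _); rewrite ?normr0 ?(ltW d0).
  rewrite /u cdualZ cdualB !qP//; last exact: dU.
  have th (t : R) : 0 <= t <= 1 -> `|0 + t * h n| <= d.
    by move=> /andP[t0 t1]; rewrite add0r; apply: le_trans (hd n); rewrite normrM (ger0_norm t0) ler_piMl.
  have := @taylor2_bound R (fun t => Phi l s (x + t *: w)) (fun t => Phi l (w :: s) (x + t *: w))
    (fun t => Phi l (w :: w :: s) (x + t *: w)) 0 (h n) C
    (fun t t01 => line _ _ (th t t01)) (fun t t01 => line _ _ (th t t01)) (fun t t01 => HC _ (th t t01)).
  rewrite add0r scale0r addr0; set a := Phi _ _ _; set b := Phi _ _ _; set c := Phi _ _ _ => T.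
  have -> : (h n)^-1 * (a - b) - c = (h n)^-1 * (a - b - h n * c) by field; rewrite gt_eqF.
  by rewrite normrM normfV (gtr0_norm (h0 n)) ler_pdivrMl// mulrCA -expr2.
(* The quotients u n weakly approach their limit at the rate h n, so u m and u n differ by a
   multiple of h m + h n. *)
have [|l|e ue] := @weak_mackey_cvg R F cF u (fun m n => h m + h n).
- move=> e e0; have e2 : 0 < e / (2 * d) by rewrite divr_gt0// mulr_gt0.
  have [N HN] := harmonic_small e2; exists N => m n /HN hm /HN hn.
  rewrite ger0_norm; last exact: addr_ge0 (ltW (h0 m)) (ltW (h0 n)).
  rewrite /h -mulrDr mulrC -ler_pdivlMr//; apply: le_trans (lerD hm hn) _.
  by rewrite le_eqVlt; apply/orP; left; apply/eqP; field; rewrite gt_eqF.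
- have [C C0 HC] := Hu l; exists C => m n; rewrite [`|h m + h n|]ger0_norm; last exact: addr_ge0 (ltW (h0 m)) (ltW (h0 n)).
  by rewrite mulrDr; apply: ler_dist3 (HC m) _; rewrite distrC; exact: HC.
exists e => _ l; have [C C0 HC] := Hu l.
apply: (cdual_limit ue (C := C * d)) => n.
by rewrite -mulrA; exact: HC.
Qed.

End RealizeJets.

Section UltraHasJets.
Context (R : realType) (md : umode) (M : weight_sequence R).
Context (E F : tvsType R) (cE : convenient E) (cF : convenient F).
Context (U : set E) (oU : cinf_open U).

Lemma multilinear_coordZ (V : normedModType R) k (T : ('I_k -> V) -> R^o) a x (v : 'I_k -> V) i :
  bounded_sym_multilinear T -> T (set_coord v i (a *: x)) = a * T (set_coord v i x).
Proof.
move=> [TL _ _]; have := TL v i 1 0 0; rewrite scaler0 addr0 scale1r => T00.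
have := TL v i a x 0; rewrite addr0 => ->.
suff -> : T (set_coord v i 0) = 0 by rewrite addr0.
by apply: (addIr (T (set_coord v i 0))); rewrite add0r -T00.
Qed.

Lemma multilinear_headZ (V : normedModType R) k (T : ('I_k.+1 -> V) -> R^o) a w (v : 'I_k -> V) :
  bounded_sym_multilinear T -> T (cons_vec (a *: w) v) = a * T (cons_vec w v).
Proof.
move=> TL; have sc x y : set_coord (cons_vec y v) ord0 x = cons_vec x v.
  apply/funext => i; rewrite /set_coord /cons_vec; case: unliftP => [j ->|->].
    by rewrite eq_sym (negbTE (neq_lift _ _)).
  by rewrite eqxx.
by rewrite -(sc _ 0) multilinear_coordZ// sc.
Qed.

Lemma multilinear_scale (V : normedModType R) k (T : ('I_k -> V) -> R^o) a (v : 'I_k -> V) :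
  bounded_sym_multilinear T -> T (fun i => a *: v i) = a ^+ k * T v.
Proof.
move=> TL; suff H (s : seq 'I_k) : uniq s ->
    T (fun i => if i \in s then a *: v i else v i) = a ^+ size s * T v.
  have := H (enum 'I_k) (enum_uniq _); rewrite size_enum_ord => <-.
  by congr T; apply/funext => i; rewrite mem_enum.
elim: s => [_|j s IH /= /andP[js us]]; first by rewrite expr0 mul1r.
rewrite exprS -mulrA -IH//; set w := (X in _ = a * T X).
have -> : (fun i => if i \in j :: s then a *: v i else v i) = set_coord w j (a *: v j).
  apply/funext => i; rewrite in_cons /set_coord; case: eqVneq => [->//|_].
  by [].
rewrite multilinear_coordZ//; congr (a * T _); apply/funext => i.
by rewrite /set_coord /w; case: eqVneq => [->|//]; rewrite (negbTE js).
Qed.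

Lemma opnorm_ub (V : normedModType R) k (T : ('I_k -> V) -> R^o) (C : R) v :
  (opnorm T <= C%:E)%E -> (forall i, `|v i| <= 1) -> `|T v| <= C.
Proof.
move=> TC v1; rewrite -lee_fin; apply: le_trans TC; apply: nnsup_ubound.
by exists v.
Qed.

Lemma jet_coef_bound (V : normedModType R) (K : set V) (J : jets K R^o) rho (C : R) k x (v : 'I_k -> V) :
  0 < rho -> (jet_rho_norm M rho J <= C%:E)%E -> (forall i, `|v i| <= 1) ->
  `|jet_coef J x v| <= C * (rho ^+ k * factM M k).
Proof.
move=> rho0 JC v1; apply: opnorm_ub => //.
have jw : jet_weight M rho k = rho ^+ k * factM M k by rewrite /jet_weight /factM; ring.
rewrite -jw mulrC EFinM -lee_pdivrMl ?jet_weight_gt0//; apply: le_trans JC.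
rewrite le_max; apply/orP; left; apply: le_trans (nnsup_ubound _); last by exists k.
apply: lee_wpmul2l; first by rewrite lee_fin invr_ge0 ltW// jet_weight_gt0.
by apply: nnsup_ubound; exists x.
Qed.

Section ScalarFunctional.
Context (B : disk E) (g : @disk_slice R E U B -> R^o) (J : jets (@disk_slice R E U B) R^o).
Hypothesis gJ : frechet_jet g J.

(** Extended by 0 outside of the slice, so that difference quotients can be written without proofs
    of membership. *)
Definition total_jet k (x : disk_space B) (v : 'I_k -> disk_space B) : R :=
  if pselect (@disk_slice R E U B x) is left Ux then jet_coef J (SigSub (mem_set Ux)) v else 0.

Lemma total_jetE k (x : @disk_slice R E U B) (v : 'I_k -> disk_space B) :
  total_jet (val x) v = jet_coef J x v.
Proof.
rewrite /total_jet; case: pselect => [Ux|/(_ (set_valP x))//].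
by congr jet_coef; exact: val_inj.
Qed.

Lemma frechet_hasd k (x w : disk_space B) (v : 'I_k -> disk_space B) :
  U (disk_incl x) -> (forall i, `|v i| <= 1) ->
  hasd (fun h => total_jet (x + h *: w) v) 0 (total_jet x (cons_vec w v)).
Proof.
move=> Ux v1 e e0; have [_ Jm Jd] := gJ; pose X : @disk_slice R E U B := SigSub (mem_set Ux).
have w1 : 0 < `|w| + 1 by rewrite ltr_wpDl.
have [d d0 dJ] := Jd k X (e / (`|w| + 1)) (divr_gt0 e0 w1).
have [r r0 rU] := disk_slice_open oU Ux.
exists (Num.min d r / (`|w| + 1)) => [|h]; first by rewrite divr_gt0// lt_min d0.
rewrite ltr_pdivlMr// => hd; have : `|h *: w| < Num.min d r.
  by rewrite normrZ; apply: le_lt_trans hd; rewrite ler_wpM2l// lerDl.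
rewrite lt_min add0r scale0r addr0 => /andP[hd' hr].
have Uy : @disk_slice R E U B (x + h *: w) by apply: rU; rewrite addrAC subrr add0r.
pose Y : @disk_slice R E U B := SigSub (mem_set Uy).
have := dJ Y; rewrite /= addrAC subrr add0r => /(_ hd')/opnorm_ub/(_ v1).
rewrite (multilinear_headZ _ _ _ (Jm _ X)) -!total_jetE /= => H.
apply: le_trans H _; rewrite normrZ mulrCA [leRHS]mulrC; apply: ler_wpM2l => //.
by rewrite mulrAC ler_pdivrMr// ler_wpM2l ?(ltW e0)// lerDl.
Qed.

End ScalarFunctional.

Context (fs : U -> F) (ufs : is_ultra md M fs) (f : E -> F) (fsf : forall x, fs x = f (val x)).

Let J (l : cdual F) (B : disk E) := projT1 (cid (ufs.2 l B (@cdual_continuous _ _ l))).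

Arguments J : clear implicits.

Let JP (l : cdual F) (B : disk E) :
  is_ubanach_jet md M (l \o fs \o @slice_incl R E U B : _ -> R^o) (J l B).
Proof. exact: projT2 (cid (ufs.2 l B (@cdual_continuous _ _ l))). Qed.

Let framed (s : seq E) (x : E) (B : disk E) (X : disk_space B) k (V : 'I_k -> disk_space B) :=
  [/\ forall i, `|V i| <= 1, dirs V = s & disk_incl X = x].

Let frame_ex (s : seq E) (x : E) : exists (B : disk E) X (V : 'I_(size s) -> disk_space B), framed s x X V.
Proof.
have [B [X XE HB]] := disk_frame cE s x.
by have [V [V1 Vs]] := dirs_lift (fun v vs => (HB v vs).1); exists B, X, V.
Qed.

Let frame_behead w s x (B : disk E) (X : disk_space B) k (V : 'I_k.+1 -> disk_space B) : framed (w :: s) x X V ->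
  [/\ framed s x X (V \o lift ord0), disk_incl (V ord0) = w & V = cons_vec (V ord0) (V \o lift ord0)].
Proof.
have VE : V = cons_vec (V ord0) (V \o lift ord0).
  by apply/funext => i; rewrite /cons_vec; case: unliftP => [j ->|->].
move=> [V1 + XE]; rewrite [in X in X -> _]VE dirs_cons => -[Vw Vs].
by split=> //; split=> // i; exact: V1.
Qed.

Let frame_shift s x (B : disk E) (X W : disk_space B) k (V : 'I_k -> disk_space B) h : framed s x X V ->
  framed s (x + h *: disk_incl W) (X + h *: W) V.
Proof. by move=> [V1 Vs XE]; split=> //; rewrite disk_inclD disk_inclZ XE. Qed.

(** The jets of l o f on different spaces E_B agree wherever both are defined. By induction on the
    directions, both sides are the derivative along w of functions that coincide near x, and
    derivatives are unique. A frame presents x and s inside some E_B. *)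
Let jet_compat l s x B1 (X1 : disk_space B1) k1 (V1 : 'I_k1 -> _) B2 (X2 : disk_space B2) k2 (V2 : 'I_k2 -> _) :
  framed s x X1 V1 -> framed s x X2 V2 -> U x -> total_jet (J l B1) X1 V1 = total_jet (J l B2) X2 V2.
Proof.
elim: s x k1 V1 k2 V2 X1 X2 => [|w s IH] x k1 V1 k2 V2 X1 X2 F1 F2 Ux.
  have base B (X : disk_space B) k (V : 'I_k -> disk_space B) : framed [::] x X V ->
      total_jet (J l B) X V = l (f x).
    move=> [_ Vs XE]; have k0 : k = 0%N by rewrite -(size_dirs V) Vs.
    subst k; rewrite -XE in Ux; have [[J0 _ _] _] := JP l B.
    have -> : X = val (SigSub (mem_set Ux) : @disk_slice R E U B) by [].
    by rewrite total_jetE J0 /= fsf /= XE.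
  by rewrite (base _ _ _ _ F1) (base _ _ _ _ F2).
have ks : forall B (X : disk_space B) k (V : 'I_k -> disk_space B), framed (w :: s) x X V -> k = (size s).+1.
  by move=> B X k V [_ Vs _]; rewrite -(size_dirs V) Vs.
have k1s := ks _ _ _ _ F1; have k2s := ks _ _ _ _ F2; subst k1 k2.
have [G1 W1 VE1] := frame_behead F1; have [G2 W2 VE2] := frame_behead F2.
have Ui B (X : disk_space B) : framed s x X (fun _ : 'I_0 => 0) \/ disk_incl X = x -> U (disk_incl X).
  by move=> [[_ _ ->]|->].
have H1 := frechet_hasd (JP l B1).1 (V1 ord0) (Ui _ X1 (or_intror (let: And3 _ _ h := G1 in h)))
  (let: And3 h _ _ := G1 in h).
have H2 := frechet_hasd (JP l B2).1 (V2 ord0) (Ui _ X2 (or_intror (let: And3 _ _ h := G2 in h)))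
  (let: And3 h _ _ := G2 in h).
rewrite VE1 VE2; apply: hasd_uniq H1 _; apply: hasd_ext H2.
have [d d0 dU] := cinf_open_line cE oU w Ux.
exists d => // h /ltW hd; rewrite add0r; apply/esym/IH; last exact: dU h hd.
  by rewrite -W1; exact: frame_shift.
by rewrite -W2; exact: frame_shift.
Qed.

Let Phi l s x : R := xget 0 [set a | exists (B : disk E) X (V : 'I_(size s) -> disk_space B),
  framed s x X V /\ a = total_jet (J l B) X V].

Let PhiE l s x B (X : disk_space B) k (V : 'I_k -> disk_space B) : framed s x X V -> U x ->
  Phi l s x = total_jet (J l B) X V.
Proof.
move=> FV Ux; rewrite /Phi; case: xgetP => [_ _ [B' [X' [V' [FV' ->]]]]|none].
  exact: jet_compat FV' FV Ux.
by have [B' [X' [V' FV']]] := frame_ex s x; case: (none (total_jet (J l B') X' V')); exists B', X', V'.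
Qed.

(** Since the scalar derivatives do not depend on the frame, [jets_realize] assembles them into
    vectors. The bound in [ujets] comes from the first half of the rho-norms, the one without Taylor
    remainders. *)
Theorem ultra_has_jets : ultra_on md M U f.
Proof.
have Phi0 l x : U x -> Phi l [::] x = l (f x).
  move=> Ux; have [B [X [V FV]]] := frame_ex [::] x; rewrite (PhiE l FV Ux).
  have [_ _ XE] := FV; rewrite -XE in Ux; have [[J0 _ _] _] := JP l B.
  have -> : X = val (SigSub (mem_set Ux) : @disk_slice R E U B) by [].
  by rewrite total_jetE J0 /= fsf /= XE.
have Phid l s x w : U x -> hasd (fun h => Phi l s (x + h *: w)) 0 (Phi l (w :: s) x).
  move=> Ux; have [B [X [V FV]]] := frame_ex (w :: s) x.
  have [FV' Vw VE] := frame_behead FV; have [V1 _ XE] := FV'.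
  have UX : U (disk_incl X) by rewrite XE.
  rewrite (PhiE l FV Ux) VE; apply: hasd_ext (frechet_hasd (JP l B).1 (V ord0) UX V1).
  have [d d0 dU] := cinf_open_line cE oU w Ux.
  exists d => // h /ltW hd; rewrite add0r -Vw (PhiE l (frame_shift (V ord0) h FV'))//.
  by rewrite Vw; exact: dU.
have [D HD] := jets_realize cE cF oU Phi0 Phid; exists D; split=> [x Ux|l s x w Ux|r B K tr cK vK KU l].
- by apply: cdual_ext cF.1 _ => l; rewrite HD// Phi0.
- rewrite HD//; apply: hasd_ext (Phid l s x w Ux).
  have [d d0 dU] := cinf_open_line cE oU w Ux.
  by exists d => // h /ltW hd; rewrite add0r HD//; exact: dU.
pose A k a := exists y s, [/\ K y, in_disk B s, size s = k & a = `|l (D s (disk_incl y))| / factM M k].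
have bA : mode_bounded md A.
  pose K' : compact_convex_subset (@disk_slice R E U B) := CompactConvexSubset KU cK vK.
  have bnd rho : 0 < rho -> (jet_rho_norm M rho (jet_restrict (@ccset_sub _ _ _ K') (J l B)) < +oo)%E ->
      exists C : R, forall k a, A k a -> a <= C * rho ^+ k.
    move=> rho0 fin; set n := jet_rho_norm _ _ _ in fin.
    have n0 : (0 <= n)%E by rewrite le_max nnsup_ge0.
    have nC : (n <= (fine n)%:E)%E by rewrite fineK// ge0_fin_numE.
    exists (fine n) => k _ [y [s [Ky sB <- ->]]]; rewrite ler_pdivrMr ?factM_gt0// -mulrA.
    have [V [V1 Vs]] := dirs_lift sB; have FV : framed s (disk_incl y) y V by split.
    have := jet_coef_bound (SigSub (mem_set Ky)) rho0 nC V1.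
    have Uy := KU y Ky; rewrite HD// (PhiE l FV Uy).
    suff -> : total_jet (J l B) y V = jet_coef (jet_restrict (@ccset_sub _ _ _ K') (J l B))
      (SigSub (mem_set Ky)) V by [].
    exact: (total_jetE (J l B) (subset_incl (@ccset_sub _ _ _ K') (SigSub (mem_set Ky))) V).
  have [_ /(_ K')[_]] := JP l B; rewrite /mode_bounded; case: md => [fin rho rho0|[rho rho0 fin]].
    exact/bnd/fin.
  by exists rho => //; exact: bnd.
have [k a [y [s [_ _ _ ->]]]|C C0 HC] := mode_bounded_test _ bA tr.
  by rewrite divr_ge0// ltW// factM_gt0.
exists C => _ [y [s [Ky sB ->]]]; rewrite cdualZ normrM ger0_norm; last first.
  by rewrite divr_ge0 ?tr.1// ltW// factM_gt0.
by rewrite -mulrA [_^-1 * _]mulrC; apply: (HC (size s)); exists y, s.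
Qed.

End UltraHasJets.
(** * The topology of C^[M](U, F) *)

Section SeminormedSpaces.
Context (R : realType) (V : lmodType R).

Lemma seminormed_nbhs (P : set (seminorm V)) (p : seminorm V) : P p ->
  nbhs (0 : seminormed P) [set x | p x < 1].
Proof. by move=> Pp; exists 1%N, (fun=> p), 1; split=> // x /(_ ord0); rewrite subr0. Qed.

(** A continuous p is below 1 on a ball of finitely many generating seminorms, and a multiple of S
    lies in that ball. *)
Lemma seminormed_bounded (P : set (seminorm V)) (S : set V) :
  (forall q, P q -> exists C : R, forall x, S x -> q x <= C) ->
  forall p : seminorm V, nbhs (0 : seminormed P) [set x | p x < 1] ->
  exists C : R, forall x, S x -> p x <= C.
Proof.
move=> HS p [n [q [e [Pq e0 qp]]]].
pose C i := projT1 (cid (HS _ (Pq i))).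
have HC i x : S x -> q i x <= C i by exact: (projT2 (cid (HS _ (Pq i)))).
pose A := 1 + \sum_i `|C i|.
have A1 : 1 <= A by rewrite lerDl; apply: sumr_ge0.
have A0 : 0 < A by exact: lt_le_trans A1.
have t0 : 0 < e / (2 * A) by rewrite divr_gt0// mulr_gt0.
exists (e / (2 * A))^-1 => x Sx; rewrite -(ler_pM2l t0) mulfV ?gt_eqF//.
rewrite -[X in X * _](gtr0_norm t0) -seminormZ; apply/ltW/qp => i.
rewrite subr0 seminormZ (gtr0_norm t0).
have CA : C i <= A.
  apply: le_trans (ler_norm _) _; rewrite /A (bigD1 i)//= addrCA lerDl addr_ge0// sumr_ge0//.
apply: le_lt_trans (ler_wpM2l (ltW t0) (le_trans (HC i x Sx) CA)) _.
have -> : e / (2 * A) * A = e / 2 by field; rewrite gt_eqF.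
by rewrite ltr_pdivrMr// ltr_pMr// ltr1n.
Qed.

Lemma fine_seminorm (N : V -> \bar R) : eseminorm N -> (forall x, N x < +oo)%E ->
  exists p : seminorm V, forall x, (p x)%:E = N x.
Proof.
move=> [N0 Nge ND NZ] fin; have NE x : (fine (N x))%:E = N x by rewrite fineK// ge0_fin_numE.
have pD x y : fine (N (x + y)) <= fine (N x) + fine (N y).
  by rewrite -lee_fin NE; apply: ND; rewrite NE.
have Zle a x : fine (N (a *: x)) <= `|a| * fine (N x).
  by rewrite -lee_fin NE; apply: NZ; rewrite NE.
have pZ a x : fine (N (a *: x)) = `|a| * fine (N x).
  apply/eqP; rewrite eq_le Zle/=; have [->|a0] := eqVneq a 0.
    by rewrite normr0 mul0r -lee_fin NE.
  by rewrite -ler_pdivlMl ?normr_gt0// -normfV -{1}[x](scalerK a0) Zle.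
by exists (Seminorm pD pZ).
Qed.

Lemma initial_seminorms_nbhs (I : Type) (T : I -> tvsType R) (phi : forall i, V -> T i) i
  (q : seminorm (T i)) (p : seminorm V) : nbhs 0 [set x | q x < 1] -> (forall v, p v = q (phi i v)) ->
  nbhs (0 : seminormed (initial_seminorms phi)) [set x | p x < 1].
Proof.
move=> q1 pq; apply: seminormed_nbhs; exists i, q => //; exact: seminorm_continuous.
Qed.

Lemma seminorm_le_nbhs (E : tvsType R) (p q : seminorm E) C : (forall x, p x <= C * q x) ->
  nbhs 0 [set x | q x < 1] -> nbhs 0 [set x | p x < 1].
Proof.
move=> pq q1; have C1 : 0 < `|C| + 1 by rewrite ltr_wpDl.
have iC : 0 < (`|C| + 1)^-1 by rewrite invr_gt0.
apply: filterS (nbhs0_seminorm_lt iC q1) => x /=.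
rewrite -[ltRHS]mul1r ltr_pdivlMr// mulrC; apply: le_lt_trans; apply: le_trans (pq x) _.
by rewrite ler_wpM2r ?seminorm_ge0// (le_trans (ler_norm C))// lerDl.
Qed.

End SeminormedSpaces.

(** * Weighted seminorms on jets *)

Section WeightSeminorms.
Context (R : realType) (md : umode) (M : weight_sequence R).
Context (V : normedModType R) (K : set V).

(** Orders with r k = 0 are left out so that all coefficients are positive, as [eseminorm_scale]
    demands. *)
Definition weight_norm (r : nat -> R) (J : jets K R^o) : \bar R :=
  nnsup [set ((r k / factM M k)%:E * jet_norm k J)%E | k in [set k | 0 < r k]].

Lemma eseminorm_weight_norm r : eseminorm (weight_norm r).
Proof.
apply: eseminorm_sup => k /= rk; apply: eseminorm_scale; first by rewrite divr_gt0// factM_gt0.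
by apply: eseminorm_sup => x _; exact: eseminorm_opnorm.
Qed.

Lemma weight_norm_le r rho C C' J : (forall k, 0 <= r k) -> 0 < rho -> 0 <= C -> (jet_rho_norm M rho J <= C%:E)%E ->
  (forall k, rho ^+ k * r k <= C') -> (weight_norm r J <= (C' * C)%:E)%E.
Proof.
move=> r0 rho0 C0 JC rC; have [rn|/forallNP nr] := pselect (exists k, 0 < r k); last first.
  rewrite /weight_norm (_ : [set k | 0 < r k] = set0) ?image_set0; last first.
    by apply/seteqP; split=> // k /nr.
  apply: nnsup_le => [|_ //]; rewrite lee_fin mulr_ge0//.
  by apply: le_trans (rC 0%N); rewrite expr0 mul1r.
have C'0 : 0 <= C'.
  by have [k rk] := rn; apply: le_trans (rC k); rewrite mulr_ge0 ?exprn_ge0// ltW.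
apply: nnsup_le => [|_ [k rk <-]]; first by rewrite lee_fin mulr_ge0.
rewrite -lee_pdivlMl ?divr_gt0 ?factM_gt0// -EFinM; apply: nnsup_le.
  by rewrite lee_fin mulr_ge0 ?mulr_ge0 ?invr_ge0// divr_ge0// ltW// factM_gt0.
move=> _ [x _ <-]; apply: opnorm_le => [|v v1].
  by rewrite mulr_ge0 ?mulr_ge0 ?invr_ge0// divr_ge0// ltW// factM_gt0.
apply: le_trans (jet_coef_bound x rho0 JC v1) _.
have -> : (r k / factM M k)^-1 * (C' * C) = C * (C' / r k * factM M k) by field; rewrite !gt_eqF ?factM_gt0.
by rewrite ler_wpM2l// ler_wpM2r ?ler_pdivlMr// ltW// factM_gt0.
Qed.

Lemma eseminorm_ujet (N : jets K R^o -> \bar R) : eseminorm N ->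
  eseminorm (fun J : ujet md M K R^o => N (ujet_val J)).
Proof.
by move=> [N0 Nge ND NZ]; split=> [|J|J L a b|c J a]; [exact: N0|exact: Nge|exact: ND|exact: NZ].
Qed.

Lemma weight_norm_rho r rho C (J : jets K R^o) : (forall k, 0 <= r k) -> 0 < rho ->
  (forall k, rho ^+ k * r k <= C) -> (jet_rho_norm M rho J < +oo)%E ->
  (weight_norm r J <= C%:E * jet_rho_norm M rho J)%E.
Proof.
move=> r0 rho0 rC fin; have n0 : (0 <= jet_rho_norm M rho J)%E by rewrite le_max nnsup_ge0.
have nE : (fine (jet_rho_norm M rho J))%:E = jet_rho_norm M rho J by rewrite fineK// ge0_fin_numE.
by rewrite -nE -EFinM; apply: (weight_norm_le r0 rho0); rewrite -?lee_fin ?nE.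
Qed.

Lemma weight_norm_lty r (J : jets K R^o) : test_weight md r -> is_ujet md M J ->
  (weight_norm r J < +oo)%E.
Proof.
move=> [r0 tr] [_].
have H rho C : 0 < rho -> (forall k, rho ^+ k * r k <= C) -> (jet_rho_norm M rho J < +oo)%E ->
    (weight_norm r J < +oo)%E.
  move=> rho0 rC fin; apply: le_lt_trans (weight_norm_rho r0 rho0 rC fin) _.
  have n0 : (0 <= jet_rho_norm M rho J)%E by rewrite le_max nnsup_ge0.
  by rewrite -[jet_rho_norm M rho J]fineK ?ge0_fin_numE// -EFinM ltry.
move: tr; case: md => [[rho rho0 [C HC]] /(_ rho^-1)|HC [rho rho0]].
  rewrite invr_gt0 => /(_ rho0); apply: (@H rho^-1 C) => [|k]; first by rewrite invr_gt0.
  by rewrite exprVn ler_pdivrMl ?exprn_gt0// mulrC.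
by have [C HC'] := HC rho rho0; exact: H HC'.
Qed.

End WeightSeminorms.

(** In the Beurling case a single rho-norm dominates the weighted seminorm. In the Roumieu case
    every rho-norm dominates it on its step, which is the description of continuity on the inductive
    limit. *)
Lemma weight_norm_continuous (R : realType) (md : umode) (M : weight_sequence R)
  (V : normedModType R) (K : set V) r (p : seminorm (ujet md M K R^o)) : test_weight md r ->
  (forall J : ujet md M K R^o, (p J)%:E = weight_norm M r (ujet_val J)) -> nbhs 0 [set J | p J < 1].
Proof.
case: md p => p [r0 tr] pE.
  have [rho rho0 [C HC]] := tr; have rho'0 : 0 < rho^-1 by rewrite invr_gt0.
  have fin (J : ujet Beurling M K R^o) : (jet_rho_norm M rho^-1 (ujet_val J) < +oo)%E.
    by have [_ /(_ _ rho'0)] : is_ujet Beurling M (ujet_val J) by exact: set_mem (valP J).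
  have [q qE] := fine_seminorm (@eseminorm_ujet _ Beurling M _ _ _ (eseminorm_rho M K R^o rho'0)) fin.
  apply: (@seminorm_le_nbhs R _ p q C) => [J|].
    rewrite -lee_fin EFinM pE qE; apply: weight_norm_rho => // k.
    by rewrite exprVn ler_pdivrMl ?exprn_gt0// mulrC.
  by apply: seminormed_nbhs; exists rho^-1.
apply: seminormed_nbhs => rho rho0; have [C HC] := tr rho rho0; exists C => J fin.
by rewrite pE; exact: weight_norm_rho.
Qed.

Lemma ujet_weight_seminorm (R : realType) (md : umode) (M : weight_sequence R)
  (V : normedModType R) (K : set V) r : test_weight md r -> exists2 p : seminorm (ujet md M K R^o),
  nbhs 0 [set J | p J < 1] & forall J : ujet md M K R^o, (p J)%:E = weight_norm M r (ujet_val J).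
Proof.
move=> tr; have fin (J : ujet md M K R^o) : (weight_norm M r (ujet_val J) < +oo)%E.
  by apply: weight_norm_lty tr _; exact: set_mem (valP J).
have [p pE] := fine_seminorm (@eseminorm_ujet _ md M _ _ _ (eseminorm_weight_norm M K r)) fin.
by exists p => //; exact: weight_norm_continuous tr pE.
Qed.

(** * Uniqueness of jets *)

Section JetUniqueness.
Context (R : realType) (md : umode) (M : weight_sequence R).
Context (E : tvsType R) (U : set E) (oU : cinf_open U) (B : disk E).
Local Notation slice := (@disk_slice R E U B).

Lemma cons_vecE (T : Type) k (v : 'I_k.+1 -> T) :
  (fun i => if unlift ord0 i is Some j then v (lift ord0 j) else v ord0) = v.
Proof. by apply/funext => i; case: unliftP => [j ->|->]. Qed.

(** [jet] is defined by choice; uniqueness makes it linear in the function, and thereby identifies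
    the seminorms of C^[M]. On unit vectors the jets agree because derivatives are unique, and
    homogeneity extends this to all vectors. *)
Lemma frechet_jet_uniq (g : slice -> R^o) (J L : jets slice R^o) :
  frechet_jet g J -> frechet_jet g L -> J = L.
Proof.
move=> gJ gL; have H k (x : disk_space B) (v : 'I_k -> disk_space B) : (forall i, `|v i| <= 1) ->
    total_jet J x v = total_jet L x v.
  elim: k x v => [|k IH] x v v1.
    have [J0 _ _] := gJ; have [L0 _ _] := gL.
    by rewrite /total_jet; case: pselect => // Ux; rewrite J0 L0.
  have [Ux|nU] := pselect (U (disk_incl x)); last by rewrite /total_jet; case: pselect.
  have v1' i : `|(fun j => v (lift ord0 j)) i| <= 1 by exact: v1.
  have H1 := frechet_hasd oU gJ (v ord0) Ux v1'.
  have H2 := frechet_hasd oU gL (v ord0) Ux v1'.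
  have E1 : cons_vec (v ord0) (fun j => v (lift ord0 j)) = v by exact: cons_vecE.
  rewrite E1 in H1 H2; apply: hasd_uniq H1 _; move: H2; congr hasd.
  by apply/funext => h; rewrite IH.
apply/funext => -[k [x v]]; rewrite -[LHS]/(jet_coef J x v) -[RHS]/(jet_coef L x v).
pose c : R := 1 + \sum_i `|v i|; have c0 : 0 < c by rewrite ltr_wpDr// sumr_ge0.
have -> : v = fun i => c *: (c^-1 *: v i).
  by apply/funext => i; rewrite scalerA mulfV ?scale1r// gt_eqF.
have [_ Jm _] := gJ; have [_ Lm _] := gL.
rewrite (multilinear_scale c _ (Jm k x)) (multilinear_scale c _ (Lm k x)); have := H k (val x) (fun i => c^-1 *: v i); rewrite !total_jetE => -> // i.
rewrite normrZ gtr0_norm ?invr_gt0// ler_pdivrMl// mulr1 /c (bigD1 i)//= addrCA lerDl.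
by rewrite addr_ge0// sumr_ge0.
Qed.

Lemma jet_lc c (f g : ubanach md M slice R^o) : jet (c *: f + g) = c *: jet f + jet g.
Proof.
apply: (frechet_jet_uniq (jetP (c *: f + g)).1).
by have H := frechet_jet_lc c (jetP f).1 (jetP g).1; exact: H.
Qed.

Lemma jet_on_lc K c (f g : ubanach md M slice R^o) :
  jet_on K (c *: f + g) = c *: jet_on K f + jet_on K g.
Proof. by apply: val_inj; rewrite /= jet_lc. Qed.

End JetUniqueness.

Lemma comp_seminorm (R : realType) (V W : lmodType R) (L : V -> W) (p : seminorm W) :
  (forall c x y, L (c *: x + y) = c *: L x + L y) -> exists q : seminorm V, forall v, q v = p (L v).
Proof.
move=> LL; have LD x y : L (x + y) = L x + L y by have := LL 1 x y; rewrite !scale1r.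
have L0 : L 0 = 0 by apply: (addIr (L 0)); rewrite -LD !add0r.
have LZ c x : L (c *: x) = c *: L x by have := LL c x 0; rewrite !addr0 L0 addr0.
have pD x y : p (L (x + y)) <= p (L x) + p (L y) by rewrite LD seminormD.
have pZ c x : p (L (c *: x)) = `|c| * p (L x) by rewrite LZ seminormZ.
by exists (Seminorm pD pZ).
Qed.

Lemma weight_norm_ge (R : realType) (M : weight_sequence R) (V : normedModType R) (K : set V)
  (r : nat -> R) (J : jets K R^o) (p : R) k x (v : 'I_k -> V) : (forall k, 0 <= r k) -> 0 <= p ->
  (weight_norm M r J <= p%:E)%E -> (forall i, `|v i| <= 1) -> r k / factM M k * `|jet_coef J x v| <= p.
Proof.
move=> r0 p0 Jp v1; have [rk|rk] := ltP 0 (r k); last first.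
  by rewrite (_ : r k = 0) ?mul0r//; apply/eqP; rewrite eq_le rk r0.
have rM : 0 < r k / factM M k by rewrite divr_gt0// factM_gt0.
rewrite -ler_pdivlMl//; apply: opnorm_ub v1; apply: (@le_trans _ _ (jet_norm k J)).
  by apply: nnsup_ubound; exists x.
rewrite EFinM lee_pdivlMl//; apply: le_trans Jp; apply: nnsup_ubound; by exists k.
Qed.

(** The Roumieu condition says that S is bounded in one step, and every admissible seminorm is
    bounded by a multiple of the norm of that step. *)
Lemma ujet_seminorm_bounded (R : realType) (md : umode) (M : weight_sequence R)
  (V : normedModType R) (K : set V) (S : set (ujet md M K R^o)) (q : seminorm (ujet md M K R^o)) :
  ujet_seminorms q ->
  (md = Beurling -> forall rho : R, 0 < rho -> exists C : R, forall J : ujet md M K R^o, S J ->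
     (jet_rho_norm M rho (ujet_val J) <= C%:E)%E) /\
  (md = Roumieu -> exists2 rho : R, 0 < rho & exists C : R, forall J : ujet md M K R^o, S J ->
     (jet_rho_norm M rho (ujet_val J) <= C%:E)%E) ->
  exists C : R, forall J : ujet md M K R^o, S J -> q J <= C.
Proof.
case: md S q => S q Sq [HB HR].
  have [rho rho0 qE] := Sq; have [C HC] := HB erefl rho rho0.
  by exists C => J SJ; rewrite -lee_fin qE; exact: HC.
have [rho rho0 [C HC]] := HR erefl; have [C' HC'] := Sq rho rho0.
exists (`|C'| * C) => J SJ; have JC := HC J SJ; rewrite -lee_fin EFinM.
have n0 : (0 <= jet_rho_norm M rho (ujet_val J))%E by rewrite le_max nnsup_ge0.
have := HC' J (le_lt_trans JC (ltry _)); move: JC n0; case: (jet_rho_norm _ _ _) => [n| |]//=.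
rewrite -!EFinM !lee_fin => nC n0 h; apply: le_trans h _.
exact: le_trans (ler_wpM2r n0 (ler_norm _)) (ler_wpM2l (normr_ge0 _) nC).
Qed.

Section UltraTopology.
Context (R : realType) (md : umode) (M : weight_sequence R).
Context (E F : tvsType R) (cE : convenient E) (U : set E) (oU : cinf_open U).
Implicit Type u : ultra md M U F.

(** Jet families belong to functions on all of E of which only the values on U matter; this passes
    from elements of C^[M](U, F) to such functions. *)
Definition extend_map (u : U -> F) (x : E) : F :=
  if pselect (U x) is left Ux then u (SigSub (mem_set Ux)) else 0.

Lemma extend_mapE (u : U -> F) (x : U) : extend_map u (val x) = u x.
Proof.
rewrite /extend_map; case: pselect => [Ux|/(_ (set_valP x))//].
by congr u; exact: val_inj.
Qed.

Lemma jet_pullback u D (i : ultra_index E F) : ujets md M U (extend_map u) D ->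
  jet (ultra_pullback i u) = scalar_jet D (Cdual (@ui_continuous _ _ _ i)) (@disk_slice R E U (ui_disk i)).
Proof.
move=> uD; have H := ujets_ubanach cE oU uD (l := Cdual (@ui_continuous _ _ _ i)) (g := ultra_pullback i u).
apply: (frechet_jet_uniq oU (jetP (ultra_pullback i u)).1 (H _).1) => x /=.
by rewrite -(extend_mapE u (slice_incl x)).
Qed.

Lemma ultra_weight_seminorm (l : cdual F) (r : nat -> R) (B : disk E) (K : set (disk_space B)) :
  test_weight md r -> compact K ->
  convex_set (K : set (convex_lmodType (disk_space B))) -> (forall y, K y -> U (disk_incl y)) ->
  exists2 q : seminorm (ultra md M U F), nbhs (0 : ultra md M U F) [set x | q x < 1] &
    forall u D y s, ujets md M U (extend_map u) D -> K y -> in_disk B s ->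
      r (size s) / factM M (size s) * `|l (D s (disk_incl y))| <= q u.
Proof.
move=> tr cK vK KU.
pose K' : compact_convex_subset (@disk_slice R E U B) := CompactConvexSubset KU cK vK.
pose i := UltraIndex (@cdual_continuous _ _ l) B.
have [p p1 pE] := @ujet_weight_seminorm R md M _ K' r tr.
have [q qE] := comp_seminorm p (jet_on_lc oU K').
have [q' q'E] : exists q' : seminorm (ultra md M U F), forall u, q' u = q (ultra_pullback i u).
  by apply: comp_seminorm => c f g; apply: val_inj; apply/funext => x /=; rewrite linearP.
have q1 : nbhs (0 : ubanach md M (@disk_slice R E U B) R^o) [set x | q x < 1].
  exact: (@initial_seminorms_nbhs _ _ _ _ (@jet_on R md M _ (@disk_slice R E U B) R^o) K' p q p1 qE).
have q'1 : nbhs (0 : ultra md M U F) [set x | q' x < 1].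
  exact: (@initial_seminorms_nbhs _ _ _ _ (@ultra_pullback R md M E U F) i q q' q1 q'E).
exists q' => // u D y s uD Ky sB.
have [v [v1 vs]] := dirs_lift sB; rewrite q'E qE -[in X in X <= _]vs.
have pu := pE (jet_on K' (ultra_pullback i u)).
have wle : (weight_norm M r (ujet_val (jet_on K' (ultra_pullback i u))) <=
    (p (jet_on K' (ultra_pullback i u)))%:E)%E by rewrite pu.
have := weight_norm_ge (SigSub (mem_set Ky)) tr.1 (seminorm_ge0 p _) wle v1.
rewrite /= (jet_pullback i uD).
by rewrite size_dirs.
Qed.

Theorem ultra_bounded_jets (Q : set (ultra md M U F)) : tvs_bounded Q ->
  forall (l : cdual F) (r : nat -> R) (B : disk E) (K : set (disk_space B)), test_weight md r -> compact K ->
  convex_set (K : set (convex_lmodType (disk_space B))) -> (forall y, K y -> U (disk_incl y)) ->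
  exists C : R, forall u D y s, Q u -> ujets md M U (extend_map u) D -> K y -> in_disk B s ->
    r (size s) / factM M (size s) * `|l (D s (disk_incl y))| <= C.
Proof.
move=> bQ l r B K tr cK vK KU; have [q q1 Hq] := ultra_weight_seminorm l tr cK vK KU.
have [C HC] := bounded_seminorm bQ q1.
by exists C => u D y s Qu uD Ky sB; apply: le_trans (HC u Qu); exact: Hq.
Qed.

(** Both initial topologies are unfolded down to the seminorms of jets on a compact convex set.
    There [test_mode_bounded], applied to all u in Q together, exchanges weights for rates: in the
    Roumieu case a single rho serves the whole of Q. *)
Theorem jets_ultra_bounded (Q : set (ultra md M U F)) (D : ultra md M U F -> seq E -> E -> F) :
  (forall u, Q u -> ujets md M U (extend_map u) (D u)) ->
  (forall (l : cdual F) (r : nat -> R) (B : disk E) (K : set (disk_space B)), test_weight md r -> compact K ->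
    convex_set (K : set (convex_lmodType (disk_space B))) -> (forall y, K y -> U (disk_incl y)) ->
    exists C : R, forall u y s, Q u -> K y -> in_disk B s ->
      r (size s) / factM M (size s) * `|l (D u s (disk_incl y))| <= C) ->
  tvs_bounded Q.
Proof.
move=> QD HQ; apply: tvs_bounded_seminorm => p p1; apply: seminormed_bounded p1 => {}p [i [q qc pE]].
have [C HC] : exists C : R, forall g, (ultra_pullback i @` Q) g -> q g <= C; last first.
  by exists C => u Qu; rewrite pE; apply: HC; exists u.
apply: seminormed_bounded (continuous_seminorm_nbhs qc) => {qc pE}q [K [q' qc qE]].
have [C HC] : exists C : R, forall g, (jet_on K @` (ultra_pullback i @` Q)) g -> q' g <= C; last first.
  by exists C => g Qg; rewrite qE; apply: HC; exists g.
apply: seminormed_bounded (continuous_seminorm_nbhs qc) => {qc qE}q' Pq'.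
pose l := Cdual (@ui_continuous _ _ _ i); pose B := ui_disk i.
have KU y : ccset K y -> U (disk_incl y) := @ccset_sub _ _ _ K y.
pose A k a := exists u y s, [/\ Q u, ccset K y, in_disk B s & size s = k /\ a = `|l (D u s (disk_incl y))| / factM M k].
have bA : mode_bounded md A.
  apply: test_mode_bounded => [k _ [u [y [s [_ _ _ [_ ->]]]]]|r tr].
    by rewrite divr_ge0// ltW// factM_gt0.
  have [C HC] := HQ l r B (ccset K) tr (@ccset_compact _ _ _ K) (@ccset_convex _ _ _ K) KU.
  exists C => k _ [u [y [s [Qu Ky sB [<- ->]]]]]; have := HC u y s Qu Ky sB.
  by rewrite mulrAC -mulrA.
have rate rho C : 0 < rho -> (forall k a, A k a -> a <= C * rho ^+ k) -> forall g,
    (jet_on K @` (ultra_pullback i @` Q)) g -> (jet_rho_norm M rho (ujet_val g) <= `|C|%:E)%E.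
  move=> rho0 HC _ [_ [u Qu <-] <-]; rewrite /= (jet_pullback i (QD u Qu)).
  apply: (scalar_jet_rho_norm cE oU (QD u Qu) (@ccset_convex _ _ _ K) KU) => // y s Ky sB.
  have := HC (size s) (`|l (D u s (disk_incl y))| / factM M (size s)).
  rewrite ler_pdivrMr ?factM_gt0// => h; apply: le_trans (h _) _; first by exists u, y, s.
  rewrite mulrA; apply: ler_wpM2r; first exact/ltW/factM_gt0.
  by apply: ler_wpM2r; [rewrite exprn_ge0// ltW|exact: ler_norm].
apply: (ujet_seminorm_bounded Pq'); split=> mdE; rewrite mdE /mode_bounded in bA.
  by move=> rho rho0; have [C HC] := bA rho rho0; exists `|C|; exact: rate.
by have [rho rho0 [C HC]] := bA; exists rho => //; exists `|C|; exact: rate.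
Qed.

End UltraTopology.

(** * Separation and Mackey completeness of C^[M](U, F) *)

Section Separation.
Context (R : realType).

Lemma cdual_hausdorff (E : tvsType R) :
  (forall x y : E, (forall l : cdual E, l x = l y) -> x = y) -> hausdorff_space E.
Proof.
move=> sep p q pq; apply: sep => l; apply: (@norm_hausdorff R R^o) => A B Ap Bq.
have lp : nbhs p ((l : E -> R^o) @^-1` A) by exact: (@cdual_continuous _ _ l p).
have lq : nbhs q ((l : E -> R^o) @^-1` B) by exact: (@cdual_continuous _ _ l q).
by have [x [Ax Bx]] := pq _ _ lp lq; exists (l x).
Qed.

Lemma cvg_dist_le (a : nat -> R) (b c d : R) N : (a n : R^o) @[n --> \oo] --> (b : R^o) ->
  (forall n, (N <= n)%N -> `|a n - d| <= c) -> `|b - d| <= c.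
Proof.
move=> /cvgrPdist_le ab H; apply/ler_addgt0Pr => e e0; have [m _ Hm] := ab e e0.
have h1 := Hm (maxn m N) (leq_maxl _ _); have h2 := H (maxn m N) (leq_maxr _ _).
by rewrite [c + e]addrC; apply: le_trans (ler_distD (a (maxn m N)) b d) (lerD h1 h2).
Qed.

Lemma seminorm_cvg (E : tvsType R) (u : nat -> E) (v : E) :
  (forall p : seminorm E, nbhs 0 [set x | p x < 1] ->
    exists N, forall n, (N <= n)%N -> p (u n - v) < 1) -> u @ \oo --> v.
Proof.
move=> H A /(nbhsB (- v)); rewrite addNr => vA; have [p p1 pA] := nbhs0_seminorm vA.
have [N HN] := H p p1; exists N => // n /= /HN/pA[z Az zE].
suff -> : u n = z by [].
by apply: (addrI (- v)); rewrite zE addrC.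
Qed.

End Separation.

Section JetAlgebra.
Context (R : realType) (md : umode) (M : weight_sequence R).
Context (E F : tvsType R) (cE : convenient E) (cF : convenient F) (U : set E) (oU : cinf_open U).

Lemma ujets_ext (f g : E -> F) D : (forall x, U x -> f x = g x) -> ujets md M U f D -> ujets md M U g D.
Proof. by move=> fg [D0 Dd Db]; split=> // x Ux; rewrite D0// fg. Qed.

Lemma ujets_uniq (f g : E -> F) D L : (forall x, U x -> f x = g x) ->
  ujets md M U f D -> ujets md M U g L -> forall s x, U x -> D s x = L s x.
Proof.
move=> fg fD gL; elim=> [|w s IH] x Ux.
  by have [-> // _ _] := fD; have [-> // _ _] := gL; exact: fg.
apply: cdual_ext cF.1 _ => l; have [_ Dd _] := fD; have [_ Ld _] := gL.
apply: hasd_uniq (Dd l s x w Ux) _; apply: hasd_ext (Ld l s x w Ux).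
have [d d0 dU] := cinf_open_line cE oU w Ux.
by exists d => // h /ltW hd; rewrite add0r IH//; exact: dU.
Qed.

Lemma ujets_lc (a : R) (f g : E -> F) D L : ujets md M U f D -> ujets md M U g L ->
  ujets md M U (fun x => a *: f x + g x) (fun s x => a *: D s x + L s x).
Proof.
move=> [D0 Dd Db] [L0 Ld Lb]; split=> [x Ux|l s x w Ux|r B K tr cK vK KU l].
- by rewrite D0// L0.
- rewrite cdualD cdualZ (_ : (fun h => _) = fun h => a * l (D s (x + h *: w)) + l (L s (x + h *: w))).
    by apply: hasdD; [apply: hasdZ; exact: Dd|exact: Ld].
  by apply/funext => h; rewrite cdualD cdualZ.
have [C HC] := Db r B K tr cK vK KU l; have [C' HC'] := Lb r B K tr cK vK KU l.
exists (`|a| * C + C') => _ [y [s [Ky sB ->]]].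
have -> : (r (size s) / factM M (size s)) *: (a *: D s (disk_incl y) + L s (disk_incl y)) =
    a *: ((r (size s) / factM M (size s)) *: D s (disk_incl y)) +
    (r (size s) / factM M (size s)) *: L s (disk_incl y) by rewrite scalerDr !scalerA [_ * a]mulrC.
rewrite cdualD cdualZ.
apply: le_trans (ler_normD _ _) _; rewrite normrM; apply: lerD.
  by rewrite ler_wpM2l//; apply: HC; exists y, s.
by apply: HC'; exists y, s.
Qed.

Implicit Type u : ultra md M U F.

Lemma extend_lc (a : R) u v x : U x -> extend_map (a *: u + v) x = a *: extend_map u x + extend_map v x.
Proof. by move=> Ux; rewrite /extend_map; case: pselect. Qed.

Lemma ultra_jets_ex u : exists D, ujets md M U (extend_map u) D.
Proof.
have uu : is_ultra md M u by exact: set_mem (valP u).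
exact: (ultra_has_jets cE cF oU uu (fun x => esym (extend_mapE u x))).
Qed.

Definition ultra_jets u := projT1 (cid (ultra_jets_ex u)).

Lemma ultra_jetsP u : ujets md M U (extend_map u) (ultra_jets u).
Proof. exact: projT2 (cid (ultra_jets_ex u)). Qed.

Lemma ultra_jets_uniq u D : ujets md M U (extend_map u) D ->
  forall s x, U x -> ultra_jets u s x = D s x.
Proof. by move=> uD; exact: ujets_uniq (ultra_jetsP u) uD. Qed.

Lemma ultra_jets_lc (a : R) u v s x : U x ->
  ultra_jets (a *: u + v) s x = a *: ultra_jets u s x + ultra_jets v s x.
Proof.
apply: ujets_uniq (ultra_jetsP _) (ujets_lc a (ultra_jetsP u) (ultra_jetsP v)) s x => x Ux.
exact: extend_lc.
Qed.

Lemma ultra_jetsZ (a : R) u s x : U x -> ultra_jets (a *: u) s x = a *: ultra_jets u s x.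
Proof.
move=> Ux; have J0 : ultra_jets 0 s x = 0.
  have h := ultra_jets_lc 1 0 0 s Ux; rewrite scaler0 addr0 scale1r in h.
  by apply: (addIr (ultra_jets 0 s x)); rewrite add0r -h.
by have := ultra_jets_lc a u 0 s Ux; rewrite J0 !addr0.
Qed.

Lemma ultra_jetsD u v s x : U x -> ultra_jets (u + v) s x = ultra_jets u s x + ultra_jets v s x.
Proof. by move=> Ux; have := ultra_jets_lc 1 u v s Ux; rewrite !scale1r. Qed.

Lemma ultra_jetsB u v s x : U x -> ultra_jets (u - v) s x = ultra_jets u s x - ultra_jets v s x.
Proof. by move=> Ux; rewrite ultra_jetsD// -scaleN1r ultra_jetsZ// scaleN1r. Qed.

Lemma convex_set1 (B : disk E) (X : disk_space B) : convex_set ([set X] : set (convex_lmodType (disk_space B))).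
Proof. by apply/convex_setP => _ _ t -> -> _; rewrite -scalerDl subrKC scale1r. Qed.

Lemma ultra_jets_continuous (l : cdual F) s x : U x -> exists2 q : seminorm (ultra md M U F),
  nbhs (0 : ultra md M U F) [set x | q x < 1] & forall u, `|l (ultra_jets u s x)| <= q u.
Proof.
move=> Ux; have [B [X XE HB]] := disk_frame cE s x; rewrite -XE in Ux.
have KU (y : disk_space B) : [set X] y -> U (disk_incl y) by move=> ->.
have [q q1 Hq] := @ultra_weight_seminorm R md M E F cE U oU l _ B _ (test_trunc_weight md M (size s)) (@compact_set1 _ X) (@convex_set1 B X) KU.
exists q => // u; have := Hq u _ X s (ultra_jetsP u) erefl (fun v vs => (HB v vs).1).
by rewrite /trunc_weight leqnn mulfV ?gt_eqF ?factM_gt0// mul1r XE.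
Qed.

(** Derivatives at a point, followed by a functional, are continuous functionals of u; those of
    order 0 separate the points of C^[M](U, F). *)
Lemma ultra_jets_cdual (l : cdual F) s x : U x ->
  exists k : cdual (ultra md M U F), forall u, k u = l (ultra_jets u s x).
Proof.
move=> Ux; have [|k kE] := @linear_of R (ultra md M U F) R^o (fun u => l (ultra_jets u s x)).
  by move=> a u v; rewrite ultra_jets_lc// cdualD cdualZ.
have [q q1 Hq] := ultra_jets_continuous l s Ux.
have kc : continuous k.
  by apply: (@linear_continuous_seminorm _ _ q k 1) => // u; rewrite kE mul1r.
by exists (Cdual kc).
Qed.

Lemma ultra_jets0 u x : ultra_jets u [::] (val x) = u x :> F.
Proof. by have [D0 _ _] := ultra_jetsP u; rewrite D0 ?extend_mapE//; exact: set_valP. Qed.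

Lemma ultra_hausdorff : hausdorff_space (ultra md M U F).
Proof.
apply: cdual_hausdorff => u v uv; apply: val_inj; apply/funext => x.
apply: cdual_ext cF.1 _ => l; have [k kE] := ultra_jets_cdual l [::] (set_valP x).
by have := uv k; rewrite !kE !ultra_jets0.
Qed.

Section Completeness.
Context (u : nat -> ultra md M U F) (Q : set (ultra md M U F)) (mu : nat -> nat -> R).
Hypothesis bQ : tvs_bounded Q.
Hypothesis mu0 : forall e : R, 0 < e -> exists N, forall m n, (N <= m)%N -> (N <= n)%N -> `|mu m n| <= e.
Hypothesis uQ : forall m n, exists2 b, Q b & u m - u n = mu m n *: b.

Let jets_diff m n : exists2 b, Q b & forall s x, U x ->
  ultra_jets (u m) s x - ultra_jets (u n) s x = mu m n *: ultra_jets b s x.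
Proof.
have [b Qb ub] := uQ m n; exists b => // s x Ux.
by rewrite -[u m](subrK (u n)) ub ultra_jets_lc// addrK.
Qed.

Let jets_cvg s x : U x -> exists e : F, ultra_jets (u n) s x @[n --> \oo] --> e.
Proof.
move=> Ux; apply: (weak_mackey_cvg cF (mu := mu)) => // l.
have [q q1 Hq] := ultra_jets_continuous l s Ux; have [C HC] := bounded_seminorm bQ q1.
exists C => m n; have [b Qb bE] := jets_diff m n.
rewrite -cdualB bE// cdualZ normrM mulrC ler_wpM2r//.
exact: le_trans (Hq b) (HC b Qb).
Qed.

Let jets_lim_ex s x : exists e : F, U x -> ultra_jets (u n) s x @[n --> \oo] --> e.
Proof.
have [/jets_cvg h|nU] := pselect (U x); last by exists 0.
by have [e He] := h s; exists e.
Qed.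

Definition jets_lim s x := projT1 (cid (jets_lim_ex s x)).

Let jets_limP s x : U x -> ultra_jets (u n) s x @[n --> \oo] --> jets_lim s x.
Proof. exact: projT2 (cid (jets_lim_ex s x)). Qed.

(** The weighted jets converge uniformly on K at the rate of mu: differences u m - u n are mu m n
    times elements of the bounded set Q, and the resulting estimate passes to the limit in m. *)
Let jets_lim_rate (l : cdual F) (r : nat -> R) (B : disk E) (K : set (disk_space B)) : test_weight md r -> compact K ->
  convex_set (K : set (convex_lmodType (disk_space B))) -> (forall y, K y -> U (disk_incl y)) ->
  exists2 C : R, 0 <= C & forall e n y s, 0 < e -> (forall m, (n <= m)%N -> `|mu m n| <= e) -> K y -> in_disk B s ->
    r (size s) / factM M (size s) * `|l (jets_lim s (disk_incl y)) - l (ultra_jets (u n) s (disk_incl y))| <= e * C.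
Proof.
move=> tr cK vK KU; have [C HC] := ultra_bounded_jets cE oU bQ l tr cK vK KU.
exists `|C| => // e n y s e0 ne Ky sB; have Uy := KU y Ky.
have c0 : 0 <= r (size s) / factM M (size s) by rewrite divr_ge0 ?tr.1// ltW// factM_gt0.
have [c_0|cn] := eqVneq (r (size s) / factM M (size s)) 0; first by rewrite c_0 mul0r mulr_ge0// ltW.
have cp : 0 < r (size s) / factM M (size s) by rewrite lt_neqAle eq_sym cn.
rewrite -ler_pdivlMl//.
have H m : (n <= m)%N -> `|l (ultra_jets (u m) s (disk_incl y)) - l (ultra_jets (u n) s (disk_incl y))| <=
    (r (size s) / factM M (size s))^-1 * (e * `|C|).
  move=> nm; have [b Qb bE] := jets_diff m n; rewrite -cdualB bE// cdualZ normrM ler_pdivlMl//.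
  rewrite mulrCA; apply: ler_pM (ne m nm) _ => //; first exact: mulr_ge0.
  by apply: le_trans (ler_norm C); exact: HC (ultra_jetsP b) Ky sB.
apply: (@cvg_dist_le R (fun m => l (ultra_jets (u m) s (disk_incl y)))
  (l (jets_lim s (disk_incl y))) _ _ n _ H).
by apply: cdual_cvg; exact: jets_limP.
Qed.

Let mu_small e : 0 < e -> exists n, forall m, (n <= m)%N -> `|mu m n| <= e.
Proof. by move=> /mu0[N HN]; exists N => m Nm; exact: HN. Qed.

(** Second order remainders are bounded uniformly in n, because the second derivatives of the u n
    are; so the estimate survives the limit and shows that the limits are derivatives of one
    another. The weighted bound follows by comparison with one u N. *)
Lemma jets_lim_ujets : ujets md M U (jets_lim [::]) jets_lim.
Proof.
split=> // [l s x w Ux|r B K tr cK vK KU l].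
  have [d d0 dU] := cinf_open_line cE oU w Ux.
  have [B [X XE HB]] := disk_frame cE (w :: s) x.
  have [_ [V VE _]] := HB w (mem_head _ _).
  pose K := [set X + h *: V | h in `[- d, d]%classic].
  have KU y : K y -> U (disk_incl y).
    move=> [h]; rewrite /= in_itv /= -ler_norml => hd <-.
    by rewrite disk_inclD disk_inclZ XE VE; exact: dU.
  have [C HC] := ultra_bounded_jets cE oU bQ l (test_trunc_weight md M (size s).+2)
    (@compact_segment R E B X V d) (@convex_segment R E B X V d) KU.
  have [N HN] := mu_small ltr01.
  have [C' C'0 HC'] := ujets_compactN cE oU (ultra_jetsP (u N)) l (size s).+2 (@compact_segment R E B X V d) KU.
  have sB : in_disk B [:: w, w & s].
    move=> v; rewrite in_cons => /predU1P[->|vs]; first by have [] := HB w (mem_head _ _).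
    by have [] := HB v vs.
  have bnd n y : (N <= n)%N -> K y -> `|l (ultra_jets (u n) [:: w, w & s] (disk_incl y))| <= C' + `|C|.
    move=> Nn Ky; have [b Qb bE] := jets_diff n N.
    rewrite -[ultra_jets (u n) _ _](subrK (ultra_jets (u N) [:: w, w & s] (disk_incl y))) bE; last exact: KU.
    rewrite addrC cdualD cdualZ; apply: le_trans (ler_normD _ _) _; apply: lerD; first exact: HC'.
    rewrite normrM; have := HC b _ y [:: w, w & s] Qb (ultra_jetsP b) Ky sB.
    rewrite /trunc_weight leqnn mulfV ?gt_eqF ?factM_gt0// mul1r => h.
    apply: le_trans (ler_piMl _ (HN n Nn)) _ => //; exact: le_trans h (ler_norm _).
  apply: (@hasd_quad _ _ _ _ d (C' + `|C|)) => // h hd; rewrite add0r scale0r addr0.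
  have Uh := dU h hd.
  have H n : (N <= n)%N -> `|l (ultra_jets (u n) s (x + h *: w)) - l (ultra_jets (u n) s x)
      - h * l (ultra_jets (u n) (w :: s) x) - 0| <= (C' + `|C|) * h ^+ 2.
    move=> Nn; rewrite subr0; have th (t : R) : 0 <= t <= 1 -> `|t * h| <= d.
      by move=> /andP[t0 t1]; apply: le_trans hd; rewrite normrM (ger0_norm t0) ler_piMl.
    apply: (ujets_taylor2 (ultra_jetsP (u n))) => t /th thd; first exact: dU.
    have := bnd n (X + (t * h) *: V) Nn; rewrite disk_inclD disk_inclZ XE VE; apply.
    by exists (t * h) => //; rewrite /= in_itv /= -ler_norml.
  rewrite -[X in `|X| <= _]subr0; apply: (cvg_dist_le (N := N) _ H).
  apply: cvgB; first by apply: cvgB; apply: cdual_cvg; exact: jets_limP.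
  by apply: cvgMr; apply: cdual_cvg; exact: jets_limP.
have [C C0 HC] := jets_lim_rate l tr cK vK KU; have [N HN] := mu_small ltr01.
have [C' HC'] := ujets_compact cE oU (ultra_jetsP (u N)) l tr cK KU.
exists (C + C') => _ [y [s [Ky sB ->]]].
have c0 : 0 <= r (size s) / factM M (size s) by rewrite divr_ge0 ?tr.1// ltW// factM_gt0.
rewrite cdualZ normrM (ger0_norm c0).
have := HC 1 N y s ltr01 HN Ky sB; have := HC' y s Ky sB; rewrite mul1r => h1 h2.
apply: le_trans (lerD h2 h1); rewrite -mulrDr; apply: ler_wpM2l => //.
rewrite -{1}[l (jets_lim _ _)](subrK (l (ultra_jets (u N) s (disk_incl y)))); exact: ler_normD.
Qed.

Lemma ultra_limit_pred : (fun x : U => jets_lim [::] (val x)) \in @ultra_pred R md M E U F.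
Proof. by apply: mem_set; exact: (ujets_is_ultra cE oU jets_lim_ujets). Qed.

(** By [jets_lim_rate], the errors divided by their rates form a bounded set. Hence a continuous
    seminorm of u n - v is bounded by a multiple of the rate, which tends to 0. *)
Lemma ultra_limit_cvg : u @ \oo --> Ultra ultra_limit_pred.
Proof.
set v := Ultra _.
have vE s x : U x -> ultra_jets v s x = jets_lim s x.
  apply: ujets_uniq (ultra_jetsP v) jets_lim_ujets s x => x Ux.
  by have := extend_mapE v (SigSub (mem_set Ux)).
pose S := [set z | exists e n, [/\ 0 < e, forall m, (n <= m)%N -> `|mu m n| <= e & z = e^-1 *: (u n - v)]].
have bS : tvs_bounded S.
  apply: (jets_ultra_bounded cE oU (D := ultra_jets)) => [z _|l r B K tr cK vK KU]; first exact: ultra_jetsP.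
  have [C C0 HC] := jets_lim_rate l tr cK vK KU.
  exists C => _ y s [e [n [e0 ne ->]]] Ky sB; have Uy := KU y Ky.
  have -> : ultra_jets (e^-1 *: (u n - v)) s (disk_incl y) =
      e^-1 *: (ultra_jets (u n) s (disk_incl y) - jets_lim s (disk_incl y)).
    by rewrite ultra_jetsZ// ultra_jetsB// vE.
  rewrite cdualZ normrM normfV (gtr0_norm e0) mulrCA ler_pdivrMl// cdualB distrC.
  exact: HC.
apply: seminorm_cvg => p p1; have [C HC] := bounded_seminorm bS p1.
have C1 : 0 < `|C| + 1 by rewrite ltr_wpDl.
have e0 : 0 < (`|C| + 1)^-1 / 2 by rewrite divr_gt0// invr_gt0.
have [N HN] := mu0 e0; exists N => n Nn.
have := HC (((`|C| + 1)^-1 / 2)^-1 *: (u n - v)).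
rewrite seminormZ normfV (gtr0_norm e0) ler_pdivrMl// => H.
apply: le_lt_trans (H _) _.
  by exists ((`|C| + 1)^-1 / 2), n; split=> // m nm; apply: HN => //; exact: leq_trans nm.
rewrite mulrAC ltr_pdivrMr// mulrC ltr_pdivrMr// mul1r.
apply: le_lt_trans (ler_norm C) _; apply: (@lt_le_trans _ _ (`|C| + 1)); first by rewrite ltrDl.
by rewrite ler_peMl ?ler1n// ltW.
Qed.

End Completeness.

Theorem ultra_convenient : convenient (ultra md M U F).
Proof.
split; first exact: ultra_hausdorff.
move=> u [Q [mu [bQ _ mu0 uQ]]]; eexists; exact: (@ultra_limit_cvg u Q mu bQ mu0 uQ).
Qed.

End JetAlgebra.
(** * Linear maps and products *)

Section LinearMaps.
Context (R : realType).

Lemma cdual_comp (E F : tvsType R) (T : E -> F) (l : cdual F) :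
  (forall a x y, T (a *: x + y) = a *: T x + T y) -> continuous T ->
  exists k : cdual E, forall x, k x = l (T x).
Proof.
move=> TL cT; have [|k kE] := @linear_of R E R^o (fun x => l (T x)).
  by move=> a x y; rewrite TL cdualD cdualZ.
have kc : continuous k.
  rewrite (_ : (k : E -> R^o) = (fun x => l (T x))); last by apply/funext.
  by move=> x; apply: continuous_comp; [exact: cT|exact: cdual_continuous].
by exists (Cdual kc).
Qed.

Lemma wbounded_linear (E F : tvsType R) (T : E -> F) (S : set E) :
  (forall a x y, T (a *: x + y) = a *: T x + T y) -> continuous T ->
  wbounded S -> wbounded (T @` S).
Proof.
move=> TL cT wS l; have [k kE] := cdual_comp l TL cT; have [C HC] := wS k.
by exists C => _ [x Sx <-]; rewrite -kE; exact: HC.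
Qed.

Lemma linear_smooth_curve (E F : tvsType R) (T : E -> F) (c : R -> E) :
  (forall a x y, T (a *: x + y) = a *: T x + T y) -> continuous T ->
  smooth_curve c -> smooth_curve (fun t => T (c t)).
Proof.
move=> TL cT [d [<- Hd]]; exists (fun n t => T (d n t)); split=> // n t.
have TB a x y : T (a *: (x - y)) = a *: (T x - T y).
  have T0 : T 0 = 0 by have := TL (-1) 0 0; rewrite scaler0 addr0 scaleN1r addNr.
  have := TL a (x - y) 0; rewrite T0 !addr0 => ->; congr (_ *: _).
  by rewrite addrC -scaleN1r TL scaleN1r addrC.
rewrite (_ : (fun h => _) = (fun h => T (h^-1 *: (d n (t + h) - d n t)))).
  by apply: cvg_comp (Hd n t) _; exact: cT.
by apply/funext => h; rewrite TB.
Qed.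

Lemma mackey_cauchy_linear (E F : tvsType R) (T : E -> F) (u : nat -> E) : convenient F ->
  (forall a x y, T (a *: x + y) = a *: T x + T y) -> continuous T ->
  mackey_cauchy u -> exists e : F, (fun n => T (u n)) @ \oo --> e.
Proof.
move=> cF TL cT [Q [mu [bQ _ mu0 uQ]]]; apply: (weak_mackey_cvg cF (mu := mu)) => // l.
have [k kE] := cdual_comp l TL cT; have [C HC] := bounded_wbounded bQ k.
exists C => m n; have [b Qb ub] := uQ m n.
by rewrite -!kE -cdualB ub cdualZ normrM mulrC ler_wpM2r//; exact: HC.
Qed.

End LinearMaps.

Section Products.
Context (R : realType).

Lemma fst_continuous (E F : tvsType R) : continuous (fst : (E * F)%type -> E).
Proof. by move=> x; exact: cvg_fst. Qed.

Lemma snd_continuous (E F : tvsType R) : continuous (snd : (E * F)%type -> F).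
Proof. by move=> x; exact: cvg_snd. Qed.

Lemma inl_continuous (E F : tvsType R) : continuous (fun x : E => (x, 0) : (E * F)%type).
Proof. by move=> x; apply: cvg_pair; [exact: cvg_id|exact: cvg_cst]. Qed.

Lemma inr_continuous (E F : tvsType R) : continuous (fun y : F => (0, y) : (E * F)%type).
Proof. by move=> x; apply: cvg_pair; [exact: cvg_cst|exact: cvg_id]. Qed.

Lemma inl_linear (E F : tvsType R) a (x y : E) :
  (a *: x + y, 0) = a *: (x, 0) + (y, 0) :> (E * F)%type.
Proof. by apply: injective_projections; rewrite /= ?scaler0 ?addr0. Qed.

Lemma inr_linear (E F : tvsType R) a (x y : F) :
  (0, a *: x + y) = a *: (0, x) + (0, y) :> (E * F)%type.
Proof. by apply: injective_projections; rewrite /= ?scaler0 ?addr0. Qed.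

Lemma cdual_pair (E F : tvsType R) (l : cdual (E * F)%type) :
  exists (l1 : cdual E) (l2 : cdual F), forall z, l z = l1 z.1 + l2 z.2.
Proof.
have [l1 H1] := cdual_comp l (@inl_linear E F) (@inl_continuous E F).
have [l2 H2] := cdual_comp l (@inr_linear E F) (@inr_continuous E F).
exists l1, l2 => -[x y]; rewrite H1 H2 -cdualD; congr (l _).
by apply: injective_projections; rewrite /= ?addr0 ?add0r.
Qed.

Lemma wbounded_pair (E F : tvsType R) (S : set (E * F)%type) :
  wbounded (fst @` S) -> wbounded (snd @` S) -> wbounded S.
Proof.
move=> S1 S2 l; have [l1 [l2 lE]] := cdual_pair l.
have [C1 H1] := S1 l1; have [C2 H2] := S2 l2; exists (C1 + C2) => z Sz; rewrite lE.
by apply: le_trans (ler_normD _ _) (lerD _ _); [apply: H1|apply: H2]; exists z.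
Qed.

Lemma pair_convenient (E F : tvsType R) : convenient E -> convenient F -> convenient (E * F)%type.
Proof.
move=> cE cF; split.
  apply: cdual_hausdorff => -[x y] [x' y'] H; congr pair.
    apply: cdual_ext cE.1 _ => l; have [//|k kE] := @cdual_comp R (E * F)%type E fst l _ (@fst_continuous E F).
    by have := H k; rewrite !kE.
  apply: cdual_ext cF.1 _ => l; have [//|k kE] := @cdual_comp R (E * F)%type F snd l _ (@snd_continuous E F).
  by have := H k; rewrite !kE.
move=> u uc; have [//|x ux] := @mackey_cauchy_linear R (E * F)%type E fst u cE _ (@fst_continuous E F) uc.
have [//|y uy] := @mackey_cauchy_linear R (E * F)%type F snd u cF _ (@snd_continuous E F) uc.
exists (x, y); rewrite (_ : u = fun n => ((u n).1, (u n).2)); last first.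
  by apply/funext => n; case: (u n).
exact: cvg_pair.
Qed.

Lemma cinf_openT (E : tvsType R) : cinf_open [set: E].
Proof. by move=> c _; rewrite preimage_setT; exact: openT. Qed.

Lemma cinf_open_pair (E F : tvsType R) (U : set E) (V : set F) :
  cinf_open U -> cinf_open V -> cinf_open (U `*` V : set (E * F)%type).
Proof.
move=> oU oV c sc; rewrite (_ : _ @^-1` _ = (fun t => (c t).1) @^-1` U `&` (fun t => (c t).2) @^-1` V)//.
apply: openI; [apply: oU|apply: oV].
  exact: (@linear_smooth_curve R (E * F)%type E fst c (fun _ _ _ => erefl) (@fst_continuous E F) sc).
exact: (@linear_smooth_curve R (E * F)%type F snd c (fun _ _ _ => erefl) (@snd_continuous E F) sc).
Qed.

Section InfiniteProducts.
Context (I : Type) (E : I -> tvsType R).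
Local Notation P := (prod_topology E).

Lemma coordinate_continuous i : continuous (fun f : P => f i).
Proof. by move=> f A fA; exact: prodfun_proj_nbhs. Qed.

(* The sets absorbing S form a filter. *)
Lemma wbounded_prod (S : set P) : (forall i, wbounded ((fun f : P => f i) @` S)) -> wbounded S.
Proof.
move=> HS; apply: bounded_wbounded => W W0.
pose G : set_system P := [set A | exists2 r : R, 0 < r & forall t, `|t| <= r -> forall x, S x -> A (t *: x)].
have FG : Filter G.
  split=> [|A B [r r0 HA] [s s0 HB]|A B AB [r r0 HA]]; first by exists 1.
    exists (Num.min r s) => [|t]; first by rewrite lt_min r0.
    by rewrite le_min => /andP[tr ts] x Sx; split; [exact: HA|exact: HB].
  by exists r => // t tr x Sx; apply: AB; exact: HA.
have [r r0 HW] : G W.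
  suff : G --> (0 : P) by apply.
  apply/prodfun_cvg => i A iA; have [p p1 pA] := nbhs0_seminorm iA.
  have [C HC] := bounded_seminorm (wbounded_bounded (HS i)) p1.
  have C1 : 0 < `|C| + 1 by rewrite ltr_wpDl.
  exists (2 * (`|C| + 1))^-1 => [|t tr x Sx]; first by rewrite invr_gt0 mulr_gt0.
  apply: pA; rewrite -[(t *: x) i]/(t *: x i) seminormZ.
  have h : p (x i) <= `|C| + 1.
    apply: le_trans (le_trans (HC (x i) _) (ler_norm C)) _; first by exists x.
    by rewrite lerDl.
  apply: le_lt_trans (ler_pM (normr_ge0 _) (seminorm_ge0 _ _) tr h) _.
  by rewrite invfM mulfVK ?gt_eqF// invf_lt1// ltr1n.
exists r^-1 => [|x Sx]; first by rewrite invr_gt0.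
exists (r *: x); first by apply: HW => //; rewrite gtr0_norm.
by rewrite scalerA mulVf ?scale1r// gt_eqF.
Qed.

Lemma prod_convenient : (forall i, convenient (E i)) -> convenient P.
Proof.
move=> cE; split.
  apply: cdual_hausdorff => f g H; apply: functional_extensionality_dep => i.
  apply: cdual_ext (cE i).1 _ => l.
  have [//|k kE] := @cdual_comp R P (E i) (fun f => f i) l _ (@coordinate_continuous i).
  by have := H k; rewrite !kE.
move=> u uc.
have H i : exists e : E i, (fun n => u n i) @ \oo --> e.
  exact: (@mackey_cauchy_linear R P (E i) (fun f => f i) u (cE i) (fun _ _ _ => erefl) (@coordinate_continuous i) uc).
exists (fun i => projT1 (cid (H i))); apply/prodfun_cvg => i A.
exact: (projT2 (cid (H i))).
Qed.

End InfiniteProducts.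

End Products.

Section JetFamilyConstructions.
Context (R : realType) (md : umode) (M : weight_sequence R).

Lemma quadr_hasd (E : tvsType R) (e : R -> E) e' d (l : cdual E) : 0 < d -> quadr e e' d ->
  hasd (fun h => l (e h)) 0 (l e').
Proof.
move=> d0 /(_ l)[C HC]; apply: (@hasd_quad _ _ _ _ d `|C|) => // h hd; rewrite add0r.
have [->|hn] := eqVneq h 0; first by rewrite subrr mul0r subr0 normr0 mulr_ge0// sqr_ge0.
have h0 : 0 < `|h| <= d by rewrite normr_gt0 hn.
have := HC _ (ex_intro _ h (conj h0 erefl)).
rewrite cdualZ !cdualB cdualZ normrM normfV (ger0_norm (sqr_ge0 h)) ler_pdivrMl ?exprn_even_gt0//.
by move=> /le_trans; apply; rewrite mulrC ler_wpM2r ?sqr_ge0// ler_norm.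
Qed.

(** Replaces the derivative of each functional by a boundedness statement. It serves for values in
    an infinite product or in C^[M](V, G), where boundedness has a criterion that avoids a
    description of the functionals. *)
Lemma ujets_intro (E F : tvsType R) (U : set E) (f : E -> F) (D : seq E -> E -> F) :
  (forall x, U x -> D [::] x = f x) ->
  (forall x w s, U x -> exists2 d : R, 0 < d & quadr (fun h => D s (x + h *: w)) (D (w :: s) x) d) ->
  (forall (r : nat -> R) (B : disk E) (K : set (disk_space B)), test_weight md r ->
        compact K -> convex_set (K : set (convex_lmodType (disk_space B))) ->
        (forall y, K y -> U (disk_incl y)) ->
        wbounded [set z : F | exists y s, [/\ K y, in_disk B s &
          z = (r (size s) / factM M (size s)) *: D s (disk_incl y)]]) ->
  ujets md M U f D.
Proof.
move=> D0 Dd Db; split=> // l s x w Ux; have [d d0 qd] := Dd x w s Ux.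
exact: quadr_hasd l d0 qd.
Qed.

Lemma ujets_linear (E F : tvsType R) (U : set E) (T : E -> F) :
  (forall a x y, T (a *: x + y) = a *: T x + T y) -> continuous T ->
  ujets md M U T (fun s x => match s with [::] => T x | [:: w] => T w | _ => 0 end).
Proof.
move=> TL cT; split=> // [l s x w Ux|r B K tr cK vK KU l].
  have hasd0 (a : R) : hasd (fun=> a) 0 0 by exact: hasd_cst.
  case: s => [|v [|v' s]]; rewrite ?linear0; try exact: hasd_cst.
  have := hasdD (hasdZ (l (T w)) (hasd_id 0)) (hasd_cst (l (T x)) 0).
  rewrite addr0 mulr1; congr hasd; apply/funext => h.
  by rewrite [x + _]addrC TL cdualD cdualZ mulrC.
have [k kE] := cdual_comp l TL cT; have [C C0 HC] := disk_cdual B k.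
have [C1 HC1] := disk_wbounded B k; have /compact_bounded[N [_ HN]] := cK.
pose N1 := N + 1; have {}HN y : K y -> `|y| <= N1.
  by move=> Ky; apply: (HN N1) => //; rewrite ltrDl.
exists (Num.max `|r 0%N / factM M 0 * (C * N1)| `|r 1%N / factM M 1 * C1|).
move=> _ [y [s [Ky sB ->]]]; rewrite cdualZ normrM.
have rM n : 0 <= r n / factM M n by rewrite divr_ge0 ?tr.1// ltW// factM_gt0.
case: s sB => [|w [|w' s]] sB; last by rewrite linear0 normr0 mulr0 le_max normr_ge0.
  rewrite le_max (ger0_norm (rM _)) -kE; apply/orP; left; apply: le_trans (ler_norm _).
  by rewrite ler_wpM2l//; apply: le_trans (HC y) _; rewrite ler_wpM2l//; exact: HN.
rewrite le_max (ger0_norm (rM _)) -kE; apply/orP; right; apply: le_trans (ler_norm _).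
by rewrite ler_wpM2l//; apply: HC1; apply: sB; exact: mem_head.
Qed.

Lemma ultra_on_linear (E F : tvsType R) (U : set E) (T : E -> F) :
  (forall a x y, T (a *: x + y) = a *: T x + T y) -> continuous T -> ultra_on md M U T.
Proof. by move=> TL cT; eexists; exact: ujets_linear. Qed.

Lemma ultra_on_pair (E F G : tvsType R) (U : set E) (f : E -> F) (g : E -> G) :
  ultra_on md M U f -> ultra_on md M U g -> ultra_on md M U (fun x => (f x, g x) : (F * G)%type).
Proof.
move=> [D [D0 Dd Db]] [L [L0 Ld Lb]]; exists (fun s x => (D s x, L s x)).
split=> [x Ux|l s x w Ux|r B K tr cK vK KU]; first by rewrite D0// L0.
  have [l1 [l2 lE]] := cdual_pair l; rewrite lE (_ : (fun h => _) = fun h => l1 (D s (x + h *: w)) + l2 (L s (x + h *: w))).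
    by apply: hasdD; [exact: Dd|exact: Ld].
  by apply/funext => h; rewrite lE.
apply: wbounded_pair.
  apply: wboundedS (Db r B K tr cK vK KU) => _ [_ [y [s [Ky sB ->]]] <-].
  by exists y, s.
apply: wboundedS (Lb r B K tr cK vK KU) => _ [_ [y [s [Ky sB ->]]] <-].
by exists y, s.
Qed.

Lemma ultra_on_prod (E : tvsType R) (cE : convenient E) (I : Type) (F : I -> tvsType R) (U : set E)
  (oU : cinf_open U) (f : E -> prod_topology F) :
  (forall i, ultra_on md M U (fun x => f x i)) -> ultra_on md M U f.
Proof.
move=> H; pose D i := projT1 (cid (H i)); have HD i : ujets md M U (fun x => f x i) (D i) := projT2 (cid (H i)).
exists (fun s x i => D i s x : F i); apply: ujets_intro => [x Ux|x w s Ux|r B K tr cK vK KU].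
- by apply: functional_extensionality_dep => i; have [-> //] := HD i.
- have [d d0 dU] := cinf_open_line cE oU w Ux; exists d => //.
  apply: wbounded_prod => i; apply: wboundedS (ujets_quadr_line cE oU (HD i) s dU) => _ [_ [h [hd ->]] <-].
  by exists h.
apply: wbounded_prod => i; have [_ _ Hb] := HD i.
apply: wboundedS (Hb r B K tr cK vK KU) => _ [_ [y [s [Ky sB ->]]] <-].
by exists y, s.
Qed.

End JetFamilyConstructions.
(** * Exponential law and evaluation *)

Section Rectangles.
Context (R : realType).

Lemma nonexpansive_continuous (V W : normedModType R) (i : V -> W) :
  (forall y z, `|i y - i z| <= `|y - z|) -> continuous i.
Proof.
move=> H y; apply/cvgrPdist_lt => e e0; apply/nbhs_ballP; exists e => //= z.
by rewrite -ball_normE /= => yz; apply: le_lt_trans yz; exact: H.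
Qed.

Lemma disk_map (E F : tvsType R) (T : E -> F) (B : disk E) (B' : disk F) :
  (forall a x y, T (a *: x + y) = a *: T x + T y) -> (forall b, disk_set B b -> disk_set B' (T b)) ->
  exists2 i : disk_space B -> disk_space B', (forall y, disk_incl (i y) = T (disk_incl y)) & continuous i.
Proof.
move=> TL BT; have T0 : T 0 = 0 by have := TL (-1) 0 0; rewrite scaler0 addr0 scaleN1r addNr.
have TZ a x : T (a *: x) = a *: T x by have := TL a x 0; rewrite T0 !addr0.
have lift (y : disk_space B) e : 0 < e -> exists2 z : disk_space B', disk_incl z = T (disk_incl y) & `|z| <= `|y| + e.
  move=> e0; have ye : `|y| < `|y| + e by rewrite ltrDl.
  have [y0|By] := disk_norm_lt ye; first by exists 0; rewrite ?y0 ?T0// normr0 addr_ge0// ltW.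
  by apply: disk_lift; [exact: le_lt_trans ye|rewrite -TZ; exact: BT].
pose i y := s2val (cid2 (lift y 1 ltr01)).
have iE y : disk_incl (i y) = T (disk_incl y) := s2valP (cid2 (lift y 1 ltr01)).
have in_ y : `|i y| <= `|y|.
  apply/ler_addgt0Pr => e e0; have [z zE ze] := lift y e e0.
  by rewrite (_ : i y = z)//; apply: disk_incl_inj; rewrite iE zE.
exists i => //; apply: nonexpansive_continuous => y z; apply: le_trans (in_ _).
rewrite (_ : i (y - z) = i y - i z)//; apply: disk_incl_inj.
by rewrite disk_inclB !iE disk_inclB addrC -scaleN1r TL scaleN1r addrC.
Qed.

(** One disk of the product contains both factors, and the product of compact sets is compact in its
    Banach space. Bounds for a jet family on the product thus become joint bounds in two
    variables. *)
Lemma disk_rectangle (E0 E1 : tvsType R) (cE : convenient (E0 * E1)%type) (B0 : disk E0) (B1 : disk E1) :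
  exists B' : disk (E0 * E1)%type, [/\ forall v, disk_set B0 v -> disk_set B' (v, 0),
    forall v, disk_set B1 v -> disk_set B' (0, v) &
    forall (K0 : set (disk_space B0)) (K1 : set (disk_space B1)), compact K0 -> compact K1 ->
    exists2 K : set (disk_space B'), compact K &
      (forall a b, K0 a -> K1 b -> exists2 z, K z & disk_incl z = (disk_incl a, disk_incl b)) /\
      (forall z, K z -> exists a b, [/\ K0 a, K1 b & disk_incl z = (disk_incl a, disk_incl b)])].
Proof.
have w0 : wbounded ((fun x : E0 => (x, 0) : (E0 * E1)%type) @` B0).
  by apply: wbounded_linear (disk_wbounded B0); [exact: inl_linear|exact: inl_continuous].
have w1 : wbounded ((fun x : E1 => (0, x) : (E0 * E1)%type) @` B1).
  by apply: wbounded_linear (disk_wbounded B1); [exact: inr_linear|exact: inr_continuous].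
have [B' HB'] := wbounded_disk cE.1 (wboundedU w0 w1).
have B'0 v : disk_set B0 v -> disk_set B' (v, 0) by move=> Bv; apply: HB'; left; exists v.
have B'1 v : disk_set B1 v -> disk_set B' (0, v) by move=> Bv; apply: HB'; right; exists v.
exists B'; split=> // K0 K1 cK0 cK1.
have [i0 i0E ci0] := disk_map (@inl_linear R E0 E1) B'0.
have [i1 i1E ci1] := disk_map (@inr_linear R E0 E1) B'1.
have iE a b : disk_incl (i0 a + i1 b) = (disk_incl a, disk_incl b).
  rewrite disk_inclD i0E i1E; by apply: injective_projections; rewrite /= ?addr0 ?add0r.
exists ((fun p => i0 p.1 + i1 p.2) @` (K0 `*` K1)); last first.
  split=> [a b Ka Kb|_ [[a b] [/= Ka Kb] <-]]; last by exists a, b.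
  by exists (i0 a + i1 b) => //; exists (a, b).
apply: continuous_compact; last exact: compact_setX.
apply: continuous_subspaceT => p; apply: cvgD.
  by apply: continuous_comp; [exact: cvg_fst|exact: ci0].
by apply: continuous_comp; [exact: cvg_snd|exact: ci1].
Qed.

End Rectangles.

(** * Currying *)

Section Curry.
Context (R : realType) (md : umode) (M : weight_sequence R) (mgM : moderate_growth M).
Context (E0 E1 G : tvsType R) (cE0 : convenient E0) (cE1 : convenient E1) (cG : convenient G).
Context (W : set E0) (V : set E1) (oW : cinf_open W) (oV : cinf_open V).
Context (f : (E0 * E1)%type -> G) (D : seq (E0 * E1)%type -> (E0 * E1)%type -> G).
Context (HD : ujets md M (W `*` V) f D).

Let cE : convenient (E0 * E1)%type. Proof. exact: pair_convenient. Qed.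
Let oWV : cinf_open (W `*` V : set (E0 * E1)%type). Proof. exact: cinf_open_pair. Qed.

Definition dirs_l (s : seq E0) : seq (E0 * E1)%type := [seq (v, 0) | v <- s].
Definition dirs_r (t : seq E1) : seq (E0 * E1)%type := [seq (0, v) | v <- t].

(** Here moderate growth enters the exponential law: it splits (j+k)! M_(j+k) at the price of
    A^(j+k), which the convolution of the weights absorbs. *)
Lemma factM_product r1 r2 : test_weight md r1 -> test_weight md r2 ->
  exists2 r, test_weight md r & forall j k,
    r1 j / factM M j * (r2 k / factM M k) <= r (j + k)%N / factM M (j + k).
Proof.
move=> t1 t2; have [A A0 HA] := moderate_growth_factM mgM.
have [r tr Hr] := test_weight_mul t1 t2 A0; exists r => // j k.
rewrite ler_pdivlMr ?factM_gt0//; apply: le_trans (Hr j k).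
have F0 n : 0 < factM M n by exact: factM_gt0.
have -> : r1 j / factM M j * (r2 k / factM M k) * factM M (j + k) =
  r1 j * r2 k * (factM M (j + k) / (factM M j * factM M k)) by field; rewrite !gt_eqF.
apply: ler_wpM2l; first by rewrite mulr_ge0 ?t1.1 ?t2.1.
by rewrite ler_pdivrMr; [exact: HA|exact: mulr_gt0].
Qed.

Lemma rectangle_bound (l : cdual G) r1 r2 (B0 : disk E0) (B1 : disk E1)
  (K0 : set (disk_space B0)) (K1 : set (disk_space B1)) :
  test_weight md r1 -> test_weight md r2 -> compact K0 -> compact K1 ->
  (forall y, K0 y -> W (disk_incl y)) -> (forall y, K1 y -> V (disk_incl y)) ->
  exists2 C : R, 0 <= C & forall x y s t, K0 x -> K1 y -> in_disk B0 s -> in_disk B1 t ->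
    r1 (size t) / factM M (size t) * (r2 (size s) / factM M (size s)) *
    `|l (D (dirs_r t ++ dirs_l s) (disk_incl x, disk_incl y))| <= C.
Proof.
move=> t1 t2 cK0 cK1 K0W K1V; have [r tr Hr] := factM_product t1 t2.
have [B' [B'0 B'1 HB']] := disk_rectangle cE B0 B1.
have [K cK [K01 Kproj]] := HB' K0 K1 cK0 cK1.
have KU z : K z -> (W `*` V) (disk_incl z).
  by move=> /Kproj[a [b [Ka Kb ->]]]; split=> /=; [exact: K0W|exact: K1V].
have [C HC] := ujets_compact cE oWV HD l tr cK KU.
exists `|C| => // x y s t Kx Ky sB tB; apply: le_trans (ler_norm C).
have [z Kz zE] := K01 x y Kx Ky.
have := HC z (dirs_r t ++ dirs_l s) Kz; rewrite size_cat !size_map zE => h.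
apply: le_trans (h _); first by rewrite ler_wpM2r.
move=> v; rewrite mem_cat => /orP[|] /mapP[w ws ->]; [exact/B'1/tB|exact/B'0/sB].
Qed.

Lemma trunc_weight1 N k : (k <= N)%N -> trunc_weight M N k / factM M k = 1.
Proof. by move=> kN; rewrite /trunc_weight kN mulfV// gt_eqF// factM_gt0. Qed.

Lemma slice_ujets s x : W x ->
  ujets md M V (fun y => D (dirs_l s) (x, y)) (fun t y => D (dirs_r t ++ dirs_l s) (x, y)).
Proof.
move=> Wx; split=> // [l t y w Vy|r B1 K1 tr cK1 vK1 K1V l].
  have [_ Dd _] := HD; have := Dd l (dirs_r t ++ dirs_l s) (x, y) (0, w) (conj Wx Vy).
  apply: hasd_ext; exists 1 => // h _; congr (l (D _ _)).
  by apply: injective_projections; rewrite /= ?scaler0 ?addr0.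
have [B0 [X XE HB]] := disk_frame cE0 s x.
have [C C0 HC] := rectangle_bound l tr (test_trunc_weight md M (size s)) (@compact_set1 _ X) cK1
  (fun y (e : [set X] y) => ltac:(by rewrite e XE)) K1V.
exists C => _ [y [t [Ky tB ->]]].
have := HC X y s t erefl Ky (fun v vs => (HB v vs).1) tB.
rewrite trunc_weight1// mulr1 XE cdualZ normrM ger0_norm//.
by rewrite divr_ge0 ?tr.1// ltW// factM_gt0.
Qed.

Let curry_pred s x : W x -> (fun y : V => D (dirs_l s) (x, val y)) \in @ultra_pred R md M E1 V G.
Proof. by move=> Wx; apply: mem_set; exact: (ujets_is_ultra cE1 oV (slice_ujets s Wx)). Qed.

Definition curry_jet s x : ultra md M V G :=
  if pselect (W x) is left Wx then Ultra (curry_pred s Wx) else 0.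

Lemma curry_jetE s x (y : V) : W x -> curry_jet s x y = D (dirs_l s) (x, val y).
Proof. by rewrite /curry_jet; case: pselect. Qed.

Local Notation uj := (ultra_jets cE1 cG oV).

Lemma curry_jet_jets s x t y : W x -> V y ->
  uj (curry_jet s x) t y = D (dirs_r t ++ dirs_l s) (x, y).
Proof.
move=> Wx Vy; apply: (ultra_jets_uniq _ _ _ (D := fun t y => D (dirs_r t ++ dirs_l s) (x, y))) => //.
apply: ujets_ext (slice_ujets s Wx) => z Vz.
by have := extend_mapE (curry_jet s x) (SigSub (mem_set Vz)); rewrite /= => ->; rewrite curry_jetE.
Qed.

(** The second order remainders in x form a bounded subset of C^[M](V, G), as their jets in y show.
    Orders in y are weighed by an arbitrary test weight, while in x only orders up to |s| + 2 occur
    and a truncated weight suffices. *)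
Lemma curry_quadr x w s : W x -> exists2 d : R, 0 < d &
  quadr (fun h => curry_jet s (x + h *: w)) (curry_jet (w :: s) x) d.
Proof.
move=> Wx; have [d d0 dW] := cinf_open_line cE0 oW w Wx; exists d => //.
have Wx0 : W (x + 0 *: w) by rewrite scale0r addr0.
apply: bounded_wbounded; apply: (jets_ultra_bounded cE1 oV (D := uj)) => [z _|l r B1 K1 tr cK1 vK1 K1V].
  exact: ultra_jetsP.
have [B0 [X XE HB]] := disk_frame cE0 (w :: s) x.
have [_ [Z ZE _]] := HB w (mem_head _ _).
pose K0 := [set X + h *: Z | h in `[- d, d]%classic].
have K0W y : K0 y -> W (disk_incl y).
  move=> [h]; rewrite /= in_itv /= -ler_norml => hd <-.
  by rewrite disk_inclD disk_inclZ XE ZE; exact: dW.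
have [C C0 HC] := rectangle_bound l tr (test_trunc_weight md M (size s).+2)
  (@compact_segment R E0 B0 X Z d) cK1 K0W K1V.
exists C => _ y t [h [/andP[h0 hd] ->]] Ky tB; have Vy := K1V y Ky.
set a := r (size t) / factM M (size t).
have a0 : 0 <= a by rewrite divr_ge0 ?tr.1// ltW// factM_gt0.
have hh0 : 0 < h ^+ 2 by rewrite exprn_even_gt0//= -normr_gt0.
rewrite ultra_jetsZ// !ultra_jetsB// ultra_jetsZ// !curry_jet_jets//; last exact: dW.
rewrite scale0r addr0 cdualZ !cdualB cdualZ normrM normfV (ger0_norm (ltW hh0)) mulrCA ler_pdivrMl//.
have [a_0|an] := eqVneq a 0; first by rewrite a_0 mul0r mulr_ge0// ltW.
have ap : 0 < a by rewrite lt_neqAle eq_sym an.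
rewrite [h ^+ 2 * C]mulrC -ler_pdivlMl// mulrA.
have EE (c : R) : (x + c *: w, disk_incl y) = (x, disk_incl y) + c *: (w, 0) :> (E0 * E1)%type.
  by apply: injective_projections; rewrite /= ?scaler0 ?addr0.
have permE p z : (W `*` V) z ->
    l (D ([seq (v, 0) | v <- p] ++ dirs_r t ++ dirs_l s) z) = l (D (dirs_r t ++ dirs_l (p ++ s)) z).
  move=> Uz; apply: (ujets_perm cE oWV HD) Uz; rewrite /dirs_l map_cat; exact/permPl/perm_catCA.
have -> : l (D (dirs_r t ++ dirs_l (w :: s)) (x, disk_incl y)) =
    l (D ((w, 0) :: dirs_r t ++ dirs_l s) (x, disk_incl y)) by rewrite (permE [:: w]).
rewrite EE; apply: (ujets_taylor2 HD) => k /andP[k0 k1]; rewrite -EE.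
  split=> //=; apply: dW; apply: le_trans hd; by rewrite normrM (ger0_norm k0) ler_piMl.
have kh : `|k * h| <= d by apply: le_trans hd; rewrite normrM (ger0_norm k0) ler_piMl.
have := permE [:: w; w] (x + (k * h) *: w, disk_incl y) (conj (dW _ kh) Vy); rewrite /= => ->.
have := HC (X + (k * h) *: Z) y [:: w, w & s] t; rewrite trunc_weight1// mulr1.
rewrite disk_inclD disk_inclZ XE ZE ler_pdivlMl// => /(_ _ Ky _ tB); apply.
  by exists (k * h) => //; rewrite /= in_itv /= -ler_norml.
move=> v; rewrite in_cons => /predU1P[->|vs]; first by have [] := HB w (mem_head _ _).
by have [] := HB v vs.
Qed.

Lemma curry_bounded (r : nat -> R) (B : disk E0) (K : set (disk_space B)) : test_weight md r ->
  compact K -> (forall y, K y -> W (disk_incl y)) ->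
  wbounded [set z | exists y s, [/\ K y, in_disk B s &
    z = (r (size s) / factM M (size s)) *: curry_jet s (disk_incl y)]].
Proof.
move=> tr cK KW; apply: bounded_wbounded; apply: (jets_ultra_bounded cE1 oV (D := uj)) => [z _|l r1 B1 K1 tr1 cK1 vK1 K1V].
  exact: ultra_jetsP.
have [C C0 HC] := rectangle_bound l tr1 tr cK cK1 KW K1V.
exists C => _ y t [x [s [Kx sB ->]]] Ky tB; have Vy := K1V y Ky; have Wx := KW x Kx.
rewrite ultra_jetsZ// curry_jet_jets// cdualZ normrM ger0_norm; last first.
  by rewrite divr_ge0 ?tr.1// ltW// factM_gt0.
by rewrite mulrA; exact: HC.
Qed.

Theorem curry_ujets : ujets md M W (curry_jet [::]) curry_jet.
Proof.
apply: ujets_intro => // [x w s|r B K tr cK _ KW]; first exact: curry_quadr.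
exact: curry_bounded.
Qed.

End Curry.

Theorem ultra_on_curry (R : realType) (md : umode) (M : weight_sequence R) (E0 E1 G : tvsType R)
  (W : set E0) (V : set E1) (f : (E0 * E1)%type -> G) : moderate_growth M ->
  convenient E0 -> convenient E1 -> convenient G -> cinf_open W -> cinf_open V ->
  ultra_on md M (W `*` V) f -> exists2 g : E0 -> ultra md M V G,
    ultra_on md M W g & forall x (y : V), W x -> g x y = f (x, val y).
Proof.
move=> mgM cE0 cE1 cG oW oV [D HD].
exists (curry_jet mgM cE0 cE1 oW oV HD [::]); first by eexists; exact: curry_ujets.
by move=> x y Wx; rewrite curry_jetE//; have [D0 _ _] := HD; rewrite D0//; split=> //; exact: set_valP.
Qed.

(** * Evaluation *)

Section Evaluation.
Context (R : realType) (md : umode) (M : weight_sequence R) (lcM : log_convex M).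
Context (E F : tvsType R) (cE : convenient E) (cF : convenient F) (U : set E) (oU : cinf_open U).
Local Notation uj := (ultra_jets cE cF oU).
Local Notation P := (ultra md M U F * E)%type.

(* The evaluation is linear in its first argument: a derivative differentiates
   it at most once. *)
Fixpoint ev_terms (s : seq P) : seq (ultra md M U F * seq E) :=
  if s is v :: s' then (v.1, [seq w.2 | w <- s']) :: [seq (p.1, v.2 :: p.2) | p <- ev_terms s']
  else [::].

Definition ev_jet (s : seq P) (z : P) : F :=
  uj z.1 [seq v.2 | v <- s] z.2 + \sum_(p <- ev_terms s) uj p.1 p.2 z.2.

Lemma ev_terms_size s : size (ev_terms s) = size s.
Proof. by elim: s => //= v s IH; rewrite size_map IH. Qed.

Lemma ev_termsP s p : p \in ev_terms s -> [/\ (size p.2).+1 = size s,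
  exists2 v, v \in s & p.1 = v.1 & forall x, x \in p.2 -> exists2 v, v \in s & x = v.2].
Proof.
elim: s p => //= v s IH p; rewrite in_cons => /predU1P[->|/mapP[q /IH[qs [w ws qw] qin] ->]] /=.
  split; first by rewrite size_map.
    by exists v => //; exact: mem_head.
  by move=> _ /mapP[w ws ->]; exists w => //; rewrite in_cons ws orbT.
split; first by rewrite qs.
  by exists w => //; rewrite in_cons ws orbT.
move=> x; rewrite in_cons => /predU1P[->|/qin[u us ->]]; first by exists v => //; exact: mem_head.
by exists u => //; rewrite in_cons us orbT.
Qed.

Lemma ev_jet_hasd (l : cdual F) s (z w : P) : U z.2 ->
  hasd (fun h => l (ev_jet s (z + h *: w))) 0 (l (ev_jet (w :: s) z)).
Proof.
move=> Uz; have J (v : ultra md M U F) := ultra_jetsP cE cF oU v.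
have hd (v : ultra md M U F) t : hasd (fun h => l (uj v t (z.2 + h *: w.2))) 0 (l (uj v (w.2 :: t) z.2)).
  by have [_ Dd _] := J v; exact: Dd.
set t := [seq v.2 | v <- s].
have H1 := hasdD (hd z.1 t) (hasdM (hasd_id 0) (hd w.1 t)).
have H2 : hasd (fun h => \sum_(p <- ev_terms s) l (uj p.1 p.2 (z.2 + h *: w.2))) 0
    (\sum_(p <- ev_terms s) l (uj p.1 (w.2 :: p.2) z.2)).
  by apply: hasd_sum => p _; exact: hd.
have := hasdD H1 H2.
have -> : l (uj z.1 (w.2 :: t) z.2) + (1 * l (uj w.1 t (z.2 + 0 *: w.2)) + 0 * l (uj w.1 (w.2 :: t) z.2)) +
    \sum_(p <- ev_terms s) l (uj p.1 (w.2 :: p.2) z.2) = l (ev_jet (w :: s) z).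
  rewrite mul1r mul0r addr0 scale0r addr0 /ev_jet [ev_terms (w :: s)]/= big_cons big_map.
  by rewrite !(cdualD l) linear_sum -addrA.
apply: hasd_ext; have [d d0 dU] := cinf_open_line cE oU w.2 Uz.
exists d => // h /ltW hd'; rewrite add0r /ev_jet (cdualD l) linear_sum.
by have Uh := dU h hd'; rewrite (ultra_jetsD cE cF oU z.1 (h *: w.1))// ultra_jetsZ// (cdualD l) (cdualZ l).
Qed.

Lemma compact_wbounded (V : tvsType R) (B : disk V) (K : set (disk_space B)) : compact K ->
  wbounded (@disk_incl R V B @` K).
Proof.
move=> /compact_bounded[N [_ HN]] l; have [C C0 HC] := disk_cdual B l.
exists (C * (N + 1)) => _ [y Ky <-]; apply: le_trans (HC y) _; rewrite ler_wpM2l//.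
by apply: (HN (N + 1)) => //; rewrite ltrDl.
Qed.

Lemma test_weight_pred (r : nat -> R) : test_weight md r -> test_weight md (fun k => r k.+1).
Proof.
move=> [r0 tr]; split=> [//|]; move: tr; case: md => [[rho rho0 [C HC]]|HC].
  by exists rho => //; exists (C * rho) => k; rewrite -mulrA -exprS.
move=> rho rho0; have [C HC'] := HC rho rho0; exists (rho^-1 * C) => k.
by rewrite ler_pdivlMl// mulrA -exprS.
Qed.

Lemma weight_nondecreasing n : M n <= M n.+1.
Proof.
have := log_convex_ratio lcM (leq0n n); rewrite weight0 mul1r; apply: le_trans.
by rewrite ler_peMl ?weight1// ltW// weight_gt0.
Qed.

(** A derivative of order n + 1 has, besides its main term, n + 1 terms of order n, for which the
    shifted weight is used. Their number is compensated by (n+1)! M_(n+1) >= (n+1) n! M_n, where M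
    is nondecreasing since it is log-convex with M_0 = 1 <= M_1. *)
Lemma ev_jet_bound (r : nat -> R) (B : disk P) (K : set (disk_space B)) : test_weight md r -> compact K ->
  convex_set (K : set (convex_lmodType (disk_space B))) ->
  (forall y, K y -> U (disk_incl y).2) ->
  wbounded [set z : F | exists y s, [/\ K y, in_disk B s &
    z = (r (size s) / factM M (size s)) *: ev_jet s (disk_incl y)]].
Proof.
move=> tr cK /convex_setP vK KU l.
have sndL a (x y : P) : (a *: x + y).2 = a *: x.2 + y.2 by [].
have fstL a (x y : P) : (a *: x + y).1 = a *: x.1 + y.1 by [].
have c1 : continuous (fst : P -> ultra md M U F) by exact: fst_continuous.
have c2 : continuous (snd : P -> E) by exact: snd_continuous.
have [B1 HB1] := wbounded_disk cE.1 (wbounded_linear sndL c2 (disk_wbounded B)).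
have BB1 b : disk_set B b -> disk_set B1 b.2 by move=> Bb; apply: HB1; exists b.
have [i iE ci] := disk_map sndL BB1.
have cK1 : compact (i @` K) by apply: continuous_compact => //; exact: continuous_subspaceT.
have K1U y : (i @` K) y -> U (disk_incl y) by move=> [x Kx <-]; rewrite iE; exact: KU.
have vK1 : convex_set ((i @` K) : set (convex_lmodType (disk_space B1))).
  apply/convex_setP => _ _ t [x Kx <-] [y Ky <-] t01; exists (t *: x + (1 - t) *: y); first exact: vK.
  by apply: disk_incl_inj; rewrite disk_inclD !disk_inclZ !iE disk_inclD !disk_inclZ.
(* The functions that occur in the terms: first components of directions, and first components of
   base points. *)
pose Q := (fst @` B) `|` (fst @` (@disk_incl R P B @` K)) : set (ultra md M U F).
have bQ : tvs_bounded Q.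
  apply: wbounded_bounded; apply: wboundedU; apply: wbounded_linear => //; first exact: disk_wbounded.
  exact: compact_wbounded.
have [C1 HC1] := ultra_bounded_jets cE oU bQ l tr cK1 vK1 K1U.
have [C2 HC2] := ultra_bounded_jets cE oU bQ l (test_weight_pred tr) cK1 vK1 K1U.
have rM n : 0 <= r n / factM M n by rewrite divr_ge0 ?tr.1// ltW// factM_gt0.
exists (C1 + `|C2|) => _ [y [s [Ky sB ->]]].
rewrite cdualZ normrM (ger0_norm (rM _)) /ev_jet cdualD linear_sum.
apply: le_trans (ler_wpM2l (rM _) (ler_normD _ _)) _; rewrite mulrDr; apply: lerD.
  have := HC1 (disk_incl y).1 _ (i y) [seq v.2 | v <- s] _ (ultra_jetsP cE cF oU _).
  rewrite iE size_map; apply.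
  - by right; exists (disk_incl y) => //; exists y.
  - by exists y.
  - by move=> _ /mapP[v vs ->]; exact/BB1/sB.
apply: le_trans (ler_wpM2l (rM _) (ler_norm_sum _ _ _)) _; rewrite mulr_sumr.
case sE: (size s) => [|n].
  by rewrite (size0nil sE) big_nil.
apply: (@le_trans _ _ (\sum_(p <- ev_terms s) `|C2| / n.+1%:R)); last first.
  rewrite big_const_seq count_predT ev_terms_size sE iter_addr_0 -[_ *+ n.+1]mulr_natr divfK//.
rewrite !big_seq; apply: ler_sum => p /ev_termsP[ps [v vs pv] pin].
rewrite sE in ps; case: ps => ps.
have := HC2 p.1 _ (i y) p.2 _ (ultra_jetsP cE cF oU _); rewrite iE ps => H.
have {}H : r n.+1 / factM M n * `|l (uj p.1 p.2 (disk_incl y).2)| <= C2.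
  apply: H; first by left; exists v => //; exact: sB.
    by exists y.
  by move=> x /pin[w ws ->]; exact/BB1/sB.
have F0 k : 0 < factM M k by exact: factM_gt0.
rewrite ler_pdivlMr// mulrAC; apply: le_trans (le_trans H (ler_norm _)).
apply: ler_wpM2r => //; rewrite -mulrA; apply: ler_wpM2l; first exact: tr.1.
rewrite ler_pdivrMl// ler_pdivlMr// /factM factS natrM.
rewrite mulrA; apply: ler_wpM2l; first by rewrite mulr_ge0.
exact: weight_nondecreasing.
Qed.

Theorem ev_ujets : ujets md M ([set: ultra md M U F] `*` U) (fun z : P => extend_map z.1 z.2) ev_jet.
Proof.
split=> [z [_ Uz]|l s z w [_ Uz]|r B K tr cK vK KU].
- rewrite /ev_jet big_nil addr0 /=; by have [-> //] := ultra_jetsP cE cF oU z.1.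
- exact: ev_jet_hasd.
by apply: ev_jet_bound => // y /KU[].
Qed.

End Evaluation.
(** * The canonical maps *)

Section Assembly.
Context (R : realType) (md : umode) (M : weight_sequence R).
Context (lcM : log_convex M) (mgM : moderate_growth M).

Lemma ultra_on_is_ultra (E F : tvsType R) (U : set E) (f : E -> F) : convenient E -> cinf_open U ->
  ultra_on md M U f -> is_ultra md M (fun x : U => f (val x)).
Proof. by move=> cE oU [D HD]; exact: (ujets_is_ultra cE oU HD). Qed.

Lemma ultra_on_map (E F : tvsType R) (f : E -> F) : convenient E ->
  ultra_on md M [set: E] f -> ultra_map md M f.
Proof. by move=> cE uf; exact: ultra_on_is_ultra cE (@cinf_openT R E) uf. Qed.

(** Substitution into a function that itself depends on the variable. The canonical maps below are
    curried forms of expressions built with it. *)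
Lemma ultra_on_eval (E0 E F : tvsType R) (cE0 : convenient E0) (cE : convenient E)
  (cF : convenient F) (W : set E0) (U : set E) (oW : cinf_open W) (oU : cinf_open U)
  (a : E0 -> ultra md M U F) (b : E0 -> E) : (forall x, W x -> U (b x)) ->
  ultra_on md M W a -> ultra_on md M W b -> ultra_on md M W (fun x => extend_map (a x) (b x)).
Proof.
move=> WU ua ub.
have cP := pair_convenient (ultra_convenient md M cE cF oU) cE.
have oP := cinf_open_pair (@cinf_openT R (ultra md M U F)) oU.
have ev : ultra_on md M ([set: ultra md M U F] `*` U) (fun z => extend_map z.1 z.2).
  by eexists; exact: (ev_ujets md lcM cE cF oU).
apply: (ultra_on_comp lcM cE0 cP oW oP _ (ultra_on_pair ua ub) ev) => x Wx.
by split=> //=; exact: WU.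
Qed.

Lemma ultra_on_snd (E0 E : tvsType R) (W : set (E0 * E)%type) : ultra_on md M W snd.
Proof. by apply: ultra_on_linear => //; exact: snd_continuous. Qed.

Lemma ultra_on_fst1 (E0 E : tvsType R) (W : set (E0 * E)%type) : ultra_on md M W fst.
Proof. by apply: ultra_on_linear => //; exact: fst_continuous. Qed.

End Assembly.

Section Maps.
Context (R : realType) (md : umode) (M : weight_sequence R).
Context (lcM : log_convex M) (mgM : moderate_growth M).
Context (E F G : tvsType R) (cE : convenient E) (cF : convenient F) (cG : convenient G).
Context (X Y : tvsType R) (cX : convenient X) (cY : convenient Y).
Context (U : set X) (V : set Y) (oU : cinf_open U) (oV : cinf_open V).

Let oUV : cinf_open (U `*` V : set (X * Y)%type). Proof. exact: cinf_open_pair. Qed.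
Let cXY : convenient (X * Y)%type. Proof. exact: pair_convenient. Qed.
Local Notation oT := (@cinf_openT R _).

Lemma ev_is_ultra : is_ultra md M
  (fun fx : [set: ultra md M U F] `*` U => (val fx).1 (snd_in fx) : F).
Proof.
have cP := pair_convenient (ultra_convenient md M cX cF oU) cX.
have oP := cinf_open_pair (@cinf_openT R (ultra md M U F)) oU.
apply: (ujets_is_ultra cP oP (ev_ujets md lcM cX cF oU)) => z.
by rewrite -(extend_mapE (val z).1 (snd_in z)).
Qed.

Lemma insertion : exists ins : E -> ultra md M [set: F] (E * F)%type,
  (forall x y, ins x (inT y) = (x, y)) /\ ultra_map md M ins.
Proof.
have uid : ultra_on md M ([set: E] `*` [set: F]) (@id (E * F)%type).
  by apply: ultra_on_linear => // x; exact: cvg_id.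
have [g ug gE] := ultra_on_curry mgM cE cF (pair_convenient cE cF) oT oT uid.
by exists g; split=> [x y|]; [rewrite gE|exact: ultra_on_map].
Qed.

Lemma uncurrying : exists hat : ultra md M U (ultra md M V G) -> ultra md M (U `*` V) G,
  (forall g x y, hat g (pair_in x y) = g x y) /\ ultra_map md M hat.
Proof.
have cVG := ultra_convenient md M cY cG oV.
have cT := ultra_convenient md M cX cVG oU.
have oP := cinf_open_pair (@cinf_openT R (ultra md M U (ultra md M V G))) oUV.
have cP := pair_convenient cT cXY.
have u : ultra_on md M ([set: ultra md M U (ultra md M V G)] `*` (U `*` V))
    (fun z => extend_map (extend_map z.1 z.2.1) z.2.2).
  have u2 := ultra_on_snd md M ([set: ultra md M U (ultra md M V G)] `*` (U `*` V)).
  apply: (ultra_on_eval (a := fun z => extend_map z.1 z.2.1) (b := fun z => z.2.2) lcM cP cY cG oP oV); [by move=> z [_ []]| |].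
    apply: (ultra_on_eval (a := fun z => z.1) (b := fun z => z.2.1) lcM cP cX cVG oP oU) => [z [_ []]//| |]; first exact: ultra_on_fst1.
    apply: (ultra_on_comp lcM cP cXY oP oUV _ u2 (ultra_on_fst1 md M (U `*` V))).
    by move=> z [].
  apply: (ultra_on_comp lcM cP cXY oP oUV _ u2 (ultra_on_snd md M (U `*` V))).
  by move=> z [].
have [h uh hE] := ultra_on_curry mgM cT cXY cG oT oUV u.
exists h; split=> [g x y|]; last exact: ultra_on_map.
by rewrite hE// !extend_mapE.
Qed.

Lemma currying : exists check : ultra md M (U `*` V) G -> ultra md M U (ultra md M V G),
  (forall f x y, check f x y = f (pair_in x y)) /\ ultra_map md M check.
Proof.
have cVG := ultra_convenient md M cY cG oV.
have cT := ultra_convenient md M cXY cG oUV.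
have oW := cinf_open_pair (@cinf_openT R (ultra md M (U `*` V) G)) oU.
have cW := pair_convenient cT cX.
have oP := cinf_open_pair oW oV; have cP := pair_convenient cW cY.
set W := _ `*` U in oW oP.
have u1 := ultra_on_fst1 md M (W `*` V).
have u : ultra_on md M (W `*` V) (fun z => extend_map z.1.1 (z.1.2, z.2)).
  apply: (ultra_on_eval (a := fun z => z.1.1) (b := fun z => (z.1.2, z.2)) lcM cP cXY cG oP oUV) => [z [[_ ?] ?]//| |].
    by apply: (ultra_on_comp lcM cP cW oP oW _ u1 (ultra_on_fst1 md M W)) => z [].
  apply: ultra_on_pair; last exact: ultra_on_snd.
  by apply: (ultra_on_comp lcM cP cW oP oW _ u1 (ultra_on_snd md M W)) => z [].
(* Curried twice: in y over the pairs (f, x), and then in x over f. *)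
have [c uc cEq] := ultra_on_curry mgM cW cY cG oW oV u.
have [c' uc' c'Eq] := ultra_on_curry mgM cT cX cVG oT oU uc.
exists c'; split=> [f x y|]; last exact: ultra_on_map.
rewrite c'Eq// cEq; last by split=> //; exact: set_valP.
by rewrite -(extend_mapE f (pair_in x y)).
Qed.

Lemma composition : exists comp : ultra md M [set: F] G * ultra md M U F -> ultra md M U G,
  (forall f g x, comp (f, g) x = f (inT (g x))) /\ ultra_map md M comp.
Proof.
have cFG := ultra_convenient md M cF cG oT; have cUF := ultra_convenient md M cX cF oU.
have cT := pair_convenient cFG cUF; have cP := pair_convenient cT cX.
have oP := cinf_open_pair (@cinf_openT R (ultra md M [set: F] G * ultra md M U F)%type) oU.
set W := _ `*` U in oP; have u1 := ultra_on_fst1 md M W.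
have u : ultra_on md M W (fun z => extend_map z.1.1 (extend_map z.1.2 z.2)).
  apply: (ultra_on_eval (a := fun z => z.1.1) (b := fun z => extend_map z.1.2 z.2) lcM cP cF cG oP oT) => //.
    exact: (ultra_on_comp lcM cP cT oP oT (fun _ _ => I) u1 (ultra_on_fst1 md M setT)).
  apply: (ultra_on_eval (a := fun z => z.1.2) (b := fun z => z.2) lcM cP cX cF oP oU) => [z []//| |]; last exact: ultra_on_snd.
  exact: (ultra_on_comp lcM cP cT oP oT (fun _ _ => I) u1 (ultra_on_snd md M setT)).
have [c uc cEq] := ultra_on_curry mgM cT cX cG oT oU u.
exists c; split=> [f g x|]; last exact: ultra_on_map.
by rewrite cEq//= extend_mapE -(extend_mapE f (inT (g x))).
Qed.

End Maps.

Section HomMap.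
Context (R : realType) (md : umode) (M : weight_sequence R).
Context (lcM : log_convex M) (mgM : moderate_growth M).
Context (E F E1 F1 : tvsType R) (cE : convenient E) (cF : convenient F).
Context (cE1 : convenient E1) (cF1 : convenient F1).
Local Notation oT := (@cinf_openT R _).

Lemma hom_map : exists hom : ultra md M [set: F] F1 * ultra md M [set: E1] E ->
    ultra md M [set: ultra md M [set: E] F] (ultra md M [set: E1] F1),
  (forall f g h x, hom (f, g) (inT h) (inT x) = f (inT (h (inT (g (inT x)))))) /\ ultra_map md M hom.
Proof.
have c0 := ultra_convenient md M cF cF1 oT; have c1 := ultra_convenient md M cE1 cE oT.
have c2 := ultra_convenient md M cE cF oT; have c3 := ultra_convenient md M cE1 cF1 oT.
have cT := pair_convenient c0 c1; have cW := pair_convenient cT c2; have cP := pair_convenient cW cE1.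
have oW := cinf_open_pair (@cinf_openT R (ultra md M [set: F] F1 * ultra md M [set: E1] E)%type)
  (@cinf_openT R (ultra md M [set: E] F)).
set W := _ `*` _ in oW; have oP := cinf_open_pair oW (@cinf_openT R E1).
set Z := _ `*` _ in oP.
have uW := ultra_on_fst1 md M Z.
have ZW (z : (ultra md M [set: F] F1 * ultra md M [set: E1] E * ultra md M [set: E] F * E1)%type) :
  Z z -> W z.1 by case.
have u1 := ultra_on_comp lcM cP cW oP oW ZW uW (ultra_on_fst1 md M W).
have u : ultra_on md M Z (fun z => extend_map z.1.1.1 (extend_map z.1.2 (extend_map z.1.1.2 z.2))).
  apply: (ultra_on_eval (a := fun z => z.1.1.1) (b := fun z => extend_map z.1.2 (extend_map z.1.1.2 z.2)) lcM cP cF cF1 oP oT) => //.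
    exact: (ultra_on_comp lcM cP cT oP oT (fun _ _ => I) u1 (ultra_on_fst1 md M setT)).
  apply: (ultra_on_eval (a := fun z => z.1.2) (b := fun z => extend_map z.1.1.2 z.2) lcM cP cE cF oP oT) => //.
    exact: (ultra_on_comp lcM cP cW oP oW ZW uW (ultra_on_snd md M W)).
  apply: (ultra_on_eval (a := fun z => z.1.1.2) (b := fun z => z.2) lcM cP cE1 cE oP oT) => //; last exact: ultra_on_snd.
  exact: (ultra_on_comp lcM cP cT oP oT (fun _ _ => I) u1 (ultra_on_snd md M setT)).
have [c uc cEq] := ultra_on_curry mgM cW cE1 cF1 oW oT u.
have [c' uc' c'Eq] := ultra_on_curry mgM cT c2 c3 oT oT uc.
exists c'; split=> [f g h x|]; last exact: ultra_on_map.
by rewrite c'Eq// cEq//= -(extend_mapE f (inT _)) -(extend_mapE h (inT _)) -(extend_mapE g (inT _)).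
Qed.

End HomMap.

Section ProductMap.
Context (R : realType) (md : umode) (M : weight_sequence R).
Context (lcM : log_convex M) (mgM : moderate_growth M).
Context (I : Type) (E F : I -> tvsType R) (cE : forall i, convenient (E i)) (cF : forall i, convenient (F i)).
Local Notation oT := (@cinf_openT R _).

Lemma product_map : exists prodmap : prod_topology (fun i => ultra md M [set: E i] (F i)) ->
    ultra md M [set: prod_topology E] (prod_topology F),
  (forall f x i, prodmap f (inT x) i = f i (inT (x i))) /\ ultra_map md M prodmap.
Proof.
have cT : convenient (prod_topology (fun i => ultra md M [set: E i] (F i))).
  by apply: prod_convenient => i; exact: (ultra_convenient md M (cE i) (cF i) oT).
have cPE := prod_convenient cE; have cPF := prod_convenient cF.
have cP := pair_convenient cT cPE.
have oP := cinf_open_pair (@cinf_openT R (prod_topology (fun i => ultra md M [set: E i] (F i))))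
  (@cinf_openT R (prod_topology E)).
set W := _ `*` _ in oP.
have up (H : I -> tvsType R) i : ultra_on md M [set: prod_topology H] (fun z => z i).
  by apply: ultra_on_linear => //; exact: coordinate_continuous.
have u : ultra_on md M W (fun z => (fun i => extend_map (z.1 i) (z.2 i)) : prod_topology F).
  apply: (ultra_on_prod cP oP) => i; apply: (ultra_on_eval (a := fun z => z.1 i) (b := fun z => z.2 i) lcM cP (cE i) (cF i) oP oT) => //.
    exact: (ultra_on_comp lcM cP cT oP oT (fun _ _ => Logic.I) (ultra_on_fst1 md M W) (up _ i)).
  exact: (ultra_on_comp lcM cP cPE oP oT (fun _ _ => Logic.I) (ultra_on_snd md M W) (up _ i)).
have [c uc cEq] := ultra_on_curry mgM cT cPE cPF oT oT u.
exists c; split=> [f x i|]; last exact: ultra_on_map.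
by rewrite cEq//= -(extend_mapE (f i) (inT _)).
Qed.

End ProductMap.

Theorem corollary5p5 (R : realType) (md : umode) (M : weight_sequence R)
    (M_log_convex : log_convex M) (M_moderate_growth : moderate_growth M)
    (E F G E1 F1 X Y : tvsType R) (I : Type) (Ei Fi : I -> tvsType R)
    (cE : convenient E) (cF : convenient F) (cG : convenient G)
    (cE1 : convenient E1) (cF1 : convenient F1)
    (cX : convenient X) (cY : convenient Y)
    (cEi : forall i, convenient (Ei i)) (cFi : forall i, convenient (Fi i))
    (U : set X) (V : set Y) (oU : cinf_open U) (oV : cinf_open V) :
  (* (1) *)
  (convenient (ultra md M U (ultra md M V G)) /\
   convenient (ultra md M (U `*` V) G) /\
   exists (hat : {linear ultra md M U (ultra md M V G) -> ultra md M (U `*` V) G})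
          (check : ultra md M (U `*` V) G -> ultra md M U (ultra md M V G)),
     (forall g x y, hat g (pair_in x y) = g x y) /\
     cancel hat check /\ cancel check hat /\
     ultra_map md M hat /\ ultra_map md M check) /\
  (* (2) *)
  is_ultra md M
    (fun fx : [set: ultra md M U F] `*` U => (val fx).1 (snd_in fx) : F) /\
  (* (3) *)
  (exists ins : E -> ultra md M [set: F] (E * F)%type,
     (forall x y, ins x (inT y) = (x, y)) /\ ultra_map md M ins) /\
  (* (4) *)
  (exists hat : ultra md M U (ultra md M V G) -> ultra md M (U `*` V) G,
     (forall g x y, hat g (pair_in x y) = g x y) /\ ultra_map md M hat) /\
  (* (5) *)
  (exists check : ultra md M (U `*` V) G -> ultra md M U (ultra md M V G),
     (forall f x y, check f x y = f (pair_in x y)) /\ ultra_map md M check) /\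
  (* (6) *)
  (exists comp : ultra md M [set: F] G * ultra md M U F -> ultra md M U G,
     (forall f g x, comp (f, g) x = f (inT (g x))) /\ ultra_map md M comp) /\
  (* (7) *)
  (exists hom : ultra md M [set: F] F1 * ultra md M [set: E1] E ->
       ultra md M [set: ultra md M [set: E] F] (ultra md M [set: E1] F1),
     (forall f g h x,
        hom (f, g) (inT h) (inT x) = f (inT (h (inT (g (inT x)))))) /\
     ultra_map md M hom) /\
  (* (8) *)
  (exists prodmap : prod_topology (fun i => ultra md M [set: Ei i] (Fi i)) ->
       ultra md M [set: prod_topology Ei] (prod_topology Fi),
     (forall f x i, prodmap f (inT x) i = f i (inT (x i))) /\
     ultra_map md M prodmap).
Proof.
have cVG := ultra_convenient md M cY cG oV.
have oUV : cinf_open (U `*` V : set (X * Y)%type) := cinf_open_pair oU oV.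
have cXY := pair_convenient cX cY.
have [hat [hatE uhat]] := uncurrying md M_log_convex M_moderate_growth cG cX cY oU oV.
have [check [checkE ucheck]] := currying md M_log_convex M_moderate_growth cG cX cY oU oV.
have pairE (z : U `*` V) : z = pair_in (fst_in z) (snd_in z).
  by apply: val_inj => /=; case: (val z).
split; last first.
  split; first exact: ev_is_ultra.
  split; first exact: insertion.
  split; first by exists hat.
  split; first by exists check.
  split; first exact: composition.
  split; first exact: hom_map.
  exact: product_map.
split; first exact: (ultra_convenient md M cX cVG oU).
split; first exact: (ultra_convenient md M cXY cG oUV).
(* [hat] comes from currying and not as a linear map; its linearity is read off from its values. *)
have [|hat' hat'E] := @linear_of R _ _ hat.
  move=> a g g'; apply: val_inj; apply/funext => z; rewrite (pairE z).
  set x := fst_in z; set y := snd_in z.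
  transitivity (a *: hat g (pair_in x y) + hat g' (pair_in x y)); last by [].
  transitivity ((a *: g + g') x y); first exact: hatE.
  by rewrite (hatE g x y) (hatE g' x y).
exists hat', check; split=> [g x y|]; first by rewrite hat'E hatE.
split=> [g|].
  apply: val_inj; apply/funext => x; apply: val_inj; apply/funext => y.
  by have := checkE (hat' g) x y; rewrite hat'E hatE.
split=> [f|]; first by apply: val_inj; apply/funext => z; rewrite (pairE z) /= hat'E hatE checkE.
split=> //; move: uhat; rewrite /ultra_map; congr is_ultra.
by apply/funext => g; rewrite hat'E.
Qed.
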